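(* Let $\rho_0\in L^\infty(\mathbb R_+,\mathbb R_+)\cap L^1(\mathbb R_+,\mathbb R_+)$ satisfy $0<R(\rho_0)<\infty$, where $R(\rho_0):=\inf\{r:\int_r^\infty\rho_0(r')\,dr'=0\}$, and let $T>0$. Then: (a) There exists an optimal sequence of quasi-solutions in $[0,T)$ with initial datum $\rho_0$. (b) Any optimal sequence of quasi-solutions in $[0,T)$ with initial datum $\rho_0$ converges weakly, for every $t\in[0,T)$, to a limit (which is then, by definition, a generalized solution in $[0,T)$ with initial datum $\rho_0$). (c) There exists a function $\bar\rho=\{\bar\rho(r,t):r\in\mathbb R_+,\,t\in\mathbb R_+\}$, continuous in $(r,t)$ for $t>0$, such that if $u$ is a generalized solution in $[0,T)$ with initial datum $\rho_0$, then $u(\cdot,t)=\bar\rho(\cdot,t)$ for all $t\in[0,T)$ (equality as elements of $L^1(\mathbb R_+)$, i.e. almost everywhere).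
   Context: Fix a parameter $j>0$; $\mathbb R_+=[0,\infty)$. Quasi-solutions. Let $\rho_0\in L^\infty(\mathbb R_+,\mathbb R_+)\cap L^1(\mathbb R_+,\mathbb R_+)$ with $0<R(\rho_0)<\infty$, $T>0$, $\epsilon>0$. A triple $(X_t,u(\cdot,t),\epsilon)$, $t\in[0,T)$, is a quasi-solution in $[0,T)$ with initial datum $\rho_0$ and accuracy parameter $\epsilon$ if: 1. $X_t$ is strictly positive, Lipschitz continuous and piecewise $C^1$ in $t$ (with finitely many discontinuities of the derivative); 2. $u(r,t)\ge 0$, $t\in[0,T)$, $r\in[0,X_t]$, is smooth in the following sense: for each $t\in[0,T)$, $u(\cdot,t)\in C^2((0,X_t),\mathbb R_+)$ and it has limits together with its derivatives at $0$ and $X_t$; for each $r\in[0,X_t]$, $u(r,t)$ is differentiable in $t$; 3. for all $t\in(0,T)$: $\frac{\partial u}{\partial t}(r,t)=\frac12\frac{\partial^2u}{\partial r^2}(r,t)$ for $r\in(0,X_t)$, $\frac{\partial u}{\partial r}(0,t)=-2j$, and $u(X_t,t)=0$; 4. $\int|u(r,0)-\rho_0(r)|\,dr\le\epsilon$; 5. $\sup_{0\le t<T}\big|\int_0^{X_t}u(r,t)\,dr-\int_0^{X_0}u(r,0)\,dr\big|\le\epsilon$. The functions $u(\cdot,t)$ are extended by $0$ to $r>X_t$. Optimal sequence. A sequence $(X^{(n)}_t,\rho^{(n)}(\cdot,t),\epsilon_n)$, $t\in[0,T)$, of quasi-solutions in $[0,T)$ with initial datum $\rho_0$ is optimal if $\lim_{n\to\infty}\epsilon_n=0$.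 Generalized solution. $\rho(r,t)$, $r\in\mathbb R_+$, $t\in[0,T)$, is a generalized solution in $[0,T)$ with initial datum $\rho_0$ (of the free boundary problem $\partial_t\rho=\frac12\partial_r^2\rho$ in $(0,X_t)$, $\partial_r\rho(0,t)=-2j$, $\rho(X_t,t)=0$, $\partial_r\rho(X_t,t)=-2j$) if there exists an optimal sequence $(X^{(n)}_t,\rho^{(n)}(\cdot,t),\epsilon_n)$ of quasi-solutions in $[0,T)$ with initial datum $\rho_0$ such that $\rho^{(n)}(\cdot,t)\to\rho(\cdot,t)$ weakly for all $t\in[0,T)$. Weak convergence means weak convergence of the measures $\rho^{(n)}(r,t)\,dr$ on $\mathbb R_+$ (tested against bounded continuous functions). *)

(* Defs.v *)
From HB Require Import structures.
From mathcomp Require Import all_boot all_order all_algebra.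
From mathcomp Require Import all_classical all_reals all_analysis.

Set Implicit Arguments.
Unset Strict Implicit.
Unset Printing Implicit Defensive.

Import Order.TTheory GRing.Theory Num.Theory.
Import numFieldNormedType.Exports.

Local Open Scope ring_scope.
Local Open Scope classical_set_scope.

Definition Rplus (R : realType) : set R := `[0, +oo[%classic.

(* Membership in L^oo(R_+, R_+) and L^1(R_+, R_+); functions on R_+ are
   represented by functions on R whose values on the negative reals are
   irrelevant, hence the restriction. *)
Definition Linfty_L1_nonneg (R : realType) (rho0 : R -> R) : Prop :=
  [/\ (rho0 \_ (@Rplus R)) \in Lfun (@lebesgue_measure R) +oo%E,
      (rho0 \_ (@Rplus R)) \in Lfun (@lebesgue_measure R) 1%E &
      {ae @lebesgue_measure R, forall r : R, Rplus r -> 0 <= rho0 r}].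

(* R(rho0); the infimum is taken in the extended reals, so that it is +oo
   when the set is empty. *)
Definition right_edge (R : realType) (rho0 : R -> R) : \bar R :=
  ereal_inf [set r%:E | r in [set r : R | 0 <= r /\
    (\int[lebesgue_measure]_(x in `[r, +oo[) (rho0 x)%:E = 0)%E]].

(* X is C^1 on [0, T[ off a finite set S, and its derivative has finite
   one-sided limits at 0 and at the points of S. *)
Definition piecewise_C1 (R : realType) (T : R) (X : R -> R) : Prop :=
  exists S : seq R, [/\ {in S, forall t : R, 0 < t < T},
    forall t : R, 0 < t < T -> t \notin S ->
      derivable X t 1 /\ {for t, continuous X^`()},
    cvg (X^`() s @[s --> 0^'+]) &
    {in S, forall t : R, cvg (X^`() s @[s --> t^'+]) /\
                     cvg (X^`() s @[s --> t^'-])}].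

(* C^2 on ]a, b[, with f', f'' having finite limits at a and b, and f having
   the limits f a and f b. *)
Definition C2_up_to_boundary (R : realType) (a b : R) (f : R -> R) : Prop :=
  [/\ derivable_oo_LRcontinuous f a b,
      {in `]a, b[, forall r : R, derivable f^`() r 1},
      {in `]a, b[, forall r : R, {for r, continuous f^`(2)}},
      cvg (f^`() r @[r --> a^'+]) /\ cvg (f^`() r @[r --> b^'-]) &
      cvg (f^`(2) r @[r --> a^'+]) /\ cvg (f^`(2) r @[r --> b^'-])].

(* Differentiability at t of f : D -> R, the difference quotients being taken
   inside D: two-sided when t is interior to D, one-sided at an endpoint. *)
Definition derivable_rel (R : realType) (D : set R) (f : R -> R) (t : R) :
    Prop :=
  exists l : R, (f s - f t) / (s - t) @[s --> within D t^'] --> l.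

Definition zero_ext (R : realType) (X : R -> R) (u : R -> R -> R) (t : R) :
  R -> R := (u ^~ t) \_ `[0, X t].

Definition mass (R : realType) (X : R -> R) (u : R -> R -> R) (t : R) : R :=
  \int[lebesgue_measure]_(r in `[0, X t]) u r t.

(* u r t is meaningful for 0 <= t < T and 0 <= r <= X t only. For fixed r the
   function s |-> u r s thus lives on {s in [0, T[ | r <= X s}. *)
Record quasi_solution (R : realType) (j : R) (rho0 : R -> R) (T eps : R)
    (X : R -> R) (u : R -> R -> R) : Prop := QuasiSolution {
  qs_eps_gt0 : 0 < eps;
  qs_X_gt0 : forall t : R, 0 <= t < T -> 0 < X t;
  qs_X_lipschitz : [lipschitz X t | t in `[0, T[%classic];
  qs_X_C1 : piecewise_C1 T X;
  qs_u_ge0 : forall r t : R, 0 <= t < T -> 0 <= r <= X t -> 0 <= u r t;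
  qs_u_C2 : forall t : R, 0 <= t < T -> C2_up_to_boundary 0 (X t) (u ^~ t);
  qs_u_time : forall r t : R, 0 <= t < T -> 0 <= r <= X t ->
    derivable_rel [set s | 0 <= s < T /\ r <= X s] (u r) t;
  qs_heat : forall r t : R, 0 < t < T -> 0 < r < X t ->
    (u r)^`() t = 2^-1 * ((u ^~ t)^`(2))%classic r;
  qs_flux : forall t : R, 0 < t < T ->
    (u ^~ t)^`() r @[r --> 0^'+] --> - (2 * j);
  qs_dirichlet : forall t : R, 0 < t < T -> u (X t) t = 0;
  qs_initial :
    (\int[lebesgue_measure]_(r in @Rplus R)
       `|zero_ext X u 0 r - rho0 r|%:E <= eps%:E)%E;
  qs_mass :
    (ereal_sup [set `|mass X u t - mass X u 0%R|%:E | t in `[0%R, T[%classic]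
       <= eps%:E)%E
}.

Definition optimal_sequence (R : realType) (j : R) (rho0 : R -> R) (T : R)
    (X : nat -> R -> R) (u : nat -> R -> R -> R) (eps : nat -> R) : Prop :=
  (forall n, quasi_solution j rho0 T (eps n) (X n) (u n)) /\
  eps n @[n --> \oo] --> 0.

(* Weak convergence of the measures v n r dr on R_+ to the finite measure
   w r dr. *)
Definition weak_cvg (R : realType) (v : nat -> R -> R) (w : R -> R) : Prop :=
  (@lebesgue_measure R).-integrable (@Rplus R) (EFin \o w) /\
  forall phi : R -> R, {within @Rplus R, continuous phi} ->
    [bounded phi r | r in @Rplus R] ->
    (\int[lebesgue_measure]_(r in @Rplus R) (phi r * v n r)) @[n --> \oo] -->
    \int[lebesgue_measure]_(r in @Rplus R) (phi r * w r).

Definition generalized_solution (R : realType) (j : R) (rho0 : R -> R) (T : R)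
    (rho : R -> R -> R) : Prop :=
  exists (X : nat -> R -> R) (u : nat -> R -> R -> R) (eps : nat -> R),
    optimal_sequence j rho0 T X u eps /\
    forall t : R, 0 <= t < T ->
      weak_cvg (fun n => zero_ext (X n) (u n) t) (rho ^~ t).

(* Main.v *)
(* For a quasi-solution put [V t r = \int_0^r u]. On [r < X t] it satisfies [V_t = V_rr / 2 + j],
   and for [r >= X t] it equals the mass, which is constant up to [2 eps]: up to [O(eps)], [V]
   solves an obstacle problem whose data do not involve [X]. The comparison principle for it
   bounds the distance of two such [V] by the sum of their accuracies, so [V] converges uniformly
   along every optimal sequence to a limit depending only on [rho0]. Parabolic scaling and
   comparison with quadratic polynomials show that the limit is [C^1,1] in space at positive
   times; its gradient is the continuous representative [rhobar], and uniform convergence of the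
   primitives gives weak convergence of the densities. As [u] is only separately regular, the
   maximum principle first needs a joint bound on [u], obtained by Baire's theorem in space and
   then in time.
   Existence: [W = heat potential + SS], with [SS] the potential of the flux at the origin, has a
   single positive zero [X t] with negative slope when the initial datum changes sign once, by
   total positivity of the Gaussian. At the times of a fine grid the datum is replaced beyond
   [X t] by a negative bump chosen so that the mass of the positive part is restored at the next
   time of the grid; [X] stays [C^1] by the implicit function theorem. *)
Require Import Defs.
From mathcomp Require Import all_boot all_order all_algebra.
From mathcomp Require Import all_classical all_reals all_analysis.
From mathcomp Require Import measurable_realfun ess_sup_inf ring lra.
Import Order.TTheory GRing.Theory Num.Theory.
Import numFieldNormedType.Exports.
Local Open Scope ring_scope.
Local Open Scope classical_set_scope.
Set Implicit Arguments.
Unset Strict Implicit.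
Unset Printing Implicit Defensive.

(** The flux condition at the free boundary never enters: conservation of mass replaces it, and
    fixes the level of the obstacle. Comparison uses forward difference quotients in time only,
    which is all that can be controlled without joint smoothness. What blocks a direct maximum
    principle: a function continuous in each variable separately may stay strictly below a barrier
    at a time [t0] and yet touch it at times decreasing to [t0]. Compactness in space does not
    exclude this as long as the slices have no common modulus of continuity; Baire's theorem
    supplies one on a portion of the set of bad times. Existence is obtained without solving a
    moving boundary problem. Between grid times the density is, up to the term [2 * j * |x|], a
    caloric function on the whole line, and the quasi-solution is its restriction to the interval of
    positivity, hence smooth up to the boundary. The fictitious datum beyond the zero is the free
    parameter that steers the mass. Over a mesh [h] the source adds at most [4 * j * h] to the
    whole-line mass, which fixes the accuracy. *)

Notation itg D f := (integrable (@lebesgue_measure _) D (EFin \o f)) (only parsing).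

(** * Real-variable and integration tools *)

Section RealBasics.
Context {R : realType}.
Implicit Types (f g : R -> R) (x l : R).

Lemma is_derive_epsP f x l : is_derive x 1 f l <->
 forall e : R, 0 < e -> exists2 d : R, 0 < d &
 forall y : R, `|y - x| < d -> `|f y - f x - l * (y - x)| <= e * `|y - x|.
Proof.
split.
 move=> [df dl] e e0;have /cvg_ex[l' H] := df.
 have {dl} El : l = l' by rewrite -dl;apply/cvg_lim.
 rewrite -{l'}El in H.
 move/cvgrPdist_le: H => /(_ _ e0) [d /= d0 Hd].
 exists d => // y yd.
 have [->|yx] := eqVneq y x;first by rewrite !subrr mulr0 subrr normr0 mulr0.
 have yx0 : y - x != 0 by rewrite subr_eq0.
 have := Hd (y - x);rewrite /ball_ /= sub0r normrN => /(_ yd yx0).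
 rewrite /shift /= scaler1 subrK => H1.
 have -> : f y - f x - l * (y - x) = - (l - (y - x)^-1 *: (f y - f x)) * (y - x).
 by rewrite /GRing.scale /=;field.
 by rewrite normrM normrN ler_wpM2r.
move=> H.
have cv : h^-1 *: ((f \o shift x) (h *: (1:R)) - f x) @[h --> 0^'] --> l.
 apply/cvgrPdist_le => e e0.
 have [d d0 Hd] := H _ e0.
 exists d => //= h /=;rewrite sub0r normrN => hd h0.
 rewrite scaler1 /shift /=.
 have := Hd (h + x);rewrite addrK => /(_ hd) H1.
 have -> : l - h^-1 *: (f (h + x) - f x) = - (h^-1 * (f (h + x) - f x - l * h)).
 by rewrite /GRing.scale /=;field.
 by rewrite normrN normrM normfV ler_pdivrMl ?normr_gt0// [_ * e]mulrC.
apply: DeriveDef;first by apply/cvg_ex;exists l.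
by apply/cvg_lim.
Qed.

Lemma is_derive_cont f x l : is_derive x 1 f l ->
 forall e : R, 0 < e -> exists2 d : R, 0 < d & forall y : R, `|y - x| < d -> `|f y - f x| < e.
Proof.
move=> /is_derive_epsP /(_ 1 ltr01) [d d0 H] e e0.
have L0 : 0 < `|l| + 1 by rewrite ltr_wpDl.
exists (Num.min d (e / (`|l| + 1))) => [|y];first by rewrite lt_min d0 divr_gt0.
rewrite lt_min => /andP[/H H1 H2].
have -> : f y - f x = (f y - f x - l * (y - x)) + l * (y - x) by ring.
apply: le_lt_trans (ler_normD _ _) _;rewrite normrM.
move: H2;rewrite ltr_pdivlMr// => H2;nra.
Qed.

Lemma cont_epsP f x : {for x, continuous f} <->
 forall e : R, 0 < e -> exists2 d : R, 0 < d & forall y : R, `|y - x| < d -> `|f y - f x| < e.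
Proof.
split.
 move=> /cvgrPdist_lt H e e0;have [d d0 Hd] := H e e0.
 exists d => // y yd;rewrite distrC;apply: Hd => /=.
 by rewrite /ball /= distrC.
move=> H;apply/cvgrPdist_lt => e e0;have [d d0 Hd] := H e e0.
by exists d => //= y /= yd;rewrite distrC;apply: Hd;rewrite distrC.
Qed.

Lemma MVT_le f df (a b : R) : a <= b ->
 (forall x, a <= x <= b -> is_derive x 1 f (df x)) ->
 exists2 c, a <= c <= b & f b - f a = df c * (b - a).
Proof.
move=> ab H.
have [||c cab E] := @MVT_segment R f df a b ab.
- by move=> x;rewrite in_itv /= => /andP[/ltW ? /ltW ?];apply: H;apply/andP.
- apply: derivable_within_continuous => x;rewrite in_itv/= => xab.
 by case: (H _ xab).
by exists c => //;move: cab;rewrite in_itv.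
Qed.

Lemma der_ext (f g : R -> R) x (a d0 : R) : 0 < d0 ->
 (forall y : R, `|y - x| < d0 -> f y = g y) -> is_derive x 1 f a -> is_derive x 1 g a.
Proof.
move=> d00 fg /is_derive_epsP H;apply/is_derive_epsP => e e0.
have [d d_gt0 Hd] := H _ e0.
exists (Num.min d d0) => [|y];first by rewrite lt_min d_gt0.
rewrite lt_min => /andP[yd yd0].
by rewrite -!fg ?subrr ?normr0//;exact: Hd.
Qed.

(** Second derivative in the symmetric sense of Schwarz. It asks for no first derivative, is
    additive, and still has a sign at a local maximum, which is all that the comparison arguments
    use. *)
Definition D2 f x (b : R) := forall e : R, 0 < e -> exists2 d : R, 0 < d &
 forall h : R, 0 < h < d -> `|f (x + h) + f (x - h) - 2 * f x - b * h ^+ 2| <= e * h ^+ 2.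

Lemma derD f g x (a b : R) : is_derive x 1 f a -> is_derive x 1 g b ->
 is_derive x 1 (fun y => f y + g y) (a + b).
Proof. by move=> ? ?;exact: is_deriveD. Qed.

Lemma derN f x (a : R) : is_derive x 1 f a -> is_derive x 1 (fun y => - f y) (- a).
Proof. by move=> ?;exact: is_deriveN. Qed.

Lemma derB f g x (a b : R) : is_derive x 1 f a -> is_derive x 1 g b ->
 is_derive x 1 (fun y => f y - g y) (a - b).
Proof. by move=> ? ?;exact: is_deriveB. Qed.

Lemma derZ (k : R) f x (a : R) : is_derive x 1 f a -> is_derive x 1 (fun y => k * f y) (k * a).
Proof. by move=> ?;exact: is_deriveZ. Qed.

Lemma derM f g x (a b : R) : is_derive x 1 f a -> is_derive x 1 g b ->
 is_derive x 1 (fun y => f y * g y) (a * g x + f x * b).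
Proof.
move=> ? ?;have := @is_deriveM R R f g x 1 a b _ _.
by rewrite addrC [g x *: a]mulrC;exact.
Qed.

Lemma derC (k x : R) : is_derive x 1 (fun _ : R => k : R) 0.
Proof. exact: is_derive_cst. Qed.

Lemma derI (x : R) : is_derive x 1 (fun y : R => y : R) 1.
Proof. exact: is_derive_id. Qed.

Lemma derV f x (a : R) : is_derive x 1 f a -> f x != 0 ->
 is_derive x 1 (fun y => (f y)^-1) (- (f x) ^- 2 * a).
Proof. by move=> ? ?;exact: is_deriveV. Qed.

Lemma derX n f x (a : R) : is_derive x 1 f a ->
 is_derive x 1 (fun y => f y ^+ n) (n%:R * f x ^+ n.-1 * a).
Proof.
move=> Hf;have -> : (fun y => f y ^+ n) = f ^+ n.
 by apply/funext => y;rewrite exprfctE.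
exact: is_deriveX.
Qed.

Lemma derE f x (a b : R) : is_derive x 1 f a -> a = b -> is_derive x 1 f b.
Proof. by move=> + <-. Qed.

Lemma der_comp f g x (a b : R) : is_derive (g x) 1 f a -> is_derive x 1 g b ->
 is_derive x 1 (fun y => f (g y)) (a * b).
Proof. exact: is_derive1_comp. Qed.

(** The mean value theorem for [phi], whose derivative compares [f'] at two symmetric points, uses
    differentiability of [f'] at [x] only. *)
Lemma D2_derive f f' x (b d0 : R) : 0 < d0 ->
 (forall y : R, `|y - x| < d0 -> is_derive y 1 f (f' y)) -> is_derive x 1 f' b ->
 D2 f x b.
Proof.
move=> d00 Hf /is_derive_epsP Hb e e0.
have e20 : 0 < e / 2 by rewrite divr_gt0.
have [d1 d10 H1] := Hb _ e20.
exists (Num.min d0 d1) => [|h /andP[h0]];first by rewrite lt_min d00.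
rewrite lt_min => /andP[hd0 hd1].
pose phi t := f (x + t) + f (x - t) - b * t ^+ 2.
pose dphi t := f' (x + t) - f' (x - t) - b * (2 * t).
have [t th|c /andP[c0 ch]] := @MVT_le phi dphi 0 h (ltW h0).
 have Hp y : `|y - x| <= t -> `|y - x| < d0.
 by move=> /le_lt_trans;apply;case/andP: th => _ /le_lt_trans;apply.
 have t0 : 0 <= t by case/andP: th.
 have A1 : is_derive t 1 (fun t => f (x + t)) (f' (x + t) * (0 + 1)).
 apply: (@der_comp f (fun t => x + t)) (derD (derC _ _) (derI _)).
 by apply: Hf;apply: Hp;rewrite (addrC x) addrK ger0_norm.
 have A2 : is_derive t 1 (fun t => f (x - t)) (f' (x - t) * (0 - 1)).
 apply: (@der_comp f (fun t => x - t)) (derB (derC _ _) (derI _)).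
 by apply: Hf;apply: Hp;rewrite (addrC x) addrK normrN ger0_norm.
 apply: (derE (derB (derD A1 A2) (derZ b (derM (derI t) (derI t))))).
 rewrite /dphi;ring.
rewrite /phi addr0 subr0 expr0n /= mulr0 subr0 => E.
have -> : f (x + h) + f (x - h) - 2 * f x - b * h ^+ 2 =
 f (x + h) + f (x - h) - b * h ^+ 2 - (f x + f x) by ring.
rewrite E /dphi.
have -> : f' (x + c) - f' (x - c) - b * (2 * c) =
 (f' (x + c) - f' x - b * (x + c - x)) - (f' (x - c) - f' x - b * (x - c - x)) by ring.
rewrite normrM expr2 [`|h - 0|]ger0_norm ?subr0 ?(ltW h0)// mulrA ler_wpM2r ?(ltW h0)//.
have B1 : `|f' (x + c) - f' x - b * (x + c - x)| <= e / 2 * h.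
 apply: le_trans (H1 _ _) _;rewrite (addrC x) addrK ger0_norm//.
 exact: le_lt_trans hd1.
 by rewrite ler_wpM2l// ltW.
have B2 : `|f' (x - c) - f' x - b * (x - c - x)| <= e / 2 * h.
 apply: le_trans (H1 _ _) _;rewrite (addrC x) addrK normrN ger0_norm//.
 exact: le_lt_trans hd1.
 by rewrite ler_wpM2l// ltW.
by apply: le_trans (ler_normB _ _) _;lra.
Qed.

Lemma D2_ext f g x (b d0 : R) : 0 < d0 -> (forall y : R, `|y - x| < d0 -> f y = g y) ->
 D2 f x b -> D2 g x b.
Proof.
move=> d00 fg H e e0;have [d d_gt0 Hd] := H e e0.
exists (Num.min d d0) => [|h /andP[h0]];first by rewrite lt_min d_gt0.
rewrite lt_min => /andP[hd hd0].
have E1 : f (x + h) = g (x + h) by apply: fg;rewrite (addrC x) addrK ger0_norm// ltW.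
have E2 : f (x - h) = g (x - h) by apply: fg;rewrite (addrC x) addrK normrN ger0_norm// ltW.
have E3 : f x = g x by apply: fg;rewrite subrr normr0.
by rewrite -E1 -E2 -E3;apply: Hd;rewrite h0.
Qed.

Lemma D2D f g x (a b : R) : D2 f x a -> D2 g x b -> D2 (fun y => f y + g y) x (a + b).
Proof.
move=> Hf Hg e e0;have e20 : 0 < e / 2 by rewrite divr_gt0.
have [d1 d10 H1] := Hf _ e20;have [d2 d20 H2] := Hg _ e20.
exists (Num.min d1 d2) => [|h /andP[h0]];first by rewrite lt_min d10.
rewrite lt_min => /andP[hd1 hd2].
have := H1 h;rewrite h0 hd1 => /(_ isT) B1.
have := H2 h;rewrite h0 hd2 => /(_ isT) B2.
rewrite [X in `|X| <= _](_ : _ = (f (x + h) + f (x - h) - 2 * f x - a * h ^+ 2) +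
 (g (x + h) + g (x - h) - 2 * g x - b * h ^+ 2));last by ring.
apply: le_trans (ler_normD _ _) _;lra.
Qed.

Lemma D2Z (k : R) f x (a : R) : D2 f x a -> D2 (fun y => k * f y) x (k * a).
Proof.
move=> Hf e e0;have k0 : 0 < `|k| + 1 by rewrite ltr_wpDl.
have [d1 d10 H1] := Hf _ (divr_gt0 e0 k0).
exists d1 => // h hd;have := H1 h hd.
rewrite [X in _ -> `|X| <= _](_ : _ = k * (f (x + h) + f (x - h) - 2 * f x - a * h ^+ 2));last by ring.
rewrite normrM => B.
have : `|k| * `|f (x + h) + f (x - h) - 2 * f x - a * h ^+ 2| <= (`|k| + 1) * (e / (`|k| + 1) * h ^+ 2).
 by apply: ler_pM => //;rewrite lerDl.
by rewrite [X in _ <= X -> _](_ : _ = e * h ^+ 2) //;field;rewrite gt_eqF.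
Qed.

Lemma D2C (k x : R) : D2 (fun=> k) x 0.
Proof.
move=> e e0;exists 1 => // h _.
rewrite [X in `|X| <= _](_ : _ = 0);last by ring.
by rewrite normr0 mulr_ge0 ?sqr_ge0// ltW.
Qed.

Lemma D2_max f x (b d0 : R) : 0 < d0 -> (forall y : R, `|y - x| < d0 -> f y <= f x) ->
 D2 f x b -> b <= 0.
Proof.
move=> d00 Hm Hb;rewrite leNgt;apply/negP => b0.
have b20 : 0 < b / 2 by rewrite divr_gt0.
have [d d_gt0 Hd] := Hb _ b20.
pose h := Num.min d d0 / 2.
have m0 : 0 < Num.min d d0 by rewrite lt_min d_gt0.
have h0 : 0 < h by rewrite divr_gt0.
have hm : h < Num.min d d0 by rewrite /h;lra.
move: hm;rewrite lt_min => /andP[hd hd0].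
have B1 : f (x + h) <= f x by apply: Hm;rewrite (addrC x) addrK ger0_norm// ltW.
have B2 : f (x - h) <= f x by apply: Hm;rewrite (addrC x) addrK normrN ger0_norm// ltW.
have := Hd h;rewrite h0 hd => /(_ isT);rewrite ler_norml => /andP[+ _].
have : 0 < b / 2 * h ^+ 2 by rewrite mulr_gt0// exprn_gt0.
lra.
Qed.

Lemma der_lt_left f x (a : R) : is_derive x 1 f a -> a < 0 ->
 exists2 d : R, 0 < d & forall y : R, x - d < y < x -> f x < f y.
Proof.
move=> /is_derive_epsP H a0.
have e0 : 0 < - a / 2 by rewrite divr_gt0 // oppr_gt0.
have [d d0 Hd] := H _ e0;exists d => // y /andP[y1 y2].
have yd : `|y - x| < d by rewrite ltr0_norm ?subr_lt0//;lra.
have := Hd y yd;rewrite [X in _ <= _ * X]ltr0_norm ?subr_lt0//.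
rewrite ler_norml => /andP[+ _];nra.
Qed.

End RealBasics.

Section Integrals.
Context {R : realType}.
Notation mu := (@lebesgue_measure R).
Implicit Types (D : set R) (f G : R -> R).

Lemma aeS (P Q : R -> Prop) : (forall x, P x -> Q x) ->
 {ae mu, forall x, P x} -> {ae mu, forall x, Q x}.
Proof. by move=> PQ;apply: filterS PQ;exact: (ae_filter_ringOfSetsType mu). Qed.

Lemma dct_seq D (F : nat -> R -> R) f G : measurable D ->
 (forall n, measurable_fun D (F n)) -> measurable_fun D f ->
 {ae mu, forall x, D x -> F n x @[n --> \oo] --> f x} ->
 itg D G ->
 (forall n x, D x -> `|F n x| <= G x) ->
 itg D f /\
 forall e : R, 0 < e -> exists N, forall n, (N <= n)%N ->
 \int[mu]_(x in D) `|F n x - f x| <= e.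
Proof.
move=> mD mF mf Ff iG FG.
have [|||||i1 i2 _] := @dominated_convergence _ _ R mu D mD (fun n => EFin \o F n) (EFin \o f) (EFin \o G).
- move=> n;apply/measurable_EFinP. have := mF n;exact.
- exact/measurable_EFinP.
- move: Ff;apply: aeS => x Hx Dx;apply: cvg_EFin;last exact: Hx.
 by apply: nearW.
- by [].
- by apply: aeW => x n Dx /=;rewrite lee_fin;exact: FG.
split=> // e e0.
move/fine_cvgP: i2 => [_ /cvgrPdist_le /(_ _ e0)[N _ HN]].
exists N => n /HN /=;rewrite sub0r normrN => H.
by apply: le_trans (ler_norm _) _.
Qed.

(** A failure gives a sequence of parameters tending to [a], to which the sequential theorem
    applies. The predicate [P] confines the parameters, for instance to one side of [a]. *)
Lemma dct_eps D (P : R -> Prop) (F : R -> R -> R) f G (a : R) : measurable D ->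
 (forall s, P s -> measurable_fun D (F s)) -> measurable_fun D f ->
 {ae mu, forall x, D x -> forall e : R, 0 < e -> exists2 d : R, 0 < d &
 forall s, P s -> `|s - a| < d -> `|F s x - f x| < e} ->
 itg D G ->
 (forall s x, P s -> D x -> `|F s x| <= G x) ->
 forall e : R, 0 < e -> exists2 d : R, 0 < d & forall s, P s -> `|s - a| < d ->
 \int[mu]_(x in D) `|F s x - f x| <= e.
Proof.
move=> mD mF mf Ff iG FG e e0;apply: contrapT => H.
have {}H : forall n : nat, exists s, [/\ P s, `|s - a| < n.+1%:R^-1 &
 e < \int[mu]_(x in D) `|F s x - f x|].
 move=> n;apply: contrapT => Hn;apply: H;exists n.+1%:R^-1 => [|s Ps sa].
 by rewrite invr_gt0.
 by rewrite leNgt;apply/negP => es;apply: Hn;exists s.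
have [s Hs] := choice H.
have [|||||_ /(_ _ e0)[N /(_ N (leqnn N))]] := @dct_seq D (fun n => F (s n)) f G mD.
- by move=> n;apply: mF;case: (Hs n).
- by [].
- move: Ff;apply: aeS => x Hx Dx;apply/cvgrPdist_lt => h h0.
 have [d d0 Hd] := Hx Dx h h0.
 have [m Hm] : exists m : nat, m.+1%:R^-1 < d.
 exists (Num.truncn d^-1);rewrite invf_plt ?posrE ?ltr0n//.
 by rewrite -[X in X < _]invrK;rewrite invrK;exact: truncnS_gt.
 exists m => // n /= mn;rewrite distrC;case: (Hs n) => Pn sn _;apply: Hd => //.
 apply: lt_trans sn _;apply: le_lt_trans Hm.
 by rewrite lef_pV2 ?posrE ?ltr0n// ler_nat.
- by [].
- by move=> n x Dx;apply: FG => //;case: (Hs n).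
by rewrite leNgt;case: (Hs N) => _ _ ->.
Qed.
End Integrals.

Section Under.
Context {R : realType}.
Notation mu := (@lebesgue_measure R).

Lemma der_under (D : set R) (f df : R -> R -> R) (G : R -> R) (a d0 : R) :
 measurable D -> 0 < d0 ->
 (forall x : R, `|x - a| < d0 -> itg D (f x)) ->
 (forall x y : R, `|x - a| < d0 -> D y -> is_derive x 1 (f ^~ y) (df x y)) ->
 itg D G ->
 (forall x y : R, `|x - a| < d0 -> D y -> `|df x y| <= G y) ->
 is_derive a 1 (fun x => \int[mu]_(y in D) f x y) (\int[mu]_(y in D) df a y).
Proof.
move=> mD d00 fi fd Gi Gb.
have I x : `]a - d0, a + d0[%classic x -> `|x - a| < d0.
 by rewrite /= in_itv /= ltr_norml => /andP[? ?];apply/andP;split;lra.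
have Ia : `]a - d0, a + d0[%classic a by rewrite /= in_itv /=;apply/andP;split;lra.
have iG : itg D (fun y => `|G y|).
 exact: integrable_norm.
have E x y : `]a - d0, a + d0[%classic x -> D y -> partial1of2 f x y = df x y.
 move=> /I xa Dy;rewrite /partial1of2 derive1E;case: (fd x y xa Dy) => _ ?;by [].
have H1 := @derivable_under_integral R _ _ mu f D mD a (a - d0) (a + d0) Ia
 (fun x Ix => fi x (I x Ix))
 (fun x y Ix Dy => @ex_derive _ _ _ _ _ _ _ (fd x y (I x Ix) Dy)) (fun y => `|G y|)
 (fun y => normr_ge0 _) iG.
have B x y : `]a - d0, a + d0[%classic x -> D y -> `|partial1of2 f x y| <= `|G y|.
 by move=> Ix Dy;rewrite E//;apply: le_trans (ler_norm _);apply: Gb (I _ Ix) Dy.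
have H2 := @differentiation_under_integral R _ _ mu f D mD a (a - d0) (a + d0) Ia
 (fun x Ix => fi x (I x Ix))
 (fun x y Ix Dy => @ex_derive _ _ _ _ _ _ _ (fd x y (I x Ix) Dy)) (fun y => `|G y|)
 (fun y => normr_ge0 _) iG B.
apply: DeriveDef;first exact: H1 B.
rewrite -derive1E H2;apply: eq_Rintegral => y /set_mem Dy;exact: E.
Qed.

Lemma cont_measurable (f : R -> R) (D : set R) : measurable D ->
 (forall x : R, exists l : R, is_derive x 1 f l) -> measurable_fun D f.
Proof.
move=> mD H;apply: measurable_funTS;apply: continuous_measurable_fun => x.
by have [l Hl] := H x;apply: differentiable_continuous;apply/derivable1_diffP;case: Hl.
Qed.
End Under.

Section IntegrableAlg.
Context {R : realType}.
Notation mu := (@lebesgue_measure R).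
Implicit Types (D : set R) (f g : R -> R).

Lemma iZ D (k : R) f : measurable D -> itg D f ->
 itg D (fun y => k * f y).
Proof.
move=> mD fi;have := @integrableZl _ (measurableTypeR R) R mu D mD k (EFin \o f) fi.
exact: eq_integrable.
Qed.

Lemma iD D f g : measurable D -> itg D f ->
 itg D g -> itg D (fun y => f y + g y).
Proof.
move=> mD fi gi;have := @integrableD _ (measurableTypeR R) R mu D mD (EFin \o f) (EFin \o g) fi gi.
exact: eq_integrable.
Qed.

Lemma iB D f g : measurable D -> itg D f ->
 itg D g -> itg D (fun y => f y - g y).
Proof.
move=> mD fi gi;have := @integrableB _ (measurableTypeR R) R mu D mD (EFin \o f) (EFin \o g) fi gi.
exact: eq_integrable.
Qed.

Lemma iabs D f : measurable D -> itg D f ->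
 itg D (fun y => `|f y|).
Proof. by move=> mD fi;exact: integrable_norm. Qed.

Lemma i_le D f g : measurable D -> measurable_fun D f ->
 (forall y, D y -> `|f y| <= g y) -> itg D g ->
 itg D f.
Proof.
move=> mD mf fg;apply: le_integrable => //.
 by apply/measurable_EFinP;have := mf;exact.
by move=> y Dy /=;rewrite lee_fin (le_trans (fg y Dy))// ler_norm.
Qed.

Lemma i_meas D f : itg D f -> measurable_fun D f.
Proof. by case/integrableP => /measurable_EFinP. Qed.

Lemma le_I D f g : measurable D -> itg D f ->
 itg D g -> (forall y : R, D y -> f y <= g y) ->
 \int[mu]_(y in D) f y <= \int[mu]_(y in D) g y.
Proof. by move=> mD fi gi fg;exact: le_Rintegral. Qed.

Lemma I_ge0 D f : (forall y : R, D y -> 0 <= f y) -> 0 <= \int[mu]_(y in D) f y.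
Proof. by move=> f0;exact: Rintegral_ge0. Qed.

Lemma I_norm D f : measurable D -> itg D f ->
 `|\int[mu]_(y in D) f y| <= \int[mu]_(y in D) `|f y|.
Proof. by move=> mD fi;exact: le_normr_Rintegral. Qed.

Lemma IZ D (k : R) f : measurable D -> itg D f ->
 \int[mu]_(y in D) (k * f y) = k * \int[mu]_(y in D) f y.
Proof. by move=> mD fi;exact: RintegralZl. Qed.

Lemma ID D f g : measurable D -> itg D f ->
 itg D g ->
 \int[mu]_(y in D) (f y + g y) = \int[mu]_(y in D) f y + \int[mu]_(y in D) g y.
Proof. by move=> mD fi gi;exact: RintegralD. Qed.

Lemma IB D f g : measurable D -> itg D f ->
 itg D g ->
 \int[mu]_(y in D) (f y - g y) = \int[mu]_(y in D) f y - \int[mu]_(y in D) g y.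
Proof. by move=> mD fi gi;exact: RintegralB. Qed.

Lemma eq_I D f g : (forall y : R, D y -> f y = g y) ->
 \int[mu]_(y in D) f y = \int[mu]_(y in D) g y.
Proof. by move=> fg;apply: eq_Rintegral => y /set_mem;exact: fg. Qed.
End IntegrableAlg.

Section Compactness.
Context {R : realType}.
Implicit Types (f : R -> R) (a b x : R).

(** Compactness in near-covering form along [0^'+]. In some uses [h] is the time elapsed after a
    given instant, in others the inverse of an upper bound. *)
Lemma compact_unif (P : R -> R -> Prop) a b :
 (forall x, a <= x <= b -> exists2 d : R, 0 < d &
 forall y h : R, a <= y <= b -> `|y - x| < d -> 0 < h < d -> P y h) ->
 exists2 d : R, 0 < d & forall x h : R, a <= x <= b -> 0 < h < d -> P x h.
Proof.
move=> H.
have /compact_near_coveringP/(_ R (0^'+) (fun h x => a <= x <= b -> P x h) _) := @segment_compact R a b.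
case.
 move=> x;rewrite /= in_itv /= => /H[d d0 Hd].
 exists (ball x d, [set h | 0 < h < d]).
 split => /=;first exact: nbhsx_ballx.
 exists d => //= h;rewrite /= sub0r normrN => hd h0;rewrite h0/=.
 by apply: le_lt_trans hd;exact: ler_norm.
 move=> [y h] [/= xy hd] yab;apply: Hd => //.
 by rewrite distrC.
move=> e /= e0 He;exists e => // x h xab /andP[h0 he].
by apply: (He h) => //=;rewrite ?in_itv//= sub0r normrN gtr0_norm.
Qed.

(** Projection onto the segment, 1-Lipschitz; composing with it extends a function continuous on
    [[a, b]] to a continuous function on the line. *)
Definition clamp a b x : R := Num.max a (Num.min b x).

Lemma clamp_in a b x : a <= b -> a <= clamp a b x <= b.
Proof. by move=> ab;rewrite /clamp le_max lexx ge_max ab ge_min lexx. Qed.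

Lemma clamp_id a b x : a <= x <= b -> clamp a b x = x.
Proof. by move=> /andP[ax xb];rewrite /clamp (min_idPr xb) (max_idPr ax). Qed.

Lemma clamp_lip a b x y : `|clamp a b x - clamp a b y| <= `|x - y|.
Proof.
wlog xy : x y / y <= x.
 by move=> W;have [/W//|/ltW/W] := leP y x;rewrite distrC (distrC y).
rewrite [X in _ <= X]ger0_norm ?subr_ge0//.
rewrite /clamp /Num.max /Num.min;repeat case: ifPn;rewrite -?leNgt => *;
 rewrite ler_norml;apply/andP;split;lra.
Qed.

Definition cont_on a b f := forall x, a <= x <= b -> forall e : R, 0 < e ->
 exists2 d : R, 0 < d & forall y : R, a <= y <= b -> `|y - x| < d -> `|f y - f x| < e.

Lemma cont_on_clamp a b f : a <= b -> cont_on a b f ->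
 forall x e : R, 0 < e -> exists2 d : R, 0 < d &
 forall y : R, `|y - x| < d -> `|f (clamp a b y) - f (clamp a b x)| < e.
Proof.
move=> ab cf x e e0;have [d d0 Hd] := cf _ (clamp_in x ab) e e0.
exists d => // y yd;apply: Hd;first exact: clamp_in.
exact: le_lt_trans (clamp_lip _ _ _ _) yd.
Qed.

Lemma EVT_eps a b f : a <= b -> cont_on a b f ->
 exists2 c : R, a <= c <= b & forall x, a <= x <= b -> f x <= f c.
Proof.
move=> ab cf.
have C : continuous (fun x => f (clamp a b x)).
 by move=> x;apply/cont_epsP;exact: cont_on_clamp.
have [c cab Hc] := EVT_max ab (continuous_subspaceT C).
have cab' : a <= c <= b by move: cab;rewrite in_itv.
exists c => // x xab;have := Hc x;rewrite in_itv /= => /(_ xab).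
by rewrite !clamp_id.
Qed.

(** Baire's theorem for a relatively closed subset [K] of an open interval covered by the relatively
    closed pieces [E n]: one piece contains a portion of [K]. Otherwise nested intervals, each
    avoiding one more [E n] on [K], shrink to a point of [K] that lies in no [E n]. *)
Lemma Baire_itv (p q : R) (K : R -> Prop) (E : nat -> R -> Prop) :
 (forall x, K x -> p < x < q) ->
 (forall x, p < x < q -> (forall d : R, 0 < d -> exists2 y, K y & `|y - x| < d) -> K x) ->
 (forall n x, K x -> (forall d : R, 0 < d -> exists y, [/\ K y, E n y & `|y - x| < d]) -> E n x) ->
 (forall x, K x -> exists n, E n x) ->
 (exists x, K x) ->
 exists n (a b x0 : R), [/\ K x0, a < x0 < b, p < a, b < q & forall x, K x -> a < x < b -> E n x].
Proof.
move=> Kpq Kcl Ecl KE [x0 Kx0];apply: contrapT => H.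
have {}H : forall n a b x0, K x0 -> a < x0 < b -> exists x, [/\ K x, a < x < b & ~ E n x].
 move=> n a b x1 Kx1 x1ab;apply: contrapT => Hn;apply: H.
 have /andP[px xq] := Kpq _ Kx1;case/andP: x1ab => ax xb.
 exists n, (Num.max a ((p + x1) / 2)), (Num.min b ((x1 + q) / 2)), x1;split => //.
 - rewrite gt_max lt_min ax xb /=;apply/andP;split;lra.
 - rewrite lt_max;apply/orP;right;lra.
 - rewrite gt_min;apply/orP;right;lra.
 move=> x Kx;rewrite gt_max lt_min => /andP[/andP[xa _] /andP[bx _]].
 by apply: contrapT => En;apply: Hn;exists x;split=> //;rewrite xa.
have step : forall (n : nat) (I : R * R), (exists x, K x /\ I.1 < x < I.2) ->
 exists J : R * R, [/\ exists x, K x /\ J.1 < x < J.2, I.1 < J.1, J.2 < I.2,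
 J.2 - J.1 < n.+1%:R^-1 & forall x, K x -> J.1 <= x <= J.2 -> ~ E n x].
 move=> n [a b] /= [x [Kx xab]].
 have [y [Ky /andP[ay yb] Ey]] := H n a b x Kx xab.
 have [d d0 Hd] : exists2 d : R, 0 < d & forall z, K z -> `|z - y| < d -> ~ E n z.
 apply: contrapT => Hc;apply: Ey;apply: Ecl => // d d0.
 apply: contrapT => Hz;apply: Hc;exists d => // z Kz zy Ez.
 by apply: Hz;exists z.
 (* The factor 1/4 keeps the closed interval of radius [r] strictly inside []a, b[], inside the ball
    where [E n] fails, and of length below [n.+1%:R^-1]. *)
 pose r : R := Num.min (Num.min d n.+1%:R^-1) (Num.min (y - a) (b - y)) / 4.
 have m0 : 0 < Num.min (Num.min d n.+1%:R^-1) (Num.min (y - a) (b - y)).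
 by rewrite !lt_min d0 invr_gt0 ltr0n/= !subr_gt0 ay yb.
 have r0 : 0 < r by rewrite divr_gt0.
 have : 4 * r <= Num.min (Num.min d n.+1%:R^-1) (Num.min (y - a) (b - y)) by rewrite /r;lra.
 rewrite !le_min => /andP[/andP[rd rn] /andP[ra rb]].
 clearbody r;exists (y - r, y + r) => /=;split;[|lra|lra| |].
 by exists y;split => //;apply/andP;split;lra.
 by apply: lt_le_trans rn;lra.
 move=> z Kz /andP[z1 z2];apply: Hd => //;rewrite ltr_norml;apply/andP;split;lra.
have [F HF] : exists F : forall (n : nat) (I : R * R), R * R,
 forall n I, (exists x, K x /\ I.1 < x < I.2) ->
 [/\ exists x, K x /\ (F n I).1 < x < (F n I).2, I.1 < (F n I).1, (F n I).2 < I.2,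
 (F n I).2 - (F n I).1 < n.+1%:R^-1 & forall x, K x -> (F n I).1 <= x <= (F n I).2 -> ~ E n x].
 have HH : forall nI : nat * (R * R), exists J : R * R, (exists x, K x /\ nI.2.1 < x < nI.2.2) ->
 [/\ exists x, K x /\ J.1 < x < J.2, nI.2.1 < J.1, J.2 < nI.2.2,
 J.2 - J.1 < nI.1.+1%:R^-1 & forall x, K x -> J.1 <= x <= J.2 -> ~ E nI.1 x].
 move=> [n I];have [HI|HI] := pselect (exists x, K x /\ I.1 < x < I.2).
 by have [J HJ] := step n I HI;exists J.
 by exists (0, 0).
 have [F HF] := choice HH.
 by exists (fun n I => F (n, I)) => n I HI;exact: (HF (n, I)).
have /andP[px0 x0q] := Kpq _ Kx0.
pose I := fix I n := if n is m.+1 then F m (I m) else (p, q).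
have HI n : exists x, K x /\ (I n).1 < x < (I n).2.
 elim: n => [|n IH] /=;first by exists x0;rewrite px0 x0q.
 by case: (HF n (I n) IH).
have Imono n m : (I n).1 <= (I (n + m)%N).1 /\ (I (n + m)%N).2 <= (I n).2.
 elim: m => [|m [IH1 IH2]];first by rewrite addn0.
 rewrite addnS /=;have [_ h1 h2 _ _] := HF (n + m)%N (I (n + m)%N) (HI (n + m)%N).
 by split;[apply: le_trans IH1 (ltW h1)|apply: le_trans (ltW h2) IH2].
have Icross n m : (I n).1 < (I m).2.
 have [x [_ /andP[x1 x2]]] := HI (n + m)%N.
 have [a1 _] := Imono n m;have [_] := Imono m n;rewrite addnC => b2.
 by apply: le_lt_trans a1 _;apply: lt_le_trans b2;exact: lt_trans x2.
pose S := [set x | exists n, x = (I n).1].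
have S0 : S !=set0 by exists (I 0).1, 0%N.
have Sb m : ubound S (I m).2 by move=> _ [n ->];exact/ltW/Icross.
have Ss : has_sup S by split => //;exists (I 0).2;exact: Sb.
pose l := sup S.
have l1 n : (I n).1 <= l by apply: sup_upper_bound => //;exists n.
have l2 n : l <= (I n).2 by apply: sup_le_ub.
have lI n : (I n.+1).1 <= l <= (I n.+1).2 by rewrite l1 l2.
have pl : p < l.
 by apply: lt_le_trans (l1 1%N);have [] := HF 0%N (I 0%N) (HI 0%N).
have lq : l < q.
 by apply: le_lt_trans (l2 1%N) _;have [] := HF 0%N (I 0%N) (HI 0%N).
have Kl : K l.
 apply: Kcl => [|d d0];first by rewrite pl.
 have [m Hm] : exists m : nat, m.+1%:R^-1 < d.
 exists (Num.truncn d^-1);rewrite invf_plt ?posrE ?ltr0n//.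
 exact: truncnS_gt.
 have [x [Kx /andP[xa xb]]] := HI m.+1;exists x => //.
 have [_ _ _ hl _] := HF m (I m) (HI m).
 have /andP[la lb] := lI m;move: xa xb la lb => /=.
 move: (F m (I m)).1 (F m (I m)).2 hl => u v hl *.
 have hl2 := lt_trans hl Hm.
 rewrite ltr_norml;apply/andP;split;lra.
have [n En] := KE _ Kl.
by have [_ _ _ _ /(_ l Kl (lI n))] := HF n (I n) (HI n).
Qed.
End Compactness.

Section IntegralItv.
Context {R : realType}.
Notation mu := (@lebesgue_measure R).
Implicit Types (f : R -> R) (a b M : R).

Lemma i_itv_bnd a b f M : measurable_fun `[a, b] f ->
 (forall y, a <= y <= b -> `|f y| <= M) -> itg `[a, b] f.
Proof.
move=> mf fM;apply: (i_le _ _ (g := fun=> M)) => //.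
apply: continuous_compact_integrable;first exact: segment_compact.
by apply: continuous_subspaceT => x;exact: cvg_cst.
Qed.

Lemma i_supp D f : measurable D -> (forall y, ~ D y -> f y = 0) ->
 itg D f -> itg setT f.
Proof.
move=> mD f0 fi;have := @integrable_mkcond _ (measurableTypeR R) R mu D (EFin \o f) mD.
case=> /(_ fi) + _;apply: eq_integrable => // y _.
rewrite /= patchE;case: ifPn => // /negP yD;rewrite f0// => /mem_set //.
Qed.

Lemma I_supp D f : (forall y, ~ D y -> f y = 0) ->
 \int[mu]_y f y = \int[mu]_(y in D) f y.
Proof.
move=> f0;rewrite [RHS]Rintegral_mkcond;apply: eq_Rintegral => y _.
by rewrite patchE;case: ifPn => // /negP yD;rewrite f0// => /mem_set.
Qed.

Lemma cont_eps_meas D f : measurable D ->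
 (forall x e : R, 0 < e -> exists2 d : R, 0 < d & forall y : R, `|y - x| < d -> `|f y - f x| < e) ->
 measurable_fun D f.
Proof.
move=> mD H;apply: measurable_funTS;apply: continuous_measurable_fun => x.
exact/cont_epsP/H.
Qed.
End IntegralItv.

Lemma max0_lip {R : realType} (u v : R) : `|Num.max u 0 - Num.max v 0| <= `|u - v|.
Proof.
wlog uv : u v / u <= v => [H|].
 by have [/H//|/ltW/H] := leP u v;rewrite distrC (distrC v).
rewrite distrC (distrC u) !ger0_norm ?subr_ge0// ?le_max2l//;last by rewrite ge_max !le_max uv lexx orbT.
rewrite lerBlDr ge_max;apply/andP;split.
 by rewrite -lerBlDl opprB addrCA subrr addr0 le_max lexx.
by rewrite addr_ge0 ?subr_ge0// le_max lexx orbT.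
Qed.

(** * Heat potentials *)

Section Kernel.
Context {R : realType}.
Implicit Types (t x y : R).

Lemma expR_ge_pow (n : nat) (s : R) : 0 <= s -> s ^+ n <= n%:R ^+ n * expR s.
Proof.
move=> s0;case: n => [|n];first by rewrite !expr0 mul1r -expR0 ler_expR.
have n0 : 0 < n.+1%:R :> R by rewrite ltr0n.
have : s / n.+1%:R <= expR (s / n.+1%:R).
 by apply: le_trans (expR_ge1Dx _);rewrite lerDr.
have sn : 0 <= s / n.+1%:R by rewrite divr_ge0// ltW.
move=> /(lerXn2r n.+1 sn (expR_ge0 _)).
rewrite -expRM_natl [n.+1%:R * _]mulrC divfK ?gt_eqF// expr_div_n ler_pdivrMr ?exprn_gt0//.
by rewrite mulrC.
Qed.

(** The value [0] for [t <= 0] makes a potential vanish before its datum is introduced, and smooth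
    across that time away from the support of the datum. *)
Definition hk t x : R := if 0 < t then
 (Num.sqrt (2 * pi))^-1 * (Num.sqrt t)^-1 * expR (- (x ^+ 2 / (2 * t))) else 0.

(** A family closed under both derivatives, each of which preserves [a <= b.*2]. That inequality
    gives bounds for [|x|] away from [0] which are uniform down to [t = 0] and for large [|x|]. *)
Definition kk (a b : nat) t x : R := x ^+ a * t ^- b * hk t x.

Lemma hk_ge0 t x : 0 <= hk t x.
Proof.
by rewrite /hk;case: ifP => // _;rewrite !mulr_ge0 ?invr_ge0 ?sqrtr_ge0 ?expR_ge0.
Qed.

Lemma sqrt2pi_ge1 : 1 <= Num.sqrt (2 * pi : R).
Proof.
rewrite -[X in X <= _]sqrtr1 ler_sqrt ?mulr_ge0 ?pi_ge0//.
have := pi_ge2 R;lra.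
Qed.

Lemma hk_le t x : 0 < t -> hk t x <= (Num.sqrt t)^-1 * expR (- (x ^+ 2 / (2 * t))).
Proof.
move=> t0;rewrite /hk t0 -mulrA ler_piMl//.
by rewrite invf_le1 ?sqrt2pi_ge1//;apply: lt_le_trans sqrt2pi_ge1.
Qed.

Lemma kk00 t x : kk 0 0 t x = hk t x.
Proof. by rewrite /kk !expr0 invr1 !mul1r. Qed.

Lemma kk_neg a b t x : t <= 0 -> kk a b t x = 0.
Proof. by rewrite leNgt /kk /hk => /negbTE ->;rewrite mulr0. Qed.

Lemma hkN t x : hk t (- x) = hk t x.
Proof. by rewrite /hk sqrrN. Qed.

Lemma kk_scale a b n t x : t != 0 -> kk a b t x = t ^+ n * kk a (b + n) t x.
Proof.
move=> t0;rewrite /kk exprD invfM.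
by field;rewrite !expf_neq0.
Qed.

Lemma hk_der_x t x : is_derive x 1 (hk t) (- (x / t) * hk t x).
Proof.
rewrite /hk;case: ifP => [t0|_];last first.
 by apply: (derE (derC 0 x));rewrite mulr0.
set c := _^-1 / _.
have D1 := derN (derM (derM (derI x) (derI x)) (derC (2 * t)^-1 x)).
have D2 : is_derive x 1 (fun y : R => expR (- (y * y * (2 * t)^-1))) _ :=
 der_comp (is_derive_expR _) D1.
have := derZ c D2.
rewrite [X in is_derive _ _ X _](_ : _ = (fun y : R => c * expR (- (y ^+ 2 / (2 * t)))));last first.
 by apply/funext => y;rewrite expr2.
move=> /derE;apply.
rewrite -expr2;set E := expR _.
by field;rewrite gt_eqF.
Qed.

Lemma hk_der_t t x : 0 < t ->
 is_derive t 1 (hk ^~ x) ((x ^+ 2 / (2 * t ^+ 2) - (2 * t)^-1) * hk t x).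
Proof.
move=> t0.
pose c := (Num.sqrt (2 * pi) : R)^-1.
pose h (s : R) := c * (Num.sqrt s)^-1 * expR (- (x ^+ 2 * (2 * s)^-1)).
have st0 : 0 < Num.sqrt t by rewrite sqrtr_gt0.
have S1 : is_derive t 1 (fun s : R => (Num.sqrt s)^-1) _ :=
 derV (is_derive1_sqrt t0) (lt0r_neq0 st0).
have t20 : 2 * t != 0 by rewrite gt_eqF// mulr_gt0.
have S2 := derV (derZ 2 (derI t)) t20.
have S3 := derN (derZ (x ^+ 2) S2).
have S4 : is_derive t 1 (fun s : R => expR (- (x ^+ 2 * (2 * s)^-1))) _ :=
 der_comp (is_derive_expR _) S3.
have S5 : is_derive t 1 h _ := derM (derZ c S1) S4.
apply: (der_ext t0 _ (derE S5 _)).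
 move=> s st;have s0 : 0 < s.
 by move: st;rewrite ltr_norml => /andP[+ _];lra.
 by rewrite /h /hk s0.
rewrite /hk t0 -/c;set E := expR _.
rewrite sqr_sqrtr ?ltW//;set q := Num.sqrt t in st0 *.
by field;rewrite !gt_eqF.
Qed.

Lemma kk_der_x (a b : nat) t x : is_derive x 1 (kk a b t)
 (a%:R * kk a.-1 b t x - kk a.+1 b.+1 t x).
Proof.
have [t0|t0] := ltP 0 t;last first.
 apply: (der_ext ltr01 _ (derE (derC 0 x) _)) => [y _|];rewrite ?kk_neg//.
 by rewrite mulr0 subr0.
have D1 : is_derive x 1 (fun y : R => y ^+ a) (a%:R * x ^+ a.-1).
 by apply: (derE (derX a (derI x)));rewrite mulr1.
have := derM (derM D1 (derC (t ^- b) x)) (hk_der_x t x).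
move=> /derE;apply;rewrite /kk [in t ^- b.+1]exprS [x ^+ a.+1]exprS.
by field;rewrite expf_neq0 gt_eqF.
Qed.

Lemma kk_der_t0 (a b : nat) t x : 0 < t -> is_derive t 1 (fun s => kk a b s x)
 (2^-1 * kk a.+2 b.+2 t x - (b%:R + 2^-1) * kk a b.+1 t x).
Proof.
move=> t0.
have D0 : is_derive t 1 (fun s : R => s ^+ b) (b%:R * t ^+ b.-1).
 by apply: (derE (derX b (derI t)));rewrite mulr1.
have D1 : is_derive t 1 (fun s : R => s ^- b) (- (t ^+ b) ^- 2 * (b%:R * t ^+ b.-1)).
 by apply: derV D0 _;rewrite expf_neq0 ?gt_eqF.
have := derM (derM (derC (x ^+ a) t) D1) (hk_der_t x t0).
move=> /derE;apply;rewrite /kk.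
have -> : t ^+ b.+2 = t ^+ b * t * t by rewrite !exprSr.
have -> : t ^+ b.+1 = t ^+ b * t by rewrite !exprSr.
have -> : x ^+ a.+2 = x ^+ a * x * x by rewrite !exprSr.
have tb : t ^+ b != 0 by rewrite expf_neq0 ?gt_eqF.
have -> : - t ^+ b ^- 2 * (b%:R * t ^+ b.-1) = - b%:R / (t ^+ b * t).
 case: b {D0 D1} tb => [|b] tb;first by rewrite !(mul0r,mulr0,oppr0).
 by rewrite /= exprS in tb *;field;move: tb;rewrite mulf_eq0 negb_or => /andP[-> ->].
by field;rewrite tb gt_eqF.
Qed.
End Kernel.

Section KernelBounds.
Context {R : realType}.
Notation mu := (@lebesgue_measure R).
Implicit Types (t x y : R).

(** For [t >= t0] the exponential absorbs the powers of [x]. For [|x| >= eta], the variable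
    [s = x ^+ 2 / (2 * t)] trades the singular power of [t] for a power of [s], absorbed likewise,
    and leaves a negative power of [|x|] because [a <= b.*2]. *)
Lemma kk_bound (a b : nat) (T t0 eta : R) : (a <= b.*2)%N -> 0 < T -> 0 < t0 -> 0 < eta ->
 exists2 C : R, 0 <= C & forall t x, t <= T -> t0 <= t \/ eta <= `|x| -> `|kk a b t x| <= C.
Proof.
move=> ab T0 t00 eta0.
pose C1 := t0 ^- b * (Num.sqrt t0)^-1 * (1 + (2 * T) ^+ a * a%:R ^+ a).
pose C2 := Num.sqrt T * (2 ^+ b.+1 * b.+1%:R ^+ b.+1) * eta ^- (b.*2.+2 - a).
have C10 : 0 <= C1.
 by rewrite /C1 !mulr_ge0 ?invr_ge0 ?exprn_ge0 ?sqrtr_ge0 ?addr_ge0 ?mulr_ge0 ?exprn_ge0// ltW// mulr_gt0.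
have C20 : 0 <= C2 by rewrite /C2 !mulr_ge0 ?invr_ge0 ?exprn_ge0 ?sqrtr_ge0// ltW.
exists (C1 + C2);first exact: addr_ge0.
move=> t x tT H.
have [t0'|tpos] := leP t 0;first by rewrite kk_neg// normr0 addr_ge0.
pose s := x ^+ 2 / (2 * t).
have s0 : 0 <= s by rewrite divr_ge0 ?sqr_ge0// mulr_ge0// ltW.
have x2 : `|x| ^+ 2 = 2 * s * t.
 by rewrite real_normK ?num_real// /s;field;rewrite gt_eqF.
have Es (n : nat) : s ^+ n * expR (- s) <= n%:R ^+ n.
 by rewrite expRN ler_pdivrMr ?expR_gt0//;exact: expR_ge_pow.
have K : `|kk a b t x| <= `|x| ^+ a * t ^- b * ((Num.sqrt t)^-1 * expR (- s)).
 have tb : 0 <= t ^- b by rewrite invr_ge0 exprn_ge0// ltW.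
 rewrite /kk !normrM normrX (ger0_norm (hk_ge0 _ _)) (ger0_norm tb).
 by rewrite ler_wpM2l ?hk_le// mulr_ge0 ?exprn_ge0.
have E1 : expR (- s) <= 1 by rewrite -expR0 ler_expR oppr_le0.
case: H => [tt|xe].
 apply: (@le_trans _ _ C1);last by rewrite lerDl.
 apply: (le_trans K);rewrite /C1.
 have A : `|x| ^+ a * expR (- s) <= 1 + (2 * T) ^+ a * a%:R ^+ a.
 apply: (@le_trans _ _ ((1 + (2 * T) ^+ a * s ^+ a) * expR (- s))).
 rewrite ler_wpM2r ?expR_ge0//.
 have : `|x| ^+ a <= 1 + (`|x| ^+ a) ^+ 2.
 have := sqr_ge0 (`|x| ^+ a - 1);have := sqr_ge0 (`|x| ^+ a);nra.
 move=> /le_trans;apply;rewrite lerD2l exprAC x2 -exprMn.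
 have Q : 2 * s * t <= 2 * T * s.
 by have := ler_wpM2l s0 tT;lra.
 have Q0 : 0 <= 2 * s * t by rewrite -x2 exprn_ge0.
 exact: (lerXn2r a Q0 (le_trans Q0 Q)).
 rewrite mulrDl mul1r lerD// -mulrA ler_wpM2l//.
 by rewrite exprn_ge0// mulr_ge0// ltW.
 rewrite [X in X <= _](_ : _ = t ^- b * (Num.sqrt t)^-1 * (`|x| ^+ a * expR (- s)));last by ring.
 apply: ler_pM => //.
 by rewrite mulr_ge0 ?invr_ge0 ?sqrtr_ge0 ?exprn_ge0// ltW.
 apply: ler_pM;rewrite ?invr_ge0 ?sqrtr_ge0 ?exprn_ge0 ?(ltW tpos)//.
 rewrite lef_pV2 ?posrE ?exprn_gt0//;apply: lerXn2r;rewrite ?nnegrE// ltW//.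
 by rewrite lef_pV2 ?posrE ?sqrtr_gt0// ler_sqrt// ltW.
apply: (@le_trans _ _ C2);last by rewrite lerDr.
have x0 : 0 < `|x| by exact: lt_le_trans xe.
apply: (le_trans K);rewrite /C2.
have E2 : `|x| ^+ a * t ^- b * ((Num.sqrt t)^-1 * expR (- s)) =
 Num.sqrt t * (2 ^+ b.+1 * (s ^+ b.+1 * expR (- s))) * `|x| ^- (b.*2.+2 - a).
 have xa : `|x| ^+ a * `|x| ^+ (b.*2.+2 - a) = (2 * s * t) ^+ b.+1.
 rewrite -exprD subnKC;last by rewrite (leq_trans ab)// !leqW.
 by rewrite -x2 -exprM mul2n doubleS.
 have -> : `|x| ^+ a = (2 * s * t) ^+ b.+1 / `|x| ^+ (b.*2.+2 - a).
 by rewrite -xa mulfK// expf_neq0// gt_eqF.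
 rewrite !exprMn [t ^+ b.+1]exprS.
 have -> : t * t ^+ b = Num.sqrt t * Num.sqrt t * t ^+ b.
 by rewrite -expr2 sqr_sqrtr// ltW.
 field;rewrite !expf_neq0 ?gt_eqF ?sqrtr_gt0//.
rewrite E2;apply: ler_pM.
- by rewrite !mulr_ge0 ?sqrtr_ge0 ?exprn_ge0 ?expR_ge0.
- by rewrite invr_ge0 exprn_ge0.
- apply: ler_pM;rewrite ?sqrtr_ge0 ?mulr_ge0 ?exprn_ge0 ?expR_ge0//.
 by rewrite ler_sqrt// ltW.
 by rewrite ler_wpM2l// exprn_ge0.
rewrite lef_pV2 ?posrE ?exprn_gt0//;apply: lerXn2r;rewrite ?nnegrE//;exact: ltW.
Qed.

(** At [t = 0] with [x != 0] both sides vanish: factoring out [t ^+ 2] leaves the kernel of index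
    [b.+2], which is bounded there. *)
Lemma kk_der_t (a b : nat) t x : (a <= b.*2)%N -> 0 < t \/ x != 0 ->
 is_derive t 1 (fun s => kk a b s x)
 (2^-1 * kk a.+2 b.+2 t x - (b%:R + 2^-1) * kk a b.+1 t x).
Proof.
move=> ab;have [t0 _|t0] := ltP 0 t;first exact: kk_der_t0.
case=> [//|x0].
rewrite !(kk_neg _ _ _ t0) !mulr0 subr0.
move: t0;rewrite le_eqVlt => /orP[/eqP -> {t}|tn];last first.
 have tn' : 0 < - t by rewrite oppr_gt0.
 apply: (der_ext tn' _ (derC 0 t)) => y.
 rewrite ltr_norml => /andP[_ yt];rewrite kk_neg//;lra.
have [||||C C0 HC] := @kk_bound a b.+2 1 1 `|x|;rewrite ?normr_gt0//.
 by rewrite doubleS doubleS !leqW.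
apply/is_derive_epsP => e e0.
exists (Num.min 1 (e / (C + 1))) => [|y];first by rewrite lt_min ltr01 divr_gt0// ltr_wpDl.
rewrite subr0 lt_min => /andP[y1 ye];rewrite mul0r subr0 (kk_neg _ _ _ (lexx 0)) subr0.
have [y0|y0] := leP y 0;first by rewrite kk_neg// normr0 mulr_ge0// ltW.
rewrite (kk_scale _ _ 2 _ (lt0r_neq0 y0)) addn2 normrM expr2 normrM.
rewrite (gtr0_norm y0) in y1 ye *.
have := HC y x (ltW y1) (or_intror (lexx _)).
move: ye;rewrite ltr_pdivlMr ?ltr_wpDl// => ye B.
have : y * y * `|kk a b.+2 y x| <= y * y * C by rewrite ler_wpM2l// mulr_ge0// ltW.
move=> /le_trans;apply;nra.
Qed.

Lemma hk_normal t : 0 < t -> hk t = normal_pdf 0 (Num.sqrt t).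
Proof.
move=> t0;have s0 : Num.sqrt t != 0 by rewrite gt_eqF// sqrtr_gt0.
apply/funext => x;rewrite normal_pdfE// /normal_peak /normal_fun /hk t0.
rewrite subr0 sqr_sqrtr ?(ltW t0)//;congr (_ * expR _).
 rewrite -invfM -sqrtrM ?mulr_ge0 ?pi_ge0//;congr ((Num.sqrt _)^-1);ring.
by rewrite mulNr mulr_natl.
Qed.

Lemma hk_int t : 0 < t -> itg setT (hk t).
Proof. by move=> t0;rewrite hk_normal//;exact: integrable_normal_pdf. Qed.

Lemma hk_int1 t : 0 < t -> \int[mu]_x hk t x = 1.
Proof. by move=> t0;rewrite hk_normal// /Rintegral integral_normal_pdf. Qed.
End KernelBounds.

Section Potential.
Context {R : realType}.
Notation mu := (@lebesgue_measure R).
Implicit Types (t x y : R).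

Definition UU (F : R -> R) (a b : nat) t x : R := \int[mu]_y (F y * kk a b t (x - y)).

(** The points where the potential is smooth: any positive time, or any time when [x] keeps a
    positive distance from the set where [F] is nonzero. The second case allows a datum to be
    altered far away without disturbing the solution nearby. *)
Definition adm (F : R -> R) t x := 0 < t \/
 exists2 eta : R, 0 < eta & forall y : R, F y != 0 -> eta <= `|x - y|.

Definition L1norm (F : R -> R) : R := \int[mu]_y `|F y|.

Variable F : R -> R.
Hypothesis iF : itg setT F.

Lemma adm_bound (a b : nat) t x : (a <= b.*2)%N -> adm F t x ->
 exists2 C : R, 0 <= C & exists2 d : R, 0 < d & forall t' x',
 `|t' - t| < d -> `|x' - x| < d ->
 adm F t' x' /\ forall y, `|F y * kk a b t' (x' - y)| <= C * `|F y|.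
Proof.
move=> ab [t0|[eta eta0 H]].
 have [|||C C0 HC] := @kk_bound R a b (2 * t) (t / 2) 1 ab;rewrite ?mulr_gt0 ?divr_gt0//.
 exists C => //;exists (t / 2);first exact: divr_gt0.
 move=> t' x';rewrite ltr_norml => /andP[h1 h2] _;split;first by left;lra.
 by move=> y;rewrite normrM mulrC ler_wpM2r// HC;[|lra|left;lra].
have T0 : 0 < `|t| + eta by rewrite ltr_wpDl.
have [|||C C0 HC] := @kk_bound R a b (`|t| + eta) 1 (eta / 2) ab;rewrite ?divr_gt0//.
exists C => //;exists (eta / 2);first exact: divr_gt0.
move=> t' x' ht hx.
have S y : F y != 0 -> eta / 2 <= `|x' - y|.
 move=> /H;have := ler_normD (x - x') (x' - y);rewrite addrA subrK (distrC x x').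
 move: hx;lra.
split;first by right;exists (eta / 2);rewrite ?divr_gt0.
move=> y;have [->|Fy] := eqVneq (F y) 0;first by rewrite mul0r normr0 mulr0.
rewrite normrM mulrC ler_wpM2r// HC//;last by right;exact: S.
have := ler_norm t;move: ht;rewrite ltr_norml => /andP[_];lra.
Qed.

Lemma kkF_meas (a b : nat) t x : measurable_fun setT (fun y => F y * kk a b t (x - y)).
Proof.
apply: measurable_funM;first exact: i_meas iF.
apply: cont_measurable => // y.
exists ((a%:R * kk a.-1 b t (x - y) - kk a.+1 b.+1 t (x - y)) * (0 - 1)).
exact: (@der_comp _ (kk a b t) (fun y => x - y)) (kk_der_x _ _ _ _) (derB (derC x y) (derI y)).
Qed.

Lemma iFC (C : R) : itg setT (fun y => C * `|F y|).
Proof.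
by apply: iZ => //;exact: iabs.
Qed.

Lemma UU_int (a b : nat) t x : (a <= b.*2)%N -> adm F t x ->
 itg setT (fun y => F y * kk a b t (x - y)).
Proof.
move=> ab /(adm_bound ab)[C C0 [d d0 /(_ t x)]].
rewrite !subrr normr0 => /(_ d0 d0)[_ H].
by apply: (i_le _ _ _ (iFC C)) => //;exact: kkF_meas.
Qed.

Lemma UU_bound (a b : nat) t x : (a <= b.*2)%N -> adm F t x ->
 exists2 C : R, 0 <= C & exists2 d : R, 0 < d & forall t' x',
 `|t' - t| < d -> `|x' - x| < d -> `|UU F a b t' x'| <= C.
Proof.
move=> ab H;have [C C0 [d d0 Hd]] := adm_bound ab H.
exists (\int[mu]_y (C * `|F y|));first by apply: Rintegral_ge0 => y _;rewrite mulr_ge0.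
exists d => // t' x' ht hx;have [A B] := Hd _ _ ht hx.
apply: le_trans (le_normr_Rintegral _ _) _ => //;first exact: UU_int.
apply: le_Rintegral => //;last exact: iFC.
exact/iabs/UU_int.
Qed.

Lemma UU_der_x (a b : nat) t x : (a <= b.*2)%N -> adm F t x ->
 is_derive x 1 (UU F a b t) (a%:R * UU F a.-1 b t x - UU F a.+1 b.+1 t x).
Proof.
move=> ab H.
have ab1 : (a.-1 <= b.*2)%N by rewrite (leq_trans (leq_pred a)).
have ab2 : (a.+1 <= b.+1.*2)%N by rewrite doubleS ltnS leqW.
have [C1 C10 [d1 d10 H1]] := adm_bound ab1 H.
have [C2 C20 [d2 d20 H2]] := adm_bound ab2 H.
pose d := Num.min d1 d2.
have d0 : 0 < d by rewrite lt_min d10.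
pose df x y := F y * (a%:R * kk a.-1 b t (x - y) - kk a.+1 b.+1 t (x - y)).
have t1 : `|t - t| < d1 by rewrite subrr normr0.
have t2 : `|t - t| < d2 by rewrite subrr normr0.
have H' := @der_under R setT (fun x y => F y * kk a b t (x - y)) df
 (fun y => (a%:R * C1 + C2) * `|F y|) x d measurableT d0.
apply: (derE (H' _ _ _ _)).
- move=> x';rewrite lt_min => /andP[h1 h2];apply: UU_int => //.
 by have [] := H1 _ _ t1 h1.
- move=> x' y _ _;rewrite /df;apply: derZ.
 apply: (derE (@der_comp _ (kk a b t) (fun x => x - y) x' _ _ (kk_der_x _ _ _ _) (derB (derI x') (derC y x')))).
 by rewrite subr0 mulr1.
- exact: iFC.
- move=> x' y;rewrite lt_min => /andP[h1 h2] _;rewrite /df.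
 have [_ /(_ y) B1] := H1 _ _ t1 h1;have [_ /(_ y) B2] := H2 _ _ t2 h2.
 rewrite mulrBr mulrCA;apply: le_trans (ler_normB _ _) _.
 by rewrite mulrDl lerD// normrM ger0_norm// -mulrA ler_wpM2l.
rewrite /df /UU -RintegralZl//;last exact: UU_int.
have E1 : itg setT (fun y => a%:R * (F y * kk a.-1 b t (x - y))).
 by apply: iZ => //;exact: UU_int.
rewrite -RintegralB//;last exact: UU_int.
by apply: eq_Rintegral => y _;ring.
Qed.

Lemma UU_der_t (a b : nat) t x : (a <= b.*2)%N -> adm F t x ->
 is_derive t 1 (fun s => UU F a b s x)
 (2^-1 * UU F a.+2 b.+2 t x - (b%:R + 2^-1) * UU F a b.+1 t x).
Proof.
move=> ab H.
have ab1 : (a.+2 <= b.+2.*2)%N by rewrite !doubleS !ltnS leqW// leqW.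
have ab2 : (a <= b.+1.*2)%N by rewrite doubleS leqW// leqW.
have [C1 C10 [d1 d10 H1]] := adm_bound ab1 H.
have [C2 C20 [d2 d20 H2]] := adm_bound ab2 H.
pose d := Num.min d1 d2.
have d0 : 0 < d by rewrite lt_min d10.
pose df s y := F y * (2^-1 * kk a.+2 b.+2 s (x - y) - (b%:R + 2^-1) * kk a b.+1 s (x - y)).
have t1 : `|x - x| < d1 by rewrite subrr normr0.
have t2 : `|x - x| < d2 by rewrite subrr normr0.
have bp : 0 <= b%:R + 2^-1 :> R by rewrite addr_ge0.
have H' := @der_under R setT (fun s y => F y * kk a b s (x - y)) df
 (fun y => (2^-1 * C1 + (b%:R + 2^-1) * C2) * `|F y|) t d measurableT d0.
apply: (derE (H' _ _ _ _)).
- move=> s;rewrite lt_min => /andP[h1 h2];apply: UU_int => //.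
 by have [] := H1 _ _ h1 t1.
- move=> s y;rewrite lt_min => /andP[h1 h2] _;rewrite /df.
 have [->|Fy] := eqVneq (F y) 0.
 by apply: (der_ext ltr01 _ (derE (derC 0 s) _)) => [z _|];rewrite mul0r.
 apply: derZ;apply: kk_der_t => //.
 have [[s0|[eta eta0 /(_ y Fy) E]] _] := H1 _ _ h1 t1;first by left.
 by right;rewrite -normr_gt0;exact: lt_le_trans E.
- exact: iFC.
- move=> s y;rewrite lt_min => /andP[h1 h2] _;rewrite /df.
 have [_ /(_ y) B1] := H1 _ _ h1 t1;have [_ /(_ y) B2] := H2 _ _ h2 t2.
 move: B1 B2;set K1 := kk a.+2 _ _ _;set K2 := kk a _ _ _ => B1 B2.
 have -> : F y * (2^-1 * K1 - (b%:R + 2^-1) * K2) = 2^-1 * (F y * K1) - (b%:R + 2^-1) * (F y * K2) by ring.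
 apply: le_trans (ler_normB _ _) _;rewrite [X in _ <= X]mulrDl.
 by rewrite lerD// normrM ger0_norm// -mulrA ler_wpM2l.
have E1 : itg setT (fun y => 2^-1 * (F y * kk a.+2 b.+2 t (x - y))).
 by apply: iZ => //;exact: UU_int.
have E2 : itg setT (fun y => (b%:R + 2^-1) * (F y * kk a b.+1 t (x - y))).
 by apply: iZ => //;exact: UU_int.
rewrite /df /UU -RintegralZl//;last exact: UU_int.
rewrite -[X in _ = _ - X]RintegralZl//;last exact: UU_int.
rewrite -RintegralB//.
by apply: eq_Rintegral => y _;ring.
Qed.

Lemma MVT_lip (f df : R -> R) (C x d : R) :
 (forall y : R, `|y - x| < d -> is_derive y 1 f (df y)) ->
 (forall y : R, `|y - x| < d -> `|df y| <= C) ->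
 forall y : R, `|y - x| < d -> `|f y - f x| <= C * `|y - x|.
Proof.
move=> Hd HC y yd.
wlog xy : f df x y Hd HC yd / x <= y.
 move=> W;have [xy|/ltW yx] := leP x y;first exact: (W f df).
 pose g z := f (- z).
 have := W g (fun z => - df (- z)) (- x) (- y).
 rewrite /g !opprK;have -> : - y + x = - (y - x) by ring.
 rewrite normrN;apply => //;last by rewrite lerN2.
 - move=> z zd;have zd' : `|- z - x| < d by rewrite -normrN opprD !opprK.
 apply: (derE (@der_comp _ f -%R z _ _ (Hd _ zd') (derN (derI z))));by rewrite mulrN1.
 - move=> z zd;rewrite normrN;apply: HC.
 by rewrite -normrN opprD !opprK.
have [z /andP[xz zy]|c /andP[xc cy] ->] := @MVT_le R f df x y xy.
 apply: Hd;apply: le_lt_trans yd;rewrite !ger0_norm ?subr_ge0//;lra.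
rewrite normrM ler_wpM2r//;apply: HC;apply: le_lt_trans yd.
rewrite !ger0_norm ?subr_ge0//;lra.
Qed.

(** Both partial derivatives are combinations of potentials with admissible indices, hence locally
    bounded; moving first in time, then in space, gives a local Lipschitz bound. *)
Lemma UU_cont (a b : nat) t x : (a <= b.*2)%N -> adm F t x ->
 forall e : R, 0 < e -> exists2 d : R, 0 < d & forall t' x',
 `|t' - t| < d -> `|x' - x| < d -> `|UU F a b t' x' - UU F a b t x| < e.
Proof.
move=> ab H e e0.
have ab1 : (a.-1 <= b.*2)%N by rewrite (leq_trans (leq_pred a)).
have ab2 : (a.+1 <= b.+1.*2)%N by rewrite doubleS ltnS leqW.
have ab3 : (a.+2 <= b.+2.*2)%N by rewrite !doubleS !ltnS leqW// leqW.
have ab4 : (a <= b.+1.*2)%N by rewrite doubleS leqW// leqW.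
have [C0 C00 [d0 d00 H0]] := adm_bound ab H.
have [C1 C10 [d1 d10 H1]] := UU_bound ab1 H.
have [C2 C20 [d2 d20 H2]] := UU_bound ab2 H.
have [C3 C30 [d3 d30 H3]] := UU_bound ab3 H.
have [C4 C40 [d4 d40 H4]] := UU_bound ab4 H.
pose C := a%:R * C1 + C2 + (2^-1 * C3 + (b%:R + 2^-1) * C4).
have bp : 0 <= b%:R + 2^-1 :> R by rewrite addr_ge0.
have CC0 : 0 <= C by rewrite /C !addr_ge0 ?mulr_ge0.
pose m := Num.min d0 (Num.min (Num.min d1 d2) (Num.min d3 d4)).
have m0 : 0 < m by rewrite !lt_min d00 d10 d20 d30 d40.
pose d := Num.min m (e / (2 * (C + 1))).
have C1p : 0 < C + 1 by rewrite ltr_wpDl.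
exists d;first by rewrite lt_min m0 divr_gt0// mulr_gt0.
move=> t' x';rewrite !lt_min => /andP[ht he] /andP[hx hxe].
have htm : `|t' - t| < m by rewrite !lt_min.
have hxm : `|x' - x| < m by rewrite !lt_min.
have xx : `|x - x| < m by rewrite subrr normr0.
have tt : `|t - t| < m by rewrite subrr normr0.
have L1 : `|UU F a b t' x' - UU F a b t x'| <= (2^-1 * C3 + (b%:R + 2^-1) * C4) * `|t' - t|.
 apply: (@MVT_lip (fun s => UU F a b s x') (fun s => 2^-1 * UU F a.+2 b.+2 s x' - (b%:R + 2^-1) * UU F a b.+1 s x') _ t m) => //.
 move=> s sm;apply: UU_der_t => //;move: sm hx;rewrite !lt_min => /and3P[sm _ _] /and3P[hx _ _].
 by have [] := H0 _ _ sm hx.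
 have q0 : 0 <= 2^-1 :> R by [].
 move=> s sm;apply: le_trans (ler_normB _ _) _;rewrite !normrM (ger0_norm q0) (ger0_norm bp).
 move: sm hx;rewrite !lt_min => /and3P[_ _ /andP[sm3 sm4]] /and3P[_ _ /andP[hx3 hx4]].
 by apply: lerD;apply: ler_wpM2l => //;[exact: H3|exact: H4].
have L2 : `|UU F a b t x' - UU F a b t x| <= (a%:R * C1 + C2) * `|x' - x|.
 apply: (@MVT_lip (UU F a b t) (fun z => a%:R * UU F a.-1 b t z - UU F a.+1 b.+1 t z) _ x m) => //.
 move=> s sm;apply: UU_der_x => //;move: sm tt;rewrite !lt_min => /and3P[sm _ _] /and3P[tt _ _].
 by have [] := H0 _ _ tt sm.
 move=> s sm;apply: le_trans (ler_normB _ _) _;rewrite !normrM (ger0_norm (ler0n _ a)).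
 move: sm tt;rewrite !lt_min => /and3P[_ /andP[sm3 sm4] _] /and3P[_ /andP[hx3 hx4] _].
 by apply: lerD;[apply: ler_wpM2l => //;exact: H1|exact: H2].
have A1 : (2^-1 * C3 + (b%:R + 2^-1) * C4) * `|t' - t| <= C * `|t' - t|.
 by rewrite ler_wpM2r// /C lerDr addr_ge0 ?mulr_ge0.
have A2 : (a%:R * C1 + C2) * `|x' - x| <= C * `|x' - x|.
 by rewrite ler_wpM2r// /C lerDl addr_ge0 ?mulr_ge0.
move: he hxe;rewrite !ltr_pdivlMr ?mulr_gt0// => he hxe.
have A3 := normr_ge0 (t' - t);have A4 := normr_ge0 (x' - x).
have {}L1 := le_trans L1 A1;have {}L2 := le_trans L2 A2.
move: L1 L2;move: (UU F a b t' x') (UU F a b t x') (UU F a b t x) => u1 u2 u3 L1 L2.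
have -> : u1 - u3 = (u1 - u2) + (u2 - u3) by ring.
apply: le_lt_trans (ler_normD _ _) _.
move: L1 L2 he hxe A3 A4;move: `|u1 - u2| `|u2 - u3| `|t' - t| `|x' - x| => p q r z;clearbody C.
by move=> *;nra.
Qed.
End Potential.

Section Heat.
Context {R : realType}.
Notation mu := (@lebesgue_measure R).
Implicit Types (t x y : R).

Lemma hk_normal_shift t x y : 0 < t -> hk t (x - y) = normal_pdf x (Num.sqrt t) y.
Proof.
move=> t0;have s0 : Num.sqrt t != 0 by rewrite gt_eqF// sqrtr_gt0.
have E : (x - y) ^+ 2 = (y - x) ^+ 2 by rewrite -sqrrN opprB.
by rewrite hk_normal// !normal_pdfE// /normal_fun subr0 E.
Qed.

Lemma hk_shift_int t x : 0 < t -> itg setT (fun y => hk t (x - y)).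
Proof.
move=> t0;have -> : (fun y => hk t (x - y)) = normal_pdf x (Num.sqrt t).
 by apply/funext => y;exact: hk_normal_shift.
exact: integrable_normal_pdf.
Qed.

Lemma hk_shift_int1 t x : 0 < t -> \int[mu]_y hk t (x - y) = 1.
Proof.
move=> t0;have -> : (fun y => hk t (x - y)) = normal_pdf x (Num.sqrt t).
 by apply/funext => y;exact: hk_normal_shift.
by rewrite /Rintegral integral_normal_pdf.
Qed.

Lemma hk_le_sqrt t x : 0 < t -> hk t x <= (Num.sqrt t)^-1.
Proof.
move=> t0;apply: le_trans (hk_le _ t0) _;rewrite ler_piMr ?invr_ge0 ?sqrtr_ge0//.
by rewrite -expR0 ler_expR oppr_le0 divr_ge0 ?sqr_ge0// mulr_ge0// ltW.
Qed.

(** A second-moment bound in pointwise form: half of the exponential absorbs [x ^+ 2], which doubles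
    the time of the remaining kernel. After integration only the unit mass of the kernel is used. *)
Lemma hk_sqr t x : 0 < t -> x ^+ 2 * hk t x <= 8 * t * hk (2 * t) x.
Proof.
move=> t0;have t20 : 0 < 2 * t by rewrite mulr_gt0.
rewrite /hk t0 t20;set c := (Num.sqrt (2 * pi))^-1.
have c0 : 0 <= c by rewrite invr_ge0 sqrtr_ge0.
pose E := expR (- (x ^+ 2 / (2 * (2 * t)))).
have EE : expR (- (x ^+ 2 / (2 * t))) = E * E.
 by rewrite -expRD;congr expR;field;rewrite gt_eqF.
have E0 : 0 < E := expR_gt0 _.
have B : x ^+ 2 * E <= 4 * t.
 pose s := x ^+ 2 / (2 * (2 * t)).
 have s0 : 0 <= s by rewrite divr_ge0 ?sqr_ge0// !mulr_ge0// ltW.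
 have s1 : s * E <= 1.
 rewrite /E -/s expRN ler_pdivrMr ?expR_gt0//.
 by have := @expR_ge_pow R 1 s s0;rewrite !expr1.
 have -> : x ^+ 2 = s * (4 * t) by rewrite /s;field;rewrite gt_eqF.
 by rewrite mulrAC ler_piMl// mulr_ge0// ltW.
have S : (Num.sqrt t)^-1 <= 2 * (Num.sqrt (2 * t))^-1.
 have s1 : 0 < Num.sqrt t by rewrite sqrtr_gt0.
 have s2 : 0 < Num.sqrt (2 * t) by rewrite sqrtr_gt0.
 rewrite -div1r ler_pdivrMr// mulrAC ler_pdivlMr// mul1r.
 have q1 : Num.sqrt t ^+ 2 = t by rewrite sqr_sqrtr// ltW.
 have q2 : Num.sqrt (2 * t) ^+ 2 = 2 * t by rewrite sqr_sqrtr// ltW.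
 rewrite -(@ler_pXn2r _ 2) ?nnegrE ?mulr_ge0 ?(ltW s1) ?(ltW s2)//.
 rewrite exprMn q1 q2;lra.
rewrite EE.
have -> : x ^+ 2 * (c / Num.sqrt t * (E * E)) = c * ((Num.sqrt t)^-1 * (x ^+ 2 * E) * E) by ring.
have -> : 8 * t * (c / Num.sqrt (2 * t) * E) = c * (2 * (Num.sqrt (2 * t))^-1 * (4 * t) * E) by ring.
rewrite ler_wpM2l// ler_wpM2r ?(ltW E0)//.
have V0 : 0 <= (Num.sqrt t)^-1 by rewrite invr_ge0 sqrtr_ge0.
have X0 : 0 <= x ^+ 2 * E by rewrite mulr_ge0 ?sqr_ge0// ltW.
exact: ler_pM.
Qed.

Definition heat (F : R -> R) t x : R := if 0 < t then UU F 0 0 t x else F x.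

Variable F : R -> R.
Hypothesis iF : itg setT F.

Lemma adm_pos t x : 0 < t -> adm F t x. Proof. by left. Qed.

Lemma UU00E t x : UU F 0 0 t x = \int[mu]_y (F y * hk t (x - y)).
Proof. by apply: eq_I => y _;rewrite kk00. Qed.

Lemma heat_int t x : 0 < t -> itg setT (fun y => F y * hk t (x - y)).
Proof.
move=> t0;have := @UU_int R F iF 0 0 t x isT (adm_pos x t0).
by apply: eq_integrable => // y _ /=;rewrite kk00.
Qed.

Lemma heat_ge0 t x : (forall y, 0 <= F y) -> 0 <= heat F t x.
Proof.
move=> F0;rewrite /heat;case: ifP => // _;rewrite UU00E.
by apply: I_ge0 => y _;rewrite mulr_ge0 ?hk_ge0.
Qed.

Lemma heat_le t x : 0 < t -> `|heat F t x| <= (Num.sqrt t)^-1 * L1norm F.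
Proof.
move=> t0;rewrite /heat t0 UU00E;apply: le_trans (I_norm _ _) _ => //.
 exact: heat_int.
rewrite /L1norm -IZ//;last exact: iabs.
apply: le_I => //;first by apply: iabs => //;exact: heat_int.
 by apply: iZ => //;exact: iabs.
by move=> y _;rewrite normrM mulrC ler_wpM2r// ger0_norm ?hk_ge0// hk_le_sqrt.
Qed.

Lemma heat_der_t t x : 0 < t -> is_derive t 1 (fun s => heat F s x)
 (2^-1 * (UU F 2 2 t x - UU F 0 1 t x)).
Proof.
move=> t0;apply: (der_ext t0 _ (derE (@UU_der_t R F iF 0 0 t x isT (adm_pos x t0)) _)).
 by move=> s;rewrite ltr_norml => /andP[st _];rewrite /heat ifT//;lra.
by rewrite add0r mulrBr.
Qed.

Lemma heat_der_x t x : 0 < t -> is_derive x 1 (heat F t) (- UU F 1 1 t x).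
Proof.
move=> t0;rewrite /heat t0.
by apply: (derE (@UU_der_x R F iF 0 0 t x isT (adm_pos x t0)));rewrite mul0r sub0r.
Qed.

Lemma heat_der_xx t x : 0 < t -> is_derive x 1 (fun y => - UU F 1 1 t y)
 (UU F 2 2 t x - UU F 0 1 t x).
Proof.
move=> t0;apply: (derE (derN (@UU_der_x R F iF 1 1 t x isT (adm_pos x t0)))).
by rewrite mul1r opprB.
Qed.

Lemma heat_D2 t x : 0 < t -> D2 (heat F t) x (UU F 2 2 t x - UU F 0 1 t x).
Proof.
move=> t0;apply: (@D2_derive R (heat F t) (fun y => - UU F 1 1 t y) x _ 1) => //.
 by move=> y _;exact: heat_der_x.
exact: heat_der_xx.
Qed.

Lemma heat_cont t x : 0 < t -> forall e : R, 0 < e -> exists2 d : R, 0 < d & forall t' x',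
 `|t' - t| < d -> `|x' - x| < d -> `|heat F t' x' - heat F t x| < e.
Proof.
move=> t0 e e0;have [d d0 Hd] := @UU_cont R F iF 0 0 t x isT (adm_pos x t0) e e0.
exists (Num.min d t) => [|t' x'];first by rewrite lt_min d0.
rewrite !lt_min => /andP[h1 h2] /andP[h3 _].
have t'0 : 0 < t' by move: h2;rewrite ltr_norml => /andP[+ _];lra.
by rewrite /heat t0 t'0;exact: Hd.
Qed.

(** Chebyshev's argument: for [y] far from [x] the oscillation, at most [2 * M], is dominated by
    [A * (x' - y) ^+ 2], and [hk_sqr] makes the corresponding integral of order [t']. *)
Lemma heat_cont0 x (M : R) : (forall y, `|F y| <= M) ->
 (forall e : R, 0 < e -> exists2 d : R, 0 < d & forall y, `|y - x| < d -> `|F y - F x| < e) ->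
 forall e : R, 0 < e -> exists2 d : R, 0 < d & forall t' x',
 t' < d -> `|x' - x| < d -> `|heat F t' x' - F x| < e.
Proof.
move=> FM cF e e0.
have M0 : 0 <= M by apply: le_trans (FM 0).
have e20 : 0 < e / 2 by rewrite divr_gt0.
have [del del0 Hdel] := cF _ e20.
have [A A0 AE] : exists2 A : R, 0 <= A & A = 8 * M / del ^+ 2.
 exists (8 * M / del ^+ 2) => //.
 by apply: divr_ge0;[apply: mulr_ge0|apply: exprn_ge0;exact: ltW].
exists (Num.min (del / 2) (e / (16 * A + 16))).
 by rewrite lt_min !divr_gt0// ltr_wpDl// mulr_ge0.
move=> t' x';rewrite !lt_min => /andP[td te] /andP[xd _].
rewrite /heat;case: ifPn => [t0|_];last first.
 by apply: lt_trans (Hdel _ _) _;lra.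
have i1 := heat_int x' t0.
have i2 := iZ (F x) measurableT (hk_shift_int x' t0).
have t20 : 0 < 2 * t' by rewrite mulr_gt0.
rewrite UU00E -[X in _ - X]mulr1 -(hk_shift_int1 x' t0) -IZ//;last exact: hk_shift_int.
rewrite -IB//.
apply: le_lt_trans (I_norm _ _) _ => //;first exact: iB.
have i3 := iZ (e / 2) measurableT (hk_shift_int x' t0).
have i4 := iZ (A * 8 * t') measurableT (hk_shift_int x' t20).
have : \int[mu]_y `|F y * hk t' (x' - y) - F x * hk t' (x' - y)| <=
 \int[mu]_y (e / 2 * hk t' (x' - y) + A * 8 * t' * hk (2 * t') (x' - y)).
 apply: le_I => //;first by apply: iabs => //;exact: iB.
 exact: iD.
 move=> y _;rewrite -mulrBl normrM [`|hk _ _|]ger0_norm ?hk_ge0//.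
 have t'0 := ltW t0;have e20' := ltW e20.
 have k0 := hk_ge0 t' (x' - y);have k20 := hk_ge0 (2 * t') (x' - y).
 have [yd|yd] := ltP `|y - x| del.
 apply: (@le_trans _ _ (e / 2 * hk t' (x' - y))).
 by rewrite ler_wpM2r// ltW// Hdel.
 by rewrite lerDl !mulr_ge0.
 apply: (@le_trans _ _ (A * 8 * t' * hk (2 * t') (x' - y)));last first.
 by rewrite lerDr mulr_ge0.
 have -> : A * 8 * t' * hk (2 * t') (x' - y) = A * (8 * t' * hk (2 * t') (x' - y)) by ring.
 apply: (@le_trans _ _ (A * ((x' - y) ^+ 2 * hk t' (x' - y))));last first.
 by rewrite ler_wpM2l// hk_sqr.
 rewrite mulrA ler_wpM2r//.
 have F2 : `|F y - F x| <= 2 * M.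
 by apply: le_trans (ler_normB _ _) _;have := FM y;have := FM x;lra.
 apply: (le_trans F2);rewrite AE mulrAC ler_pdivlMr ?exprn_gt0//.
 have D : del / 2 <= `|x' - y|.
 have := ler_normD (y - x') (x' - x);rewrite addrA subrK (distrC y x').
 move: yd xd;lra.
 have : (del / 2) ^+ 2 <= (x' - y) ^+ 2.
 rewrite -(real_normK (num_real (x' - y))).
 by rewrite ler_pXn2r// ?nnegrE// divr_ge0// ltW.
 move=> D2;rewrite [X in _ <= X](_ : _ = 2 * M * (4 * (x' - y) ^+ 2));last by ring.
 by rewrite ler_wpM2l ?mulr_ge0//;move: D2;rewrite expr_div_n;lra.
move/le_lt_trans;apply.
rewrite ID// !IZ//;[|exact: hk_shift_int..].
rewrite !hk_shift_int1// !mulr1.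
have : t' * (16 * A + 16) < e by move: te;rewrite ltr_pdivlMr// ltr_wpDl// mulr_ge0.
have : 0 <= A * t' by rewrite mulr_ge0// ltW.
nra.
Qed.

(* Reflection at [c]: the difference solves the Dirichlet problem on either side of [c]. *)
Lemma heat_refl_ge0 t x (c : R) : (forall y, 0 <= F y) ->
 (forall y, F y != 0 -> 0 <= (x - c) * (y - c)) ->
 0 <= heat F t x - heat F t (2 * c - x).
Proof.
move=> F0 Fc;rewrite subr_ge0 /heat;case: ifP => [t0|_];last first.
 have [->//|/[dup] /Fc H1 Fx] := eqVneq (F (2 * c - x)) 0.
 have -> : 2 * c - x = x;last by [].
 have := sqr_ge0 (x - c);move: H1;rewrite expr2 => H1 H2.
 have : (x - c) ^+ 2 = 0 by apply/eqP;rewrite eq_le sqr_ge0 expr2 andbT;lra.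
 by move=> /eqP;rewrite sqrf_eq0 subr_eq0 => /eqP ->;ring.
rewrite !UU00E;apply: le_I => //;[exact: heat_int..|].
move=> y _;have [->|Fy] := eqVneq (F y) 0;first by rewrite !mul0r.
rewrite ler_wpM2l// /hk t0 ler_wpM2l ?mulr_ge0 ?invr_ge0 ?sqrtr_ge0//.
rewrite ler_expR lerN2 ler_wpM2r ?invr_ge0 ?mulr_ge0 ?(ltW t0)//.
have := Fc y Fy;nra.
Qed.

End Heat.

(** The direct and the reflected kernel agree at [y = c], so the mean value theorem bounds their
    difference by a multiple of [|y - c|]: mass close to the reflection point contributes little,
    uniformly for times away from [0]. *)
Lemma heat_refl_le {R : realType} (t0 T : R) : 0 < t0 -> 0 < T -> exists2 C : R, 0 <= C &
 forall (F : R -> R) (t x c : R), (@lebesgue_measure R).-integrable setT (EFin \o F) -> t0 <= t <= T -> (@lebesgue_measure R).-integrable setT (EFin \o (fun y => `|F y| * `|y - c|)) ->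
 heat F t x - heat F t (2 * c - x) <= C * \int[@lebesgue_measure R]_y (`|F y| * `|y - c|).
Proof.
move=> t00 T0;have [|||C C0 HC] := @kk_bound R 1 1 T t0 1 isT;rewrite ?ltr01//.
exists (2 * C);first by rewrite mulr_ge0.
move=> F t x c iF /andP[tt tT] ic;have tp : 0 < t by exact: lt_le_trans tt.
rewrite /heat tp !UU00E -IB//;[|exact: heat_int..].
rewrite -IZ//;apply: le_I => //.
- by apply: iB => //;exact: heat_int.
- by apply: iZ.
move=> y _;rewrite -mulrBr.
have E : hk t (2 * c - x - y) = hk t (x + y - 2 * c) by rewrite -hkN;congr (hk t _);ring.
have L : `|hk t (x - y) - hk t (2 * c - x - y)| <= C * (2 * `|y - c|).
 have -> : 2 * `|y - c| = `|(x - y) - (x + y - 2 * c)|.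
 by rewrite -[2 in LHS]ger0_norm// -normrM -normrN;congr `|_|;ring.
 rewrite E;apply: (@MVT_lip R (hk t) (fun z => - (z / t) * hk t z) C _ (`|(x - y) - (x + y - 2 * c)| + 1)).
 - by move=> z _;exact: hk_der_x.
 - move=> z _;have := HC t z tT (or_introl tt);rewrite /kk !expr1.
 by rewrite -normrN !mulNr.
 - by rewrite ltrDl.
apply: le_trans (ler_norm _) _;rewrite normrM.
have := ler_wpM2l (normr_ge0 (F y)) L;lra.
Qed.

Section HeatCont.
Context {R : realType}.
Notation mu := (@lebesgue_measure R).

Lemma heat_jcont (F : R -> R) (M : R) : itg setT F ->
 (forall y, `|F y| <= M) ->
 (forall x e : R, 0 < e -> exists2 d : R, 0 < d & forall y : R, `|y - x| < d -> `|F y - F x| < e) ->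
 forall t x e : R, 0 <= t -> 0 < e -> exists2 d : R, 0 < d & forall t' x' : R,
 `|t' - t| < d -> `|x' - x| < d -> `|heat F t' x' - heat F t x| < e.
Proof.
move=> iF FM cF t x e;rewrite le_eqVlt => /orP[/eqP <- {t}|t0] e0;last exact: heat_cont.
have [d d0 Hd] := heat_cont0 iF FM (cF x) e0.
exists d => // t' x';rewrite subr0 => td xd;rewrite {2}/heat ltxx;apply: Hd => //.
exact: le_lt_trans (ler_norm _) td.
Qed.
End HeatCont.

(** * Joint regularity of quasi-solutions *)

Section Rough.
Context {R : realType}.
Notation mu := (@lebesgue_measure R).
Implicit Types (s t r x y a b c d e : R).

(** One-sided, because the even extension of a density with nonzero flux has a corner at the
    origin. *)
Definition rder0 (f : R -> R) (p : R) := forall e, 0 < e -> exists2 d, 0 < d &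
 forall h : R, 0 < h < d -> `|f h - f 0 - p * h| <= e * h.

(** What a quasi-solution, extended evenly and by zero, offers without joint regularity: each slice
    is Lipschitz with its own constant ([rg_lip]), each point is followed continuously in time
    ([rg_tc]), and among the sizes of [g] only the mass is bounded uniformly ([rg_mass]). The
    arguments of [g] are time, then space. *)
Record rough (j T : R) (X : R -> R) (g : R -> R -> R) : Prop := Rough {
 rg_X : forall t, 0 <= t < T -> 0 < X t;
 rg_Xb : exists L : R, forall t, 0 <= t < T -> X t <= L;
 rg_Xc : forall t, 0 < t < T -> forall e, 0 < e -> exists2 d, 0 < d &
 forall s, `|s - t| < d -> `|X s - X t| < e;
 rg_ge0 : forall t r, 0 <= g t r;
 rg_supp : forall t r, 0 < t < T -> X t <= `|r| -> g t r = 0;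
 rg_lip : forall t, 0 < t < T -> exists N : nat, forall r r' : R,
 `|g t r - g t r'| <= N%:R * `|r - r'|;
 rg_tc : forall t r, 0 < t < T -> forall e, 0 < e -> exists2 d, 0 < d &
 forall s, `|s - t| < d -> `|g s r - g t r| < e;
 rg_C2 : forall t, 0 < t < T -> exists g1 g2 : R -> R, [/\
 forall r, 0 < r < X t -> is_derive r 1 (g t) (g1 r) /\ is_derive r 1 g1 (g2 r),
 forall r, 0 < r < X t -> is_derive t 1 (fun s => g s r) (2^-1 * g2 r),
 exists C : R, forall r, 0 < r < X t -> `|g2 r| <= C,
 (forall r, 0 < r < X t -> {for r, continuous g2}) &
 rder0 (g t) (- (2 * j))];
 rg_mass : exists C : R, forall t c d, 0 < t < T -> 0 <= c ->
 \int[mu]_(r in `[c, d]) g t r <= C }.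

Variables (j T : R) (X : R -> R) (g : R -> R -> R).
Hypothesis Hg : rough j T X g.

Section Signed.
Variable sg : R.
Hypothesis sg1 : sg = 1 \/ sg = -1.

(** Comparison from above ([sg = 1]) and from below ([sg = -1]) are treated at once: the goal is
    always [zz < 0]. *)
Definition zz (w : R -> R -> R) t r := sg * (g t r - w t r).

Definition jcont a b c d (w : R -> R -> R) := forall t r, a <= t <= b -> c <= r <= d ->
 forall e, 0 < e -> exists2 h : R, 0 < h & forall t' r' : R, a <= t' <= b -> c <= r' <= d ->
 `|t' - t| < h -> `|r' - r| < h -> `|w t' r' - w t r| < e.

(* Admissible comparison functions on the rectangle [a, b] x [c, d]; the condition [cf_X]
 says that contact can only occur where the equation for [g] is available. *)
Record config a b c d (w : R -> R -> R) : Prop := Config {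
 cf_c : 0 <= c < d;
 cf_cont : jcont a b c d w;
 cf_in : forall t r, a < t <= b -> c < r < d -> exists wt wrr : R,
 [/\ is_derive t 1 (fun s => w s r) wt, D2 (w t) r wrr & 0 < sg * (wt - 2^-1 * wrr)];
 cf_left : (forall t, a <= t <= b -> zz w t c < 0) \/
 (c = 0 /\ forall t, a < t <= b -> exists2 p : R, rder0 (w t) p & 0 < sg * (- (2 * j) - p));
 cf_right : forall t, a <= t <= b -> zz w t d < 0;
 cf_X : exists2 k : R, 0 < k & forall t r, a <= t <= b -> c <= r <= d ->
 - k <= zz w t r -> r < X t;
 cf_init : forall r, c <= r <= d -> zz w a r < 0 }.

Definition Cmp a b := forall c d w, config a b c d w ->
 forall t r, a <= t <= b -> c <= r <= d -> zz w t r < 0.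

(** A time from which comparison works for a while. Goodness of all times of an interval propagates
    comparison through it ([cmp_chain]); the difficulty is to show that no positive time is bad. *)
Definition GoodR a := exists2 h : R, 0 < h & forall b, a < b < a + h -> b < T -> Cmp a b.

Lemma config_sub a b c d w a' b' : config a b c d w -> a <= a' -> a' < b' -> b' <= b ->
 (forall r, c <= r <= d -> zz w a' r < 0) -> config a' b' c d w.
Proof.
move=> H aa ab bb z0;have I t : a' <= t <= b' -> a <= t <= b.
 by move=> /andP[h1 h2];rewrite (le_trans aa)//= (le_trans h2).
have I2 t : a' < t <= b' -> a < t <= b.
 by move=> /andP[h1 h2];rewrite (le_lt_trans aa)//= (le_trans h2).
have [h1 h2 h3 h4 h5 [k k0 h6] h7] := H;split => //.
- move=> t r /I ht hr e e0;have [h h0 Hh] := h2 t r ht hr e e0.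
 by exists h => // t' r' /I ht' hr';exact: Hh.
- by move=> t r /I2;exact: h3.
- case: h4 => [h4|[c0 h4]];[left|right];first by move=> t /I;exact: h4.
 by split=> // t /I2;exact: h4.
- by move=> t /I;exact: h5.
- by exists k => // t r /I;exact: h6.
Qed.

Lemma sgn : `|sg| = 1.
Proof. by case: sg1 => ->;rewrite ?normrN normr1. Qed.

Lemma cf_ab a b c d w : config a b c d w -> c <= d.
Proof. by case=> /andP[_ /ltW]. Qed.

Lemma w_cont a b c d w t : config a b c d w -> a <= t <= b -> cont_on c d (w t).
Proof.
move=> H ht r hr e e0;have [h h0 Hh] := cf_cont H ht hr e0.
by exists h => // y hy yr;apply: Hh => //;rewrite subrr normr0.
Qed.

Lemma g_cont t : 0 < t < T -> forall c d, cont_on c d (g t).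
Proof.
move=> ht c d r hr e e0;have [N HN] := rg_lip Hg ht.
have N1 : 0 < N%:R + 1 :> R by rewrite ltr_wpDl.
exists (e / (N%:R + 1)) => [|y _ yr];first by rewrite divr_gt0.
apply: le_lt_trans (HN _ _) _;move: yr;rewrite ltr_pdivlMr//.
have := normr_ge0 (y - r);nra.
Qed.

Lemma z_cont a b c d w t : config a b c d w -> a <= t <= b -> 0 < t < T ->
 cont_on c d (zz w t).
Proof.
move=> H ht ht' r hr e e0.
have e20 : 0 < e / 2 by rewrite divr_gt0.
have [h1 h10 H1] := w_cont H ht hr e20.
have [h2 h20 H2] := g_cont ht' hr e20.
exists (Num.min h1 h2) => [|y hy];first by rewrite lt_min h10.
rewrite lt_min => /andP[/(H1 _ hy) y1 /(H2 _ hy) y2].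
rewrite /zz -mulrBr normrM sgn mul1r.
have -> : g t y - w t y - (g t r - w t r) = (g t y - g t r) - (w t y - w t r) by ring.
apply: le_lt_trans (ler_normB _ _) _;lra.
Qed.

Lemma g_int t r : 0 < t < T -> 0 < r < X t -> exists grr : R,
 is_derive t 1 (fun s => g s r) (2^-1 * grr) /\ D2 (g t) r grr.
Proof.
move=> ht /andP[r0 rX];have [g1 [g2 [H1 H2 _ _]]] := rg_C2 Hg ht.
exists (g2 r);split;first by apply: H2;rewrite r0.
pose d := Num.min r (X t - r).
have d0 : 0 < d by rewrite lt_min r0 subr_gt0.
apply: (@D2_derive _ _ g1 _ _ d) => //;last by apply: (H1 r _).2;rewrite r0.
move=> y;rewrite lt_min !ltr_norml => /andP[/andP[y1 y2] /andP[y3 y4]].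
by apply: (H1 y _).1;apply/andP;split;lra.
Qed.

Lemma g_rder0 t : 0 < t < T -> rder0 (g t) (- (2 * j)).
Proof. by move=> ht;have [g1 [g2 []]] := rg_C2 Hg ht. Qed.

(* At the first contact time the parabolic inequality is violated; what survives without
 joint continuity is a time with no contact which is a limit, from the right, of contact
 times. *)
Lemma cmp_trunk a b c d w : 0 <= a -> b < T -> config a b c d w ->
 ~ (forall t r, a <= t <= b -> c <= r <= d -> zz w t r < 0) ->
 exists t0, [/\ a <= t0 < b, forall r, c <= r <= d -> zz w t0 r < 0 &
 forall h : R, 0 < h -> exists t r, [/\ t0 < t < t0 + h, t <= b, c <= r <= d & 0 <= zz w t r]].
Proof.
move=> a0 bT H NH.
pose A := [set t | a <= t <= b /\ exists2 r, c <= r <= d & 0 <= zz w t r].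
have A0 : A !=set0.
 apply: contrapT => A0;apply: NH => t r ht hr;rewrite ltNge;apply/negP => zr.
 by apply: A0;exists t;split => //;exists r.
have Al : lbound A a by move=> t [/andP[]].
have Ai : has_inf A by split => //;exists a.
pose t0 := inf A.
have at0 : a <= t0 by apply: lb_le_inf.
have t0b : t0 <= b.
 case: A0 => t At;apply: le_trans (ge_inf _ At) _;first by exists a.
 by case: At => /andP[].
have near h : 0 < h -> exists2 t, A t & t < t0 + h.
 by move=> h0;have [t At th] := inf_adherent h0 Ai;exists t.
have lbA t : A t -> t0 <= t by move=> At;apply: ge_inf => //;exists a.
have no : forall r, c <= r <= d -> zz w t0 r < 0.
 move=> r1 hr1;rewrite ltNge;apply/negP => zr1.
 have at0' : a < t0.
 rewrite lt_neqAle at0 andbT;apply/eqP => E.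
 by have := cf_init H hr1;rewrite E ltNge zr1.
 have tT : 0 < t0 < T by rewrite (le_lt_trans a0)//= (le_lt_trans t0b).
 have ht0 : a <= t0 <= b by rewrite at0.
 have ht0' : a < t0 <= b by rewrite at0'.
 have [r0 hr0 rmax] := EVT_eps (cf_ab H) (z_cont H ht0 tT).
 have zr0 : 0 <= zz w t0 r0 by apply: le_trans zr1 (rmax _ hr1).
 have rd : r0 < d.
 rewrite lt_neqAle;case/andP: (hr0) => _ ->;rewrite andbT;apply/eqP => E.
 by have := cf_right H ht0;rewrite -E ltNge zr0.
 have rX : r0 < X t0.
 have [k k0 Hk] := cf_X H;apply: Hk => //.
 by apply: le_trans zr0;rewrite oppr_le0 ltW.
 have cr : c < r0.
 rewrite lt_neqAle;case/andP: (hr0) => -> _;rewrite andbT;apply/eqP => E.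
 case: (cf_left H) => [/(_ _ ht0)|[c0 /(_ _ ht0')[p Hp sp]]].
 by rewrite E ltNge zr0.
 have E0 : r0 = 0 by rewrite -E.
 (* At the flux boundary the strict inequality of slopes makes [zz] increase to the right of [0] at
    rate about [q], against maximality. *)
 set q := sg * (- (2 * j) - p) in sp.
 have q4 : 0 < q / 4 by rewrite divr_gt0.
 have [d1 d10 Hd1] := g_rder0 tT q4.
 have [d2 d20 Hd2] := Hp _ q4.
 pose h : R := Num.min (Num.min d1 d2) d / 2.
 have m0 : 0 < Num.min (Num.min d1 d2) d by rewrite !lt_min d10 d20 -E0 rd.
 have h0 : 0 < h by rewrite divr_gt0.
 have : h < Num.min (Num.min d1 d2) d by rewrite /h;lra.
 rewrite !lt_min => /andP[/andP[hd1 hd2] hd].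
 have := Hd1 h;rewrite h0 hd1 => /(_ isT) B1.
 have := Hd2 h;rewrite h0 hd2 => /(_ isT) B2.
 have := rmax h;rewrite c0 (ltW h0) (ltW hd) E0 => /(_ isT).
 rewrite /zz leNgt => /negP;apply.
 rewrite -subr_gt0 -mulrBr.
 have -> : sg * (g t0 h - w t0 h - (g t0 0 - w t0 0)) = q * h +
 sg * ((g t0 h - g t0 0 - - (2 * j) * h) - (w t0 h - w t0 0 - p * h)) by rewrite /q;ring.
 have : `|sg * ((g t0 h - g t0 0 - - (2 * j) * h) - (w t0 h - w t0 0 - p * h))| <= q / 2 * h.
 rewrite normrM sgn mul1r;apply: le_trans (ler_normB _ _) _;lra.
 rewrite ler_norml => /andP[+ _].
 have : 0 < q / 2 * h by rewrite mulr_gt0// divr_gt0.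
 lra.
 have hin : c < r0 < d by rewrite cr.
 have [wt [wrr [Dw D2w sw]]] := cf_in H ht0' hin.
 have r00 : 0 < r0 < X t0.
 by rewrite rX andbT;apply: le_lt_trans cr;case/andP: (cf_c H).
 have [grr [Dg D2g]] := g_int tT r00.
 have Dz := derZ sg (derB Dg Dw).
 have D2z : D2 (zz w t0) r0 (sg * (grr + -1 * wrr)).
 apply: (@D2_ext _ (fun y => sg * (g t0 y + -1 * w t0 y)) _ _ _ 1) => //.
 by move=> y _;rewrite mulN1r.
 exact/D2Z/D2D/D2Z.
 have zm : sg * (grr + -1 * wrr) <= 0.
 pose dd := Num.min (r0 - c) (d - r0).
 have dd0 : 0 < dd by rewrite lt_min !subr_gt0 cr.
 apply: D2_max dd0 _ D2z => y;rewrite lt_min !ltr_norml => /andP[/andP[y1 y2] /andP[y3 y4]].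
 by apply: rmax;apply/andP;split;lra.
 have neg : sg * (2^-1 * grr - wt) < 0.
 have -> : sg * (2^-1 * grr - wt) = 2^-1 * (sg * (grr + -1 * wrr)) - sg * (wt - 2^-1 * wrr) by field.
 lra.
 (* Contact with a negative time derivative means contact slightly earlier as well, against the
    choice of [t0] as an infimum. *)
 have [d1 d10 Hd1] := der_lt_left Dz neg.
 pose t1 : R := Num.max a (t0 - d1 / 2).
 have t1a : a <= t1 by rewrite /t1 le_max lexx.
 have t1t : t1 < t0 by rewrite /t1 gt_max at0' /=;lra.
 have At1 : A t1.
 split;first by rewrite t1a /= (le_trans (ltW t1t)).
 exists r0 => //;apply: le_trans zr0 (ltW _);apply: Hd1;rewrite t1t andbT.
 by rewrite /t1 lt_max;apply/orP;right;lra.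
 by have := lbA _ At1;rewrite leNgt t1t.
have t0A t : A t -> t0 < t.
 move=> At;rewrite lt_neqAle lbA// andbT;apply/eqP => E.
 by case: At => _ [r hr];rewrite -E leNgt no.
exists t0;split => //.
 rewrite at0 /=;case: A0 => t /[dup] At [/andP[_ tb] _].
 exact: lt_le_trans (t0A _ At) tb.
move=> h /near[t At th];case: (At) => /andP[_ tb] [r hr zr].
by exists t, r;rewrite t0A.
Qed.

(** The time [t0] of [cmp_trunk] is free of contact, so the configuration restarts there, and
    goodness of [t0] excludes contact times just after it. *)
Lemma cmp_chain a b : 0 <= a -> b < T -> (forall t, a <= t < b -> GoodR t) -> Cmp a b.
Proof.
move=> a0 bT G c d w H;apply: contrapT => /(cmp_trunk a0 bT H)[t0 [ht0 z0 Hn]].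
have [h h0 Hh] := G _ ht0.
have [t [r [/andP[t1 t2] tb hr]]] := Hn _ h0.
case/andP: (ht0) => at0 _.
have C : Cmp t0 t by apply: Hh;rewrite ?t1 ?t2// (le_lt_trans tb).
rewrite leNgt (C c d w)//;first exact: config_sub H at0 t1 tb z0.
by rewrite lexx ltW.
Qed.

Lemma zt_cont a b c d w r : 0 < a -> b < T -> config a b c d w -> c <= r <= d ->
 cont_on a b (fun t => zz w t r).
Proof.
move=> a0 bT H hr t ht e e0;have e20 : 0 < e / 2 by rewrite divr_gt0.
have tT : 0 < t < T by case/andP: ht => h1 h2;rewrite (lt_le_trans a0)//= (le_lt_trans h2).
have [h1 h10 H1] := cf_cont H ht hr e20.
have [h2 h20 H2] := rg_tc Hg r tT e20.
exists (Num.min h1 h2) => [|y hy];first by rewrite lt_min h10.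
rewrite lt_min => /andP[y1 y2].
have {}H1 : `|w y r - w t r| < e / 2 by apply: H1 => //;rewrite subrr normr0.
have {}H2 := H2 _ y2.
rewrite /zz -mulrBr normrM sgn mul1r.
have -> : g y r - w y r - (g t r - w t r) = (g y r - g t r) - (w y r - w t r) by ring.
apply: le_lt_trans (ler_normB _ _) _;lra.
Qed.

Lemma neg_margin f a b : a <= b -> cont_on a b f -> (forall x, a <= x <= b -> f x < 0) ->
 exists2 k : R, 0 < k & forall x, a <= x <= b -> f x <= - k.
Proof.
move=> ab cf f0;have [x0 x0ab H] := EVT_eps ab cf.
exists (- f x0) => [|x xab];first by rewrite oppr_gt0 f0.
by rewrite opprK;exact: H.
Qed.

(** Comparison from [a] when all later times are good, without joint continuity at [a]. The
    one-sided bound and dominated convergence make the part of [zz w s] above [- kap] small in L^1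
    as [s] decreases to [a]. Its heat potential [P], added to the barrier at the cost of a margin
    [kap / 2], restores strict inequality at time [s]; by time [t] this potential has decayed below
    [kap / 4]. *)
Lemma start a b c d w : 0 < a -> a < b -> b < T -> (forall t, a < t < b -> GoodR t) ->
 config a b c d w ->
 (exists h B : R, 0 < h /\ forall t r, a < t < a + h -> t <= b -> c <= r <= d -> zz w t r <= B) ->
 forall t r, a <= t <= b -> c <= r <= d -> zz w t r < 0.
Proof.
move=> a0 ab bT G H [hB [B [hB0 HB]]].
have cd := cf_ab H;have [c0 cd'] := andP (cf_c H).
have aab : a <= a <= b by rewrite lexx ltW.
have inT t : a <= t <= b -> 0 < t < T.
 by move=> /andP[h1 h2];rewrite (lt_le_trans a0)//= (le_lt_trans h2).
have [k1 k10 Hk1] := neg_margin cd (z_cont H aab (inT _ aab)) (cf_init H).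
have cdd : c <= d <= d by rewrite lexx cd.
have ccd : c <= c <= d by rewrite lexx cd.
have [k2 k20 Hk2] := neg_margin (ltW ab) (zt_cont a0 bT H cdd) (cf_right H).
have [k3 k30 Hk3] : exists2 k3 : R, 0 < k3 & (forall t, a <= t <= b -> zz w t c <= - k3) \/
 (c = 0 /\ forall t, a < t <= b -> exists2 p : R, rder0 (w t) p & 0 < sg * (- (2 * j) - p)).
 case: (cf_left H) => [/(neg_margin (ltW ab) (zt_cont a0 bT H ccd))[k k0 Hk]|h].
 by exists k => //;left.
 by exists 1 => //;right.
have [k4 k40 Hk4] := cf_X H.
have [kap kap0 [q1 q2 q3 q4]] : exists2 kap : R, 0 < kap & [/\ kap <= k1, kap <= k2, kap <= k3 & kap <= k4].
 exists (Num.min (Num.min k1 k2) (Num.min k3 k4));first by rewrite !lt_min k10 k20 k30 k40.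
 by split;rewrite !ge_min lexx ?orbT.
pose F s y : R := Num.max (zz w s (clamp c d `|y|) + kap) 0.
have F0 s y : 0 <= F s y by rewrite /F le_max lexx orbT.
have Fge s y : c <= y <= d -> zz w s y + kap <= F s y.
 by move=> hy;rewrite /F ger0_norm ?(le_trans c0)//;[rewrite clamp_id// le_max lexx|case/andP: hy].
have maxlip := @max0_lip R.
have Fc s : a <= s <= b -> forall x e : R, 0 < e -> exists2 d1 : R, 0 < d1 &
 forall y : R, `|y - x| < d1 -> `|F s y - F s x| < e.
 move=> hs x e e0;have [d1 d10 Hd1] := cont_on_clamp cd (z_cont H hs (inT _ hs)) `|x| e0.
 exists d1 => // y yx;apply: le_lt_trans (maxlip _ _) _.
 rewrite (_ : _ - _ = zz w s (clamp c d `|y|) - zz w s (clamp c d `|x|));last by ring.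
 by apply: Hd1;apply: le_lt_trans yx;exact: ler_dist_dist.
have Fsupp s : a <= s <= b -> forall y, ~ `[- d, d]%classic y -> F s y = 0.
 move=> hs y;rewrite /= in_itv /= => yd.
 have dy : d < `|y| by rewrite ltNge;apply/negP;rewrite ler_norml.
 rewrite /F /clamp (min_idPl (ltW dy)) (max_idPr cd);apply/max_idPr.
 have := Hk2 _ hs;lra.
have FB s y : a < s < a + hB -> s <= b -> `|F s y| <= `|B| + kap.
 move=> hs sb;rewrite ger0_norm// /F ge_max;apply/andP;split;last by rewrite addr_ge0// ltW.
 rewrite lerD2r;apply: le_trans (ler_norm _);apply: HB => //;exact: clamp_in.
have mD : measurable (`[- d, d]%classic : set R) by exact: measurable_itv.
have iFD s : a < s < a + hB -> s <= b -> itg `[- d, d] (F s).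
 move=> hs sb;apply: (@i_itv_bnd _ _ _ _ (`|B| + kap)) => [|y _];last exact: FB.
 apply: cont_eps_meas => //;apply: Fc;rewrite sb andbT ltW//;by case/andP: hs.
have iF s : a < s < a + hB -> s <= b -> itg setT (F s).
 move=> hs sb;apply: i_supp mD _ (iFD s hs sb);apply: Fsupp.
 by rewrite sb andbT ltW//;case/andP: hs.
have small e : 0 < e -> exists2 h : R, 0 < h & forall s, a < s < a + hB -> s <= b ->
 `|s - a| < h -> L1norm (F s) <= e.
 move=> e0.
 have [|||||h h0 Hh] := @dct_eps R `[- d, d]%classic (fun s => a < s < a + hB /\ s <= b) F (fun=> 0)
 (fun=> `|B| + kap) a mD _ _ _ _ _ e e0.
 - by move=> s [hs sb];apply: i_meas;exact: iFD.
 - exact: measurable_cst.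
 - apply: aeW => y _ e1 e10.
 have [h h0 Hh] := zt_cont a0 bT H (clamp_in `|y| cd) aab e10.
 exists h => // s [hs sb] sa;rewrite subr0 ger0_norm// /F gt_max e10 andbT.
 have hs' : a <= s <= b by rewrite sb andbT ltW//;case/andP: hs.
 have := Hh s hs' sa;have := Hk1 _ (clamp_in `|y| cd).
 rewrite ltr_norml => ? /andP[_];lra.
 - by apply: (@i_itv_bnd _ _ _ _ `|(`|B| + kap)|).
 - by move=> s y [hs sb] _;exact: FB.
 exists h => // s hs sb sa.
 have := Hh s (conj hs sb) sa;rewrite /L1norm (@I_supp _ `[- d, d]%classic).
 by rewrite (eq_I (g := fun y => `|F s y|)) => // y _;rewrite subr0.
 by move=> y /Fsupp ->;rewrite ?normr0// sb andbT ltW//;case/andP: hs.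
move=> t r ht hr.
have [ta|ta] := ltP a t;last first.
 have -> : t = a by apply/eqP;rewrite eq_le ta;case/andP: ht.
 exact: (cf_init H).
case/andP: (ht) => _ tb.
have ta2 : 0 < (t - a) / 2 by rewrite divr_gt0// subr_gt0.
(* Since [t - s >= (t - a) / 2], an L^1 norm below this threshold makes each of the two potentials
   in [P] at most [kap / 8] at time [t]. *)
have e0 : 0 < kap / 8 * Num.sqrt ((t - a) / 2) by rewrite mulr_gt0 ?divr_gt0// sqrtr_gt0.
have [h h0 Hh] := small _ e0.
pose dl : R := Num.min (Num.min h hB) ((t - a) / 2).
have dl0 : 0 < dl by rewrite !lt_min h0 hB0.
have : dl / 2 < dl by lra.
rewrite {2}/dl !lt_min => /andP[/andP[dh dB] dt].
pose s : R := a + dl / 2.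
have as_ : a < s by rewrite /s;lra.
have sB : a < s < a + hB by rewrite as_ /s;lra.
have st : s < t by rewrite /s;lra.
have sb : s < b by exact: lt_le_trans tb.
have hs : a <= s <= b by rewrite !ltW.
have sh : `|s - a| < h by rewrite /s (addrC a) addrK gtr0_norm//;lra.
have L1 := Hh s sB (ltW sb) sh.
(* Symmetrized in [r], so that its slope at the origin is [0] and the flux condition on the barrier
   is unaffected. *)
pose P t r : R := heat (F s) (t - s) r + heat (F s) (t - s) (- r).
pose w2 t r : R := w t r + sg * (P t r - kap / 2).
have P0 t' r' : 0 <= P t' r' by rewrite /P addr_ge0// heat_ge0.
have zw2 t' r' : zz w2 t' r' = zz w t' r' + kap / 2 - P t' r'.
 by rewrite /zz /w2;case: sg1 => ->;ring.
have iFs := iF s sB (ltW sb).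
have Pc t1 r1 e : s <= t1 -> 0 < e -> exists2 d1 : R, 0 < d1 & forall t' r',
 `|t' - t1| < d1 -> `|r' - r1| < d1 -> `|P t' r' - P t1 r1| < e.
 move=> st1 e0';have e20 : 0 < e / 2 by rewrite divr_gt0.
 have t10 : 0 <= t1 - s by rewrite subr_ge0.
 have FBs y := FB s y sB (ltW sb).
 have [d1 d10 H1] := heat_jcont iFs FBs (Fc s hs) r1 t10 e20.
 have [d2 d20 H2] := heat_jcont iFs FBs (Fc s hs) (- r1) t10 e20.
 exists (Num.min d1 d2) => [|t' r'];first by rewrite lt_min d10.
 rewrite !lt_min => /andP[u1 u2] /andP[v1 v2].
 have E1 : t' - s - (t1 - s) = t' - t1 by ring.
 have := H1 (t' - s) r';rewrite E1 => /(_ u1 v1) B1.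
 have v2' : `|- r' - - r1| < d2 by rewrite (_ : - r' - - r1 = - (r' - r1)) ?normrN//;ring.
 have := H2 (t' - s) (- r');rewrite E1 => /(_ u2 v2') B2.
 rewrite /P [X in `|X|](_ : _ = (heat (F s) (t' - s) r' - heat (F s) (t1 - s) r1) +
 (heat (F s) (t' - s) (- r') - heat (F s) (t1 - s) (- r1)));last by ring.
 by apply: le_lt_trans (ler_normD _ _) _;clear -B1 B2;lra.
have Hc : config s b c d w2.
 have I t' : s <= t' <= b -> a <= t' <= b.
 by move=> /andP[h1 h2];rewrite h2 andbT (le_trans (ltW as_)).
 have I' t' : s < t' <= b -> a < t' <= b.
 by move=> /andP[h1 h2];rewrite h2 andbT (lt_trans as_).
 split.
 - by rewrite c0.
 - move=> t1 r1 ht1 hr1 e e0';have e20 : 0 < e / 2 by rewrite divr_gt0.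
 have [d1 d10 H1] := cf_cont H (I _ ht1) hr1 e20.
 have st1 : s <= t1 by case/andP: ht1.
 have [d2 d20 H2] := Pc t1 r1 _ st1 e20.
 exists (Num.min d1 d2) => [|t' r' ht' hr'];first by rewrite lt_min d10.
 rewrite !lt_min => /andP[u1 u2] /andP[v1 v2].
 have := H1 t' r' (I _ ht') hr' u1 v1;have := H2 t' r' u2 v2 => B2 B1.
 rewrite /w2 [X in `|X|](_ : _ = (w t' r' - w t1 r1) + sg * (P t' r' - P t1 r1));last by ring.
 by apply: le_lt_trans (ler_normD _ _) _;rewrite normrM sgn mul1r;clear -B1 B2;lra.
 - move=> t1 r1 ht1 hr1;have [wt [wrr [D1 D2w sp]]] := cf_in H (I' _ ht1) hr1.
 have t10 : 0 < t1 - s by rewrite subr_gt0;case/andP: ht1.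
 have Sh := derB (derI t1) (derC s t1).
 have E1 : is_derive t1 1 (fun t => heat (F s) (t - s) r1) _ :=
 @der_comp R (fun t => heat (F s) t r1) (fun t => t - s) t1 _ _ (heat_der_t iFs r1 t10) Sh.
 have E2 : is_derive t1 1 (fun t => heat (F s) (t - s) (- r1)) _ :=
 @der_comp R (fun t => heat (F s) t (- r1)) (fun t => t - s) t1 _ _ (heat_der_t iFs (- r1) t10) Sh.
 have D2a := heat_D2 iFs r1 t10.
 have D2b : D2 (fun r => heat (F s) (t1 - s) (- r)) r1 (UU (F s) 2 2 (t1 - s) (- r1) - UU (F s) 0 1 (t1 - s) (- r1)).
 move=> e e0';have [d1 d10 Hd1] := heat_D2 iFs (- r1) t10 e0'.
 exists d1 => // h1 hh;have := Hd1 h1 hh.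
 by rewrite !opprD opprK (addrC (heat _ _ (- r1 + h1))).
 have DP := derD D1 (derZ sg (derB (derD E1 E2) (derC (kap / 2) t1))).
 have D2P := D2D D2w (D2Z sg (D2D (D2D D2a D2b) (D2C (- (kap / 2)) r1))).
 eexists;eexists;split;[exact: DP|exact: D2P|].
 move: sp;move: (UU (F s) 2 2 (t1 - s) r1 - UU (F s) 0 1 (t1 - s) r1)
 (UU (F s) 2 2 (t1 - s) (- r1) - UU (F s) 0 1 (t1 - s) (- r1)) => u1 u2.
 by clear -sg1;case: sg1 => ->;lra.
 - case: Hk3 => [Hk3|[c00 Hk3]];[left|right].
 move=> t' /I ht';rewrite zw2;by have := Hk3 _ ht';have := P0 t' c;clear -q3 kap0;lra.
 split=> // t1 ht1;have [p Hp sp] := Hk3 _ (I' _ ht1);exists p => //.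
 have t10 : 0 < t1 - s by rewrite subr_gt0;case/andP: ht1.
 move=> e e0';have e20 : 0 < e / 2 by rewrite divr_gt0.
 have [d1 d10 Hd1] := Hp _ e20.
 have Dp : is_derive (0 : R) 1 (P t1) 0.
 have E1 := heat_der_x iFs 0 t10.
 have E2 : is_derive (0 : R) 1 (fun r => heat (F s) (t1 - s) (- r)) (- UU (F s) 1 1 (t1 - s) (- 0) * - 1) :=
 @der_comp R (heat (F s) (t1 - s)) -%R 0 _ _ (heat_der_x iFs (- 0) t10) (derN (derI 0)).
 by apply: (derE (derD E1 E2));rewrite oppr0;ring.
 have [d2 d20 Hd2] := (is_derive_epsP (P t1) 0 0).1 Dp _ e20.
 exists (Num.min d1 d2) => [|h1 /andP[h10]];first by rewrite lt_min d10.
 rewrite lt_min => /andP[h1d1 h1d2].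
 have := Hd1 h1;rewrite h10 h1d1 => /(_ isT) B1.
 have := Hd2 h1;rewrite !subr0 mul0r subr0 (gtr0_norm h10) => /(_ h1d2) B2.
 rewrite /w2 [X in `|X|](_ : _ = (w t1 h1 - w t1 0 - p * h1) + sg * (P t1 h1 - P t1 0));last by ring.
 by apply: le_trans (ler_normD _ _) _;rewrite normrM sgn mul1r;clear -B1 B2;lra.
 - move=> t' /I ht';rewrite zw2;by have := Hk2 _ ht';have := P0 t' d;clear -q2 kap0;lra.
 - exists (kap / 2) => [|t' r' /I ht' hr'];first by rewrite divr_gt0.
 rewrite zw2 => B1;apply: Hk4 => //;move: B1 (P0 t' r') q4;clear -kap0;lra.
 - move=> r' hr';rewrite zw2 /P subrr /heat ltxx.
 by move: (Fge s r' hr') (F0 s (- r'));clear -kap0;lra.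
have C : Cmp s b.
 apply: cmp_chain => //;first exact: ltW (lt_trans a0 as_).
 move=> t' /andP[h1 h2];apply: G;rewrite h2 andbT;exact: lt_le_trans h1.
have st' : s <= t <= b by rewrite tb ltW.
have := C _ _ _ Hc t r st' hr;rewrite zw2.
have ts0 : 0 < t - s by rewrite subr_gt0.
have K : P t r <= kap / 4.
 have N (x : R) : heat (F s) (t - s) x <= kap / 8.
 apply: le_trans (ler_norm _) _;apply: le_trans (heat_le iFs x ts0) _.
 rewrite mulrC ler_pdivrMr ?sqrtr_gt0//;apply: (le_trans L1).
 have k8 : 0 <= kap / 8 by rewrite ltW// divr_gt0.
 apply: ler_wpM2l k8 _ _ _;rewrite ler_sqrt;last exact: ltW.
 by rewrite /s;move: dt;lra.
 by rewrite /P;move: (N r) (N (- r));lra.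
lra.
Qed.

Lemma w_bnd a b c d w : a < b -> config a b c d w ->
 exists h B : R, 0 < h /\ forall t r, a < t < a + h -> t <= b -> c <= r <= d -> `|w t r| <= B.
Proof.
move=> ab H;have cd := cf_ab H.
have aab : a <= a <= b by rewrite lexx ltW.
have wc := w_cont H aab.
have awc : cont_on c d (fun r => `|w a r|).
 move=> r hr e e0;have [h h0 Hh] := wc r hr e e0.
 by exists h => // y hy yr;apply: le_lt_trans (Hh y hy yr);exact: ler_dist_dist.
have [r0 _ M] := EVT_eps cd awc.
have [|h h0 Hh] := @compact_unif R (fun r h => a + h <= b -> `|w (a + h) r| <= `|w a r0| + 1) c d.
 move=> r hr;have [h h0 Hh] := cf_cont H aab hr ltr01.
 exists h => // y k hy yr /andP[k0 kh] akb.
 have ak : a <= a + k <= b by rewrite akb lerDl ltW.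
 have kk : `|a + k - a| < h by rewrite (addrC a) addrK gtr0_norm.
 have := Hh _ _ ak hy kk yr.
 have := M r hr;have := ler_normD (w (a + k) y - w a r) (w a r);rewrite subrK.
 lra.
exists h, (`|w a r0| + 1);split => // t r /andP[ta th] tb hr.
have -> : t = a + (t - a) by ring.
by apply: Hh => //;rewrite ?subr_gt0 ?ta;[lra|rewrite addrCA subrr addr0].
Qed.

(** For [sg = -1] this follows from [0 <= g] and the boundedness of the barrier; for [sg = 1] it is
    the outcome of the Baire argument in space, [stepB]. *)
Hypothesis Bnd : forall a b c d w, 0 < a -> a < b -> b < T ->
 (forall t, a < t < b -> GoodR t) -> config a b c d w ->
 exists h B : R, 0 < h /\ forall t r, a < t < a + h -> t <= b -> c <= r <= d -> zz w t r <= B.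

Lemma good_start a b : 0 < a -> a < b -> b < T -> (forall t, a < t < b -> GoodR t) -> GoodR a.
Proof.
move=> a0 ab bT G;exists (b - a) => [|b' /andP[ab' b'b] _];first by rewrite subr_gt0.
have b'b2 : b' < b by lra.
have b'T : b' < T by exact: lt_trans bT.
have G' t : a < t < b' -> GoodR t.
 by move=> /andP[h1 h2];apply: G;rewrite h1 (lt_trans h2).
by move=> c d w H;apply: (start _ _ _ _ H) => //;exact: (Bnd _ _ _ _ H).
Qed.

(** Baire in time. [K] collects the times without a neighbourhood of good times, and [E n] those
    whose slice is [n]-Lipschitz, a closed condition by continuity in time at each point. On a
    portion of [K] the slices are then equi-Lipschitz. Contact times accumulating at a contact-free
    time can be moved into [K], where equicontinuity and compactness exclude them. *)
Lemma all_good t : 0 < t < T -> GoodR t.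
Proof.
move=> tT;apply: contrapT => nG.
pose K (t : R) := 0 < t < T /\ ~ exists2 h : R, 0 < h & forall s, `|s - t| < h -> 0 < s < T -> GoodR s.
pose E (n : nat) (t : R) := forall r r' : R, `|g t r - g t r'| <= n%:R * `|r - r'|.
have nK s : 0 < s < T -> ~ K s -> GoodR s.
 move=> sT sK;have [h h0 Hh] : exists2 h : R, 0 < h & forall s', `|s' - s| < h -> 0 < s' < T -> GoodR s'.
 by apply: contrapT => Hn;apply: sK.
 by apply: Hh => //;rewrite subrr normr0.
have Kcl x : 0 < x < T -> (forall d : R, 0 < d -> exists2 y, K y & `|y - x| < d) -> K x.
 move=> xT Hx;split => // -[h h0 Hh];have [y [yT Hy] yx] := Hx _ h0.
 apply: Hy;exists (h - `|y - x|) => [|s sy sT];first by rewrite subr_gt0.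
 apply: Hh => //;have := ler_normD (s - y) (y - x);rewrite addrA subrK.
 by move: sy yx;lra.
have [|||n [al [be [x0 [[x0T nx0] x0ab al0 beT HE]]]]] := @Baire_itv R 0 T K E (fun x H => H.1) Kcl.
- move=> n x [xT _] Hx r r';rewrite leNgt;apply/negP => lt1.
 pose e : R := (`|g x r - g x r'| - n%:R * `|r - r'|) / 3.
 have e0 : 0 < e by rewrite divr_gt0// subr_gt0.
 have [d1 d10 H1] := rg_tc Hg r xT e0.
 have [d2 d20 H2] := rg_tc Hg r' xT e0.
 have [|y [_ Ey]] := Hx (Num.min d1 d2);first by rewrite lt_min d10.
 rewrite lt_min => /andP[/H1 B1 /H2 B2].
 have B3 := Ey r r'.
 have : `|g x r - g x r'| <= `|g y r - g x r| + `|g y r - g y r'| + `|g y r' - g x r'|.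
 have -> : g x r - g x r' = - (g y r - g x r) + (g y r - g y r') + (g y r' - g x r') by ring.
 apply: le_trans (ler_normD _ _) _;rewrite lerD2r.
 by apply: le_trans (ler_normD _ _) _;rewrite normrN.
 have e3 : 3 * e = `|g x r - g x r'| - n%:R * `|r - r'| by rewrite /e;field.
 by clearbody e;lra.
- by move=> x [xT _];have [N HN] := rg_lip Hg xT;exists N.
- by exists t;split=> // -[h h0 Hh];apply: nG;apply: Hh;rewrite ?subrr ?normr0.
have inT s : al < s < be -> 0 < s < T.
 by move=> /andP[h1 h2];rewrite (lt_trans al0)//= (lt_trans h2).
have main s t' : al < s -> s < t' -> t' < be -> Cmp s t'.
 move=> als st' t'be c d w H;apply: contrapT => NH.
 have s0 : 0 <= s by rewrite ltW// (lt_trans al0).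
 have t'T : t' < T by exact: lt_trans beT.
 have [t0 [/andP[st0 t0t'] z0 Hn]] := cmp_trunk s0 t'T H NH.
 have t0in : al < t0 < be by rewrite (lt_le_trans als)//= (lt_trans t0t').
 have noG : ~ GoodR t0.
 move=> [h h0 Hh];have [t1 [r [/andP[t01 t1h] t1t' hr]]] := Hn _ h0.
 rewrite leNgt (Hh t1 _ _ c d w)//.
 - by rewrite t01.
 - exact: le_lt_trans t'T.
 - exact: config_sub H st0 t01 t1t' z0.
 - by rewrite lexx ltW.
 have Kt0 : K t0 by apply: contrapT => /(nK t0 (inT t0 t0in)).
 (* Contact times near [t0] may be taken in [K]: let [p] be the last point of [K] up to a contact
    time [t1]; if there were no contact at [p], comparison would propagate from [p] to [t1] through
    good times. *)
 have acc h : 0 < h -> exists p r, [/\ K p, t0 < p < t0 + h, p <= t', c <= r <= d & 0 <= zz w p r].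
 move=> h0.
 have [h1 [h10 h1h h1t Gh]] : exists h1, [/\ 0 < h1, h1 <= h, t0 + h1 <= t' & True].
 exists (Num.min h (t' - t0));rewrite lt_min h0 subr_gt0 t0t' ge_min lexx /=;split => //.
 by rewrite -lerBrDl ge_min lexx orbT.
 have [q [Kq /andP[q1 q2]]] : exists q, K q /\ t0 < q < t0 + h1.
 apply: contrapT => nq;apply: noG;apply: (@good_start t0 (t0 + h1)).
 - by case/andP: (inT _ t0in).
 - by rewrite ltrDl.
 - exact: le_lt_trans t'T.
 - move=> u /andP[u1 u2];apply: nK;last by move=> Ku;apply: nq;exists u;rewrite u1 u2.
 apply: inT;case/andP: t0in => v1 v2;rewrite (lt_trans v1)//=.
 by apply: lt_trans u2 _;exact: le_lt_trans t'be.
 have qt0 : 0 < q - t0 by rewrite subr_gt0.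
 have [t1 [r [/andP[t01 t1q] t1t' hr zr]]] := Hn _ h10.
 pose S := [set u | K u /\ t0 <= u <= t1].
 have S0 : S !=set0 by exists t0;split => //;rewrite lexx ltW.
 have Sb : ubound S t1 by move=> u [_ /andP[]].
 have Ss : has_sup S by split => //;exists t1.
 pose p := sup S.
 have pt1 : p <= t1 by apply: sup_le_ub.
 have t0p : t0 <= p by apply: sup_upper_bound => //;split => //;rewrite lexx ltW.
 have pin : 0 < p < T.
 by apply: inT;case/andP: t0in => v1 v2;rewrite (lt_le_trans v1)//= (le_lt_trans pt1)// (le_lt_trans t1t').
 have Kp : K p.
 apply: Kcl => // e e0;have [u [Ku /andP[u1 u2]] pu] := sup_adherent e0 Ss.
 have up : u <= p by apply: sup_upper_bound => //;split => //;rewrite u1.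
 by exists u => //;rewrite ler0_norm ?subr_le0//;move: pu up;rewrite -/p;lra.
 have KfreeG u : p < u -> u <= t1 -> GoodR u.
 move=> pu ut1;apply: nK.
 by case/andP: pin => v1 v2;rewrite (lt_trans v1)//= (le_lt_trans ut1)// (le_lt_trans t1t').
 move=> Ku;have : u <= p by apply: sup_upper_bound => //;split => //;rewrite ut1 (le_trans t0p)// ltW.
 by rewrite leNgt pu.
 have t0p' : t0 < p.
 rewrite lt_neqAle t0p andbT;apply/eqP => Etp;apply: noG.
 apply: (@good_start t0 t1) => //;first by case/andP: (inT _ t0in).
 exact: le_lt_trans t'T.
 by move=> u /andP[u1 u2];apply: KfreeG;rewrite -?Etp// ltW.
 have sp : s <= p by exact: le_trans t0p.
 have ph : p < t0 + h by lra.
 have pt' : p <= t' by exact: le_trans t1t'.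
 have [pe|pe] := eqVneq p t1.
 by exists p, r;rewrite t0p' ph pe in Kp pt' zr *;split => //;rewrite -?pe ?t0p'.
 have pt1' : p < t1 by rewrite lt_neqAle pe.
 apply: contrapT => nz;have zp : forall r', c <= r' <= d -> zz w p r' < 0.
 move=> r' hr';rewrite ltNge;apply/negP => zr';apply: nz.
 by exists p, r';rewrite t0p' ph.
 have t1T : t1 < T by exact: le_lt_trans t'T.
 have p0 : 0 < p by case/andP: pin.
 have Gp : GoodR p.
 by apply: (@good_start p t1) => // u /andP[u1 u2];apply: KfreeG => //;exact: ltW.
 have Cp : Cmp p t1.
 apply: cmp_chain;[exact: ltW|by []|move=> u /andP[]].
 rewrite le_eqVlt => /orP[/eqP <-//|u1 u2];apply: KfreeG => //;exact: ltW.
 move: zr;rewrite leNgt (Cp c d w)//;first exact: config_sub H sp pt1' t1t' zp.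
 by rewrite lexx ltW.
 have cd := cf_ab H.
 have st0t' : s <= t0 <= t' by rewrite st0 ltW.
 have t0T := inT _ t0in.
 have [|h h0 Hh] := @compact_unif R (fun r h => K (t0 + h) -> t0 + h <= t' -> zz w (t0 + h) r < 0) c d.
 move=> r hr;pose e : R := - zz w t0 r / 4.
 have e0 : 0 < e by rewrite divr_gt0// oppr_gt0 z0.
 have [d1 d10 H1] := cf_cont H st0t' hr e0.
 have [d2 d20 H2] := rg_tc Hg r t0T e0.
 have n0 : 0 < n%:R + 1 :> R by rewrite ltr_wpDl.
 exists (Num.min (Num.min d1 d2) (Num.min (e / (n%:R + 1)) (be - t0))).
 by rewrite !lt_min d10 d20 divr_gt0// subr_gt0;case/andP: t0in.
 move=> y k hy;rewrite !lt_min => /andP[/andP[yd1 _] /andP[yn _]] /andP[k0].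
 move=> /andP[/andP[kd1 kd2] /andP[_ kb]] Kk kt'.
 have kk : `|t0 + k - t0| = k by rewrite (addrC t0) addrK gtr0_norm.
 have sk : s <= t0 + k <= t' by rewrite kt' andbT (le_trans st0)// lerDl ltW.
 have B1 : `|w (t0 + k) y - w t0 r| < e by apply: H1 => //;rewrite kk.
 have B2 : `|g (t0 + k) r - g t0 r| < e by apply: H2;rewrite kk.
 have B3 : `|g (t0 + k) y - g (t0 + k) r| <= e.
 apply: le_trans (HE _ Kk _ y r) _.
 by rewrite (lt_trans (_ : al < t0)) ?ltrDl//=;[lra|case/andP: t0in].
 move: yn;rewrite ltr_pdivlMr// mulrDr mulr1.
 by have := normr_ge0 (y - r);move: (`|_|) => u;nra.
 have Ezz : zz w (t0 + k) y = zz w t0 r + sg * ((g (t0 + k) y - g (t0 + k) r) + (g (t0 + k) r - g t0 r) - (w (t0 + k) y - w t0 r)).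
 by rewrite /zz;ring.
 rewrite Ezz;apply: (@le_lt_trans _ _ (zz w t0 r + (e + e + e)));last first.
 have e4 : 4 * e = - zz w t0 r by rewrite /e;field.
 by clearbody e;lra.
 rewrite lerD2l;apply: le_trans (ler_norm _) _;rewrite normrM sgn mul1r.
 apply: le_trans (ler_normB _ _) _;apply: lerD;last exact: ltW.
 apply: le_trans (ler_normD _ _) _;apply: lerD => //;exact: ltW.
 have [p [r [Kp /andP[p1 p2] pt' hr zr]]] := acc _ h0.
 have Ep : p = t0 + (p - t0) by ring.
 move: zr;rewrite leNgt Ep Hh// -?Ep// subr_gt0 p1 /=;lra.
(* Comparison between any two times of []al, be[] makes all times near [x0] good, which contradicts
   [K x0]. *)
apply: nx0;exists (Num.min (x0 - al) (be - x0)).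
 by rewrite lt_min !subr_gt0.
move=> s;rewrite lt_min !ltr_norml => /andP[/andP[s1 s2] /andP[s3 s4]] sT.
exists (be - s) => [|b /andP[sb bs] bT];first by rewrite subr_gt0;lra.
by apply: main => //;lra.
Qed.

End Signed.

End Rough.

Lemma D2_refl {R : realType} (f : R -> R) (k x l : R) : D2 f (k - x) l -> D2 (fun y => f (k - y)) x l.
Proof.
move=> H e e0;have [d d0 Hd] := H e e0;exists d => // h /Hd.
rewrite (_ : k - (x + h) = k - x - h);last by ring.
by rewrite (_ : k - (x - h) = k - x + h) 1?(addrC (f (k - x - h)));last by ring.
Qed.

Lemma jcontD {R : realType} (a b c d : R) (w1 w2 : R -> R -> R) : jcont a b c d w1 ->
 jcont a b c d w2 -> jcont a b c d (fun t r => w1 t r + w2 t r).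
Proof.
move=> H1 H2 t r ht hr e e0;have e20 : 0 < e / 2 by rewrite divr_gt0.
have [h1 h10 {}H1] := H1 t r ht hr _ e20.
have [h2 h20 {}H2] := H2 t r ht hr _ e20.
exists (Num.min h1 h2) => [|t' r' ht' hr'];first by rewrite lt_min h10.
rewrite !lt_min => /andP[a1 a2] /andP[b1 b2].
have {}H1 := H1 t' r' ht' hr' a1 b1;have {}H2 := H2 t' r' ht' hr' a2 b2.
rewrite (_ : _ - _ = (w1 t' r' - w1 t r) + (w2 t' r' - w2 t r));last by ring.
apply: le_lt_trans (ler_normD _ _) _;lra.
Qed.

Lemma jcontZ {R : realType} (a b c d k : R) (w : R -> R -> R) : jcont a b c d w ->
 jcont a b c d (fun t r => k * w t r).
Proof.
move=> H t r ht hr e e0;have k0 : 0 < `|k| + 1 by rewrite ltr_wpDl.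
have [|h h0 {}H] := H t r ht hr (e / (`|k| + 1));first by rewrite divr_gt0.
exists h => // t' r' ht' hr' th rh;rewrite -mulrBr normrM.
have := H t' r' ht' hr' th rh;rewrite ltr_pdivlMr// mulrDr mulr1 mulrC.
by apply: le_lt_trans;rewrite lerDl.
Qed.

Lemma jcont_t {R : realType} (a b c d : R) (f : R -> R) : (forall x e : R, 0 < e ->
 exists2 h : R, 0 < h & forall y : R, `|y - x| < h -> `|f y - f x| < e) ->
 jcont a b c d (fun t _ => f t) /\ jcont a b c d (fun _ r => f r).
Proof.
by move=> H;split => t r _ _ e e0;[have [h h0 Hh] := H t e e0|have [h h0 Hh] := H r e e0];
 exists h => // t' r' _ _ th rh;apply: Hh.
Qed.

Lemma der_jcont {R : realType} (a b c d : R) (f df : R -> R) : (forall x : R, is_derive x 1 f (df x)) ->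
 jcont a b c d (fun t _ => f t) /\ jcont a b c d (fun _ r => f r).
Proof. by move=> H;apply: jcont_t => x;apply: is_derive_cont (H x). Qed.

Lemma der_continuous {R : realType} (f : R -> R) (x l : R) : is_derive x 1 f l -> {for x, continuous f}.
Proof. by move=> /is_derive_cont H;exact/cont_epsP. Qed.

(** * Bounds on the density between two points where it is bounded *)

Section Gap.
Context {R : realType}.
Notation mu := (@lebesgue_measure R).
Implicit Types (s t r x y v u a b c d e : R).
Variables (j T : R) (X : R -> R) (g : R -> R -> R).
Hypothesis Hg : rough j T X g.

(** The excess [F] over [n2] vanishes at both sides, so Dirichlet potentials dominate it: [FA] is
    reflected at [c] and [FB] at [d]. By [heat_refl_le] their value at [t] is controlled by the
    integral of [F] against [(v - c) * (d - v)] at an earlier time [s]. The weight tames the sides,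
    where only the mass is bounded; inside, dominated convergence sends the integral to [0] as [s]
    decreases to [a]. *)
Lemma gap_bound a b c d (n2 : R) : 0 <= a -> a < b -> b < T ->
 (forall t, a < t < b -> GoodR j T X g 1 t) -> 0 <= c -> c < d -> 0 <= n2 ->
 (forall s, a < s < b -> g s c <= n2) -> (forall s, a < s < b -> g s d <= n2) ->
 (forall rho, 0 < rho -> exists N : R, forall s v, a < s < b -> c + rho <= v <= d - rho -> g s v <= N) ->
 {ae mu, forall v, c <= v <= d -> exists2 h : R, 0 < h & forall s, a < s < a + h -> g s v <= n2} ->
 forall t y, a < t < b -> c <= y <= d -> g t y <= n2 + 1 + T.
Proof.
move=> a0 ab bT G c0 cd n20 gc gd gm gae t y /andP[at_ tb] hy.
have cd' := ltW cd.
have inT s : a < s -> s < b -> 0 < s < T by move=> h1 h2;rewrite (le_lt_trans a0)//= (lt_trans h2).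
pose F s v : R := Num.max (g s (clamp c d v) - n2) 0.
have F0 s v : 0 <= F s v by rewrite /F le_max lexx orbT.
have Fout s v : a < s < b -> v <= c \/ d <= v -> F s v = 0.
 move=> hs [vc|dv];apply/max_idPr;rewrite subr_le0 /clamp.
 by rewrite (min_idPr (le_trans vc cd')) (max_idPl vc) gc.
 by rewrite (min_idPl dv) (max_idPr cd') gd.
have Fin s v : c <= v <= d -> F s v = Num.max (g s v - n2) 0 by move=> hv;rewrite /F clamp_id.
have Fc s : a < s < b -> forall x e : R, 0 < e -> exists2 h : R, 0 < h &
 forall v : R, `|v - x| < h -> `|F s v - F s x| < e.
 move=> /andP[h1 h2] x e e0.
 have [h h0 Hh] := cont_on_clamp cd' (g_cont Hg (inT _ h1 h2) (c := c) (d := d)) x e0.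
 exists h => // v vx;apply: le_lt_trans (Hh v vx);apply: le_trans (max0_lip _ _) _.
 by rewrite opprB addrA subrK.
(* Each part is weighted by the distance to the opposite side. The two parts add up to [F], and
   their first moments about the respective reflection points are the same multiple of [Wt s]. *)
pose FA s v := F s v * ((d - v) / (d - c)).
pose FB s v := F s v * ((v - c) / (d - c)).
have dc0 : 0 < d - c by rewrite subr_gt0.
have dcn : d - c != 0 by rewrite gt_eqF.
have prodc s (q : R -> R) : a < s < b -> (forall x, exists l : R, is_derive x 1 q l) ->
 forall x e : R, 0 < e -> exists2 h : R, 0 < h &
 forall v : R, `|v - x| < h -> `|F s v * q v - F s x * q x| < e.
 move=> hs Hq x;have C : {for x, continuous (fun v => F s v * q v)}.
 by apply: cvgM;[exact/cont_epsP/Fc|have [l /is_derive_cont ?] := Hq x;exact/cont_epsP].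
 exact: (cont_epsP _ x).1 C.
have dA x : exists l : R, is_derive x 1 (fun v => (d - v) / (d - c)) l.
 by eexists;exact: derM (derB (derC d x) (derI x)) (derC _ x).
have dB x : exists l : R, is_derive x 1 (fun v => (v - c) / (d - c)) l.
 by eexists;exact: derM (derB (derI x) (derC c x)) (derC _ x).
have FAc s hs := prodc s _ hs dA.
have FBc s hs := prodc s _ hs dB.
have mI u v : measurable (`[u, v]%classic : set R) by exact: measurable_itv.
have outI (u v x : R) : ~ `[u, v]%classic x -> x <= u \/ v <= x.
 rewrite /= in_itv /= => H;have [|ux] := leP x u;[by left|right].
 by rewrite leNgt;apply/negP => xv;apply: H;rewrite !ltW.
have contI (f : R -> R) : (forall x e : R, 0 < e -> exists2 h : R, 0 < h &
 forall v : R, `|v - x| < h -> `|f v - f x| < e) -> (forall x, x <= c \/ d <= x -> f x = 0) ->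
 [/\ itg `[c, d] f, itg setT f & exists M : R, forall x, `|f x| <= M].
 move=> fc f0.
 have iI : itg `[c, d] f.
 apply: continuous_compact_integrable;first exact: segment_compact.
 by apply: continuous_subspaceT => x;exact/cont_epsP/fc.
 split => //;first by apply: (i_supp (mI c d)) iI => x /outI;exact: f0.
 have nc : cont_on c d (fun x => `|f x|).
 move=> x _ e e0;have [h h0 Hh] := fc x e e0;exists h => // v _ vx.
 by apply: le_lt_trans (Hh v vx);exact: ler_dist_dist.
 have [x0 _ Hx0] := EVT_eps cd' nc;exists `|f x0| => x.
 have [xi|/negP xi] := boolP (c <= x <= d);first exact: Hx0.
 rewrite f0 ?normr0//;apply: outI;rewrite /= in_itv/=;exact: xi.
have FA0 s x : a < s < b -> x <= c \/ d <= x -> FA s x = 0 by move=> hs hx;rewrite /FA Fout ?mul0r.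
have FB0 s x : a < s < b -> x <= c \/ d <= x -> FB s x = 0 by move=> hs hx;rewrite /FB Fout ?mul0r.
have FApos s x : a < s < b -> 0 <= FA s x.
 move=> hs;have [xc|xc] := leP x c;first by rewrite FA0//;left.
 have [xd|xd] := leP d x;first by rewrite FA0//;right.
 by rewrite mulr_ge0// divr_ge0 ?subr_ge0 ?(ltW xd)// ltW.
have FBpos s x : a < s < b -> 0 <= FB s x.
 move=> hs;have [xc|xc] := leP x c;first by rewrite FB0//;left.
 have [xd|xd] := leP d x;first by rewrite FB0//;right.
 by rewrite mulr_ge0// divr_ge0 ?subr_ge0 ?(ltW xc)// ltW.
have FAin s x : a < s < b -> FA s x != 0 -> c <= x <= d.
 move=> hs;have [xc|xc] := leP x c;first by rewrite FA0 ?eqxx//;left.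
 have [xd|xd] := leP d x;first by rewrite FA0 ?eqxx//;right.
 by move=> _;rewrite (ltW xc) (ltW xd).
have FBin s x : a < s < b -> FB s x != 0 -> c <= x <= d.
 move=> hs;have [xc|xc] := leP x c;first by rewrite FB0 ?eqxx//;left.
 have [xd|xd] := leP d x;first by rewrite FB0 ?eqxx//;right.
 by move=> _;rewrite (ltW xc) (ltW xd).
pose Wt s := \int[mu]_(v in `[c, d]) (F s v * ((v - c) * (d - v))).
have iW s : a < s < b -> itg `[c, d] (fun v => F s v * ((v - c) * (d - v))).
 move=> hs;have [x|x hx|//] := contI (fun v => F s v * ((v - c) * (d - v)));last by rewrite Fout// mul0r.
 have C : {for x, continuous (fun v => F s v * ((v - c) * (d - v)))}.
 have Q : {for x, continuous (fun v : R => (v - c) * (d - v))}.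
 exact: der_continuous (derM (derB (derI x) (derC c x)) (derB (derC d x) (derI x))).
 by apply: cvgM;[exact/cont_epsP/Fc|exact: Q].
 exact: (cont_epsP _ x).1 C.
have [K K0 HK] : exists2 K : R, 0 <= K & forall s, a < s <= (a + t) / 2 -> g t y <= n2 + 1 + T + K * Wt s.
 have t20 : 0 < (t - a) / 2 by rewrite divr_gt0// subr_gt0.
 have T0 : 0 < T by apply: lt_trans bT;exact: le_lt_trans ab.
 have [C C0 HC] := @heat_refl_le R ((t - a) / 2) T t20 T0.
 exists (2 * C / (d - c)) => [|s /andP[as_ st2]];first by rewrite divr_ge0 ?mulr_ge0// ltW.
 have st : s < t by lra.
 have sb : s < b by exact: lt_trans tb.
 have hs : a < s < b by rewrite as_.
 have [iA1 iA MA] := contI _ (FAc s hs) (fun x => @FA0 s x hs).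
 have [iB1 iB MB] := contI _ (FBc s hs) (fun x => @FB0 s x hs).
 case: MA => MA HMA;case: MB => MB HMB.
 pose P tau r : R := (heat (FA s) tau r - heat (FA s) tau (2 * c - r)) +
 (heat (FB s) tau r - heat (FB s) tau (2 * d - r)).
 have PA tau r : c <= r -> 0 <= heat (FA s) tau r - heat (FA s) tau (2 * c - r).
 move=> cr;apply: heat_refl_ge0 => // [x|x /FAin];first exact: FApos.
 by move=> /(_ hs)/andP[cx _];rewrite mulr_ge0 ?subr_ge0.
 have PB tau r : r <= d -> 0 <= heat (FB s) tau r - heat (FB s) tau (2 * d - r).
 move=> cr;apply: heat_refl_ge0 => // [x|x /FBin];first exact: FBpos.
 by move=> /(_ hs)/andP[_ cx];rewrite -mulrNN mulr_ge0// oppr_ge0 subr_le0.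
 (* The constant [1] makes the side inequalities strict and the term in [tau] makes [w] a strict
    supersolution; together they account for the [1 + T] of the bound. *)
 pose w tau r := n2 + 1 + P (tau - s) r + (tau - s).
 have ts : s <= t <= t by rewrite lexx ltW.
 suff H : config j X g 1 s t c d w.
 have CC : Cmp j X g 1 s t.
 apply: (cmp_chain Hg) => //;[by left|exact: ltW (le_lt_trans a0 as_)|exact: lt_trans bT|].
 move=> u /andP[u1 u2];apply: G;rewrite (lt_le_trans as_)//=;exact: lt_trans tb.
 have := CC _ _ _ H t y ts hy;rewrite /zz mul1r subr_lt0 => /ltW/le_trans;apply.
 have tst : (t - a) / 2 <= t - s <= T.
 apply/andP;split;[lra|];have := le_lt_trans a0 as_;have := lt_trans tb bT;lra.
 have absI (f : R -> R) (m : R) : (forall x e : R, 0 < e -> exists2 h : R, 0 < h &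
 forall v : R, `|v - x| < h -> `|f v - f x| < e) -> (forall x, x <= c \/ d <= x -> f x = 0) ->
 itg setT (fun v => `|f v| * `|v - m|).
 move=> fc f0;have [x|x hx|//] := contI (fun v => `|f v| * `|v - m|);last by rewrite f0// normr0 mul0r.
 have C' : {for x, continuous (fun v => `|f v| * `|v - m|)}.
 apply: cvgM;first by apply: cvg_norm;exact/cont_epsP/fc.
 by apply: cvg_norm;apply: cvgB;[exact: cvg_id|exact: cvg_cst].
 exact: (cont_epsP _ x).1 C'.
 have B1 := HC (FA s) (t - s) y c iA tst (absI _ c (FAc s hs) (fun x => @FA0 s x hs)).
 have B2 := HC (FB s) (t - s) y d iB tst (absI _ d (FBc s hs) (fun x => @FB0 s x hs)).
 have E1 : \int[mu]_v (`|FA s v| * `|v - c|) = (d - c)^-1 * Wt s.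
 rewrite (@I_supp _ `[c, d]) => [|x /outI hx];last by rewrite FA0// normr0 mul0r.
 rewrite -IZ//;last exact: iW.
 apply: eq_I => v;rewrite /= in_itv /= => /andP[cv vd].
 by rewrite ger0_norm ?FApos// ger0_norm ?subr_ge0// /FA;field.
 have E2 : \int[mu]_v (`|FB s v| * `|v - d|) = (d - c)^-1 * Wt s.
 rewrite (@I_supp _ `[c, d]) => [|x /outI hx];last by rewrite FB0// normr0 mul0r.
 rewrite -IZ//;last exact: iW.
 apply: eq_I => v;rewrite /= in_itv /= => /andP[cv vd].
 by rewrite ger0_norm ?FBpos// distrC ger0_norm ?subr_ge0// /FB;field.
 rewrite E1 in B1;rewrite E2 in B2;rewrite /w /P.
 have -> : 2 * C / (d - c) * Wt s = C * ((d - c)^-1 * Wt s) + C * ((d - c)^-1 * Wt s) by field.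
 case/andP: tst => _;move: B1 B2.
 move: (heat _ _ _ - heat _ _ _) (heat _ _ _ - heat _ _ _) (C * _) => u1 u2 u3.
 clear -c0;lra.
 have Pc x : heat (FA s) 0 x = FA s x /\ heat (FB s) 0 x = FB s x by rewrite /heat ltxx.
 have jh F' M : itg setT F' -> (forall y, `|F' y| <= M) ->
 (forall x e : R, 0 < e -> exists2 d : R, 0 < d & forall y : R, `|y - x| < d -> `|F' y - F' x| < e) ->
 forall m : R, jcont s t c d (fun u r => heat F' (u - s) r + -1 * heat F' (u - s) (2 * m - r)).
 move=> iF' bF' cF' m;apply: jcontD;[|apply: jcontZ].
 move=> u r /andP[su _] _ e e0;have := @heat_jcont R F' M iF' bF' cF' (u - s) r e.
 rewrite subr_ge0 => /(_ su e0)[h h0 Hh];exists h => // u' r' _ _ hu hr.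
 by apply: Hh => //;rewrite opprB addrA subrK.
 move=> u r /andP[su _] _ e e0;have := @heat_jcont R F' M iF' bF' cF' (u - s) (2 * m - r) e.
 rewrite subr_ge0 => /(_ su e0)[h h0 Hh];exists h => // u' r' _ _ hu hr.
 apply: Hh;first by rewrite opprB addrA subrK.
 by rewrite (_ : _ - _ = r - r');[rewrite distrC|ring].
 have wge u r : s <= u <= t -> c <= r <= d -> n2 + 1 <= w u r.
 move=> /andP[su _] /andP[cr rd];rewrite /w /P.
 have := PA (u - s) r cr;have := PB (u - s) r rd.
 move: (heat _ _ _ - heat _ _ _) (heat _ _ _ - heat _ _ _) => u1 u2.
 by clear -su;lra.
 have inb u : s <= u <= t -> a < u < b.
 by move=> /andP[h1 h2];rewrite (lt_le_trans as_)//= (le_lt_trans h2).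
 split.
 - by rewrite c0.
 - rewrite /w /P;have [J1 _] := @der_jcont R s t c d (fun u => n2 + 1 + (u - s)) _ (fun x => derD (derC (n2 + 1) x) (derB (derI x) (derC s x))).
 have J2 := jh _ _ iA HMA (FAc s hs) c;have J3 := jh _ _ iB HMB (FBc s hs) d.
 have J := jcontD J1 (jcontD J2 J3).
 move=> u r hu hr e e0;have [h h0 Hh] := J u r hu hr e e0;exists h => // u' r' hu' hr' k1 k2.
 have := Hh u' r' hu' hr' k1 k2;congr (`|_| < _);ring.
 - move=> u r /andP[su ut] /andP[cr rd].
 have us0 : 0 < u - s by rewrite subr_gt0.
 pose V F' := UU F' 2 2 (u - s);pose V' F' := UU F' 0 1 (u - s).
 have dt F' m : itg setT F' -> is_derive u 1 (fun v => heat F' (v - s) m) (2^-1 * (V F' m - V' F' m)).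
 move=> iF';have D1 : is_derive u 1 (fun v : R => v - s) (1 - 0) := derB (derI u) (derC s u).
 have := @der_comp R (fun v => heat F' v m) (fun v => v - s) u _ _ (heat_der_t iF' m us0) D1.
 by move=> H;apply: (derE H);rewrite /V /V';ring.
 have d2 F' m : itg setT F' -> D2 (heat F' (u - s)) m (V F' m - V' F' m).
 by move=> iF';exact: heat_D2.
 eexists;eexists;split.
 + exact: (derD (derD (derC (n2 + 1) u) (derD (derB (dt _ r iA) (dt _ (2 * c - r) iA)) (derB (dt _ r iB) (dt _ (2 * d - r) iB)))) (derB (derI u) (derC s u))).
 + have DD := D2D (D2D (d2 _ r iA) (D2Z (-1) (D2_refl (d2 _ (2 * c - r) iA))))
 (D2D (d2 _ r iB) (D2Z (-1) (D2_refl (d2 _ (2 * d - r) iB)))).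
 apply: (@D2_ext _ _ _ _ _ 1 _ _ (D2D (D2C (n2 + 1 + (u - s)) r) DD)) => // v _.
 rewrite /w /P;ring.
 + move: (V _ _) (V _ _) (V _ _) (V _ _) (V' _ _) (V' _ _) (V' _ _) (V' _ _) => v1 v2 v3 v4 v5 v6 v7 v8.
 clear -c0;lra.
 - left => u hu;rewrite /zz mul1r subr_lt0;apply: le_lt_trans (gc _ (inb u hu)) _.
 by apply: lt_le_trans (wge u c hu _);[rewrite ltrDl|rewrite lexx].
 - move=> u hu;rewrite /zz mul1r subr_lt0;apply: le_lt_trans (gd _ (inb u hu)) _.
 by apply: lt_le_trans (wge u d hu _);[rewrite ltrDl|rewrite lexx andbT].
 - exists 2^-1 => // u r hu hr;have := wge u r hu hr;rewrite /zz mul1r => W Z.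
 have gpos : 0 < g u r by move: W Z;move: (w u r) => w' W Z;clear -W Z n20;lra.
 rewrite ltNge;apply/negP => Xr;move: gpos;rewrite (rg_supp Hg) ?ltxx//.
 by case/andP: (inb u hu) => *;exact: inT.
 by apply: le_trans Xr (ler_norm _).
 - move=> r /[dup] hr /andP[cr rd];rewrite /zz mul1r subr_lt0 /w /P subrr !(Pc _).1 !(Pc _).2.
 rewrite (FA0 s (2 * c - r))//;last by left;lra.
 rewrite (FB0 s (2 * d - r))//;last by right;lra.
 have -> : n2 + 1 + (FA s r - 0 + (FB s r - 0)) + 0 = n2 + 1 + F s r by rewrite /FA /FB;field.
 have FG : g s r - n2 <= F s r by rewrite Fin// le_max lexx.
 by move: (F s r) FG => f1 FG;clear -FG;lra.
have [C1 C10 HC1] : exists2 C1 : R, 0 <= C1 & forall s, a < s < b -> \int[mu]_(v in `[c, d]) F s v <= C1.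
 have [C1 HC1] := rg_mass Hg;exists `|C1| => // s hs.
 apply: le_trans (ler_norm C1);case/andP: (hs) => h1 h2.
 apply: le_trans (HC1 s c d (inT _ h1 h2) c0);apply: le_I => //.
 - by have [] := contI _ (Fc s hs) (fun x => @Fout s x hs).
 - apply: continuous_compact_integrable;first exact: segment_compact.
 apply: continuous_subspaceT => x;have [N HN] := rg_lip Hg (inT _ h1 h2).
 apply/(cont_epsP (g s)) => e e0;have N0 : 0 < N%:R + 1 :> R by rewrite ltr_wpDl.
 exists (e / (N%:R + 1)) => [|v];first by rewrite divr_gt0.
 rewrite ltr_pdivlMr// mulrDr mulr1 mulrC;apply: le_lt_trans.
 by apply: le_trans (HN _ _) _;rewrite lerDl.
 - move=> v;rewrite /= in_itv /= => hv;rewrite Fin// ge_max lerBlDr lerDl n20 /=;exact: rg_ge0 Hg _ _.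
apply/ler_addgt0Pr => e e0.
have K1 : 0 < K + 1 by rewrite ltr_wpDl.
have C11 : 0 < C1 + 1 by rewrite ltr_wpDl.
pose e' : R := e / (K + 1) / 2.
have e'0 : 0 < e' by rewrite !divr_gt0.
(* A layer of width [rho] at each side carries a weight at most [rho * (d - c)], hence contributes
   at most [e'] by the mass bound; between the layers the local bound [N] allows truncation at
   [N']. *)
pose rho : R := e' / ((d - c) * (C1 + 1)).
have rho0 : 0 < rho by rewrite divr_gt0// mulr_gt0.
have [N HN] := gm rho rho0.
pose N' : R := Num.max N 0.
have N'0 : 0 <= N' by rewrite /N' le_max lexx orbT.
pose phi v : R := (v - c) * (d - v).
have phi0 v : c <= v <= d -> 0 <= phi v <= (d - c) ^+ 2.
 move=> /andP[h1 h2];rewrite mulr_ge0 ?subr_ge0//= expr2 ler_pM ?subr_ge0 ?lerD2r ?lerD2l ?lerN2//.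
pose M s v : R := Num.min (F s v) N' * phi v.
have Mc s : a < s < b -> itg `[c, d] (M s).
 move=> hs;have [x|x hx|//] := contI (M s);last first.
 by rewrite /M Fout// (min_idPl N'0) mul0r.
 have minE (u v : R) : Num.min u v = u - Num.max (u - v) 0.
 by rewrite /Num.min /Num.max subr_lt0;case: ifPn => _;rewrite ?subr0// opprB addrCA subrr addr0.
 have C : {for x, continuous (fun v => F s v - Num.max (F s v - N') 0)}.
 apply: cvgB;first exact/cont_epsP/Fc.
 apply/(cont_epsP (fun v => Num.max (F s v - N') 0)) => e1 e10.
 have [h h0 Hh] := Fc s hs x e1 e10;exists h => // v vx.
 apply: le_lt_trans (max0_lip _ _) _;by rewrite opprB addrA subrK Hh.
 have Q : {for x, continuous phi}.
 exact: der_continuous (derM (derB (derI x) (derC c x)) (derB (derC d x) (derI x))).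
 have C2 : {for x, continuous (fun v => (F s v - Num.max (F s v - N') 0) * phi v)} by apply: cvgM.
 have := (cont_epsP _ x).1 C2;rewrite /M => H e1 e10;have [h h0 Hh] := H e1 e10.
 by exists h => // v;rewrite !minE;exact: Hh.
have Mle s v : a < s < b -> c <= v <= d -> F s v * phi v <= rho * (d - c) * F s v + M s v.
 move=> hs hv;have /andP[p0 _] := phi0 v hv;have [h1 h2] := andP hv.
 have pd : 0 <= rho * (d - c) by rewrite mulr_ge0 ?ltW.
 have M0 : 0 <= M s v by rewrite mulr_ge0// le_min F0.
 have side : phi v <= rho * (d - c) -> F s v * phi v <= rho * (d - c) * F s v + M s v.
 move=> ple;apply: (@le_trans _ _ (rho * (d - c) * F s v));last by rewrite lerDl.
 by rewrite mulrC ler_wpM2r.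
 have [vc|vc] := leP (c + rho) v;last first.
 have vc' : v - c <= rho by rewrite lerBlDl ltW.
 by apply: side;rewrite /phi ler_pM ?subr_ge0// lerD2l lerN2.
 have [vd|vd] := leP v (d - rho);last first.
 have vd' : d - v <= rho by rewrite lerBlDr -lerBlDl ltW.
 by apply: side;rewrite /phi mulrC ler_pM ?subr_ge0// lerD2r.
 have FN : F s v <= N'.
 rewrite Fin// /N';apply: le_max2 => //;by rewrite lerBlDr (le_trans (HN s v hs _)) ?lerDl ?vc.
 by rewrite /M (min_idPl FN) lerDr mulr_ge0.
have i1 (k : R) : itg `[c, d] (fun=> k).
 by apply: i_itv_bnd => [|y' _];[exact: measurable_cst|exact: lexx].
have [|||||h h0 Hh] := @dct_eps R `[c, d] (fun s => a < s < b) M (fun=> 0) (fun=> N' * (d - c) ^+ 2) a (mI c d) _ _ _ _ _ e' e'0.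
- by move=> s /Mc/i_meas.
- exact: measurable_cst.
- apply: aeS gae => v H;rewrite /= in_itv /= => hv e1 e10.
 have [h h0 Hh] := H hv;exists h => // s /andP[h1 h2];rewrite gtr0_norm ?subr_gt0// => sh.
 rewrite /M Fin// (max_idPr _) ?subr_le0 ?Hh ?h1 -?ltrBlDl//.
 by rewrite (min_idPl N'0) mul0r subr0 normr0.
- exact: i1.
- move=> s v hs;rewrite /= in_itv /= => hv;have /andP[p0 p1] := phi0 v hv.
 have m0 : 0 <= Num.min (F s v) N' by rewrite le_min F0.
 rewrite ger0_norm;last exact: mulr_ge0.
 by rewrite ler_pM// ge_min lexx orbT.
pose s : R := a + Num.min ((t - a) / 2) (h / 2).
have m0 : 0 < Num.min ((t - a) / 2) (h / 2) by rewrite lt_min !divr_gt0// subr_gt0.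
have as_ : a < s by rewrite ltrDl.
have st : s <= (a + t) / 2.
 have : Num.min ((t - a) / 2) (h / 2) <= (t - a) / 2 by rewrite ge_min lexx.
 rewrite /s;lra.
have hs : a < s < b by rewrite as_;lra.
have sh : `|s - a| < h.
 rewrite gtr0_norm ?subr_gt0// /s (addrC a) addrK.
 have : Num.min ((t - a) / 2) (h / 2) <= h / 2 by rewrite ge_min lexx orbT.
 lra.
have := HK s;rewrite as_ st => /(_ isT)/le_trans;apply;rewrite lerD2l.
have W1 : Wt s <= e' + e'.
 have iF : itg `[c, d] (F s) by have [] := contI _ (Fc s hs) (fun x => @Fout s x hs).
 have iF' := iZ (rho * (d - c)) (mI c d) iF.
 have W2 : Wt s <= \int[mu]_(v in `[c, d]) (rho * (d - c) * F s v + M s v).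
 apply: le_I => //;[exact: iW|exact: iD (Mc s hs)|].
 by move=> v;rewrite /= in_itv /=;exact: Mle.
 rewrite (ID (mI c d) iF' (Mc s hs)) (IZ _ (mI c d) iF) in W2.
 apply: le_trans W2 _;apply: lerD.
 have := HC1 s hs;move: (\int[mu]_(_ in _) _) => u0 u1.
 have -> : e' = rho * (d - c) * (C1 + 1) by rewrite /rho;field;rewrite gt_eqF.
 by apply: ler_wpM2l;[rewrite mulr_ge0 ?ltW|rewrite (le_trans u1)// lerDl].
 have := Hh s hs sh;apply: le_trans.
 apply: le_I => //;[exact: Mc|apply: iabs => //;apply: iB => //;exact: Mc|].
 by move=> v _;rewrite subr0 ler_norm.
apply: (@le_trans _ _ (K * (e' + e')));first by rewrite ler_wpM2l.
have -> : e' + e' = e / (K + 1) by rewrite /e';field;rewrite gt_eqF.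
by rewrite mulrCA ler_piMr ?ltW// ltr_pdivrMr// mul1r ltrDl.
Qed.
End Gap.

Section Edges.
Context {R : realType}.
Implicit Types (K : R -> Prop) (l r x c d : R).

(** Finds the left end of the component of [r] in the complement of [K], stopping at [l] if no point
    of [K] is met before. *)
Lemma left_edge K l r : l < r ->
 (forall x, l <= x <= r -> (forall d, 0 < d -> exists2 y : R, K y & `|y - x| < d) -> K x) -> ~ K r ->
 exists c, [/\ l <= c < r, c = l \/ K c & forall x, c < x <= r -> ~ K x].
Proof.
move=> lr Kcl nKr;pose S := [set x | l <= x <= r /\ (x = l \/ K x)].
have Sl : S l by split;[rewrite lexx ltW|left].
have Ss : has_sup S by split;[exists l|exists r => x [/andP[]]].
pose c := sup S.
have lc : l <= c by apply: sup_upper_bound.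
have cr : c <= r by apply: sup_le_ub;[exists l|move=> x [/andP[]]].
have Sc : c = l \/ K c.
 have [cl|cl] := eqVneq c l;first by left.
 have lc' : l < c by rewrite lt_neqAle eq_sym cl.
 right;apply: Kcl => [|d d0];first by rewrite lc.
 have m0 : 0 < Num.min d (c - l) by rewrite lt_min d0 subr_gt0.
 have [x [xlr xK]] := sup_adherent m0 Ss;rewrite -/c => cx.
 have xc : x <= c by apply: sup_upper_bound.
 case: xK => [xl|Kx].
 have : Num.min d (c - l) <= c - l by rewrite ge_min lexx orbT.
 by move: cx;rewrite xl;move: (Num.min _ _) => m cx mc;exfalso;lra.
 exists x => //;rewrite ler0_norm ?subr_le0// opprB ltrBlDl -ltrBlDr.
 by apply: le_lt_trans cx;rewrite lerD2l lerN2 ge_min lexx.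
exists c;split => //.
 rewrite lc lt_neqAle cr andbT /=;apply/eqP => cr';case: Sc => [cl|Kc].
 by move: lr;rewrite -cr' cl ltxx.
 by apply: nKr;rewrite -cr'.
move=> x /andP[cx xr] Kx;have : x <= c by apply: sup_upper_bound => //;split;[rewrite xr (le_trans lc (ltW cx))|right].
by rewrite leNgt cx.
Qed.

Lemma right_edge_of K l r : l < r ->
 (forall x, l <= x <= r -> (forall d, 0 < d -> exists2 y : R, K y & `|y - x| < d) -> K x) -> ~ K l ->
 exists c, [/\ l < c <= r, c = r \/ K c & forall x, l <= x < c -> ~ K x].
Proof.
move=> lr Kcl nKl.
have [|x hx H||c [/andP[rc cl] cE Hc]] := @left_edge (fun x => K (- x)) (- r) (- l).
- by rewrite ltrN2.
- apply: Kcl => [|d d0];first by rewrite lerNr lerNl andbC.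
 by have [y Ky yx] := H d d0;exists (- y) => //;rewrite -opprD normrN.
- by rewrite opprK.
exists (- c);split.
- by rewrite ltrNr cl lerNl.
- by case: cE => [->|];[left;rewrite opprK|right].
- by move=> x /andP[h1 h2] Kx;apply: (Hc (- x));rewrite ?opprK// lerN2 h1 ltrNr h2.
Qed.

End Edges.

Section StepB.
Context {R : realType}.
Notation mu := (@lebesgue_measure R).
Implicit Types (s t r x y v u a b c d e h : R).
Variables (j T : R) (X : R -> R) (g : R -> R -> R).
Hypothesis Hg : rough j T X g.

(* Baire in space: on a component of the good set of [r]s, [gap_bound] applies. *)
Lemma stepB a b : 0 <= a -> a < b -> b < T ->
 (forall t, a < t < b -> GoodR j T X g 1 t) ->
 (forall r, 0 <= r -> exists2 h, 0 < h & exists C : R, forall s, a < s < a + h -> g s r <= C) ->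
 (exists2 B0 : R, 0 <= B0 & {ae mu, forall v, 0 <= v ->
 exists2 h, 0 < h & forall s, a < s < a + h -> g s v <= B0}) ->
 exists2 h, 0 < h & exists C : R, forall s r, a < s < a + h -> 0 <= r -> g s r <= C.
Proof.
move=> a0 ab bT G H1 [B0 B00 H2].
pose b1 : R := (a + b) / 2.
have [ab1 b1b] : a < b1 /\ b1 < b by rewrite /b1;split;lra.
have inT s : a < s -> s < b -> 0 < s < T by move=> h1 h2;rewrite (le_lt_trans a0)//= (lt_trans h2).
have [L HL] := rg_Xb Hg.
have L0 : 0 < L.
 have m := inT b1 ab1 b1b;have h : 0 <= b1 < T by case/andP: m => /ltW -> ->.
 exact: lt_le_trans (rg_X Hg h) (HL _ h).
pose E (n : nat) r := forall s, a < s < b1 -> g s r <= n%:R.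
have natub (x : R) : exists n : nat, x <= n%:R.
 by exists (Num.bound `|x|);rewrite (le_trans (ler_norm x))// ltW// archi_boundP.
have Eex r : 0 <= r -> exists n, E n r.
 move=> r0;have [h h0 [C HC]] := H1 r r0.
 pose a1 : R := a + Num.min (h / 2) (b1 - a).
 have m0 : 0 < Num.min (h / 2) (b1 - a) by rewrite lt_min divr_gt0// subr_gt0.
 have aa1 : a < a1 by rewrite ltrDl.
 have a1b : a1 <= b1 by rewrite /a1 -lerBrDl ge_min lexx orbT.
 have gc : cont_on a1 b1 (fun t => g t r).
 move=> t /andP[h1 h2] e e0.
 have [d d0 Hd] := rg_tc Hg r (inT t (lt_le_trans aa1 h1) (le_lt_trans h2 b1b)) e0.
 by exists d => // y _;exact: Hd.
 have [x0 _ Hx0] := EVT_eps a1b gc.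
 have [n1 Hn1] := natub C;have [n2 Hn2] := natub (g x0 r).
 exists (n1 + n2)%N => s /andP[as_ sb];rewrite natrD.
 have [sa|sa] := leP a1 s.
 apply: le_trans (Hx0 s _) _;first by rewrite sa ltW.
 by apply: le_trans Hn2 _;rewrite lerDr.
 apply: le_trans (HC s _) _;last by apply: le_trans Hn1 _;rewrite lerDl.
 rewrite as_ (lt_le_trans sa)// lerD2l ge_min;apply/orP;left;lra.
pose K r := [/\ 0 <= r, r < L + 2 & ~ exists2 h, 0 < h & exists n, forall r', 0 <= r' -> `|r' - r| < h -> E n r'].
have nK r : 0 <= r -> r < L + 2 -> ~ K r -> exists2 h, 0 < h & exists n, forall r', 0 <= r' -> `|r' - r| < h -> E n r'.
 by move=> r0 rL nKr;apply: contrapT => H;apply: nKr.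
have Ecl n x : (forall d, 0 < d -> exists2 y, E n y & `|y - x| < d) -> E n x.
 move=> H s hs;apply/ler_addgt0Pr => e e0.
 have [|N HN] := rg_lip Hg (t := s);first by case/andP: hs => h1 h2;apply: inT => //;exact: lt_trans b1b.
 have N0 : 0 < N%:R + 1 :> R by rewrite ltr_wpDl.
 have [|y Ey yx] := H (e / (N%:R + 1));first by rewrite divr_gt0.
 have := Ey s hs;have := HN x y;have := ler_norm (g s x - g s y).
 move: yx;rewrite ltr_pdivlMr// mulrDr mulr1 mulrC distrC.
 have := normr_ge0 (x - y).
 move: (N%:R * `|x - y|) (`|x - y|) (`|g s x - g s y|) (g s x) (g s y) => u1 u2 u3 u4 u5.
 by clear -e0;lra.
have Kcl x : -1 < x < L + 2 -> (forall d, 0 < d -> exists2 y, K y & `|y - x| < d) -> K x.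
 move=> /andP[_ xL] H;split => //.
 rewrite leNgt;apply/negP => x0.
 have [|y [y0 _ _]] := H (- x);first by rewrite oppr_gt0.
 by rewrite ltr_norml => /andP[_];lra.
 move=> [h h0 [n Hn]];have [|y [y0 yL Ky]] := H (h / 2);first by rewrite divr_gt0.
 move=> yx;apply: Ky;exists (h / 2);first by rewrite divr_gt0.
 exists n => r' r'0 ry;apply: Hn => //.
 have := ler_normD (r' - y) (y - x);rewrite addrA subrK => /le_lt_trans;apply;lra.
(* A bound is coded as the inverse of a small increment, which is the form that [compact_unif] can
   make uniform. *)
have unif y : (exists2 h, 0 < h & exists n, forall r', 0 <= r' -> `|r' - y| < h -> E n r') ->
 exists2 d, 0 < d & forall z k, 0 <= z -> `|z - y| < d -> 0 < k < d -> forall u, a < u < b1 -> g u z <= k^-1.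
 move=> [h h0 [m Hm]];have m1 : 0 < m%:R + 1 :> R by rewrite ltr_wpDl.
 exists (Num.min h (m%:R + 1)^-1) => [|z k z0];first by rewrite lt_min h0 invr_gt0.
 rewrite !lt_min => /andP[zh _] /andP[k0 /andP[_ km]] u hu.
 apply: le_trans (Hm z z0 zh u hu) _;apply: (@le_trans _ _ (m%:R + 1));first by rewrite lerDl.
 by rewrite -[leLHS]invrK lef_pV2 ?posrE ?invr_gt0// ltW.
have Kempty : forall x, ~ K x.
 move=> x Kx.
 have [|||||n [al [be [x0 [Kx0 /andP[ax0 x0b] al1 beL HE]]]]] := @Baire_itv R (-1) (L + 2) K E.
 - by move=> y [y0 yL _];rewrite yL (lt_le_trans _ y0)//;lra.
 - exact: Kcl.
 - by move=> m y _ H;apply: Ecl => d /H[z [_ Ez zy]];exists z.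
 - by move=> y [y0 _ _];exact: Eex.
 - by exists x.
 have [x00 x0L nx0] := Kx0.
 pose l : R := Num.max 0 ((x0 + al) / 2).
 pose q : R := (x0 + be) / 2.
 have l0 : 0 <= l by rewrite /l le_max lexx.
 have lx0 : l <= x0 by rewrite /l ge_max x00;lra.
 have all : al < l by rewrite /l lt_max;apply/orP;right;lra.
 have x0q : x0 < q by rewrite /q;lra.
 have qbe : q < be by rewrite /q;lra.
 have [nl Hnl] := Eex l l0.
 have [nq Hnq] : exists m, E m q by apply: Eex;exact: le_trans (ltW x0q).
 have [nB HnB] := natub B0.
 (* One constant above the bound on the portion of [K], the bounds at the end points [l] and [q],
    and the initial bound [B0]: it serves for every component of the complement of [K] in the
    portion. *)
 pose n2 : R := (n + nl + nq + nB)%:R.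
 have n20 : 0 <= n2 by [].
 have [nn2 nln2 nqn2 nBn2] : [/\ n%:R <= n2, nl%:R <= n2, nq%:R <= n2 & nB%:R <= n2].
 by rewrite /n2 !ler_nat;split;rewrite ?leq_addl// -?addnA ?leq_addr// addnCA ?leq_addr// addnA addnCA leq_addr.
 clearbody n2.
 have Kcl' x1 x2 : l <= x1 -> x2 <= q -> forall y, x1 <= y <= x2 ->
 (forall d, 0 < d -> exists2 z, K z & `|z - y| < d) -> K y.
 move=> h1 h2 y /andP[y1 y2];apply: Kcl;apply/andP;split;first by lra.
 by lra.
 have T0 : 0 <= T by lra.
 have main r : l <= r <= q -> forall s, a < s < b1 -> g s r <= n2 + 1 + T.
 move=> /andP[lr rq] s hs.
 have triv m : E m r -> m%:R <= n2 -> g s r <= n2 + 1 + T.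
 move=> Em mn2;apply: le_trans (Em s hs) _;apply: le_trans mn2 _.
 by rewrite -addrA lerDl addr_ge0.
 have [Kr|nKr] := pselect (K r);first by apply: triv nn2;apply: HE => //;lra.
 have [rl|rl] := eqVneq l r;first by apply: triv nln2;rewrite -rl.
 have [rq'|rq'] := eqVneq r q;first by apply: triv nqn2;rewrite rq'.
 have lr' : l < r by rewrite lt_neqAle rl.
 have rq2 : r < q by rewrite lt_neqAle rq'.
 have [c [/andP[lc cr] cE cK]] := left_edge lr' (Kcl' l r (lexx l) rq) nKr.
 have [d [/andP[rd dq] dE dK]] := right_edge_of rq2 (Kcl' r q lr (lexx q)) nKr.
 have Kcd v : c < v < d -> ~ K v.
 move=> /andP[cv vd];have [vr|vr] := leP v r;first by apply: cK;rewrite cv.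
 by apply: dK;rewrite vd ltW.
 have Eb y : l <= y <= q -> y = l \/ y = q \/ K y -> forall u, a < u < b1 -> g u y <= n2.
 move=> /andP[y1 y2] [->|[->|Ky]] u hu.
 - exact: le_trans (Hnl _ hu) nln2.
 - exact: le_trans (Hnq _ hu) nqn2.
 - by apply: le_trans nn2;apply: HE => //;lra.
 have cd : c < d by exact: lt_trans rd.
 have G' t : a < t < b1 -> GoodR j T X g 1 t.
 by move=> /andP[h1 h2];apply: G;rewrite h1 (lt_trans h2).
 apply: (@gap_bound R j T X g Hg a b1 c d n2 a0 ab1 _ G' _ cd n20) => //.
 - exact: lt_trans bT.
 - exact: le_trans lc.
 - apply: Eb;first by rewrite lc (le_trans (ltW cr)).
 by case: cE;[left|right;right].
 - apply: Eb;first by rewrite dq (le_trans lr (ltW rd)).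
 by case: dE;right;[left|right].
 - move=> rho rho0.
 have [|h h0 Hh] := @compact_unif R (fun y h => forall u, a < u < b1 -> g u y <= h^-1) (c + rho) (d - rho).
 move=> y /andP[y1 y2].
 have [y0 yL ycd] : [/\ 0 <= y, y < L + 2 & c < y < d] by clear -rho0 y1 y2 lc dq qbe beL l0;split;lra.
 have [h h0 [m Hm]] := nK y y0 yL (Kcd y ycd).
 have [k k0 Hk] := unif y (ex_intro2 _ _ h h0 (ex_intro _ m Hm)).
 exists k => // z k' /andP[z1 _];apply: Hk;clear -z1 l0 lc rho0;lra.
 exists (h / 2)^-1 => u v hu hv;apply: Hh => //;lra.
 - apply: aeS H2 => v Hv /andP[cv vd];have [|h h0 Hh] := Hv;first by lra.
 by exists h => // u hu;apply: le_trans (Hh u hu) _;exact: le_trans nBn2.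
 - lra.
 apply: nx0.
 have [N HN] := natub (n2 + 1 + T).
 exists (Num.min (x0 - (x0 + al) / 2) (q - x0));first by rewrite lt_min !subr_gt0 x0q;lra.
 exists N => r' r'0;rewrite lt_min => /andP[h1 h2] s hs.
 apply: le_trans HN;apply: main => //;rewrite /l ge_max r'0 /=.
 by move: h1 h2;rewrite !ltr_norml => /andP[k1 _] /andP[_ k2];clear -k1 k2;apply/andP;split;lra.
have [|h h0 Hh] := @compact_unif R (fun y h => forall u, a < u < b1 -> g u y <= h^-1) 0 (L + 1).
 move=> y /andP[y1 y2];have [|k k0 Hk] := unif y (nK y y1 _ (Kempty y));first by lra.
 by exists k => // z k' /andP[z1 _];apply: Hk.
exists (b1 - a);first by rewrite subr_gt0.
exists (h / 2)^-1 => s r;rewrite addrC subrK => /[dup] hs /andP[as_ sb] r0.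
have [rL|rL] := leP r (L + 1);first by apply: Hh => //;[rewrite r0|lra].
have sT := inT s as_ (lt_trans sb b1b).
rewrite (rg_supp Hg sT) ?invr_ge0 ?divr_ge0 ?ltW// ger0_norm//.
have : X s <= L by apply: HL;case/andP: sT => /ltW -> ->.
lra.
Qed.
End StepB.

Section Reg.
Context {R : realType}.
Notation mu := (@lebesgue_measure R).
Implicit Types (s t r x y v u a b c d e h : R).
Variables (j T : R) (X : R -> R) (g : R -> R -> R).
Hypothesis Hg : rough j T X g.

Lemma rough_L : exists2 L : R, 0 <= L & forall t, 0 < t < T -> X t <= L.
Proof.
have [L HL] := rg_Xb Hg;exists `|L| => // t /andP[t0 tT].
by rewrite (le_trans _ (ler_norm L))// HL// ltW.
Qed.

Lemma g_bnd t : 0 < t < T -> exists2 B : R, 0 <= B & forall r, g t r <= B.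
Proof.
move=> tT;have [L L0 HL] := rough_L.
have [|x0 _ Hx] := @EVT_eps R (- L) L (g t) _ (g_cont Hg tT (c := - L) (d := L));first lra.
exists (g t x0) => [|r];first exact: rg_ge0 Hg _ _.
have [rL|rL] := leP `|r| L;first by apply: Hx;rewrite -ler_norml.
by rewrite (rg_supp Hg tT) ?(rg_ge0 Hg)// (le_trans (HL _ tT))// ltW.
Qed.

Lemma good sg t : sg = 1 \/ sg = -1 -> 0 < t < T -> GoodR j T X g sg t.
Proof.
move=> sg1;apply: (all_good Hg sg1) => a b c d w a0 ab bT G H.
have [h [B [h0 HB]]] := w_bnd ab H.
case: sg1 G H => -> G H;last first.
 exists h, B;split => // t' r ht tb hr;rewrite /zz mulN1r opprB.
 have := HB t' r ht tb hr;have := ler_norm (w t' r);have := rg_ge0 Hg t' r.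
 by move: (g t' r) (w t' r) (`|w t' r|) => u1 u2 u3;lra.
have aT : 0 < a < T by rewrite a0 (lt_trans ab).
have [B0 B00 HB0] := g_bnd aT.
have near r : exists2 h, 0 < h & forall s, a < s < a + h -> g s r <= B0 + 1.
 have [d1 d10 Hd] := rg_tc Hg r aT ltr01;exists d1 => // s /andP[h1 h2].
 have := Hd s;rewrite gtr0_norm ?subr_gt0// ltrBlDl => /(_ h2);have := HB0 r.
 have := ler_norm (g s r - g a r).
 by move: (g s r) (g a r) (`|_|) => u1 u2 u3;lra.
have [||h' h'0 [C HC]] := stepB Hg (ltW a0) ab bT G.
- by move=> r _;have [h1 h10 H1] := near r;exists h1 => //;exists (B0 + 1).
- by exists (B0 + 1);[rewrite addr_ge0|apply: aeW => v _;exact: near].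
exists (Num.min h h'), (C + B);split;first by rewrite lt_min h0.
move=> t' r /andP[at' t'h] tb /[dup] hr /andP[cr rd].
have c0 : 0 <= c by case/andP: (cf_c H).
have t1 : a < t' < a + h by rewrite at' (lt_le_trans t'h)// lerD2l ge_min lexx.
have t2 : a < t' < a + h' by rewrite at' (lt_le_trans t'h)// lerD2l ge_min lexx orbT.
rewrite /zz mul1r;have := HB t' r t1 tb hr;have := HC t' r t2 (le_trans c0 cr).
by rewrite ler_norml => h1 /andP[h2 _];rewrite lerD// lerNl.
Qed.

Lemma cmp sg a b : sg = 1 \/ sg = -1 -> 0 < a -> b < T -> Cmp j X g sg a b.
Proof.
move=> s1 a0 bT;apply: (cmp_chain Hg s1 (ltW a0) bT) => t /andP[h1 h2].
by apply: good => //;rewrite (lt_le_trans a0)//= (lt_trans h2).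
Qed.

Lemma der_expN x : is_derive x 1 (fun y : R => expR (- y)) (- expR (- x)).
Proof.
have := @der_comp R expR (fun y => - y) x _ _ (is_derive_expR _) (derN (derI x)).
by move=> H;apply: (derE H);ring.
Qed.

Lemma D2_expN x : D2 (fun y : R => expR (- y)) x (expR (- x)).
Proof.
apply: (@D2_derive _ _ (fun y => - expR (- y)) _ _ 1) => //;first by move=> y _;exact: der_expN.
by have := derN (der_expN x);rewrite opprK.
Qed.

Lemma rder0_der (f : R -> R) (p : R) : is_derive (0 : R) 1 f p -> rder0 f p.
Proof.
move=> /is_derive_epsP H e e0;have [d d0 Hd] := H e e0;exists d => // h /andP[h0 hd].
by have := Hd h;rewrite subr0 (gtr0_norm h0);apply.
Qed.

Lemma rder0D (f1 f2 : R -> R) (p1 p2 : R) : rder0 f1 p1 -> rder0 f2 p2 ->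
 rder0 (fun y => f1 y + f2 y) (p1 + p2).
Proof.
move=> H1 H2 e e0;have e20 : 0 < e / 2 by rewrite divr_gt0.
have [d1 d10 {}H1] := H1 _ e20;have [d2 d20 {}H2] := H2 _ e20.
exists (Num.min d1 d2) => [|h];first by rewrite lt_min d10.
rewrite lt_min => /andP[h0 /andP[h1 h2]].
have := H1 h;rewrite h0 h1 => /(_ isT) B1;have := H2 h;rewrite h0 h2 => /(_ isT) B2.
rewrite (_ : _ - _ = (f1 h - f1 0 - p1 * h) + (f2 h - f2 0 - p2 * h));last by ring.
apply: le_trans (ler_normD _ _) _.
by rewrite (_ : e * h = e / 2 * h + e / 2 * h) ?lerD//;field.
Qed.

Lemma cfX_supp a b c d w : 0 < a -> b < T -> 0 <= c -> (forall t r, a <= t <= b -> c <= r <= d -> 1 <= w t r) ->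
 exists2 k : R, 0 < k & forall t r, a <= t <= b -> c <= r <= d -> - k <= zz g 1 w t r -> r < X t.
Proof.
move=> a0 bT c0 H;exists 2^-1 => // t r ht hr;rewrite /zz mul1r => Z.
have := H t r ht hr => W;have gpos : 0 < g t r by move: Z W;move: (g t r) (w t r) => u1 u2;lra.
rewrite ltNge;apply/negP => Xr;move: gpos;rewrite (rg_supp Hg) ?ltxx//.
 by case/andP: ht => h1 h2;rewrite (lt_le_trans a0)//= (le_lt_trans h2).
exact: le_trans Xr (ler_norm _).
Qed.

(** A barrier reduces the bound to that of a single slice. Its slope [- p] at the origin lies below
    the flux [- 2 * j], and its growth rate [p] in time exceeds half its second derivative,
    [p * expR (- r) / 2]. *)
Lemma bound_from s0 t' : 0 < s0 -> s0 < t' -> t' < T ->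
 exists C : R, forall s r, s0 <= s <= t' -> 0 <= r -> g s r <= C.
Proof.
move=> s00 st' t'T;have s0T : 0 < s0 < T by rewrite s00 (lt_trans st').
have [B B0 HB] := g_bnd s0T;have [L L0 HL] := rough_L.
pose p : R := 2 * `|j| + 1;have p0 : 0 < p by rewrite ltr_wpDl// mulr_ge0.
pose w t r : R := (B + 1 + p * (t - s0)) + p * expR (- r).
have w1 t r : s0 <= t -> 1 + B + p * (t - s0) <= w t r /\ 1 <= w t r.
 move=> st;have h0 : 0 <= p * (t - s0) by rewrite mulr_ge0 ?subr_ge0// ltW.
 have h1 : 0 <= p * expR (- r) by rewrite mulr_ge0 ?expR_ge0// ltW.
 rewrite /w;split;lra.
have wle t r : s0 <= t <= t' -> 0 <= r -> w t r <= B + 1 + p * (t' - s0) + p.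
 move=> /andP[h1 h2] r0;rewrite /w;apply: lerD;first by rewrite lerD2l ler_pM2l// lerD2r.
 by rewrite ler_piMr ?(ltW p0)// -expR0 ler_expR lerNl oppr0.
have dw t : is_derive t 1 (fun t : R => B + 1 + p * (t - s0)) p.
 have := derD (derC (B + 1) t) (derZ p (derB (derI t) (derC s0 t))).
 by move=> H;apply: (derE H);ring.
have C : config j X g 1 s0 t' 0 (L + 1) w.
 split.
 - by rewrite lexx ltr_wpDl.
 - apply: jcontD;first exact: (@der_jcont R s0 t' 0 (L + 1) _ _ dw).1.
 apply: jcontZ;exact: (@der_jcont R s0 t' 0 (L + 1) _ _ der_expN).2.
 - move=> t r _ /andP[r0 _];exists (p + 0), (0 + p * expR (- r));split.
 + exact: derD (dw t) (derC _ t).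
 + exact: D2D (D2C _ r) (D2Z p (D2_expN r)).
 + have : p * expR (- r) <= p by rewrite ler_piMr ?(ltW p0)// -expR0 ler_expR lerNl oppr0 ltW.
 by move: (_ * expR _) => u1;lra.
 - right;split=> // t _;exists (- p).
 have : is_derive (0 : R) 1 (w t) (0 + p * (- expR (- 0))) := derD (derC _ 0) (derZ p (der_expN 0)).
 by rewrite oppr0 expR0 mulrN1 add0r;exact: rder0_der.
 by rewrite mul1r opprK /p;have := ler_norm j;move: (`|j|) => u1;lra.
 - move=> t /andP[h1 h2];rewrite /zz mul1r (rg_supp Hg).
 + by rewrite sub0r oppr_lt0;apply: lt_le_trans (w1 t _ h1).2.
 + by rewrite (lt_le_trans s00)//= (le_lt_trans h2).
 + rewrite ger0_norm ?addr_ge0//;apply: le_trans (HL t _) _;last by rewrite lerDl.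
 by rewrite (lt_le_trans s00)//= (le_lt_trans h2).
 - by apply: cfX_supp => // t r /andP[h1 _] _;exact: (w1 _ _ h1).2.
 - move=> r _;rewrite /zz mul1r;have := (w1 s0 r (lexx _)).1;rewrite subrr mulr0 addr0.
 by have := HB r;move: (g _ _) (w _ _) => u1 u2;lra.
exists (B + 1 + p * (t' - s0) + p) => s r hs r0.
have sT : 0 < s < T by case/andP: hs => h1 h2;rewrite (lt_le_trans s00)//= (le_lt_trans h2).
have [rL|rL] := leP r (L + 1);last first.
 rewrite (rg_supp Hg sT);last by rewrite ger0_norm// (le_trans (HL s sT))//;lra.
 by apply: le_trans (wle s0 0 _ _);rewrite ?lexx ?(ltW st')//;apply: le_trans (w1 s0 0 (lexx _)).2.
have := @cmp 1 s0 t' (or_introl erefl) s00 t'T _ _ _ C s r hs;rewrite r0 rL => /(_ isT).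
by rewrite /zz mul1r subr_lt0 => /ltW/le_trans;apply;exact: wle.
Qed.

(** The slice at time [t], frozen and shifted by [C * (s - t)] up or down, is a barrier because its
    second derivative is bounded by [C2]. The terms in [eta] provide strictness and are removed at
    the end; [d < X t] keeps the rectangle in the region of the equation for a short time. *)
Lemma time_lip t d : 0 < t < T -> 0 < d < X t -> exists2 h, 0 < h & exists2 C : R, 0 <= C &
 forall s r, t <= s < t + h -> 0 <= r <= d -> `|g s r - g t r| <= C * (s - t).
Proof.
move=> /[dup] tT /andP[t0 t1] /[dup] hd /andP[d0 dX].
have [g1 [g2 [D1 D2g [C2 HC2] _ r0]]] := rg_C2 Hg tT.
have Xd : 0 < X t - d by rewrite subr_gt0.
have [h1 h10 H1] := rg_Xc Hg tT Xd.
have /is_derive_epsP := D2g d hd;move=> /(_ 1 ltr01)[h2 h20 H2].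
pose h : R := Num.min (Num.min h1 h2) (T - t) / 2.
have m0 : 0 < Num.min (Num.min h1 h2) (T - t) by rewrite !lt_min h10 h20 subr_gt0.
have h0 : 0 < h by rewrite divr_gt0.
have [hh1 hh2 hT] : [/\ h < h1, h < h2 & h < T - t].
 have : h < Num.min (Num.min h1 h2) (T - t) by rewrite /h;lra.
 by rewrite !lt_min => /andP[/andP[]].
have C20 : 0 <= C2 by apply: le_trans (HC2 d hd).
pose C : R := C2 + 1.
clearbody h.
have bT : t + h < T by lra.
have atd s : t <= s <= t + h -> `|g s d - g t d| <= C * (s - t).
 move=> /andP[k1 k2];have st : 0 <= s - t by rewrite subr_ge0.
 have k3 : s - t < h2 by lra.
 have := H2 s;rewrite ger0_norm// mul1r => /(_ k3) B.
 have := HC2 d hd => B2;rewrite (_ : _ - _ = (g s d - g t d - 2^-1 * g2 d * (s - t)) + 2^-1 * g2 d * (s - t));last by rewrite subrK.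
 apply: le_trans (ler_normD _ _) _;rewrite /C mulrDl mul1r addrC;apply: lerD => //.
 rewrite normrM (ger0_norm st) ler_wpM2r// normrM gtr0_norm//.
 by move: B2;move: (`|_|) => u1 B2;lra.
exists h => //;exists C => [|s r /andP[s1 s2] hr];first by rewrite addr_ge0.
have main sg : sg = 1 \/ sg = -1 -> sg * (g s r - g t r) <= C * (s - t).
 move=> sg1;apply/ler_addgt0Pr => e e0.
 pose eta : R := e / (2 + h).
 have eta0 : 0 < eta by rewrite divr_gt0// addr_gt0.
 pose w u y : R := g t y + sg * ((C * (u - t) + eta * (1 + (u - t))) + eta * expR (- y)).
 have sgsg : sg * sg = 1 by case: sg1 => ->;rewrite ?mulr1// mulrNN mulr1.
 have zE u y : zz g sg w u y = sg * (g u y - g t y) - ((C * (u - t) + eta * (1 + (u - t))) + eta * expR (- y)).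
 by rewrite /zz /w opprD addrA mulrBr mulrA sgsg mul1r.
 have dw u : is_derive u 1 (fun u : R => C * (u - t) + eta * (1 + (u - t))) (C + eta).
 have := derD (derZ C (derB (derI u) (derC t u))) (derZ eta (derD (derC 1 u) (derB (derI u) (derC t u)))).
 by move=> H;apply: (derE H);ring.
 have K : config j X g sg t (t + h) 0 d w.
 split.
 - by rewrite lexx.
 - apply: jcontD.
 move=> u y _ hy e1 e10;have [k k0 Hk] := g_cont Hg tT hy e10.
 by exists k => // u' y' _ hy' _;exact: Hk.
 apply: jcontZ;apply: jcontD;first exact: (@der_jcont R t (t + h) 0 d _ _ dw).1.
 apply: jcontZ;exact: (@der_jcont R t (t + h) 0 d _ _ der_expN).2.
 - move=> u y hu /andP[y0 yd];have yX : 0 < y < X t by rewrite y0 (lt_trans yd).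
 exists (0 + sg * ((C + eta) + 0)), (g2 y + sg * (0 + eta * expR (- y)));split.
 + exact: derD (derC _ u) (derZ sg (derD (dw u) (derC _ u))).
 + apply: D2D;last exact: D2Z (D2D (D2C _ y) (D2Z eta (D2_expN y))).
 have mm : 0 < Num.min y (X t - y) by rewrite lt_min y0;case/andP: yX => _;rewrite subr_gt0.
 apply: (@D2_derive _ _ g1 _ _ _ mm);last by apply: (D1 y _).2.
 move=> z;rewrite lt_min !ltr_norml => /andP[/andP[z1 z2] /andP[z3 z4]].
 by apply: (D1 z _).1;apply/andP;split;lra.
 + have := HC2 y yX;have : eta * expR (- y) <= eta.
 by rewrite ler_piMr ?(ltW eta0)// -expR0 ler_expR lerNl oppr0 ltW.
 have : 0 <= eta * expR (- y) by rewrite mulr_ge0 ?expR_ge0// ltW.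
 rewrite ler_norml /C;move: (eta * expR _) => u1.
 by case: sg1 => -> p1 p2 /andP[p3 p4];lra.
 - right;split=> // u _;exists (- (2 * j) + sg * (- eta)).
 apply: rder0D => //;apply: rder0_der.
 have := derZ sg (derD (derC (C * (u - t) + eta * (1 + (u - t))) 0) (derZ eta (der_expN 0))).
 by rewrite oppr0 expR0 mulrN1 add0r.
 have -> : sg * (- (2 * j) - (- (2 * j) + sg * - eta)) = sg * sg * eta by clear;ring.
 by rewrite sgsg mul1r.
 - move=> u hu;rewrite zE subr_lt0.
 have ut : 0 <= u - t by case/andP: hu;rewrite subr_ge0.
 have := atd u hu;have : 0 <= eta * expR (- d) by rewrite mulr_ge0 ?expR_ge0// ltW.
 have : 0 < eta * (1 + (u - t)) by rewrite mulr_gt0// ltr_wpDr.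
 have : sg * (g u d - g t d) <= `|g u d - g t d|.
 by case: sg1 => ->;rewrite ?mul1r ?mulN1r ?ler_norm// -normrN ler_norm.
 by move: (sg * _) (eta * _) (eta * _) (C * _) (`|_|) => u1 u2 u3 u4 u5;lra.
 - exists 1 => // u y /andP[u1 u2] /andP[_ yd] _.
 have k3 : u - t < h1 by lra.
 have := H1 u;rewrite ger0_norm ?subr_ge0// => /(_ k3);rewrite ltr_norml => /andP[+ _];lra.
 - move=> y _;rewrite zE !subrr !mulr0 !add0r addr0 mulr1 oppr_lt0.
 by rewrite addr_gt0// mulr_gt0 ?expR_gt0.
 have sin : t <= s <= t + h by rewrite s1 ltW.
 have := @cmp sg t (t + h) sg1 t0 bT _ _ _ K s r sin hr;rewrite zE subr_lt0 => /ltW/le_trans;apply.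
 rewrite -addrA lerD2l -mulrDr.
 have -> : e = eta * (2 + h) by rewrite /eta;field;rewrite gt_eqF// addr_gt0.
 rewrite ler_pM2l//;have : expR (- r) <= 1 by rewrite -expR0 ler_expR lerNl oppr0;case/andP: hr.
 lra.
rewrite ler_norml;apply/andP;split.
 by rewrite lerNl -mulN1r;apply: main;right.
by rewrite -[leLHS]mul1r;apply: main;left.
Qed.
End Reg.

(** * Comparison of primitives *)

Section Helpers.
Context {R : realType}.
Notation mu := (@lebesgue_measure R).
Implicit Types (f : R -> R) (a b c x r : R).

Lemma I_split f a b c : a <= b -> b <= c -> itg `[a, c] f ->
 \int[mu]_(y in `[a, c]) f y = \int[mu]_(y in `[a, b]) f y + \int[mu]_(y in `[b, c]) f y.
Proof.
move=> ab bc fi.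
have i1 : mu.-integrable `]b, c] (EFin \o f).
 apply: integrableS fi => //;apply: subset_itvr;rewrite bnd_simp//.
have := @Rintegral_itvB R f (BLeft a) (BRight c) b fi;rewrite !bnd_simp => /(_ ab bc) H.
have := Rintegral_itv_obnd_cbnd i1 => <-;rewrite -H addrCA subrr addr0 //.
Qed.

Lemma iS f a b c d : a <= c -> d <= b -> itg `[a, b] f ->
 itg `[c, d] f.
Proof. by move=> ac db;apply: integrableS => //;apply: subset_itvScc. Qed.

Lemma I_cst a b (k : R) : a <= b -> \int[mu]_(y in `[a, b]) k = k * (b - a).
Proof.
move=> ab;have M : mu `[a, b]%classic = (b - a)%:E.
 rewrite lebesgue_measure_itv /= lte_fin;case: ltP => //= ba.
 by rewrite (le_anti (introT andP (conj ab ba))) subrr.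
by rewrite Rintegral_cst//;congr (_ * _);rewrite -[RHS]/(fine (b - a)%:E) -M.
Qed.

Lemma i_cst a b (k : R) : itg `[a, b] (fun=> k).
Proof. by apply: (@i_itv_bnd _ _ _ _ `|k|) => // y' _;exact: measurable_cst. Qed.

Lemma I_diff_le f a b (B : R) : a <= b -> itg `[a, b] f ->
 (forall y, a <= y <= b -> f y <= B) -> \int[mu]_(y in `[a, b]) f y <= B * (b - a).
Proof.
move=> ab fi fB;rewrite -I_cst//;apply: le_I => //;first exact: i_cst.
Qed.

Lemma I_set1 f a : \int[mu]_(y in `[a, a]) f y = 0.
Proof. by rewrite set_itv1 Rintegral_set1. Qed.

Lemma FTC_at f a b x : itg `[a, b] f -> a < x -> x < b ->
 {for x, continuous f} -> is_derive x 1 (fun y => \int[mu]_(z in `[a, y]) f z) (f x).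
Proof.
move=> fi ax xb cf;have [d1 d2] := @continuous_FTC1_closed R f a x b xb fi ax cf.
by rewrite -d2 derive1E;apply: derivableP.
Qed.

Lemma zero_der_cst (f : R -> R) (d : R) : (forall x, 0 < x < d -> is_derive x 1 f 0) ->
 forall x y, 0 < x -> x <= y -> y < d -> f x = f y.
Proof.
move=> H x y x0 xy yd;have [|c _ /eqP] := @MVT_le R f (fun=> 0) x y xy.
 by move=> z /andP[z1 z2];apply: H;rewrite (lt_le_trans x0)//= (le_lt_trans z2).
by rewrite mul0r subr_eq0 => /eqP.
Qed.
End Helpers.

Section Records.
Context {R : realType}.
Notation mu := (@lebesgue_measure R).
Implicit Types (s t r x y v u a b c d e h : R).

(** At [t = 0] no boundary condition is imposed, so [g 0] may jump at [X 0]: convergence of the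
    later slices is asked only off that point, where an upper bound is kept. *)
Record rough0 (X : R -> R) (g : R -> R -> R) : Prop := Rough0 {
 r0_meas : measurable_fun setT (g 0);
 r0_bnd : exists2 B : R, 0 <= B & forall r, g 0 r <= B;
 r0_supp : forall r, X 0 < r -> g 0 r = 0;
 r0_near : forall r, 0 <= r -> exists2 h : R, 0 < h & forall s, 0 < s < h -> g s r <= g 0 r + 1;
 r0_cvg : forall r, 0 <= r -> r != X 0 -> forall e, 0 < e -> exists2 h : R, 0 < h &
 forall s, 0 < s < h -> `|g s r - g 0 r| < e }.

(** The obstacle problem for the primitive of a density, with exactly what the maximum principle
    consumes. In [fl_E] the equation is given by forward difference quotients in time, uniformly for
    [r] near [r0], and by a second derivative in the sense of [D2]. *)
Record flow (j T : R) (X : R -> R) (V : R -> R -> R) : Prop := Flow {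
 fl_X : exists2 L : R, 0 <= L & forall t, 0 <= t < T -> 0 < X t <= L;
 fl_0 : forall t, 0 <= t < T -> V t 0 = 0;
 fl_mono : forall t r (r' : R), 0 <= t < T -> 0 <= r -> r <= r' -> V t r <= V t r';
 fl_M : forall t r, 0 <= t < T -> X t <= r -> V t r = V t (X t);
 fl_lip : forall t, 0 <= t < T -> exists2 B : R, 0 <= B & forall r (r' : R), 0 <= r -> 0 <= r' ->
 `|V t r - V t r'| <= B * `|r - r'|;
 fl_cont : forall t, 0 <= t < T -> forall e, 0 < e -> exists2 d : R, 0 < d &
 forall s r, 0 <= s < T -> `|s - t| < d -> 0 <= r -> `|V s r - V t r| <= e;
 fl_der : forall t r, 0 < t < T -> 0 < r -> exists p : R, [/\ is_derive r 1 (V t) p, 0 <= p &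
 X t <= r -> p = 0];
 fl_E : forall t (r0 : R), 0 < t < T -> 0 < r0 < X t -> exists2 p : R, D2 (V t) r0 p &
 forall e, 0 < e -> exists2 d : R, 0 < d & forall s r, t < s < t + d -> `|r - r0| < d ->
 `|V s r - V t r - (s - t) * (p / 2 + j)| <= e * (s - t) }.

End Records.

Section FlowOf.
Context {R : realType}.
Notation mu := (@lebesgue_measure R).
Implicit Types (s t r x y v u a b c d e h : R).
Variables (j T : R) (X : R -> R) (g : R -> R -> R).
Hypotheses (Hg : rough j T X g) (H0 : rough0 X g).

Definition VV t r := \int[mu]_(y in `[0, r]) g t y.

(** All positive times being good, [stepB] applies at [a = 0] and bounds [g] just after the initial
    time; [bound_from] takes over from there. *)
Lemma bound_to t' : 0 < t' -> t' < T -> exists2 C : R, 0 <= C & forall s r, 0 <= s <= t' -> 0 <= r -> g s r <= C.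
Proof.
move=> t'0 t'T;have [B B0 HB] := r0_bnd H0.
have T0 : 0 < T by exact: lt_trans t'T.
pose b : R := t' / 2.
have b0 : 0 < b by rewrite divr_gt0.
have bt' : b < t' by rewrite /b;lra.
have [|||h h0 [C1 HC1]] := @stepB R j T X g Hg 0 b (lexx _) b0 (lt_trans bt' t'T).
- by move=> t /andP[h1 h2];apply: (good Hg);[left|rewrite h1 (lt_trans h2)// (lt_trans bt')].
- move=> r r0;have [h h0 Hh] := r0_near H0 r0;exists h => //;exists (g 0 r + 1) => s.
 by rewrite add0r;exact: Hh.
- exists (B + 1);first by rewrite addr_ge0.
 apply: aeW => r r0;have [h h0 Hh] := r0_near H0 r0;exists h => // s;rewrite add0r => hs.
 by apply: le_trans (Hh s hs) _;rewrite lerD2r.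
pose s0 : R := Num.min (h / 2) b.
have s00 : 0 < s0 by rewrite lt_min divr_gt0.
have s0h : s0 < h.
 have : s0 <= h / 2 by rewrite /s0 ge_min lexx.
 lra.
have s0t : s0 < t' by apply: le_lt_trans bt';rewrite /s0 ge_min lexx orbT.
clearbody s0 b.
have [C2 HC2] := bound_from Hg s00 s0t t'T.
exists (B + `|C1| + `|C2|) => [|s r /andP[sge st] r0];first by rewrite !addr_ge0.
have [ss|ss] := ltP s s0;last first.
 apply: le_trans (HC2 s r _ r0) _;first by rewrite ss.
 by apply: le_trans (ler_norm _) _;rewrite lerDr addr_ge0.
have [->|sn0] := eqVneq s 0;first by apply: le_trans (HB r) _;rewrite -addrA lerDl addr_ge0.
have s_gt : 0 < s by rewrite lt_neqAle eq_sym sn0.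
apply: le_trans (HC1 s r _ r0) _;first by rewrite add0r s_gt (lt_trans ss).
by apply: le_trans (ler_norm _) _;rewrite addrAC lerDr addr_ge0.
Qed.

Lemma g_meas t : 0 <= t < T -> measurable_fun setT (g t).
Proof.
move=> /andP[t0 tT];have [->|tn0] := eqVneq t 0;first exact: r0_meas H0.
have tT' : 0 < t < T by rewrite lt_neqAle eq_sym tn0 t0.
apply: cont_eps_meas => // x;have [N HN] := rg_lip Hg tT'.
move=> e e0;have N0 : 0 < N%:R + 1 :> R by rewrite ltr_wpDl.
exists (e / (N%:R + 1)) => [|v];first by rewrite divr_gt0.
rewrite ltr_pdivlMr// mulrDr mulr1 mulrC;apply: le_lt_trans.
by apply: le_trans (HN _ _) _;rewrite lerDl.
Qed.

Lemma g_i t a b : 0 <= t < T -> 0 <= a -> itg `[a, b] (g t).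
Proof.
move=> /[dup] tT /andP[t0 tT'] a0.
have [C _ HC] : exists2 C : R, 0 <= C & forall s r, 0 <= s <= (t + T) / 2 -> 0 <= r -> g s r <= C.
 by apply: bound_to;lra.
apply: (@i_itv_bnd _ _ _ _ C) => [|y /andP[ay _]].
 by apply: measurable_funTS;exact: g_meas.
rewrite ger0_norm ?(rg_ge0 Hg)//;apply: HC;last exact: le_trans ay.
by rewrite t0;lra.
Qed.

Lemma VV_sub t a b : 0 <= t < T -> 0 <= a -> a <= b -> VV t b - VV t a = \int[mu]_(y in `[a, b]) g t y.
Proof.
move=> tT a0 ab;have := I_split a0 ab (g_i b tT (lexx 0));rewrite /VV => ->.
by rewrite addrAC subrr add0r.
Qed.

Lemma VV_lip t : 0 <= t < T -> exists2 B : R, 0 <= B & forall r (r' : R), 0 <= r -> 0 <= r' ->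
 `|VV t r - VV t r'| <= B * `|r - r'|.
Proof.
move=> /[dup] tT /andP[t0 tT'].
have [C C0 HC] : exists2 C : R, 0 <= C & forall s r, 0 <= s <= (t + T) / 2 -> 0 <= r -> g s r <= C.
 by apply: bound_to;lra.
have tt : 0 <= t <= (t + T) / 2 by rewrite t0;lra.
exists C => // r r' r0 r0';wlog rr : r r' r0 r0' / r' <= r.
 by move=> H;have [/H|/ltW/H] := leP r' r;[apply|rewrite distrC (distrC r);apply].
rewrite (VV_sub tT r0' rr) (ger0_norm (_ : 0 <= r - r')) ?subr_ge0// ger0_norm;last by apply: I_ge0 => y _;exact: rg_ge0 Hg _ _.
apply: I_diff_le => //;first exact: g_i.
by move=> y /andP[y1 _];apply: HC => //;exact: le_trans y1.
Qed.

Lemma g_supp0 t r : 0 <= t < T -> X t < r -> g t r = 0.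
Proof.
move=> /andP[t0 tT] Xr;have [E|tn0] := eqVneq t 0;first by rewrite E (r0_supp H0)// -E.
have tT' : 0 < t < T by rewrite lt_neqAle eq_sym tn0 t0.
by apply: (rg_supp Hg tT');apply: le_trans (ltW Xr) (ler_norm _).
Qed.

Lemma VV_M t r : 0 <= t < T -> X t <= r -> VV t r = VV t (X t).
Proof.
move=> tT Xr;apply/eqP;rewrite -subr_eq0;have X0 : 0 <= X t by apply/ltW/(rg_X Hg).
rewrite (VV_sub tT X0 Xr) -Rintegral_itv_obnd_cbnd;last first.
 by apply: integrableS (g_i r tT X0) => //;apply: subset_itvr;rewrite bnd_simp.
rewrite (@eq_I _ _ _ (fun=> 0)) => [|y];last by rewrite /= in_itv /= => /andP[Xy _];exact: g_supp0.
by rewrite Rintegral_cst// mul0r.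
Qed.

Lemma g_pt t r : 0 <= t < T -> 0 <= r -> r != X 0 -> forall e, 0 < e ->
 exists2 d : R, 0 < d & forall s, 0 <= s -> `|s - t| < d -> `|g s r - g t r| < e.
Proof.
move=> /andP[t0 tT] r0 rX e e0;have [E|tn0] := eqVneq t 0;last first.
 have tT' : 0 < t < T by rewrite lt_neqAle eq_sym tn0 t0.
 by have [d d0 Hd] := rg_tc Hg r tT' e0;exists d => // s _;exact: Hd.
have [h h0 Hh] := r0_cvg H0 r0 rX e0;exists h => // s s0.
rewrite E subr0 => sh;have [->|sn0] := eqVneq s 0;first by rewrite subrr normr0.
apply: Hh;rewrite lt_neqAle eq_sym sn0 s0 /=;exact: le_lt_trans (ler_norm _) sh.
Qed.

Lemma VV_cont t : 0 <= t < T -> forall e, 0 < e -> exists2 d : R, 0 < d &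
 forall s r, 0 <= s < T -> `|s - t| < d -> 0 <= r -> `|VV s r - VV t r| <= e.
Proof.
move=> /[dup] tT /andP[t0 tT'] e e0.
pose t1 : R := (t + T) / 2.
have [tt1 t1T] : t < t1 /\ t1 < T by rewrite /t1;split;lra.
have [C C0 HC] : exists2 C : R, 0 <= C & forall s r, 0 <= s <= t1 -> 0 <= r -> g s r <= C.
 by apply: bound_to => //;lra.
have [L HL] := rg_Xb Hg.
have mI : measurable (`[0, L]%classic : set R) by exact: measurable_itv.
have inT s : 0 <= s <= t1 -> 0 <= s < T by move=> /andP[-> h];exact: le_lt_trans t1T.
have tin : 0 <= t <= t1 by rewrite t0 ltW.
have gC s r : 0 <= s <= t1 -> 0 <= r -> `|g s r| <= C.
 by move=> hs r0;rewrite ger0_norm ?(rg_ge0 Hg)//;exact: HC.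
have [|||||h h0 Hh] := @dct_eps R `[0, L] (fun s => 0 <= s <= t1) g (g t) (fun=> C) t mI _ _ _ _ _ e e0.
- by move=> s hs;apply: measurable_funTS;apply: g_meas;exact: inT.
- by apply: measurable_funTS;exact: g_meas.
(* For [t = 0] pointwise convergence may fail at [X 0], a negligible point. *)
- have /negligibleP N : mu [set X 0] = 0%E by exact: lebesgue_measure_set1.
 apply: (@negligibleS _ _ _ mu _ _ _ (N _)) => //.
 move=> x Nx;apply: contrapT => /= /eqP xX;apply: Nx;rewrite /= in_itv /= => /andP[x0 _] e1 e10.
 have [d d0 Hd] := g_pt tT x0 xX e10;exists d => // s /andP[s0 _];exact: Hd.
- exact: i_cst.
- by move=> s x hs;rewrite /= in_itv /= => /andP[x0 _];exact: gC.
exists (Num.min h (t1 - t)) => [|s r /andP[s0 sT]];first by rewrite lt_min h0 subr_gt0.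
rewrite lt_min => /andP[sh st] r0.
have sin : 0 <= s <= t1.
 by rewrite s0 /=;move: st;have := ler_norm (s - t);move: (`|_|) => u;lra.
apply: le_trans (Hh s sin sh).
wlog rL : r r0 / r <= L.
 move=> H;have [/H|Lr] := leP r L;first exact.
 have L0 : 0 <= L by apply: le_trans (HL t tT);apply/ltW/(rg_X Hg).
 have EV u : 0 <= u <= t1 -> VV u r = VV u L.
 move=> /inT uT;have XL := HL u uT.
 by rewrite VV_M// ?(VV_M uT XL)// (le_trans XL)// ltW.
 by rewrite !EV//;exact: H.
have i1 u : 0 <= u <= t1 -> itg `[0, r] (g u) by move=> /inT uT;exact: g_i.
rewrite /VV -IB//;[|exact: i1..].
apply: le_trans (I_norm _ _) _ => //;first by apply: iB => //;exact: i1.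
rewrite [leRHS](I_split r0 rL).
 by rewrite lerDl;apply: I_ge0.
by apply: iabs => //;apply: iB => //;apply: g_i => //;exact: inT.
Qed.

(** The heat equation integrated over [[0, r]]. [time_lip] dominates the forward difference
    quotients up to the origin, and the flux there contributes the source [j]. *)
Lemma VV_E t r0 : 0 < t < T -> 0 < r0 < X t -> exists2 p : R, D2 (VV t) r0 p &
 forall e, 0 < e -> exists2 d : R, 0 < d & forall s r, t < s < t + d -> `|r - r0| < d ->
 `|VV s r - VV t r - (s - t) * (p / 2 + j)| <= e * (s - t).
Proof.
move=> /[dup] tT /andP[t0 tT'] /andP[r00 rX].
have tT0 : 0 <= t < T by rewrite ltW.
have [g1 [g2 [D1 Dt [C2 HC2] g2c rd0]]] := rg_C2 Hg tT.
have C20 : 0 <= C2 by apply: le_trans (HC2 r0 _);rewrite ?r00.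
exists (g1 r0).
 have mm : 0 < Num.min r0 (X t - r0) by rewrite lt_min r00 subr_gt0.
 apply: (@D2_derive _ _ (g t) _ _ _ mm);last by apply: (D1 r0 _).1;rewrite r00.
 move=> y;rewrite lt_min !ltr_norml => /andP[/andP[y1 y2] /andP[y3 y4]].
 apply: (@FTC_at _ _ 0 (X t));[exact: g_i|lra|lra|].
 by apply: der_continuous (D1 y _).1;apply/andP;split;lra.
move=> e e0;pose d0 : R := (r0 + X t) / 2.
have [r0d dX] : r0 < d0 /\ d0 < X t by rewrite /d0;split;lra.
clearbody d0.
have d00 : 0 < d0 by exact: lt_trans r0d.
have mI : measurable (`[0, d0]%classic : set R) by exact: measurable_itv.
have [|h1 h10 [C C0 HC]] := time_lip Hg tT (d := d0);first by rewrite d00.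
have pin y : 0 < y -> y <= d0 -> 0 < y < X t by move=> -> yd;exact: le_lt_trans dX.
pose Q s y : R := (g s y - g t y) / (s - t).
have g1lip x y : 0 < x -> x <= y -> y <= d0 -> `|g1 y - g1 x| <= C2 * (y - x).
 move=> x0 xy yd;have [|c /andP[c1 c2] ->] := @MVT_le R g1 g2 x y xy.
 by move=> z /andP[z1 z2];apply: (D1 z _).2;apply: pin;[exact: lt_le_trans z1|exact: le_trans yd].
 rewrite normrM (ger0_norm (_ : 0 <= y - x)) ?subr_ge0// ler_wpM2r ?subr_ge0//.
 by apply: HC2;apply: pin;[exact: lt_le_trans c1|exact: le_trans yd].
(* The one-sided derivative at [0] and the Lipschitz bound on [g1] together give the limit of [g1]
   itself at the origin. *)
have g1lim e1 : 0 < e1 -> exists2 d, 0 < d & forall r, 0 < r < d -> `|g1 r + 2 * j| <= e1.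
 move=> e10;have e20 : 0 < e1 / 2 by rewrite divr_gt0.
 have [d d'0 Hd] := rd0 _ e20.
 pose dd : R := Num.min (Num.min d d0) (e1 / 2 / (C2 + 1)).
 have C21 : 0 < C2 + 1 by rewrite ltr_wpDl.
 exists dd => [|r /andP[rp]];first by rewrite !lt_min d'0 d00 divr_gt0.
 rewrite !lt_min => /andP[/andP[rd rd0'] rC].
 have B1 : `|g t r - g t 0 - g1 r * r| <= C2 * r * r.
 apply/ler_addgt0Pr => e2 e2p.
 have [N HN] := rg_lip Hg tT.
 pose x : R := Num.min r (e2 / (N%:R + `|g1 r| + 1)).
 have K0 : 0 < N%:R + `|g1 r| + 1 by rewrite ltr_wpDl// addr_ge0.
 have xp : 0 < x by rewrite lt_min rp divr_gt0.
 have xr : x <= r by rewrite ge_min lexx.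
 have xe : x * (N%:R + `|g1 r|) <= e2.
 apply: (@le_trans _ _ (x * (N%:R + `|g1 r| + 1)));first by rewrite ler_pM2l// lerDl.
 by rewrite -ler_pdivlMr// ge_min lexx orbT.
 have [|c /andP[c1 c2] E] := @MVT_le R (g t) g1 x r xr.
 by move=> z /andP[z1 z2];apply: (D1 z _).1;apply: pin;[exact: lt_le_trans z1|exact: le_trans z2 (ltW _)].
 have -> : g t r - g t 0 - g1 r * r = (g1 c - g1 r) * (r - x) + ((g t x - g t 0) - g1 r * x).
 by rewrite mulrBl -E;ring.
 apply: le_trans (ler_normD _ _) _;apply: lerD.
 rewrite normrM (ger0_norm (_ : 0 <= r - x)) ?subr_ge0//.
 apply: ler_pM;rewrite ?subr_ge0//;last by rewrite lerBlDr lerDl ltW.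
 rewrite distrC;apply: le_trans (g1lip c r _ c2 (ltW rd0')) _;first exact: lt_le_trans c1.
 by rewrite ler_wpM2l// lerBlDr lerDl (le_trans (ltW xp)).
 apply: le_trans (ler_normB _ _) _;apply: le_trans xe;rewrite mulrDr normrM (gtr0_norm xp) (mulrC x `|_|) lerD2r.
 by have := HN x 0;rewrite subr0 (gtr0_norm xp) mulrC.
 have B2 := Hd r;rewrite rp rd in B2;have {}B2 := B2 isT.
 have B3 : `|(g1 r + 2 * j) * r| <= e1 * r.
 rewrite (_ : _ * r = (g t r - g t 0 - - (2 * j) * r) - (g t r - g t 0 - g1 r * r));last by ring.
 apply: le_trans (ler_normB _ _) _;have : C2 * r * r <= e1 / 2 * r.
 rewrite ler_pM2r//;move: rC;rewrite ltr_pdivlMr// => /ltW;apply: le_trans.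
 by rewrite mulrDr mulr1 mulrC lerDl ltW.
 by move: B1 B2;move: (`|_|) (`|_|) (C2 * r * r) => u1 u2 u3;lra.
 by move: B3;rewrite normrM (gtr0_norm rp) ler_pM2r.
(* The term [g2 0], an uncontrolled value, is included so that one bound holds on the closed
   interval. *)
pose M2 : R := Num.max C2 `|g2 0|.
have g2M y : 0 <= y -> y <= d0 -> `|g2 y| <= M2.
 move=> y0 yd;have [->|yn0] := eqVneq y 0;first by rewrite /M2 le_max lexx orbT.
 have y0' : 0 < y by rewrite lt_neqAle eq_sym yn0.
 by rewrite /M2 le_max HC2 ?pin.
have M20 : 0 <= M2 by apply: le_trans (g2M 0 (lexx _) (ltW d00)).
have g2m : measurable_fun `[0, d0]%classic g2.
 apply/measurable_fun_itv_obnd_cbndP.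
 have mO : measurable (`]0, X t[%classic : set R) by exact: measurable_itv.
 apply: (measurable_funS mO).
 by move=> y;rewrite /= !in_itv /= => /andP[y1 y2];exact: pin.
 apply: open_continuous_measurable_fun;first exact: interval_open.
 by move=> y;rewrite inE /= in_itv /=;exact: g2c.
have g2i : itg `[0, d0] g2.
 by apply: (@i_itv_bnd _ _ _ _ M2) => // y /andP[];exact: g2M.
have h2i := iZ 2^-1 mI g2i.
pose Phi r : R := \int[mu]_(y in `[0, r]) (2^-1 * g2 y).
have PhiE r : 0 < r -> r < d0 -> Phi r = 2^-1 * g1 r + j.
 move=> r0' rd.
 have Pd x : 0 < x < d0 -> is_derive x 1 (fun y => Phi y - 2^-1 * g1 y) 0.
 move=> /andP[x0 xd];have xin := pin x x0 (ltW xd).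
 have B1 : is_derive x 1 Phi (2^-1 * g2 x).
 by apply: (FTC_at h2i) => //;apply: cvgM;[exact: cvg_cst|exact: g2c].
 by apply: (derE (derB B1 (derZ 2^-1 (D1 x xin).2)));rewrite subrr.
 apply/eqP;rewrite -subr_eq0 opprD addrA -normr_le0;apply/ler_addgt0Pr => e1 e10;rewrite add0r.
 have [d d'0 Hd] := g1lim _ e10.
 have M21 : 0 < M2 + 1 by rewrite ltr_wpDl.
 pose m : R := Num.min (Num.min r d) (e1 / (M2 + 1)).
 have m0 : 0 < m by rewrite !lt_min r0' d'0 divr_gt0.
 have [x0 xm] : 0 < m / 2 /\ m / 2 < m by split;[rewrite divr_gt0|lra].
 move: (m / 2) x0 xm => x x0;rewrite !lt_min => /andP[/andP[xr xd] xe].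
 have := zero_der_cst Pd x0 (ltW xr) rd => <-.
 have P1 : `|Phi x| <= e1 / 2.
 have i2 := iS (lexx 0) (le_trans (ltW xr) (ltW rd)) h2i.
 apply: le_trans (I_norm _ i2) _ => //.
 apply: (@le_trans _ _ (M2 / 2 * (x - 0))).
 apply: I_diff_le;[exact: ltW|exact: iabs|move=> y /andP[y0 yx]].
 rewrite normrM gtr0_norm// mulrC ler_pM2r//;apply: g2M => //.
 by apply: le_trans yx _;rewrite ltW// (lt_trans xr).
 have : (M2 + 1) * x <= e1 by rewrite mulrC -ler_pdivlMr// ltW.
 by clear -x0 M20;rewrite subr0;lra.
 have P2 := Hd x;rewrite x0 xd in P2;have {}P2 := P2 isT.
 rewrite (_ : _ - _ - j = Phi x - 2^-1 * (g1 x + 2 * j));last by move: (Phi x) => u;field.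
 apply: le_trans (ler_normB _ _) _;rewrite normrM (gtr0_norm (_ : 0 < 2^-1 :> R))//;lra.
have e20 : 0 < e / 2 by rewrite divr_gt0.
pose t2 : R := t + Num.min h1 (T - t).
have m0 : 0 < Num.min h1 (T - t) by rewrite lt_min h10 subr_gt0.
have t2h : t2 <= t + h1 by rewrite lerD2l ge_min lexx.
have t2T : t2 <= T by rewrite -lerBrDl ge_min lexx orbT.
have tt2 : t < t2 by rewrite ltrDl.
clearbody t2.
have sT s : t < s < t2 -> 0 <= s < T by move=> /andP[k1 k2];rewrite (le_trans (ltW t0) (ltW k1)) (lt_le_trans k2).
have Qi s r : t < s < t2 -> itg `[0, r] (Q s).
 move=> hs;have mm : measurable (`[0, r]%classic : set R) by exact: measurable_itv.
 have := iZ (s - t)^-1 mm (iB mm (g_i r (sT s hs) (lexx 0)) (g_i r tT0 (lexx 0))).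
 by apply: eq_integrable => // y _;rewrite /= mulrC.
have [|||||h2 h20 Hh2] := @dct_eps R `[0, d0] (fun s => t < s < t2) Q (fun y => 2^-1 * g2 y) (fun=> C) t mI _ _ _ _ _ (e / 2) e20.
- by move=> s /(Qi s d0)/i_meas.
- exact: i_meas h2i.
- have /negligibleP N : mu [set (0 : R)] = 0%E by exact: lebesgue_measure_set1.
 apply: (@negligibleS _ _ _ mu _ _ _ (N _)) => //.
 move=> x Nx;apply: contrapT => /= /eqP x0;apply: Nx;rewrite /= in_itv /= => /andP[x0' xd] e1 e10.
 have xp : 0 < x by rewrite lt_neqAle eq_sym x0.
 have e21 : 0 < e1 / 2 by rewrite divr_gt0.
 have /is_derive_epsP := Dt x (pin x xp xd);move=> /(_ _ e21)[d d'0 Hd];exists d => // s /andP[ts _] st.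
 have st0 : 0 < s - t by rewrite subr_gt0.
 rewrite -(@ltr_pM2r _ (s - t))// -[X in _ * X < _](gtr0_norm st0) -normrM mulrBl /Q divfK ?gt_eqF//.
 apply: le_lt_trans (Hd s st) _;rewrite (gtr0_norm st0) ltr_pM2r//;lra.
- exact: i_cst.
- move=> s y /andP[k1 k2];rewrite /= in_itv /= => hy.
 have st0 : 0 < s - t by rewrite subr_gt0.
 rewrite /Q normrM normfV (gtr0_norm st0) ler_pdivrMr//;apply: HC => //.
 by rewrite (ltW k1) (lt_le_trans k2).
pose d1 : R := Num.min (Num.min r0 (d0 - r0)) (Num.min (e / (C2 + 1)) (Num.min h2 (t2 - t))).
exists d1.
 by rewrite !lt_min r00 !subr_gt0 r0d tt2 h20 divr_gt0 ?ltr_wpDl.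
move=> s r /andP[s1 s2];rewrite !lt_min => /andP[/andP[rr0 rd0']] /andP[rC _].
have : s - t < d1 by rewrite ltrBlDl.
rewrite !lt_min => /andP[_] /andP[_] /andP[sh2 st2].
have st0 : 0 < s - t by rewrite subr_gt0.
have s_in : t < s < t2 by rewrite s1;lra.
have [rp rd] : 0 < r /\ r < d0.
 by move: rr0 rd0';rewrite !ltr_norml => /andP[k1 _] /andP[_ k2];split;lra.
have -> : VV s r - VV t r = (s - t) * \int[mu]_(y in `[0, r]) Q s y.
 rewrite /VV -IB//;[|exact: g_i (sT s s_in) _|exact: g_i];rewrite -IZ//;last exact: Qi.
 by apply: eq_I => y _;rewrite /Q mulrC divfK ?gt_eqF.
have PE := PhiE r rp rd.
have B1 : `|\int[mu]_(y in `[0, r]) Q s y - Phi r| <= e / 2.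
 apply: le_trans (Hh2 s s_in _);last by rewrite gtr0_norm.
 have i2 := iS (lexx 0) (ltW rd) h2i.
 rewrite /Phi -IB//;last exact: Qi.
 apply: le_trans (I_norm _ _) _ => //;first by apply: iB => //;exact: Qi.
 rewrite [leRHS](I_split (ltW rp) (ltW rd));first by rewrite lerDl;apply: I_ge0.
 by apply: iabs => //;apply: iB => //;exact: Qi.
have B2 : `|g1 r - g1 r0| <= e.
 have G : `|g1 r - g1 r0| <= C2 * `|r - r0|.
 have [rr|rr] := leP r0 r.
 rewrite (ger0_norm (_ : 0 <= r - r0)) ?subr_ge0//;apply: g1lip => //;exact: ltW.
 rewrite distrC (distrC r) (gtr0_norm (_ : 0 < r0 - r)) ?subr_gt0//;apply: g1lip => //;exact: ltW.
 apply: le_trans G _;move: rC;rewrite ltr_pdivlMr ?ltr_wpDl// => /ltW;apply: le_trans.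
 by rewrite mulrC ler_wpM2l// lerDl.
rewrite -mulrBr normrM (gtr0_norm st0) mulrC ler_pM2r//.
rewrite (_ : _ - _ = (\int[mu]_(y in `[0, r]) Q s y - Phi r) + 2^-1 * (g1 r - g1 r0)).
 apply: le_trans (ler_normD _ _) _;rewrite normrM (gtr0_norm (_ : 0 < 2^-1 :> R))//;lra.
by rewrite PE;move: (\int[mu]_(_ in _) _) => u;field.
Qed.

Lemma rough_flow : flow j T X VV.
Proof.
split.
- have [L HL] := rg_Xb Hg;exists `|L| => // t tT;rewrite (rg_X Hg tT) /=.
 exact: le_trans (HL t tT) (ler_norm _).
- by move=> t _;exact: I_set1.
- move=> t r r' tT r0 rr;rewrite -subr_ge0 VV_sub//;apply: I_ge0 => y _;exact: rg_ge0 Hg _ _.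
- exact: VV_M.
- exact: VV_lip.
- exact: VV_cont.
- move=> t r tT r0;exists (g t r);split;[|exact: rg_ge0 Hg _ _|].
 have tT0 : 0 <= t < T by case/andP: tT => /ltW -> ->.
 apply: (@FTC_at R (g t) 0 (r + 1)) => //;[exact: g_i|by rewrite ltrDl|].
 apply/(cont_epsP (g t)) => e e0;have [N HN] := rg_lip Hg tT.
 have N0 : 0 < N%:R + 1 :> R by rewrite ltr_wpDl.
 exists (e / (N%:R + 1)) => [|v];first by rewrite divr_gt0.
 rewrite ltr_pdivlMr// mulrDr mulr1 mulrC;apply: le_lt_trans.
 by apply: le_trans (HN _ _) _;rewrite lerDl.
 by move=> Xr;apply: (rg_supp Hg tT);apply: le_trans Xr (ler_norm _).
- exact: VV_E.
Qed.
End FlowOf.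

Section Forward.
Context {R : realType}.
Implicit Types (s t r x y v u a b c d e h k : R) (E : R -> R -> R).

(** Continuity in space slice by slice and in time uniformly in space: the form in which [fl_lip]
    and [fl_cont] provide it and [fwd] uses it. *)
Definition tcont a b c d E := (forall t, a <= t <= b -> cont_on c d (E t)) /\
 forall t, a <= t <= b -> forall e, 0 < e -> exists2 h : R, 0 < h & forall s r, a <= s <= b ->
 c <= r <= d -> `|s - t| < h -> `|E s r - E t r| <= e.

Lemma tcontD a b c d E E' : tcont a b c d E -> tcont a b c d E' ->
 tcont a b c d (fun t r => E t r + E' t r).
Proof.
move=> [A1 A2] [B1 B2];split=> t ht.
 move=> r hr e e0;have e20 : 0 < e / 2 by rewrite divr_gt0.
 have [h1 h10 H1] := A1 t ht r hr _ e20;have [h2 h20 H2] := B1 t ht r hr _ e20.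
 exists (Num.min h1 h2) => [|y hy];first by rewrite lt_min h10.
 rewrite lt_min => /andP[/(H1 y hy) K1 /(H2 y hy) K2].
 rewrite (_ : _ - _ = (E t y - E t r) + (E' t y - E' t r));last by ring.
 by apply: le_lt_trans (ler_normD _ _) _;lra.
move=> e e0;have e20 : 0 < e / 2 by rewrite divr_gt0.
have [h1 h10 H1] := A2 t ht _ e20;have [h2 h20 H2] := B2 t ht _ e20.
exists (Num.min h1 h2) => [|s r hs hr];first by rewrite lt_min h10.
rewrite lt_min => /andP[/(H1 s r hs hr) K1 /(H2 s r hs hr) K2].
rewrite (_ : _ - _ = (E s r - E t r) + (E' s r - E' t r));last by ring.
by apply: le_trans (ler_normD _ _) _;lra.
Qed.

Lemma tcontN a b c d E : tcont a b c d E -> tcont a b c d (fun t r => - E t r).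
Proof.
move=> [A1 A2];split=> t ht.
 move=> r hr e e0;have [h h0 H] := A1 t ht r hr _ e0.
 by exists h => // y hy yr;rewrite -opprD normrN;exact: H.
move=> e e0;have [h h0 H] := A2 t ht _ e0.
by exists h => // s r hs hr st;rewrite -opprD normrN;exact: H.
Qed.

Lemma tcont_r a b c d (f : R -> R) : (forall x, exists l : R, is_derive x 1 f l) ->
 tcont a b c d (fun _ r => f r).
Proof.
move=> H;split=> t _.
 move=> r _ e e0;have [l Dl] := H r;have [h h0 Hh] := is_derive_cont Dl e0.
 by exists h => // y _;exact: Hh.
by move=> e e0;exists 1 => // s r _ _ _;rewrite subrr normr0 ltW.
Qed.

Lemma tcont_t a b c d k : tcont a b c d (fun t _ => k * t).
Proof.
split=> t _.
 by move=> r _ e e0;exists 1 => // y _ _;rewrite subrr normr0.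
move=> e e0;have k0 : 0 < `|k| + 1 by rewrite ltr_wpDl.
exists (e / (`|k| + 1)) => [|s r _ _];first by rewrite divr_gt0.
rewrite -mulrBr normrM ltr_pdivlMr// => /ltW;apply: le_trans.
by rewrite mulrC ler_wpM2l// lerDl.
Qed.

(* Maximum principle without spatial derivatives: a maximum at the critical level may not
 increase immediately. *)
Lemma fwd a b c d k E : c <= d -> tcont a b c d E -> (forall r, c <= r <= d -> E a r < k) ->
 (forall t, a < t < b -> (forall r, c <= r <= d -> E t r <= k) -> forall r0 : R, c <= r0 <= d ->
 E t r0 = k -> exists2 h : R, 0 < h & forall s r, t < s < t + h -> c <= r <= d -> `|r - r0| < h ->
 E s r <= k) ->
 forall t r, a <= t <= b -> c <= r <= d -> E t r <= k.
Proof.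
move=> cd [Ec Et] Ea step.
pose A := [set t | a <= t <= b /\ exists2 r, c <= r <= d & k < E t r].
suff A0 : ~ (A !=set0).
 move=> t r ht hr;rewrite leNgt;apply/negP => kE;apply: A0;exists t;split => //.
 by exists r.
move=> A0;have Ai : has_inf A by split => //;exists a => t [/andP[]].
pose t0 := inf A.
have lbA t : A t -> t0 <= t by move=> At;apply: ge_inf => //;case: Ai.
have at0 : a <= t0 by apply: lb_le_inf => // t [/andP[]].
have t0b : t0 <= b by case: A0 => t /[dup] /lbA h [/andP[_ tb] _];exact: le_trans tb.
have ht0 : a <= t0 <= b by rewrite at0.
have E0 r : c <= r <= d -> E t0 r <= k.
 move=> hr;rewrite leNgt;apply/negP => kE.
 have at0' : a < t0.
 by rewrite lt_neqAle at0 andbT;apply/eqP => e0;move: kE;rewrite -e0 ltNge ltW ?Ea.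
 have ek : 0 < (E t0 r - k) / 2 by rewrite divr_gt0// subr_gt0.
 have [h h0 Hh] := Et t0 ht0 _ ek.
 pose s : R := Num.max a (t0 - h / 2).
 have as_ : a <= s by rewrite le_max lexx.
 have st0 : s < t0 by rewrite gt_max at0' /=;lra.
 have sh : `|s - t0| < h.
 rewrite ltr0_norm ?subr_lt0// opprB ltrBlDl -ltrBlDr lt_max;apply/orP;right;lra.
 have sab : a <= s <= b by rewrite as_ (le_trans (ltW st0)).
 have := Hh s r sab hr sh;rewrite ler_norml => /andP[h1 _].
 have : t0 <= s by apply: lbA;split => //;exists r => //;lra.
 by rewrite leNgt st0.
have At0 : ~ A t0 by move=> [_ [r hr]];rewrite ltNge E0.
have t0A t : A t -> t0 < t.
 by move=> At;rewrite lt_neqAle lbA// andbT;apply/eqP => e0;apply: At0;rewrite e0.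
have t0b' : t0 < b by case: A0 => t /[dup] /t0A h [/andP[_ tb] _];exact: lt_le_trans tb.
have [|h h0 Hh] := @compact_unif R (fun r h => t0 + h <= b -> E (t0 + h) r <= k) c d.
 move=> r0 hr0;have := E0 r0 hr0;rewrite le_eqVlt => /orP[/eqP Ek|Ek].
 have at0' : a < t0.
 by rewrite lt_neqAle at0 andbT;apply/eqP => e0;have := Ea r0 hr0;rewrite e0 Ek ltxx.
 have [|h h0 Hh] := step t0 _ E0 r0 hr0 Ek;first by rewrite at0'.
 exists h => // y u hy yr /andP[u0 uh] _;apply: Hh => //.
 by rewrite ltrDl u0 ltrD2l.
 have ek : 0 < (k - E t0 r0) / 2 by rewrite divr_gt0// subr_gt0.
 have [h1 h10 H1] := Ec t0 ht0 r0 hr0 _ ek;have [h2 h20 H2] := Et t0 ht0 _ ek.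
 exists (Num.min h1 h2) => [|y u hy];first by rewrite lt_min h10.
 rewrite !lt_min => /andP[y1 _] /andP[u0 /andP[_ u2]] ub.
 have B1 := H1 y hy y1.
 have := H2 (t0 + u) y;rewrite (addrC t0) addrK (gtr0_norm u0) (addrC u) ub (le_trans at0) ?lerDl ?(ltW u0)//.
 move=> /(_ isT hy u2);rewrite ler_norml => /andP[_ B2].
 by move: B1;rewrite ltr_norml => /andP[_ B1];lra.
have [t At th] := inf_adherent h0 Ai;have [/andP[_ tb] [r hr kE]] := At.
have := Hh r (t - t0) hr;rewrite subr_gt0 t0A//= (addrC t0) subrK ltrBlDl => /(_ th tb).
by rewrite leNgt kE.
Qed.

End Forward.

Section Compare.
Context {R : realType}.
Implicit Types (s t r x y v u a b c d e h k j T : R) (X : R -> R) (V : R -> R -> R).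

Lemma tcont_flow j T X V a b c d : flow j T X V -> 0 <= a -> b < T -> 0 <= c -> tcont a b c d V.
Proof.
move=> F a0 bT c0;have inT t : a <= t <= b -> 0 <= t < T.
 by move=> /andP[h1 h2];rewrite (le_trans a0)//= (le_lt_trans h2).
split=> t /inT ht.
 move=> r /andP[cr _] e e0;have [B B0 HB] := fl_lip F ht.
 have B1 : 0 < B + 1 by rewrite ltr_wpDl.
 exists (e / (B + 1)) => [|y /andP[cy _]];first by rewrite divr_gt0.
 rewrite ltr_pdivlMr// => h;apply: le_lt_trans (HB _ _ _ _) _;[exact: le_trans cy|exact: le_trans cr|].
 by apply: le_lt_trans h;rewrite mulrC ler_wpM2l// lerDl.
move=> e e0;have [h h0 Hh] := fl_cont F ht e0.
by exists h => // s r /inT hs /andP[cr _] st;apply: Hh => //;exact: le_trans cr.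
Qed.

Lemma flow_leM j T X V t r : flow j T X V -> 0 <= t < T -> 0 <= r -> V t r <= V t (X t).
Proof.
move=> F tT r0;have [rX|Xr] := leP r (X t);first exact: (fl_mono F).
by rewrite (fl_M F tT (ltW Xr)).
Qed.

Lemma flow_ge0 j T X V t r : flow j T X V -> 0 <= t < T -> 0 <= r -> 0 <= V t r.
Proof. by move=> F tT r0;rewrite -(fl_0 F tT);exact: (fl_mono F). Qed.

Lemma local_max_left (f : R -> R) x c (p : R) : c < x -> is_derive x 1 f p -> (forall y, c <= y <= x -> f y <= f x) -> 0 <= p.
Proof.
move=> cx D H;rewrite leNgt;apply/negP => p0;have [d d0 Hd] := der_lt_left D p0.
have yx : Num.max c (x - d / 2) < x by rewrite gt_max cx /=;lra.
have := H (Num.max c (x - d / 2));rewrite le_max lexx (ltW yx) => /(_ isT).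
by rewrite leNgt Hd// yx andbT lt_max;apply/orP;right;lra.
Qed.

Lemma D2_max_in (f : R -> R) x c d (b : R) : c < x < d -> D2 f x b -> (forall y, c <= y <= d -> f y <= f x) -> b <= 0.
Proof.
move=> /andP[cx xd] D H;have m0 : 0 < Num.min (x - c) (d - x) by rewrite lt_min !subr_gt0 cx.
apply: D2_max m0 _ D => y;rewrite lt_min !ltr_norml => /andP[/andP[y1 y2] /andP[y3 y4]].
by apply: H;apply/andP;split;lra.
Qed.

Lemma D2_quad (al be ga x : R) : D2 (fun y => al * y ^+ 2 + be * y + ga) x (2 * al).
Proof.
move=> e e0;exists 1 => // h /andP[h0 _].
rewrite (_ : _ - _ = 0);first by rewrite normr0 mulr_ge0 ?sqr_ge0// ltW.
by clear;ring.
Qed.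

Lemma D2_lin k x : D2 (fun y : R => k * y) x 0.
Proof.
move=> e e0;exists 1 => // h /andP[h0 _].
rewrite (_ : _ - _ = 0);first by rewrite normr0 mulr_ge0 ?sqr_ge0// ltW.
by clear;ring.
Qed.

(** Let [r0] be a maximum point of the penalized difference [E] at the critical level. Beyond [X2]
    the value of [V2] is its full mass, and the hypothesis on the masses excludes the level. Between
    [X1] and [X2] the slope of [V1] is [0] and that of [V2] nonnegative, so the term in [- eta * r]
    excludes a maximum. Below both edges the two equations hold, with sources differing by
    [j1 - j2]. The edges are never compared with each other. *)
Lemma flow_le j1 j2 T X1 X2 V1 V2 c : flow j1 T X1 V1 -> flow j2 T X2 V2 -> 0 <= c ->
 (forall r, 0 <= r -> V1 0 r - V2 0 r <= c) ->
 (forall t, 0 <= t < T -> V1 t (X1 t) - V2 t (X2 t) <= c) ->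
 forall t r, 0 <= t < T -> 0 <= r -> V1 t r - V2 t r <= c + `|j1 - j2| * t.
Proof.
move=> F1 F2 c0 H0 HM t1 r1 /andP[t10 t1T] r10.
apply/ler_addgt0Pr => e e0.
have [L1 L10 HL1] := fl_X F1;have [L2 L20 HL2] := fl_X F2.
have K0 : 0 < 1 + t1 + r1 by rewrite -addrA ltr_wpDr ?addr_ge0.
pose eta : R := e / (1 + t1 + r1).
have eta0 : 0 < eta by rewrite divr_gt0.
have ee : e = eta * (1 + t1 + r1) by rewrite /eta divfK// gt_eqF.
clearbody eta.
pose J : R := `|j1 - j2|;have J0 : 0 <= J by rewrite normr_ge0.
pose E t r : R := (V1 t r - V2 t r) + (- (J + eta)) * t + - eta * r.
(* Large enough to contain [r1] and for a maximum at [Lm] to lie beyond [X2]. *)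
pose Lm : R := L2 + r1 + 1.
have Lm0 : 0 <= Lm by rewrite /Lm;lra.
have inT t : 0 <= t <= t1 -> 0 <= t < T by move=> /andP[-> h];exact: le_lt_trans t1T.
have tE : tcont 0 t1 0 Lm E.
 apply: tcontD;last first.
 by apply: (@tcont_r R 0 t1 0 Lm (fun r => - eta * r)) => x;eexists;exact: derZ (derI x).
 apply: tcontD;last exact: tcont_t.
 by apply: tcontD;[exact: tcont_flow F1 _ _ _|apply: tcontN;exact: tcont_flow F2 _ _ _].
have := @fwd R 0 t1 0 Lm (c + eta) E Lm0 tE.
move=> /(_ _ _ t1 r1);rewrite t10 lexx r10 (_ : r1 <= Lm);last by rewrite /Lm;lra.
move=> H;have {}H : E t1 r1 <= c + eta.
 apply: H => //.
 move=> r /andP[r0 _];have := H0 r r0;have : 0 <= eta * r by rewrite mulr_ge0// ltW.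
 by rewrite /E mulr0 mulNr;lra.
 move=> t /andP[t0 tt1] Ek r0 /andP[r00 r0L] Er0.
 have tT : 0 <= t < T by apply: inT;rewrite !ltW.
 have tT' : 0 < t < T by rewrite t0;case/andP: tT.
 have Jt : 0 < (J + eta) * t by rewrite mulr_gt0// ltr_wpDl.
 have r0p : 0 < r0.
 rewrite lt_neqAle r00 andbT;apply/eqP => e1;move: Er0.
 by rewrite -e1 /E (fl_0 F1 tT) (fl_0 F2 tT) subrr mulr0 mulNr;lra.
 have er0 : 0 <= eta * r0 by rewrite mulr_ge0// ltW.
 have [X2r|rX2] := leP (X2 t) r0.
 have := HM t tT;have := flow_leM F1 tT r00;move: Er0.
 by rewrite /E (fl_M F2 tT X2r) !mulNr;lra.
 have r0L' : r0 < Lm.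
 by case/andP: (HL2 t tT) => _ h;rewrite /Lm;lra.
 have Emax y : 0 <= y <= Lm -> E t y <= E t r0 by rewrite Er0;exact: Ek.
 have rX1 : r0 < X1 t.
 rewrite ltNge;apply/negP => X1r.
 have [p1 [D1 p10 /(_ X1r) p1E]] := fl_der F1 tT' r0p.
 have [p2 [D2' p20 _]] := fl_der F2 tT' r0p.
 have DE : is_derive r0 1 (E t) (p1 - p2 + 0 + - eta * 1) :=
 derD (derD (derB D1 D2') (derC (- (J + eta) * t) r0)) (derZ (- eta) (derI r0)).
 have : 0 <= p1 - p2 + 0 + - eta * 1.
 apply: (local_max_left r0p DE) => y /andP[y0 yr];apply: Emax.
 by rewrite y0 (le_trans yr).
 by rewrite p1E;lra.
 have [|p1 P1 HE1] := fl_E F1 (r0 := r0) tT';first by rewrite r0p.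
 have [|p2 P2 HE2] := fl_E F2 (r0 := r0) tT';first by rewrite r0p.
 have pp : p1 + -1 * p2 <= 0.
 have D2l : D2 (fun y => - eta * y) r0 0. exact: D2_lin.
 have DE : D2 (E t) r0 (p1 + -1 * p2 + 0 + 0).
 apply: (@D2_ext R _ _ _ _ 1 _ _ (D2D (D2D (D2D P1 (D2Z (-1) P2)) (D2C (- (J + eta) * t) r0)) D2l)) => //.
 by move=> y _;rewrite /E mulN1r.
 have := @D2_max_in _ r0 0 Lm _ _ DE Emax;rewrite r0p r0L' => /(_ isT);lra.
 have e40 : 0 < eta / 2 by rewrite divr_gt0.
 have [h1 h10 K1] := HE1 _ e40;have [h2 h20 K2] := HE2 _ e40.
 exists (Num.min h1 h2) => [|s r /andP[ts sh] hr];first by rewrite lt_min h10.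
 have [sh1 sh2] : s < t + h1 /\ s < t + h2.
 by split;apply: lt_le_trans sh _;rewrite lerD2l ge_min lexx ?orbT.
 rewrite lt_min => /andP[rh1 rh2].
 have {K1} := K1 s r;rewrite ts sh1 => /(_ isT rh1);rewrite ler_norml => /andP[_ K1].
 have {K2} := K2 s r;rewrite ts sh2 => /(_ isT rh2);rewrite ler_norml => /andP[K2 _].
 have := Ek r hr;rewrite /E.
 have st : 0 < s - t by rewrite subr_gt0.
 have A1 : (s - t) * (p1 - p2) <= 0 by rewrite pmulr_rle0//;move: pp;clear;lra.
 have A2 : (s - t) * (j1 - j2) <= (s - t) * J by rewrite ler_pM2l// ler_norm.
 move: K1 K2 A1 A2;move: (V1 s r) (V2 s r) (V1 t r) (V2 t r) => v1 v2 v3 v4.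
 clear;nra.
by move: H;rewrite /E ee -/J;move: (V1 _ _) (V2 _ _) => v1 v2 H;clear -H;lra.
Qed.
End Compare.

Section Barriers.
Context {R : realType}.
Implicit Types (s t r x y v u a b c d e h k j T : R) (X : R -> R) (V : R -> R -> R).

Lemma tcont_psi a b c d (al be ga A : R) : tcont a b c d (fun t r => (al * r ^+ 2 + be * r + ga) + A * t).
Proof.
apply: (@tcontD R a b c d (fun _ r => al * r ^+ 2 + be * r + ga));last exact: tcont_t.
apply: (@tcont_r R a b c d (fun r => al * r ^+ 2 + be * r + ga)) => x.
by eexists;exact: derD (derD (derZ al (derX 2 (derI x))) (derZ be (derI x))) (derC ga x).
Qed.

(** The condition [A < al + j] makes the polynomial a strict subsolution where the equation holds;
    contact beyond [X t] is excluded by the assumed comparison with the mass. *)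
Lemma flow_ge_quad j T X V a b c d k (al be ga A : R) : flow j T X V -> 0 <= a -> b < T -> 0 <= c -> c < d ->
 A < al + j ->
 (forall r, c <= r <= d -> al * r ^+ 2 + be * r + ga + A * a - V a r < k) ->
 (forall t, a <= t <= b -> al * c ^+ 2 + be * c + ga + A * t - V t c < k) ->
 (forall t, a <= t <= b -> al * d ^+ 2 + be * d + ga + A * t - V t d < k) ->
 (forall t r, a <= t <= b -> c <= r <= d -> al * r ^+ 2 + be * r + ga + A * t - V t (X t) < k) ->
 forall t r, a <= t <= b -> c <= r <= d -> al * r ^+ 2 + be * r + ga + A * t - V t r <= k.
Proof.
move=> F a0 bT c0 cd Aal Ha Hc Hd HM.
pose E t r : R := (al * r ^+ 2 + be * r + ga + A * t) + - V t r.
apply: (@fwd R a b c d k E (ltW cd)) => //.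
 by apply: tcontD;[exact: tcont_psi|apply: tcontN;exact: tcont_flow F _ _ _].
move=> t /andP[at_ tb] Ek r0 /[dup] hr0 /andP[cr rd] Er0.
have ht : a <= t <= b by rewrite !ltW.
have tT : 0 < t < T by rewrite (le_lt_trans a0)//= (lt_trans tb).
have tT0 : 0 <= t < T by case/andP: tT => /ltW -> ->.
have cr' : c < r0.
 rewrite lt_neqAle cr andbT;apply/eqP => e;have := Hc t ht.
 by rewrite e -Er0 /E ltxx.
have rd' : r0 < d.
 rewrite lt_neqAle rd andbT;apply/eqP => e;have := Hd t ht.
 by rewrite -e -Er0 /E ltxx.
have rX : r0 < X t.
 rewrite ltNge;apply/negP => Xr;have := HM t r0 ht hr0.
 by rewrite -(fl_M F tT0 Xr) -Er0 /E ltxx.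
have [|p P HE] := fl_E F (r0 := r0) tT;first by rewrite rX andbT (le_lt_trans c0).
have pp : 2 * al + 0 + -1 * p <= 0.
 have DE : D2 (E t) r0 (2 * al + 0 + -1 * p).
 apply: (@D2_ext R _ _ _ _ 1 _ _ (D2D (D2D (D2_quad al be ga r0) (D2C (A * t) r0)) (D2Z (-1) P))) => //.
 by move=> y _;rewrite /E mulN1r.
 by apply: (@D2_max_in R (E t) r0 c d _ _ DE);[rewrite cr'|move=> y hy;rewrite Er0;exact: Ek].
have e0 : 0 < al + j - A by rewrite subr_gt0.
have [h h0 K] := HE _ e0;exists h => // s r /andP[ts sh] hr rh.
have := K s r;rewrite ts sh => /(_ isT rh);rewrite ler_norml => /andP[K1 _].
have := Ek r hr;rewrite /E.
have st : 0 < s - t by rewrite subr_gt0.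
have A1 : (s - t) * (2 * al - p) <= 0 by rewrite pmulr_rle0//;move: pp;clear;lra.
by move: K1 A1;move: (V s r) (V t r) => v1 v2;clear;nra.
Qed.

(** Here concavity replaces a condition on the mass. At a contact beyond [X t] the function [V] is
    flat, so the polynomial is nonincreasing there and, by strict concavity, the difference would be
    larger still at [d]. *)
Lemma flow_le_quad j T X V a b c d k (al be ga A : R) : flow j T X V -> 0 <= a -> b < T -> 0 <= c -> c < d ->
 al < 0 -> al + j < A ->
 (forall r, c <= r <= d -> V a r - (al * r ^+ 2 + be * r + ga + A * a) < k) ->
 (forall t, a <= t <= b -> V t c - (al * c ^+ 2 + be * c + ga + A * t) < k) ->
 (forall t, a <= t <= b -> V t d - (al * d ^+ 2 + be * d + ga + A * t) < k) ->
 forall t r, a <= t <= b -> c <= r <= d -> V t r - (al * r ^+ 2 + be * r + ga + A * t) <= k.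
Proof.
move=> F a0 bT c0 cd al0 Aal Ha Hc Hd.
pose E t r : R := V t r + - (al * r ^+ 2 + be * r + ga + A * t).
apply: (@fwd R a b c d k E (ltW cd)) => //.
 by apply: tcontD;[exact: tcont_flow F _ _ _|apply: tcontN;exact: tcont_psi].
move=> t /andP[at_ tb] Ek r0 /[dup] hr0 /andP[cr rd] Er0.
have ht : a <= t <= b by rewrite !ltW.
have tT : 0 < t < T by rewrite (le_lt_trans a0)//= (lt_trans tb).
have tT0 : 0 <= t < T by case/andP: tT => /ltW -> ->.
have cr' : c < r0.
 rewrite lt_neqAle cr andbT;apply/eqP => e;have := Hc t ht.
 by rewrite e -Er0 /E ltxx.
have rd' : r0 < d.
 rewrite lt_neqAle rd andbT;apply/eqP => e;have := Hd t ht.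
 by rewrite -e -Er0 /E ltxx.
have rX : r0 < X t.
 rewrite ltNge;apply/negP => Xr.
 have [p [Dp _ /(_ Xr) p0]] := fl_der F tT (le_lt_trans c0 cr').
 have DE : is_derive r0 1 (E t) (p + - (al * (2 * r0) + be * 1 + 0 + 0)).
 have := derD Dp (derN (derD (derD (derD (derZ al (derX 2 (derI r0))) (derZ be (derI r0))) (derC ga r0)) (derC (A * t) r0))).
 by move=> H;apply: (derE H);rewrite /= expr1 mulr1.
 have L : 0 <= p + - (al * (2 * r0) + be * 1 + 0 + 0).
 by apply: (local_max_left cr' DE) => y /andP[y1 y2];rewrite Er0;apply: Ek;rewrite y1 (le_trans y2).
 have := Ek d;rewrite lexx (ltW cd) -Er0 /E (fl_M F tT0 Xr) (fl_M F tT0 (le_trans Xr (ltW rd'))) => /(_ isT).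
 have dr : 0 < d - r0 by rewrite subr_gt0.
 have Q : 0 < - al * (d - r0) by rewrite mulr_gt0// oppr_gt0.
 have Q2 : 0 < (- al * (d - r0)) * (d - r0) by rewrite mulr_gt0.
 have Q3 : 0 <= (p + - (al * (2 * r0) + be * 1 + 0 + 0)) * (d - r0) by rewrite mulr_ge0// ltW.
 by move: Q2 Q3;rewrite p0;move: (V _ _) => v;clear;nra.
have [|p P HE] := fl_E F (r0 := r0) tT;first by rewrite rX andbT (le_lt_trans c0).
have pp : p + -1 * (2 * al + 0) <= 0.
 have DE : D2 (E t) r0 (p + -1 * (2 * al + 0)).
 apply: (@D2_ext R _ _ _ _ 1 _ _ (D2D P (D2Z (-1) (D2D (D2_quad al be ga r0) (D2C (A * t) r0))))) => //.
 by move=> y _;rewrite /E mulN1r.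
 by apply: (@D2_max_in R (E t) r0 c d _ _ DE);[rewrite cr'|move=> y hy;rewrite Er0;exact: Ek].
have e0 : 0 < A - (al + j) by rewrite subr_gt0.
have [h h0 K] := HE _ e0;exists h => // s r /andP[ts sh] hr rh.
have := K s r;rewrite ts sh => /(_ isT rh);rewrite ler_norml => /andP[_ K1].
have := Ek r hr;rewrite /E.
have st : 0 < s - t by rewrite subr_gt0.
have A1 : (s - t) * (p - 2 * al) <= 0 by rewrite pmulr_rle0//;move: pp;clear;lra.
by move: K1 A1;move: (V s r) (V t r) => v1 v2;clear;nra.
Qed.

Lemma flow_restrict j T (T' : R) X V : T' <= T -> flow j T X V -> flow j T' X V.
Proof.
move=> TT [[L L0 a1] a2 a3 a4 a5 a6 a7 a8].
have w t : 0 <= t < T' -> 0 <= t < T by move=> /andP[-> h];exact: lt_le_trans TT.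
have w' t : 0 < t < T' -> 0 < t < T by move=> /andP[-> h];exact: lt_le_trans TT.
split.
- by exists L => // t /w;exact: a1.
- by move=> t /w;exact: a2.
- by move=> t r r' /w;exact: a3.
- by move=> t r /w;exact: a4.
- by move=> t /w;exact: a5.
- move=> t /w ht e e0;have [d d0 Hd] := a6 t ht e e0;exists d => // s r /w;exact: Hd.
- by move=> t r /w';exact: a7.
- by move=> t r0 /w';exact: a8.
Qed.

(** Parabolic scaling of the variables only: the values, hence the mass, stay the same and the
    source becomes [m ^+ 2 * j]. *)
Lemma flow_scale j T X V m : 0 < m -> flow j T X V ->
 flow (m ^+ 2 * j) (T / m ^+ 2) (fun t => X (m ^+ 2 * t) / m) (fun t r => V (m ^+ 2 * t) (m * r)).
Proof.
move=> m0 [[L L0 a1] a2 a3 a4 a5 a6 a7 a8].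
have mn : m != 0 by rewrite gt_eqF.
have m2 : 0 < m ^+ 2 by rewrite exprn_gt0.
have w t : 0 <= t < T / m ^+ 2 -> 0 <= m ^+ 2 * t < T.
 by move=> /andP[t0];rewrite ltr_pdivlMr// mulrC => ->;rewrite mulr_ge0// ltW.
have w' t : 0 < t < T / m ^+ 2 -> 0 < m ^+ 2 * t < T.
 by move=> /andP[t0];rewrite ltr_pdivlMr// mulrC => ->;rewrite mulr_gt0.
have mr r : 0 <= r -> 0 <= m * r by move=> r0;rewrite mulr_ge0// ltW.
have Xm t : m * (X t / m) = X t by rewrite mulrC divfK.
have normm x y : `|m * x - m * y| = m * `|x - y| by rewrite -mulrBr normrM gtr0_norm.
have normm2 x y : `|m ^+ 2 * x - m ^+ 2 * y| = m ^+ 2 * `|x - y| by rewrite -mulrBr normrM gtr0_norm.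
split.
- exists (L / m);first by rewrite divr_ge0// ltW.
 by move=> t /w/a1 /andP[X0 XL];rewrite divr_gt0//= ler_pM2r ?invr_gt0.
- by move=> t /w ht;rewrite mulr0 a2.
- by move=> t r r' /w ht r0 rr;apply: a3 => //;[exact: mr|rewrite ler_pM2l].
- by move=> t r /w ht;rewrite ler_pdivrMr// (mulrC r) => Xr;rewrite Xm;exact: a4.
- move=> t /w/a5[B B0 HB];exists (B * m);first by rewrite mulr_ge0// ltW.
 by move=> r r' r0 r0';apply: le_trans (HB _ _ (mr _ r0) (mr _ r0')) _;rewrite normm mulrA.
- move=> t /w ht e e0;have [d d0 Hd] := a6 _ ht e e0.
 exists (d / m ^+ 2);first by rewrite divr_gt0.
 move=> s r /w hs st r0;apply: Hd => //;last exact: mr.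
 by rewrite normm2 mulrC -ltr_pdivlMr.
- move=> t r /w' ht r0;have [|p [Dp p0 Xp]] := a7 _ (m * r) ht;first by rewrite mulr_gt0.
 exists (p * m);split;[|by rewrite mulr_ge0// ltW|by rewrite ler_pdivrMr// (mulrC r) => /Xp ->;rewrite mul0r].
 have := @der_comp R (V (m ^+ 2 * t)) (fun y => m * y) r _ _ Dp (derZ m (derI r)).
 by move=> H;apply: (derE H);rewrite mulr1.
- move=> t r0 /w' ht /andP[r00];rewrite ltr_pdivlMr// (mulrC r0) => rX.
 have [|p P HE] := a8 _ (m * r0) ht;first by rewrite rX mulr_gt0.
 exists (m ^+ 2 * p).
 move=> e e0;have em : 0 < e / m ^+ 2 by rewrite divr_gt0.
 have [d d0 Hd] := P _ em;exists (d / m);first by rewrite divr_gt0.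
 move=> h /andP[h0];rewrite ltr_pdivlMr// (mulrC h) => hd.
 have := Hd (m * h);rewrite hd mulr_gt0// => /(_ isT).
 rewrite mulrDr mulrBr (_ : e / m ^+ 2 * (m * h) ^+ 2 = e * h ^+ 2);last by field.
 by rewrite (_ : p * (m * h) ^+ 2 = m ^+ 2 * p * h ^+ 2)//;ring.
 move=> e e0;have em : 0 < e / m ^+ 2 by rewrite divr_gt0.
 have [d d0 Hd] := HE _ em;exists (Num.min (d / m ^+ 2) (d / m));first by rewrite lt_min !divr_gt0.
 move=> s r /andP[ts sd];rewrite lt_min => /andP[_ rd].
 have sd' : s - t < d / m ^+ 2.
 by rewrite ltrBlDl;apply: lt_le_trans sd _;rewrite lerD2l ge_min lexx.
 have := Hd (m ^+ 2 * s) (m * r).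
 rewrite normm ltr_pM2l// ts /= -ltrBlDl -mulrBr (mulrC (m ^+ 2) (s - t)) -ltr_pdivlMr// sd' => /(_ isT).
 rewrite (mulrC m) -ltr_pdivlMr// => /(_ rd).
 rewrite (_ : e / m ^+ 2 * ((s - t) * m ^+ 2) = e * (s - t));last by field.
 by rewrite (_ : (s - t) * m ^+ 2 * (p / 2 + j) = (s - t) * (m ^+ 2 * p / 2 + m ^+ 2 * j))//;field.
Qed.
End Barriers.

(** * Regularity of the limit *)

Section Limit.
Context {R : realType}.
Implicit Types (s t r x y v u a b c d e h k m : R).
Variables (j T M0 B R0 : R) (X : nat -> R -> R) (W : nat -> R -> R -> R) (V : R -> R -> R).
Hypotheses (j0 : 0 < j) (B0 : 0 <= B) (R00 : 0 <= R0) (T0 : 0 < T).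
Hypothesis HF : forall n, flow j T (X n) (W n).
Hypothesis HV : forall e, 0 < e -> exists N : nat, forall n t r, (N <= n)%N -> 0 <= t < T -> 0 <= r ->
 `|W n t r - V t r| <= e.
Hypothesis HM : forall e, 0 < e -> exists N : nat, forall n t, (N <= n)%N -> 0 <= t < T ->
 `|W n t (X n t) - M0| <= e.
Hypothesis V0_lip : forall r (r' : R), 0 <= r -> r <= r' -> V 0 r' - V 0 r <= B * (r' - r).
Hypothesis V0_M : forall r, R0 <= r -> V 0 r = M0.

Lemma both e : 0 < e -> exists n : nat, (forall t r, 0 <= t < T -> 0 <= r -> `|W n t r - V t r| <= e) /\
 (forall t, 0 <= t < T -> `|W n t (X n t) - M0| <= e).
Proof.
move=> e0;have [N1 H1] := HV e0;have [N2 H2] := HM e0;exists (maxn N1 N2);split.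
 by move=> t r;apply: H1;rewrite leq_maxl.
by move=> t;apply: H2;rewrite leq_maxr.
Qed.

Lemma V_at0 t : 0 <= t < T -> V t 0 = 0.
Proof.
move=> tT;apply/eqP;rewrite -normr_le0;apply/ler_addgt0Pr => e e0.
have [n [Hn _]] := both e0;have := Hn t 0 tT (lexx _).
by rewrite (fl_0 (HF n) tT) sub0r normrN add0r.
Qed.

Lemma V_mono t r (r' : R) : 0 <= t < T -> 0 <= r -> r <= r' -> V t r <= V t r'.
Proof.
move=> tT r0 rr;apply/ler_addgt0Pr => e e0;have e20 : 0 < e / 2 by rewrite divr_gt0.
have [n [Hn _]] := both e20;have := Hn t r tT r0;have := Hn t r' tT (le_trans r0 rr).
rewrite !ler_norml => /andP[h1 h2] /andP[h3 h4];have := fl_mono (HF n) tT r0 rr;lra.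
Qed.

Lemma V_ge0 t r : 0 <= t < T -> 0 <= r -> 0 <= V t r.
Proof. by move=> tT r0;rewrite -(V_at0 tT);apply: V_mono. Qed.

Lemma V_leM t r : 0 <= t < T -> 0 <= r -> V t r <= M0.
Proof.
move=> tT r0;apply/ler_addgt0Pr => e e0;have e20 : 0 < e / 2 by rewrite divr_gt0.
have [n [Hn Hm]] := both e20;have := Hn t r tT r0;have := Hm t tT.
by rewrite !ler_norml => /andP[h1 h2] /andP[h3 h4];have := flow_leM (HF n) tT r0;lra.
Qed.

Lemma M0_ge0 : 0 <= M0.
Proof. by rewrite -(V0_M (lexx R0));apply: V_ge0;rewrite ?lexx. Qed.

(** [B * R0] measures the change of the initial primitive under dilation, and [3 * j * T] that of
    the source, since [m ^+ 2 - 1 <= 3 * (m - 1)] for [1 <= m <= 2]. *)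
Definition Cs := B * R0 + 3 * j * T.

Lemma Cs_ge0 : 0 <= Cs.
Proof. by rewrite addr_ge0 ?mulr_ge0// ltW. Qed.

(** Each approximation is compared with its own parabolic dilation, which has the same masses. The
    result is a Lipschitz estimate along parabolic orbits, the source of all regularity of the
    limit. *)
Lemma V_scale m t r : 1 <= m -> m <= 2 -> 0 <= t -> m ^+ 2 * t < T -> 0 <= r ->
 `|V (m ^+ 2 * t) (m * r) - V t r| <= Cs * (m - 1).
Proof.
move=> m1 m2 t0 mt r0.
have mp : 0 < m by lra.
have m2p : 0 < m ^+ 2 by rewrite exprn_gt0.
have m21 : 1 <= m ^+ 2 by rewrite exprn_ege1.
have tT' : 0 <= t < T / m ^+ 2 by rewrite t0 ltr_pdivlMr// mulrC.
have TT : T / m ^+ 2 <= T by rewrite ler_pdivrMr// ler_peMr// ltW.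
have inT u : 0 <= u < T / m ^+ 2 -> 0 <= u < T by move=> /andP[-> h];exact: lt_le_trans TT.
have inT2 u : 0 <= u < T / m ^+ 2 -> 0 <= m ^+ 2 * u < T.
 by move=> /andP[u0];rewrite ltr_pdivlMr// mulrC => ->;rewrite mulr_ge0// ltW.
have tT := inT t tT';have tT2 := inT2 t tT'.
have mr u : 0 <= u -> 0 <= m * u by move=> u0;rewrite mulr_ge0// ltW.
apply/ler_addgt0Pr => e e0;have e40 : 0 < e / 4 by rewrite divr_gt0.
have [n [Hn Hm]] := both e40.
have Fn := HF n;have F1 := flow_restrict TT Fn;have F2 := flow_scale mp Fn.
have z0 : 0 <= (0 : R) < T by rewrite lexx.
have jj : `|m ^+ 2 * j - j| <= 3 * j * (m - 1).
 rewrite ger0_norm;last by rewrite subr_ge0 ler_peMl// ltW.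
 rewrite (_ : m ^+ 2 * j - j = (m + 1) * (m - 1) * j);last by ring.
 rewrite -!mulrA [leRHS]mulrCA [leLHS]mulrA [leLHS]mulrC ler_pM2l// ler_wpM2r ?subr_ge0//;lra.
have jt : `|m ^+ 2 * j - j| * t <= 3 * j * T * (m - 1).
 rewrite (_ : 3 * j * T * (m - 1) = 3 * j * (m - 1) * T);last by ring.
 by apply: ler_pM => //;case/andP: tT => _ /ltW.
have I1 u : 0 <= u -> V 0 u <= V 0 (m * u).
 by move=> u0;apply: V_mono => //;rewrite ler_peMl.
have I2 u : 0 <= u -> V 0 (m * u) - V 0 u <= B * R0 * (m - 1).
 move=> u0;have [uR|uR] := leP R0 u.
 rewrite !V0_M//;first by rewrite subrr !mulr_ge0// subr_ge0.
 by apply: le_trans uR _;rewrite ler_peMl.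
 apply: le_trans (V0_lip u0 _) _;first by rewrite ler_peMl.
 rewrite -mulrA ler_wpM2l// -[X in _ - X]mul1r -mulrBl mulrC ler_wpM2r ?subr_ge0//;exact: ltW.
have cpos : 0 <= e / 2 + B * R0 * (m - 1) by rewrite addr_ge0 ?mulr_ge0 ?subr_ge0// ?divr_ge0// ltW.
have e2pos : 0 <= e / 2 by rewrite divr_ge0// ltW.
have A1 := @flow_le R _ _ _ _ _ _ _ _ F2 F1 cpos.
have A2 := @flow_le R _ _ _ _ _ _ _ _ F1 F2 e2pos.
have mXE u : m * (X n (m ^+ 2 * u) / m) = X n (m ^+ 2 * u) by rewrite mulrC divfK// gt_eqF.
have Q0 : 0 <= B * R0 * (m - 1) by rewrite !mulr_ge0// subr_ge0.
have {}A1 := A1 _ _ t r tT' r0;have {}A2 := A2 _ _ t r tT' r0.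
have K1 := Hn t r tT r0;have K2 := Hn _ _ tT2 (mr r r0).
have {A1} A1 : W n (m ^+ 2 * t) (m * r) - W n t r <= e / 2 + B * R0 * (m - 1) + `|m ^+ 2 * j - j| * t.
 apply: A1 => [u u0|u hu].
 have := Hn 0 u z0 u0;have := Hn 0 _ z0 (mr u u0);have := I2 u u0.
 rewrite mulr0 !ler_norml => q1 /andP[q2 q3] /andP[q4 q5].
 by move: q1 q2 q3 q4 q5;lra.
 have := Hm u (inT u hu);have := Hm _ (inT2 u hu).
 rewrite mXE !ler_norml => /andP[q2 q3] /andP[q4 q5].
 by move: Q0 q2 q3 q4 q5;lra.
have {A2} A2 : W n t r - W n (m ^+ 2 * t) (m * r) <= e / 2 + `|j - m ^+ 2 * j| * t.
 apply: A2 => [u u0|u hu].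
 have := Hn 0 u z0 u0;have := Hn 0 _ z0 (mr u u0);have := I1 u u0.
 rewrite mulr0 !ler_norml => q1 /andP[q2 q3] /andP[q4 q5].
 by move: q1 q2 q3 q4 q5;lra.
 have := Hm u (inT u hu);have := Hm _ (inT2 u hu).
 rewrite mXE !ler_norml => /andP[q2 q3] /andP[q4 q5].
 by move: q2 q3 q4 q5;lra.
rewrite (distrC j) in A2.
rewrite /Cs mulrDl;move: A1 A2 K1 K2;rewrite !ler_norml => q1 q2 /andP[q3 q4] /andP[q5 q6].
by apply/andP;split;move: q1 q2 q3 q4 q5 q6 jt Q0;lra.
Qed.

(* With [m ^+ 2 = t / s]. *)
Lemma ratio s t : 0 < s -> s <= t -> t <= 4 * s -> exists m, [/\ 1 <= m, m <= 2, m ^+ 2 * s = t &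
 m - 1 <= (t - s) / s].
Proof.
move=> s0 st t4;pose m := Num.sqrt (t / s).
have q0 : 0 <= t / s by rewrite divr_ge0 ?(ltW s0)// (le_trans (ltW s0)).
have q1 : 1 <= t / s by rewrite ler_pdivlMr ?mul1r.
have m1 : 1 <= m by rewrite -[leLHS]sqrtr1 ler_sqrt// (lt_le_trans ltr01).
have mm : m ^+ 2 = t / s by rewrite sqr_sqrtr.
have m2 : m <= 2.
 have : m ^+ 2 <= 2 ^+ 2 by rewrite mm ler_pdivrMr// (_ : 2 ^+ 2 = 4 :> R)// -natrX.
 by rewrite ler_pXn2r// ?nnegrE// (le_trans _ m1).
exists m;split => //;first by rewrite mm divfK// gt_eqF.
rewrite mulrBl divff ?gt_eqF// -mm;nra.
Qed.

(** Monotonicity in space turns the estimate along the parabolic orbit through [r] into an upper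
    bound for the increment in time at fixed [r]. *)
Lemma V_up s t r : 0 < s -> s <= t -> t <= 4 * s -> t < T -> 0 <= r ->
 V t r - V s r <= Cs * ((t - s) / s).
Proof.
move=> s0 st t4 tT r0;have [m [m1 m2 mt mq]] := ratio s0 st t4.
have := @V_scale m s r m1 m2 (ltW s0);rewrite mt => /(_ tT r0).
have t_in : 0 <= t < T by rewrite tT (le_trans (ltW s0)).
have := @V_mono t r (m * r) t_in r0;rewrite ler_peMl// => /(_ isT).
have : Cs * (m - 1) <= Cs * ((t - s) / s) by rewrite ler_wpM2l ?Cs_ge0.
rewrite ler_norml => q1 q2 /andP[q3 q4];lra.
Qed.

Variable tau : R.
Hypothesis tau0 : 0 < tau.

(** For [t0 >= tau] this makes [K1 * (t0 / 2)] at least [M0], which settles the starting time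
    [t0 / 2], and [K1 * (t0 - t)] at least the time increments of [V_up], which settles the
    sides. *)
Definition K1 := 2 * (M0 + Cs) / tau.

Lemma K1_ge0 : 0 <= K1.
Proof. by rewrite divr_ge0 ?(ltW tau0)// mulr_ge0// addr_ge0 ?Cs_ge0 ?M0_ge0. Qed.

Lemma half_in t0 t : tau <= t0 -> t0 / 2 <= t <= t0 -> [/\ 0 < t, t0 <= 4 * t & (t0 - t) / t <= 2 / tau * (t0 - t)].
Proof.
move=> h1 /andP[h2 h3];have t00 : 0 < t0 := lt_le_trans tau0 h1;have t0' : 0 < t by lra.
split => //;first lra.
rewrite mulrC ler_wpM2r ?subr_ge0// -[leLHS]mul1r ler_pdivrMr// mulrAC ler_pdivlMr//;lra.
Qed.

(** An upper bound [2 * K1] on the second space derivative, in chord form. The barrier is the chord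
    at time [t0] minus [K1 * ((r - a) * (b - r))], lowered by [K1 * (t0 - t)] at earlier times; as
    [al] and [A] are both [K1], positivity of [j] makes it a strict subsolution. *)
Lemma V_low t0 a b r : tau <= t0 -> t0 < T -> 0 <= a -> a < b -> a <= r <= b ->
 V t0 a * (b - r) + V t0 b * (r - a) <= (b - a) * (V t0 r + K1 * ((r - a) * (b - r))).
Proof.
move=> tt0 t0T a0 ab /[dup] hr /andP[ar rb].
have t00 : 0 < t0 := lt_le_trans tau0 tt0.
have t0in : 0 <= t0 < T by rewrite ltW.
have ba : 0 < b - a by rewrite subr_gt0.
have ban : b - a != 0 by rewrite gt_eqF.
have b0 : 0 <= b by lra.
pose P := (V t0 b - V t0 a) / (b - a).
pose al := K1;pose be := P - K1 * (a + b);pose ga := V t0 a - P * a + K1 * (a * b) - K1 * t0.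
have qE y : al * y ^+ 2 + be * y + ga = V t0 a + P * (y - a) - K1 * ((y - a) * (b - y)) - K1 * t0.
 by rewrite /al /be /ga;ring.
have chM y : a <= y <= b -> V t0 a + P * (y - a) <= M0.
 move=> /andP[ay yb];have V1 := V_leM t0in a0;have V2 := V_leM t0in b0;have V12 := V_mono t0in a0 (ltW ab).
 apply: (le_trans _ V2);rewrite -lerBrDl /P mulrAC ler_pdivrMr// ler_wpM2l ?subr_ge0//;lra.
have kk0 y : a <= y <= b -> 0 <= K1 * ((y - a) * (b - y)).
 by move=> /andP[ay yb];rewrite mulr_ge0 ?K1_ge0// mulr_ge0 ?subr_ge0.
have K1t : M0 <= K1 * (t0 / 2).
 have -> : K1 * (t0 / 2) = (M0 + Cs) * (t0 / tau) by rewrite /K1;field;rewrite gt_eqF.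
 apply: (@le_trans _ _ (M0 + Cs));first by rewrite lerDl Cs_ge0.
 apply: ler_peMr;first by apply: addr_ge0;[exact: M0_ge0|exact: Cs_ge0].
 by rewrite ler_pdivlMr// mul1r.
have lat y t : y = a \/ y = b -> t0 / 2 <= t <= t0 -> V t0 y - K1 * (t0 - t) <= V t y.
 move=> hy /[dup] ht /andP[ht1 ht2];have [tp t4 tq] := half_in tt0 ht.
 have y0 : 0 <= y by case: hy => ->.
 have := V_up tp ht2 t4 t0T y0.
 have : Cs * ((t0 - t) / t) <= K1 * (t0 - t).
 apply: le_trans (_ : Cs * (2 / tau * (t0 - t)) <= _);first by rewrite ler_wpM2l ?Cs_ge0.
 have -> : K1 * (t0 - t) = (M0 + Cs) * (2 / tau * (t0 - t)) by rewrite /K1;field;rewrite gt_eqF.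
 by apply: ler_wpM2r;[rewrite mulr_ge0 ?subr_ge0// divr_ge0// ltW|rewrite lerDr M0_ge0].
 lra.
suff H k : 0 < k -> al * r ^+ 2 + be * r + ga + K1 * t0 - V t0 r <= k.
 have H' : V t0 a + P * (r - a) - K1 * ((r - a) * (b - r)) <= V t0 r.
 by apply/ler_addgt0Pr => k /H;rewrite qE;move: (V t0 r) => v;lra.
 have := ler_wpM2l (ltW ba) H'.
 rewrite (_ : (b - a) * (_ - _) = V t0 a * (b - r) + V t0 b * (r - a) - (b - a) * (K1 * ((r - a) * (b - r)))).
 by rewrite lerBlDr -mulrDr.
 by rewrite /P;field.
move=> k0;have k40 : 0 < k / 4 by rewrite divr_gt0.
have [n [Hn Hm]] := both k40.
have tin t : t0 / 2 <= t <= t0 -> 0 <= t < T by move=> /andP[h1 h2];apply/andP;split;lra.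
have h0 : 0 <= t0 / 2 by lra.
have e0 : K1 < al + j by rewrite ltrDl.
have := @flow_ge_quad R j T (X n) (W n) (t0 / 2) t0 a b (k / 2) al be ga K1 (HF n) h0 t0T a0 ab e0.
have hh : t0 / 2 <= t0 / 2 <= t0 by apply/andP;split;lra.
have hh' : t0 / 2 <= t0 <= t0 by apply/andP;split;lra.
move=> /(_ _ _ _ _ t0 r hh' hr) H.
suff : al * r ^+ 2 + be * r + ga + K1 * t0 - W n t0 r <= k / 2.
 have r0 : 0 <= r by lra.
 by have := Hn t0 r t0in r0;rewrite ler_norml => /andP[];move: (W _ _ _) (V _ _) k0;move=> w1 v1;lra.
apply: H.
- move=> y hy;rewrite qE;have := chM y hy;have := kk0 y hy.
 have := flow_ge0 (HF n) (tin _ hh) (le_trans a0 (proj1 (andP hy))).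
 by move: (W _ _ _) K1t k0;move=> w;lra.
- move=> t ht;rewrite qE subrr mul0r !mulr0;have := lat a t (or_introl erefl) ht.
 by have := Hn t a (tin t ht) a0;rewrite ler_norml => /andP[];move: (W _ _ _) (V _ _) (V _ _) k0;move=> w1 v1 v2;lra.
- move=> t ht;rewrite qE subrr !mulr0 (_ : P * (b - a) = V t0 b - V t0 a);last by rewrite /P divfK.
 have := lat b t (or_intror erefl) ht.
 by have := Hn t b (tin t ht) b0;rewrite ler_norml => /andP[];move: (W _ _ _) (V _ _) (V _ _) (V _ _) k0;move=> w1 v1 v2 v3;lra.
- move=> t y ht hy;rewrite qE;have := chM y hy;have := kk0 y hy.
 have : K1 * t <= K1 * t0 by rewrite ler_wpM2l ?K1_ge0//;case/andP: ht.
 by have := Hm t (tin t ht);rewrite ler_norml => /andP[];move: (W _ _ _) k0;move=> w1;lra.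
Qed.

Variable Rm : R.
Hypothesis Rm0 : 0 <= Rm.

Definition C3 := Cs + M0 + 2 * K1 * Rm ^+ 2.
Definition L2 := 2 * (M0 + C3) / tau.
(** One unit more than [L2 + j], so that [al + j < A] holds strictly in [flow_le_quad] for
    [al = - K2] and [A = - L2]. *)
Definition K2 := L2 + j + 1.

Lemma C3_ge0 : 0 <= C3.
Proof.
apply: addr_ge0;first by apply: addr_ge0;[exact: Cs_ge0|exact: M0_ge0].
by apply: mulr_ge0;[apply: mulr_ge0 => //;exact: K1_ge0|exact: sqr_ge0].
Qed.

Lemma L2_ge0 : 0 <= L2.
Proof. by rewrite divr_ge0 ?(ltW tau0)// mulr_ge0// addr_ge0 ?C3_ge0 ?M0_ge0. Qed.

Lemma K2_ge0 : 0 <= K2.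
Proof. by rewrite !addr_ge0 ?L2_ge0// ltW. Qed.

(** The converse of [V_up]. [V_scale] bounds [V t r] by [V t0 (m * r)], and [V_low] on [[0, m * r]],
    where [V] vanishes at the left end, bounds the increment from [r] to [m * r]; the term in
    [Rm ^+ 2] of [C3] comes from there. *)
Lemma V_down t0 t r : tau <= t0 -> t0 < T -> t0 / 2 <= t <= t0 -> 0 <= r <= Rm ->
 V t r - V t0 r <= C3 * ((t0 - t) / t).
Proof.
move=> tt0 t0T /[dup] ht /andP[h1 h2] /andP[r0 rm].
have [tp t4 _] := half_in tt0 ht.
have t00 : 0 < t0 := lt_le_trans tau0 tt0.
have t0in : 0 <= t0 < T by rewrite ltW.
have tin : 0 <= t < T by rewrite (ltW tp) (le_lt_trans h2).
have q0 : 0 <= (t0 - t) / t by rewrite divr_ge0 ?subr_ge0// ltW.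
have [->|rn0] := eqVneq r 0;first by rewrite !V_at0// subrr mulr_ge0// C3_ge0.
have rp : 0 < r by rewrite lt_neqAle eq_sym rn0.
have [m [m1 m2 mt mq]] := ratio tp h2 t4.
have := @V_scale m t r m1 m2 (ltW tp);rewrite mt => /(_ t0T r0).
have [->|mn1] := eqVneq m 1.
 rewrite mul1r subrr mulr0 normr_le0 subr_eq0 => /eqP ->.
 by rewrite subrr mulr_ge0// C3_ge0.
have m1' : 1 < m by rewrite lt_neqAle eq_sym mn1.
have rmr : r < m * r by rewrite ltr_pMl.
have := V_low tt0 t0T (lexx 0) (lt_trans rp rmr) (r := r).
rewrite r0 (ltW rmr) => /(_ isT);rewrite V_at0// mul0r add0r !subr0.
rewrite (_ : m * r * (V t0 r + K1 * (r * (m * r - r))) = (m * (V t0 r + K1 * (r ^+ 2 * (m - 1)))) * r);last by ring.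
rewrite ler_pM2r// => L.
rewrite ler_norml => /andP[S _].
have V1 := V_leM t0in r0.
have A1 : (m - 1) * V t0 r <= (m - 1) * M0 by rewrite ler_wpM2l// subr_ge0.
have A2 : m * (K1 * (r ^+ 2 * (m - 1))) <= 2 * (K1 * (Rm ^+ 2 * (m - 1))).
 apply: ler_pM => //;[lra|by apply: mulr_ge0;[exact: K1_ge0|apply: mulr_ge0;[exact: sqr_ge0|rewrite subr_ge0]]|].
 by rewrite ler_wpM2l ?K1_ge0// ler_wpM2r ?subr_ge0// ler_pXn2r ?nnegrE.
have A3 : C3 * (m - 1) <= C3 * ((t0 - t) / t) by rewrite ler_wpM2l// C3_ge0.
apply: le_trans A3;move: S L A1 A2;rewrite /C3.
rewrite (_ : (_ + 2 * K1 * Rm ^+ 2) * (m - 1) = Cs * (m - 1) + (m - 1) * M0 + 2 * (K1 * (Rm ^+ 2 * (m - 1))));last by ring.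
rewrite (mulrDr m);move: (2 * (K1 * _)) (m * (K1 * _)) => u1 u2.
by move: (V _ _) (V _ _) (V _ _) => v1 v2 v3 *;lra.
Qed.

(** The mirror image of [V_low]: [V_down] controls the sides, and the total mass [M0] bounds [V]
    from above at time [t0 / 2]. It amounts to a lower bound [- 2 * K2] on the second space
    derivative. *)
Lemma V_high t0 a b r : tau <= t0 -> t0 < T -> 0 <= a -> a < b -> b <= Rm -> a <= r <= b ->
 (b - a) * V t0 r <= V t0 a * (b - r) + V t0 b * (r - a) + (b - a) * (K2 * ((r - a) * (b - r))).
Proof.
move=> tt0 t0T a0 ab bRm /[dup] hr /andP[ar rb].
have t00 : 0 < t0 := lt_le_trans tau0 tt0.
have t0in : 0 <= t0 < T by rewrite ltW.
have ba : 0 < b - a by rewrite subr_gt0.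
have ban : b - a != 0 by rewrite gt_eqF.
have b0 : 0 <= b by lra.
pose P := (V t0 b - V t0 a) / (b - a).
pose al := - K2;pose be := P + K2 * (a + b);pose ga := V t0 a - P * a - K2 * (a * b) + L2 * t0.
have qE y : al * y ^+ 2 + be * y + ga = V t0 a + P * (y - a) + K2 * ((y - a) * (b - y)) + L2 * t0.
 by rewrite /al /be /ga;ring.
have ch0 y : a <= y <= b -> 0 <= V t0 a + P * (y - a).
 move=> /andP[ay yb];have V1 := V_ge0 t0in a0;have V12 := V_mono t0in a0 (ltW ab).
 by rewrite addr_ge0// mulr_ge0 ?subr_ge0// divr_ge0 ?subr_ge0// ltW.
have kk0 y : a <= y <= b -> 0 <= K2 * ((y - a) * (b - y)).
 by move=> /andP[ay yb];rewrite mulr_ge0 ?K2_ge0// mulr_ge0 ?subr_ge0.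
have L2t : M0 <= L2 * (t0 / 2).
 have -> : L2 * (t0 / 2) = (M0 + C3) * (t0 / tau) by rewrite /L2;field;rewrite gt_eqF.
 apply: (@le_trans _ _ (M0 + C3));first by rewrite lerDl C3_ge0.
 apply: ler_peMr;first by apply: addr_ge0;[exact: M0_ge0|exact: C3_ge0].
 by rewrite ler_pdivlMr// mul1r.
have lat y t : y = a \/ y = b -> t0 / 2 <= t <= t0 -> V t y <= V t0 y + L2 * (t0 - t).
 move=> hy /[dup] ht /andP[ht1 ht2];have [tp t4 tq] := half_in tt0 ht.
 have y0 : 0 <= y <= Rm by case: hy => ->;apply/andP;split;lra.
 have := V_down tt0 t0T ht y0.
 have : C3 * ((t0 - t) / t) <= L2 * (t0 - t).
 apply: le_trans (_ : C3 * (2 / tau * (t0 - t)) <= _);first by rewrite ler_wpM2l ?C3_ge0.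
 have -> : L2 * (t0 - t) = (M0 + C3) * (2 / tau * (t0 - t)) by rewrite /L2;field;rewrite gt_eqF.
 by apply: ler_wpM2r;[rewrite mulr_ge0 ?subr_ge0// divr_ge0// ltW|rewrite lerDr M0_ge0].
 lra.
suff H k : 0 < k -> V t0 r - (al * r ^+ 2 + be * r + ga + - L2 * t0) <= k.
 have H' : V t0 r <= V t0 a + P * (r - a) + K2 * ((r - a) * (b - r)).
 by apply/ler_addgt0Pr => k /H;rewrite qE;move: (V t0 r) => v;lra.
 have := ler_wpM2l (ltW ba) H'.
 rewrite mulrDr;rewrite (_ : (b - a) * (_ + P * _) = V t0 a * (b - r) + V t0 b * (r - a))//.
 by rewrite /P;field.
move=> k0;have k40 : 0 < k / 4 by rewrite divr_gt0.
have [n [Hn Hm]] := both k40.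
have tin t : t0 / 2 <= t <= t0 -> 0 <= t < T by move=> /andP[h1 h2];apply/andP;split;lra.
have h0 : 0 <= t0 / 2 by lra.
have al0 : al < 0 by rewrite oppr_lt0 ltr_wpDl// addr_ge0 ?L2_ge0// ltW.
have e0 : al + j < - L2 by rewrite /al /K2;lra.
have := @flow_le_quad R j T (X n) (W n) (t0 / 2) t0 a b (k / 2) al be ga (- L2) (HF n) h0 t0T a0 ab al0 e0.
have hh : t0 / 2 <= t0 / 2 <= t0 by apply/andP;split;lra.
have hh' : t0 / 2 <= t0 <= t0 by apply/andP;split;lra.
move=> /(_ _ _ _ t0 r hh' hr) H.
suff : W n t0 r - (al * r ^+ 2 + be * r + ga + - L2 * t0) <= k / 2.
 have r0 : 0 <= r by lra.
 by have := Hn t0 r t0in r0;rewrite ler_norml => /andP[];move: (W _ _ _) (V _ _) k0;move=> w1 v1;lra.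
apply: H.
- move=> y hy;rewrite qE;have := ch0 y hy;have := kk0 y hy.
 have := flow_leM (HF n) (tin _ hh) (le_trans a0 (proj1 (andP hy))).
 have := Hm _ (tin _ hh);rewrite ler_norml => /andP[].
 by move: (W _ _ _) (W _ _ _) L2t k0;move=> w1 w2;lra.
- move=> t ht;rewrite qE subrr mul0r !mulr0;have := lat a t (or_introl erefl) ht.
 by have := Hn t a (tin t ht) a0;rewrite ler_norml => /andP[];move: (W _ _ _) (V _ _) (V _ _) k0;move=> w1 v1 v2;lra.
- move=> t ht;rewrite qE subrr !mulr0 (_ : P * (b - a) = V t0 b - V t0 a);last by rewrite /P divfK.
 have := lat b t (or_intror erefl) ht.
 by have := Hn t b (tin t ht) b0;rewrite ler_norml => /andP[];move: (W _ _ _) (V _ _) (V _ _) (V _ _) k0;move=> w1 v1 v2 v3;lra.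
Qed.

(** The chord form of a [C^1,1] bound, meaningful before any derivative is known to exist. *)
Lemma C11 : exists2 K : R, 0 <= K & forall t a b r, tau <= t -> t < T -> 0 <= a -> a < b -> b <= Rm -> a <= r <= b ->
 `|(b - a) * V t r - (V t a * (b - r) + V t b * (r - a))| <= (b - a) * (K * ((r - a) * (b - r))).
Proof.
exists (K1 + K2) => [|t a b r tt tT a0 ab bRm hr];first by rewrite addr_ge0 ?K1_ge0 ?K2_ge0.
have B1 := V_low tt tT a0 ab hr;have B2 := V_high tt tT a0 ab bRm hr.
have [ar rb] := andP hr.
have P0 : 0 <= (b - a) * ((r - a) * (b - r)) by rewrite !mulr_ge0 ?subr_ge0// ltW.
have Q1 := mulr_ge0 K1_ge0 P0;have Q2 := mulr_ge0 K2_ge0 P0.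
rewrite ler_norml;apply/andP;split;move: B1 B2 Q1 Q2.
 by rewrite (mulrDr (b - a)) (mulrCA (b - a) K1) (mulrCA (b - a) (K1 + K2)) (mulrDl K1 K2);move: (K1 * _) (K2 * _) => u1 u2;lra.
by rewrite (mulrCA (b - a) K2) (mulrCA (b - a) (K1 + K2)) (mulrDl K1 K2);move: (K1 * _) (K2 * _) => u1 u2;lra.
Qed.
End Limit.

Section Grad.
Context {R : realType}.
Notation mu := (@lebesgue_measure R).
Implicit Types (s t r x y v u a b c d e h k m : R).
Variables (T : R) (V : R -> R -> R).
Hypothesis HC : forall tau Rm : R, 0 < tau -> 0 <= Rm -> exists2 K : R, 0 <= K &
 forall t a b r, tau <= t -> t < T -> 0 <= a -> a < b -> b <= Rm -> a <= r <= b ->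
 `|(b - a) * V t r - (V t a * (b - r) + V t b * (r - a))| <= (b - a) * (K * ((r - a) * (b - r))).
Hypothesis Vt : forall t, 0 <= t < T -> forall e, 0 < e -> exists2 d : R, 0 < d &
 forall s r, 0 <= s < T -> `|s - t| < d -> 0 <= r -> `|V s r - V t r| <= e.
Hypothesis Vr : forall t r, 0 <= t < T -> 0 <= r -> forall e, 0 < e -> exists2 d : R, 0 < d &
 forall r' : R, 0 <= r' -> `|r' - r| < d -> `|V t r' - V t r| <= e.
Hypothesis Vm : forall t r (r' : R), 0 <= t < T -> 0 <= r -> r <= r' -> V t r <= V t r'.
Hypothesis V00 : forall t, 0 <= t < T -> V t 0 = 0.

Definition quo t r h : R := (V t (r + h) - V t r) / h.

(** The right derivative in space, selected through a linear rate of convergence of the difference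
    quotients. *)
Definition GG t r : R := xget 0 [set l : R | exists2 K : R, 0 <= K &
 forall h, 0 < h <= 1 -> `|quo t r h - l| <= K * h].

(** The chord inequality on [[r, r + h]] at the intermediate point [r + k], divided by [h * k]. *)
Lemma quo_dist (K Rm t r h k : R) : (forall a b r, 0 <= a -> a < b -> b <= Rm -> a <= r <= b ->
 `|(b - a) * V t r - (V t a * (b - r) + V t b * (r - a))| <= (b - a) * (K * ((r - a) * (b - r)))) ->
 0 <= r -> 0 < k -> k <= h -> r + h <= Rm -> `|quo t r h - quo t r k| <= K * (h - k).
Proof.
move=> H r0 k0 kh rR;have h0 : 0 < h by exact: lt_le_trans kh.
have hn : h != 0 by rewrite gt_eqF.
have kn : k != 0 by rewrite gt_eqF.
have := H r (r + h) (r + k) r0;rewrite ltrDl h0 rR lerDl lerD2l kh (ltW k0) => /(_ isT isT isT).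
have -> : r + h - r = h by ring.
have -> : r + k - r = k by ring.
have -> : r + h - (r + k) = h - k by ring.
rewrite (_ : h * V t (r + k) - (V t r * (h - k) + V t (r + h) * k) = (h * k) * (quo t r k - quo t r h));last first.
 by rewrite /quo;field;rewrite hn kn.
rewrite normrM gtr0_norm ?mulr_gt0// (_ : h * (K * (k * (h - k))) = h * k * (K * (h - k)));last by ring.
by rewrite ler_pM2l ?mulr_gt0// distrC.
Qed.

(** By [quo_dist], every upper barrier [quo + K * k] lies above every lower barrier [quo - K * k].
    The infimum of the former is the derivative, with a rate that is uniform in [t] and [r]. *)
Lemma GG_spec (tau Rm : R) : 0 < tau -> 0 <= Rm -> exists2 K : R, 0 <= K & forall t r h, tau <= t -> t < T ->
 0 <= r -> r + 1 <= Rm -> 0 < h <= 1 -> `|quo t r h - GG t r| <= K * h.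
Proof.
move=> tau0 Rm0;have [K K0 HK] := HC tau0 Rm0;exists K => // t r h tt tT r0 rR hh.
have HK' a b y := HK t a b y tt tT.
have D k1 k2 : 0 < k1 -> k1 <= k2 -> k2 <= 1 -> `|quo t r k2 - quo t r k1| <= K * (k2 - k1).
 move=> k10 k12 k21;apply: (quo_dist HK' r0 k10 k12);apply: le_trans rR;by rewrite lerD2l.
pose S := [set quo t r k + K * k | k in [set k : R | 0 < k <= 1]].
have S0 : S !=set0 by exists (quo t r 1 + K * 1), 1 => //=;rewrite ltr01 lexx.
have lbS k : 0 < k <= 1 -> lbound S (quo t r k - K * k).
 move=> /andP[k0 k1] _ [k' /= /andP[k'0 k'1] <-].
 have kk1 : 0 <= K * k by rewrite mulr_ge0// ltW.
 have kk2 : 0 <= K * k' by rewrite mulr_ge0// ltW.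
 have [kk|/ltW kk] := leP k k'.
 by have := D _ _ k0 kk k'1;rewrite ler_norml mulrBr => /andP[h1 h2];lra.
 by have := D _ _ k'0 kk k1;rewrite ler_norml mulrBr => /andP[h1 h2];lra.
have Si : has_inf S by split=> //;exists (quo t r h - K * h);exact: lbS.
pose l := inf S.
have Hl k : 0 < k <= 1 -> `|quo t r k - l| <= K * k.
 move=> hk;have h1 : l <= quo t r k + K * k by apply: ge_inf;[case: Si|exists k].
 have h2 : quo t r k - K * k <= l by apply: lb_le_inf => //;exact: lbS.
 by rewrite ler_norml;apply/andP;split;lra.
have [K' K'0 HK2] : exists2 K' : R, 0 <= K' & forall k, 0 < k <= 1 -> `|quo t r k - GG t r| <= K' * k.
 by apply: (@xgetPex _ 0 [set l : R | exists2 K : R, 0 <= K & forall h, 0 < h <= 1 -> `|quo t r h - l| <= K * h]);exists l, K.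
suff -> : GG t r = l by exact: Hl.
apply/eqP;rewrite -subr_eq0 -normr_le0;apply/ler_addgt0Pr => e e0;rewrite add0r.
have KK : 0 < K + K' + 1 by rewrite ltr_wpDl// addr_ge0.
pose k : R := Num.min 1 (e / (K + K' + 1)).
have k01 : 0 < k <= 1 by rewrite lt_min ltr01 divr_gt0//= ge_min lexx.
have ke : (K + K' + 1) * k <= e by rewrite mulrC -ler_pdivlMr// ge_min lexx orbT.
have := Hl k k01;have := HK2 k k01;move: (quo t r k) (GG t r) => q g h1 h2.
rewrite (_ : g - l = (q - l) - (q - g));last by ring.
apply: le_trans (ler_normB _ _) _;have : 0 < k by case/andP: k01.
clearbody k;move: ke h1 h2;rewrite !mulrDl mul1r;move: (`|_|) (`|_|) (K * k) (K' * k) => u1 u2 u3 u4;lra.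
Qed.

Lemma GG_ge0 t r : 0 < t < T -> 0 <= r -> 0 <= GG t r.
Proof.
move=> /andP[t0 tT] r0;have R1 : 0 <= r + 1 by rewrite addr_ge0.
have [K K0 HK] := GG_spec t0 R1.
rewrite -(opprK (GG t r)) oppr_ge0;apply/ler_addgt0Pr => e e0;rewrite add0r.
have K1 : 0 < K + 1 by rewrite ltr_wpDl.
pose k : R := Num.min 1 (e / (K + 1)).
have k01 : 0 < k <= 1 by rewrite lt_min ltr01 divr_gt0//= ge_min lexx.
have ke : (K + 1) * k <= e by rewrite mulrC -ler_pdivlMr// ge_min lexx orbT.
have k0 : 0 < k by case/andP: k01.
have q0 : 0 <= quo t r k.
 rewrite divr_ge0 ?(ltW k0)// subr_ge0;apply: Vm => //;last by rewrite lerDl ltW.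
 by rewrite (ltW t0).
have := HK t r k (lexx _) tT r0 (lexx _) k01;rewrite ler_norml => /andP[h1 h2].
by move: ke;rewrite mulrDl mul1r;move: q0 h1 h2;move: (quo _ _ _) (GG _ _) (K * k) => q g u;lra.
Qed.

Lemma V_jc t r e : 0 <= t < T -> 0 <= r -> 0 < e -> exists2 d : R, 0 < d & forall s (r' : R), 0 <= s < T ->
 0 <= r' -> `|s - t| < d -> `|r' - r| < d -> `|V s r' - V t r| <= e.
Proof.
move=> tT r0 e0;have e20 : 0 < e / 2 by rewrite divr_gt0.
have [d1 d10 H1] := Vt tT e20;have [d2 d20 H2] := Vr tT r0 e20.
exists (Num.min d1 d2) => [|s r' hs hr];first by rewrite lt_min d10.
rewrite !lt_min => /andP[s1 _] /andP[_ r2];have B1 := H1 s r' hs s1 hr;have B2 := H2 r' hr r2.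
rewrite (_ : _ - _ = (V s r' - V t r') + (V t r' - V t r));last by ring.
by apply: le_trans (ler_normD _ _) _;lra.
Qed.

(** At a fixed step the quotients are jointly continuous, and [GG_spec] makes their convergence
    locally uniform. *)
Lemma GG_cont t r e : 0 < t < T -> 0 <= r -> 0 < e -> exists2 d : R, 0 < d & forall s (r' : R), 0 < s < T ->
 0 <= r' -> `|s - t| < d -> `|r' - r| < d -> `|GG s r' - GG t r| < e.
Proof.
move=> /[dup] tT /andP[t0 tT'] r0 e0;have t20 : 0 < t / 2 by rewrite divr_gt0.
have R2 : 0 <= r + 2 by rewrite addr_ge0.
have [K K0 HK] := GG_spec t20 R2.
have K1 : 0 < K + 1 by rewrite ltr_wpDl.
pose h : R := Num.min 1 (e / 4 / (K + 1)).
have h01 : 0 < h <= 1 by rewrite lt_min ltr01 !divr_gt0//= ge_min lexx.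
have he : (K + 1) * h <= e / 4 by rewrite mulrC -ler_pdivlMr// ge_min lexx orbT.
have h0 : 0 < h by case/andP: h01.
clearbody h.
have Kh : K * h <= e / 4 by apply: le_trans he;rewrite ler_pM2r// lerDl.
have tT0 : 0 <= t < T by rewrite ltW.
have eh : 0 < e * h / 8 by rewrite divr_gt0// mulr_gt0.
have [d1 d10 H1] := V_jc tT0 r0 eh.
have [|d2 d20 H2] := @V_jc t (r + h) _ tT0 _ eh;first by rewrite addr_ge0// ltW.
exists (Num.min (Num.min d1 d2) (Num.min 1 (t / 2))) => [|s r' hs hr].
 by rewrite !lt_min d10 d20 ltr01.
rewrite !lt_min => /andP[/andP[s1 s2] /andP[_ st]] /andP[/andP[r1 r2] /andP[r3 _]].
have hs0 : 0 <= s < T by case/andP: hs => /ltW -> ->.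
have ts : t / 2 <= s by move: st;rewrite ltr_norml => /andP[+ _];lra.
have r'R : r' + 1 <= r + 2 by move: r3;rewrite ltr_norml => /andP[_ +];lra.
have B1 := H1 s r' hs0 hr s1 r1.
have B2 := H2 s (r' + h) hs0;rewrite addr_ge0 ?(ltW h0)// in B2.
have {}B2 := B2 isT s2;rewrite (_ : r' + h - (r + h) = r' - r) in B2;last by ring.
have {}B2 := B2 r2.
have sT' : s < T by case/andP: hs.
have C1 := HK s r' h ts sT' hr r'R h01.
have tt2 : t / 2 <= t by lra.
have rR : r + 1 <= r + 2 by lra.
have C2 := HK t r h tt2 tT' r0 rR h01.
have Q : `|quo s r' h - quo t r h| <= e / 4.
 rewrite /quo -mulrBl normrM normfV (gtr0_norm h0) ler_pdivrMr//.
 rewrite (_ : _ - _ - _ = (V s (r' + h) - V t (r + h)) - (V s r' - V t r));last by ring.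
 by apply: le_trans (ler_normB _ _) _;lra.
rewrite (_ : _ - _ = (quo s r' h - quo t r h) + ((quo t r h - GG t r) - (quo s r' h - GG s r')));last by ring.
apply: le_lt_trans (ler_normD _ _) _.
have := ler_normB (quo t r h - GG t r) (quo s r' h - GG s r').
move: Q C1 C2 Kh;move: (`|_|) (`|_|) (`|_|) (`|_|) (K * h) => u1 u2 u3 u4 u5;lra.
Qed.

(** By construction [GG] is a right derivative; the chord inequality centred at [r] transfers the
    expansion to the left. *)
Lemma GG_der t r : 0 < t < T -> 0 < r -> is_derive r 1 (V t) (GG t r).
Proof.
move=> /andP[t0 tT] r0;have R2 : 0 <= r + 1 by rewrite addr_ge0// ltW.
have [K K0 HK] := HC t0 R2.
have [K' K'0 HG] := GG_spec t0 R2.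
have KK : 0 < 3 * K + K' + 1 by rewrite ltr_wpDl// addr_ge0// mulr_ge0.
apply/is_derive_epsP => e e0.
exists (Num.min (Num.min 1 r) (e / (3 * K + K' + 1))) => [|y];first by rewrite !lt_min ltr01 r0 divr_gt0.
rewrite !lt_min => /andP[/andP[y1 yr] ye].
have [->|yn] := eqVneq y r;first by rewrite !subrr mulr0 subrr normr0 mulr0.
pose h := `|y - r|;have h0 : 0 < h by rewrite normr_gt0 subr_eq0.
have h01 : 0 < h <= 1 by rewrite h0 ltW.
have he : (3 * K + K' + 1) * h <= e by rewrite mulrC -ler_pdivlMr// ltW.
have he' : K' * h + 2 * K * h <= e.
 apply: le_trans he;rewrite !mulrDl mul1r;have : 0 <= K * h by rewrite mulr_ge0// ltW.
 by move: (K * h) (K' * h) h0 => u u';lra.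
have G := HG t r h (lexx _) tT (ltW r0) (lexx _) h01.
have hn : h != 0 by rewrite gt_eqF.
have right : `|V t (r + h) - V t r - GG t r * h| <= K' * h * h.
 rewrite (_ : _ - _ - _ = (quo t r h - GG t r) * h);last by rewrite /quo;field.
 by rewrite normrM (gtr0_norm h0) ler_pM2r.
have [ry|yr'] := ltP r y.
 have yE : y = r + h by rewrite /h gtr0_norm ?subr_gt0//;ring.
 rewrite yE (_ : r + h - r = h);last by ring.
 apply: le_trans right _;rewrite (gtr0_norm h0) ler_pM2r//;apply: le_trans he';rewrite lerDl.
 by rewrite mulr_ge0 ?mulr_ge0// ltW.
have yE : y = r - h by rewrite /h ler0_norm ?subr_le0//;ring.
have B := HK t (r - h) (r + h) r (lexx _) tT;rewrite -yE (yE) in B.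
have {}B : `|(r + h - (r - h)) * V t r - (V t (r - h) * (r + h - r) + V t (r + h) * (r - (r - h)))|
 <= (r + h - (r - h)) * (K * ((r - (r - h)) * (r + h - r))).
 apply: B;[by rewrite subr_ge0 ltW|lra|by rewrite lerD2l;case/andP: h01|by apply/andP;split;lra].
have {}B : `|2 * V t r - V t (r - h) - V t (r + h)| <= 2 * K * h * h.
 rewrite -(ler_pM2l h0) -{1}(gtr0_norm h0) -normrM.
 move: B;rewrite (_ : (r + h - (r - h)) * V t r - _ = h * (2 * V t r - V t (r - h) - V t (r + h)));last by ring.
 by rewrite (_ : (r + h - (r - h)) * _ = h * (2 * K * h * h));last by ring.
rewrite yE (_ : r - h - r = - h);last by ring.
rewrite normrN (gtr0_norm h0).
rewrite (_ : _ - _ - _ = - (2 * V t r - V t (r - h) - V t (r + h)) - (V t (r + h) - V t r - GG t r * h));last by ring.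
apply: le_trans (ler_normB _ _) _;rewrite normrN.
apply: (@le_trans _ _ ((K' * h + 2 * K * h) * h));last by rewrite ler_pM2r.
by rewrite (_ : (K' * h + 2 * K * h) * h = 2 * K * h * h + K' * h * h);[exact: lerD|ring].
Qed.

Lemma GG_meas t : 0 < t < T -> forall x e, 0 < e -> exists2 h : R, 0 < h &
 forall y, `|y - x| < h -> `|GG t (Num.max y 0) - GG t (Num.max x 0)| < e.
Proof.
move=> tT x e e0;have [|d d0 Hd] := @GG_cont t (Num.max x 0) e tT _ e0;first by rewrite le_max lexx orbT.
exists d => // y yx;apply: Hd => //;first by rewrite le_max lexx orbT.
 by rewrite subrr normr0.
exact: le_lt_trans (max0_lip _ _) yx.
Qed.

Lemma GG_i t a b : 0 < t < T -> itg `[a, b] (fun y => GG t (Num.max y 0)).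
Proof.
move=> tT;apply: continuous_compact_integrable;first exact: segment_compact.
by apply: continuous_subspaceT => x;apply/(cont_epsP (fun y => GG t (Num.max y 0)))/GG_meas.
Qed.

Lemma V_int t r : 0 < t < T -> 0 <= r -> V t r = \int[mu]_(y in `[0, r]) GG t (Num.max y 0).
Proof.
move=> /[dup] tT /andP[t0 tT'] r0;have tT0 : 0 <= t < T by rewrite ltW.
pose F y := \int[mu]_(z in `[0, y]) GG t (Num.max z 0).
have [->|rn] := eqVneq r 0;first by rewrite V00// I_set1.
have rp : 0 < r by rewrite lt_neqAle eq_sym rn.
have D x : 0 < x < r + 1 -> is_derive x 1 (fun y => V t y - F y) 0.
 move=> /andP[x0 xr];have D1 : is_derive x 1 F (GG t (Num.max x 0)).
 apply: (@FTC_at R _ 0 (r + 1) x (GG_i _ _ tT) x0 xr).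
 by apply/(cont_epsP (fun y => GG t (Num.max y 0)))/GG_meas.
 by apply: (derE (derB (GG_der tT x0) D1));rewrite (max_idPl (ltW x0)) subrr.
have r1 : r < r + 1 by rewrite ltrDl.
apply/eqP;rewrite -subr_eq0 -normr_le0;apply/ler_addgt0Pr => e e0;rewrite add0r.
have e20 : 0 < e / 2 by rewrite divr_gt0.
have [d d0 Hd] := Vr tT0 (lexx 0) e20.
have [B HB] : exists B : R, forall y, 0 <= y <= r -> `|GG t (Num.max y 0)| <= B.
 have c : cont_on 0 r (fun y => `|GG t (Num.max y 0)|).
 move=> y _ e1 e10;have [h h0 Hh] := GG_meas tT y e10;exists h => // z _ zy.
 by apply: le_lt_trans (Hh z zy);exact: ler_dist_dist.
 by have [x0 _ H] := EVT_eps r0 c;eexists;exact: H.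
have B0 : 0 <= B by apply: le_trans (HB 0 _);rewrite ?lexx.
have B1 : 0 < B + 1 by rewrite ltr_wpDl.
pose x : R := Num.min (Num.min r d) (e / (B + 1) / 2) / 2.
have m0 : 0 < Num.min (Num.min r d) (e / (B + 1) / 2) by rewrite !lt_min rp d0 !divr_gt0.
have x0 : 0 < x by rewrite divr_gt0.
have : x < Num.min (Num.min r d) (e / (B + 1) / 2) by rewrite /x;lra.
clearbody x;rewrite !lt_min => /andP[/andP[xr xd] xe].
rewrite -(zero_der_cst D x0 (ltW xr) r1).
apply: le_trans (ler_normB _ _) _.
have V1 : `|V t x| <= e / 2.
 by have := Hd x (ltW x0);rewrite !subr0 V00// subr0 gtr0_norm//;apply.
have F1 : `|F x| <= e / 2.
 apply: le_trans (I_norm _ (GG_i _ _ tT)) _ => //.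
 apply: (@le_trans _ _ (B * (x - 0))).
 apply: I_diff_le;[exact: ltW|exact: iabs (GG_i _ _ tT)|move=> y /andP[y0 yx]].
 by apply: HB;rewrite y0 (le_trans yx (ltW xr)).
 have : (B + 1) * x <= e / 2 by rewrite mulrC -ler_pdivlMr// mulrAC ltW.
 by rewrite subr0 mulrDl;lra.
lra.
Qed.
End Grad.

Section OneVar.
Context {R : realType}.
Implicit Types (f h : R -> R) (x y r e d : R).

Lemma cvg_right_eps f x (l : R) : f y @[y --> x^'+] --> l -> forall e, 0 < e -> exists2 d : R, 0 < d &
 forall y : R, x < y < x + d -> `|f y - l| <= e.
Proof.
move=> /cvgrPdist_le H e e0;have [d /= d0 Hd] := H _ e0.
exists d => // y /andP[xy yd];rewrite distrC;apply: Hd => //=.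
by rewrite ltr0_norm ?subr_lt0// opprB ltrBlDl.
Qed.

Lemma cvg_left_eps f x (l : R) : f y @[y --> x^'-] --> l -> forall e, 0 < e -> exists2 d : R, 0 < d &
 forall y : R, x - d < y < x -> `|f y - l| <= e.
Proof.
move=> /cvgrPdist_le H e e0;have [d /= d0 Hd] := H _ e0.
exists d => // y /andP[yd xy];rewrite distrC;apply: Hd => //=.
by rewrite gtr0_norm ?subr_gt0// ltrBlDl -ltrBlDr.
Qed.

Lemma bnd_oo f (X : R) : 0 < X -> (forall r, 0 < r < X -> {for r, continuous f}) ->
 cvg (f r @[r --> 0^'+]) -> cvg (f r @[r --> X^'-]) ->
 exists2 C : R, 0 <= C & forall r, 0 < r < X -> `|f r| <= C.
Proof.
move=> X0 fc /cvg_ex[/= l1 H1] /cvg_ex[/= l2 H2].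
have [d1 d10 K1] := cvg_right_eps H1 ltr01;have [d2 d20 K2] := cvg_left_eps H2 ltr01.
pose d : R := Num.min (Num.min d1 d2) X / 2.
have m0 : 0 < Num.min (Num.min d1 d2) X by rewrite !lt_min d10 d20.
have d0 : 0 < d by rewrite divr_gt0.
have : d < Num.min (Num.min d1 d2) X by rewrite /d;lra.
have dX : d <= X - d.
 have : Num.min (Num.min d1 d2) X <= X by rewrite ge_min lexx orbT.
 by rewrite /d;lra.
clearbody d;rewrite !lt_min => /andP[/andP[dd1 dd2] dX'].
have c : cont_on d (X - d) (fun r => `|f r|).
 move=> r /andP[h1 h2] e e0;have rX : 0 < r < X by apply/andP;split;lra.
 have [h h0 Hh] := (cont_epsP f r).1 (fc r rX) e e0;exists h => // y _ yr.
 by apply: le_lt_trans (Hh y yr);exact: ler_dist_dist.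
have [x0 _ Hx0] := EVT_eps dX c.
exists (`|f x0| + `|l1| + `|l2| + 1) => [|r /andP[r0 rX]];first by rewrite !addr_ge0.
have n1 := normr_ge0 l1;have n2 := normr_ge0 l2;have n3 := normr_ge0 (f x0).
have [rd|dr] := ltP r d.
 have := K1 r;rewrite r0 add0r (lt_trans rd)// => /(_ isT) h1.
 have := ler_normD (f r - l1) l1;rewrite subrK;lra.
have [rd|rd] := leP r (X - d);first by apply: le_trans (Hx0 r _) _;rewrite ?dr//;lra.
have := K2 r;rewrite rX andbT => /(_ _);rewrite (_ : X - d2 < r);last by lra.
move=> /(_ isT) h1;have := ler_normD (f r - l2) l2;rewrite subrK;lra.
Qed.

Lemma C2_facts f (X : R) : 0 < X -> C2_up_to_boundary 0 X f -> exists g1 g2 : R -> R, [/\ g1 = f^`()%classic, g2 = f^`(2)%classic,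
 forall r, 0 < r < X -> [/\ is_derive r 1 f (g1 r), is_derive r 1 g1 (g2 r) & {for r, continuous g2}],
 exists2 C : R, 0 <= C & forall r, 0 < r < X -> `|g1 r| <= C /\ `|g2 r| <= C &
 {within `[0, X], continuous f}].
Proof.
move=> X0 [[fd fr fl] g1d g2c [c1 c2] [c3 c4]].
exists f^`()%classic, f^`(2)%classic;split;[by []|by []| | |].
- move=> r rX;have rX' : r \in `]0, X[%R by rewrite in_itv.
 have rX2 : r \in `]0, X[%classic by rewrite inE.
 have E2 : f^`(2)%classic = (f^`()%classic)^`()%classic by [].
 split;[|rewrite E2|by apply: g2c].
 by rewrite derive1E;apply: derivableP;exact: fd.
 by rewrite derive1E;apply: derivableP;apply: g1d.
- have [|C1 C10 H1] := bnd_oo X0 _ c1 c2.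
 move=> r rX;have rX2 : r \in `]0, X[%classic by rewrite inE /= in_itv.
 by apply: (@der_continuous R _ r (f^`()%classic^`()%classic r));rewrite derive1E;apply: derivableP;apply: g1d.
 have [|C2 C20 H2] := bnd_oo X0 _ c3 c4.
 by move=> r rX;apply: g2c;rewrite inE /= in_itv.
 exists (C1 + C2) => [|r rX];first by rewrite addr_ge0.
 by split;[apply: le_trans (H1 r rX) _;rewrite lerDl|apply: le_trans (H2 r rX) _;rewrite lerDr].
- exact: derivable_oo_LRcontinuous_within.
Qed.

Lemma lip_closed f g1 (X C : R) : 0 <= C -> (forall r, 0 < r < X -> is_derive r 1 f (g1 r)) ->
 (forall r, 0 < r < X -> `|g1 r| <= C) -> {within `[0, X], continuous f} ->
 forall a b : R, 0 <= a -> a <= b -> b <= X -> `|f b - f a| <= C * (b - a).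
Proof.
move=> C0 fd fC fc a b a0 ab bX.
have [->|ne] := eqVneq a b;first by rewrite !subrr normr0 mulr0.
have ab' : a < b by rewrite lt_neqAle ne.
have inX x : x \in `]a, b[%R -> 0 < x < X.
 by rewrite in_itv /= => /andP[h1 h2];rewrite (le_lt_trans a0)//= (lt_le_trans h2).
have [x /inX xX||c /inX cX ->] := @MVT R f g1 a b ab';first exact: fd.
 by apply: continuous_subspaceW fc;apply: subset_itvScc.
by rewrite normrM (gtr0_norm (_ : 0 < b - a)) ?subr_gt0// ler_wpM2r ?subr_ge0// fC.
Qed.
End OneVar.

Lemma derivable_rel_cont {R : realType} (D : set R) (f : R -> R) (t : R) : derivable_rel D f t ->
 exists (l : R), forall e : R, 0 < e -> exists2 d : R, 0 < d & forall s : R, D s -> `|s - t| < d ->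
 `|f s - f t - l * (s - t)| <= e * `|s - t|.
Proof.
move=> [l Hl];exists l => e e0;move/cvgrPdist_le: Hl => /(_ e e0).
rewrite /within /= => -[d /= d0 Hd];exists d => // s Ds st.
have [->|sn] := eqVneq s t;first by rewrite !subrr mulr0 subrr normr0 mulr0.
have := Hd s;rewrite /ball_ /= distrC => /(_ st sn Ds).
have s0 : s - t != 0 by rewrite subr_eq0.
rewrite distrC => H;rewrite -(ler_pM2r (_ : 0 < `|s - t|^-1)) ?invr_gt0 ?normr_gt0//.
rewrite mulfK ?normr_eq0// -normfV -normrM mulrBl mulfK//.
Qed.

(** * From quasi-solutions to the obstacle problem *)

Section FromQuasi.
Context {R : realType}.
Notation mu := (@lebesgue_measure R).
Implicit Types (s t r x y e d : R).
Variables (j : R) (rho0 : R -> R) (T eps : R) (X : R -> R) (u : R -> R -> R).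
Hypotheses (Q : quasi_solution j rho0 T eps X u) (T0 : 0 < T).

(** Extended evenly in space and by zero beyond the edge, with time as first argument, to match
    [rough]. *)
Definition ubar t r : R := if (0 <= t < T) && (`|r| <= X t) then u `|r| t else 0.

Lemma X_lip : exists2 L : R, 0 <= L & forall s t, 0 <= s < T -> 0 <= t < T -> `|X s - X t| <= L * `|s - t|.
Proof.
have [M [_ HM]] := qs_X_lipschitz Q;exists (`|M| + 1) => [|s t hs ht];first by rewrite addr_ge0.
have := HM (`|M| + 1);rewrite (le_lt_trans (ler_norm M)) ?ltrDl// => /(_ isT).
by move=> /(_ (s, t));apply;split;rewrite /= in_itv.
Qed.

Lemma ubarE t r : 0 <= t < T -> 0 <= r -> r <= X t -> ubar t r = u r t.
Proof. by move=> tT r0 rX;rewrite /ubar tT ger0_norm// rX. Qed.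

Lemma ubar0 t r : X t < `|r| -> ubar t r = 0.
Proof. by move=> Xr;rewrite /ubar (leNgt `|r|) Xr andbF. Qed.

Lemma ubar_ge0 t r : 0 <= ubar t r.
Proof. by rewrite /ubar;case: ifPn => // /andP[tT rX];apply: (qs_u_ge0 Q) => //;rewrite normr_ge0. Qed.

Lemma X_cont t : 0 <= t < T -> forall e, 0 < e -> exists2 d : R, 0 < d &
 forall s, 0 <= s < T -> `|s - t| < d -> `|X s - X t| < e.
Proof.
move=> tT e e0;have [L L0 HL] := X_lip;have L1 : 0 < L + 1 by rewrite ltr_wpDl.
exists (e / (L + 1)) => [|s sT];first by rewrite divr_gt0.
rewrite ltr_pdivlMr// => h;apply: le_lt_trans (HL s t sT tT) (le_lt_trans _ h).
by rewrite mulrC ler_wpM2l// lerDl.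
Qed.

Lemma u_facts t : 0 <= t < T -> exists g1 g2 : R -> R, [/\ g1 = ((u ^~ t)^`())%classic, g2 = ((u ^~ t)^`(2))%classic,
 forall r, 0 < r < X t -> [/\ is_derive r 1 (u ^~ t) (g1 r), is_derive r 1 g1 (g2 r) & {for r, continuous g2}],
 exists2 C : R, 0 <= C & forall r, 0 < r < X t -> `|g1 r| <= C /\ `|g2 r| <= C &
 {within `[0, X t], continuous (u ^~ t)}].
Proof. by move=> tT;apply: C2_facts;[exact: (qs_X_gt0 Q)|exact: (qs_u_C2 Q)]. Qed.

Lemma u_bnd t : 0 <= t < T -> exists2 B : R, 0 <= B & forall r, ubar t r <= B.
Proof.
move=> tT;have [g1 [g2 [_ _ D [C C0 HC] c]]] := u_facts tT.
have L := lip_closed C0 (fun r h => let: And3 a _ _ := D r h in a) (fun r h => (HC r h).1) c.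
have X0 := qs_X_gt0 Q tT.
exists (`|u 0 t| + C * X t) => [|r];first by rewrite addr_ge0// mulr_ge0// ltW.
rewrite /ubar tT /=;case: ifPn => [rX|_];last by rewrite addr_ge0// mulr_ge0// ltW.
have := L 0 `|r| (lexx _) (normr_ge0 r) rX;rewrite subr0.
have : C * `|r| <= C * X t by rewrite ler_wpM2l.
by have := ler_norm (u 0 t);rewrite ler_norml => h1 h2 /andP[_ h3];lra.
Qed.

(* Continuity in time of the extended density; at [r = X t] it needs [u (X t) t = 0]. *)
Lemma ubar_t t r : 0 <= t < T -> (`|r| = X t -> u (X t) t = 0) -> forall e, 0 < e ->
 exists2 d : R, 0 < d & forall s, 0 <= s < T -> `|s - t| < d -> `|ubar s r - ubar t r| < e.
Proof.
move=> tT H e e0;have [rX|Xr] := leP `|r| (X t);last first.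
 have d0 : 0 < `|r| - X t by rewrite subr_gt0.
 have [d d'0 Hd] := X_cont tT d0;exists d => // s sT st.
 rewrite (ubar0 Xr) ubar0 ?subrr ?normr0//.
 by have := Hd s sT st;rewrite ltr_norml => /andP[_];rewrite ltrD2r.
have [|l Hl] := derivable_rel_cont (qs_u_time Q (r := `|r|) tT _);first by rewrite normr_ge0.
have [d1 d10 H1] := Hl 1 ltr01.
have K0 : 0 < `|l| + 1 + 1 by rewrite ltr_wpDl// addr_ge0.
pose d2 := e / (`|l| + 1 + 1);have d20 : 0 < d2 by rewrite divr_gt0.
have close s : 0 <= s < T -> `|r| <= X s -> `|s - t| < d1 -> `|s - t| < d2 -> `|ubar s r - ubar t r| < e.
 move=> sT rXs s1 s2;rewrite /ubar sT tT rX rXs /=.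
 have := H1 s (conj sT rXs) s1;rewrite mul1r => B.
 have st0 := normr_ge0 (s - t).
 rewrite (_ : _ - _ = (u `|r| s - u `|r| t - l * (s - t)) + l * (s - t));last by rewrite subrK.
 apply: le_lt_trans (ler_normD _ _) _;rewrite normrM.
 by move: s2;rewrite ltr_pdivlMr// mulrC !mulrDl !mul1r;lra.
have [rX'|rX'] := ltP `|r| (X t).
 have d0 : 0 < X t - `|r| by rewrite subr_gt0.
 have [d3 d30 H3] := X_cont tT d0;exists (Num.min d3 (Num.min d1 d2)) => [|s sT];first by rewrite !lt_min d30 d10.
 rewrite !lt_min => /andP[s3 /andP[s1 s2]];apply: close => //.
 by have := H3 s sT s3;rewrite ltr_norml => /andP[h _];lra.
have rE : `|r| = X t by apply/eqP;rewrite eq_le rX rX'.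
exists (Num.min d1 d2) => [|s sT];first by rewrite !lt_min d10.
rewrite !lt_min => /andP[s1 s2];have [rXs|Xsr] := leP `|r| (X s);first exact: close.
by rewrite (ubar0 Xsr) /ubar tT rE lexx /= H// subrr normr0.
Qed.

Lemma ubar_mass t : 0 <= t < T -> \int[mu]_(y in `[0, X t]) ubar t y = mass X u t.
Proof. by move=> tT;apply: eq_I => y;rewrite /= in_itv /= => /andP[y0 yX];rewrite ubarE. Qed.

Lemma mass_eps t : 0 <= t < T -> `|mass X u t - mass X u 0| <= eps.
Proof.
move=> tT;rewrite -lee_fin;apply: le_trans (qs_mass Q).
by apply: ereal_sup_ubound;exists t => //;rewrite /= in_itv.
Qed.

Lemma ubar_meas t : 0 <= t < T -> itg setT (ubar t).
Proof.
move=> tT;have [g1 [g2 [_ _ _ _ c]]] := u_facts tT;have X0 := qs_X_gt0 Q tT.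
have [B B0 HB] := u_bnd tT.
have mI : measurable (`[- X t, X t]%classic : set R) by exact: measurable_itv.
apply: (i_supp mI).
 move=> y;rewrite /= in_itv /= => h;apply: ubar0;rewrite ltNge;apply/negP => yX;apply: h.
 by rewrite -ler_norml.
apply: (@i_itv_bnd _ _ _ _ B) => [|y _];last by rewrite ger0_norm ?ubar_ge0.
have cc : cont_on 0 (X t) (u ^~ t).
 move=> x hx e e0;have /subspace_continuousP/(_ x) := c.
 rewrite /= in_itv /= => /(_ hx) /cvgrPdist_lt /(_ e e0) [d /= d0 Hd].
 exists d => // y hy yx;rewrite distrC;apply: Hd;rewrite /ball_ /= ?in_itv//= distrC//.
apply: (@eq_measurable_fun _ _ _ _ _ (fun y => u (clamp 0 (X t) `|y|) t)).
 move=> y;rewrite inE /= in_itv /= => hy;rewrite /ubar tT /= ler_norml hy clamp_id//.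
 by rewrite normr_ge0 ler_norml.
apply: cont_eps_meas => // x e e0.
have [d d0 Hd] := cont_on_clamp (ltW X0) cc `|x| e0;exists d => // y yx.
by apply: Hd;apply: le_lt_trans yx;exact: ler_dist_dist.
Qed.

Lemma ubar_I0 t : 0 <= t < T -> forall m : R, X t <= m -> \int[mu]_(y in `[0, m]) ubar t y = mass X u t.
Proof.
move=> tT m Xm;rewrite -ubar_mass//;have X0 := qs_X_gt0 Q tT.
have i1 a b : itg `[a, b] (ubar t) by apply: integrableS (ubar_meas tT).
rewrite (I_split (ltW X0) Xm)// -[X in _ + X]Rintegral_itv_obnd_cbnd;last first.
 by apply: integrableS (ubar_meas tT).
rewrite (@eq_I _ `]X t, m] _ (fun=> 0)) => [|y];first by rewrite Rintegral_cst// mul0r addr0.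
rewrite /= in_itv /= => /andP[Xy _];apply: ubar0.
by apply: lt_le_trans Xy (ler_norm _).
Qed.

Lemma ubar_I t c d : 0 <= t < T -> 0 <= c -> \int[mu]_(y in `[c, d]) ubar t y <= mass X u t.
Proof.
move=> tT c0;have X0 := qs_X_gt0 Q tT.
have i1 a b : itg `[a, b] (ubar t) by apply: integrableS (ubar_meas tT).
have p a b : 0 <= \int[mu]_(y in `[a, b]) ubar t y by apply: I_ge0 => y _;exact: ubar_ge0.
have [dc|cd] := ltP d c.
 rewrite set_itv_ge -?leNgt ?bnd_simp -?ltNge// Rintegral_set0 -ubar_mass//.
pose m : R := Num.max d (X t).
rewrite -(@ubar_I0 t tT m) ?le_max ?lexx ?orbT//.
have dm : d <= m by rewrite le_max lexx.
rewrite (I_split c0 (le_trans cd dm))// (I_split cd dm)//.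
by have := p 0 c;have := p d m;lra.
Qed.

Lemma quasi_rough : rough j T X ubar.
Proof.
have w t : 0 < t < T -> 0 <= t < T by move=> /andP[/ltW -> ->].
split.
- exact: (qs_X_gt0 Q).
- have [L L0 HL] := X_lip;exists (X 0 + L * T) => t /[dup] tT /andP[t0 tT'].
 have z : 0 <= (0 : R) < T by rewrite lexx.
 have := HL t 0 tT z;rewrite subr0 (ger0_norm t0) ler_norml => /andP[_ h].
 have : L * t <= L * T by rewrite ler_wpM2l// ltW.
 lra.
- move=> t /[dup] tT /andP[t0 tT'] e e0;have [d d0 Hd] := X_cont (w t tT) e0.
 exists (Num.min d (Num.min t (T - t))) => [|s];first by rewrite !lt_min d0 t0 subr_gt0.
 rewrite !lt_min => /andP[sd /andP[s1 s2]];apply: Hd => //.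
 by move: s1 s2;rewrite !ltr_norml => /andP[h1 _] /andP[_ h2];apply/andP;split;lra.
- exact: ubar_ge0.
- move=> t r tT Xr;have [rX|] := ltP (X t) `|r|;first exact: ubar0.
 move=> rX;have E : `|r| = X t by apply/eqP;rewrite eq_le rX Xr.
 by rewrite /ubar w// E lexx /=;exact: (qs_dirichlet Q).
- move=> t tT;have [g1 [g2 [_ _ D [C C0 HC] c]]] := u_facts (w t tT).
 have L := lip_closed C0 (fun r h => let: And3 a _ _ := D r h in a) (fun r h => (HC r h).1) c.
 have X0 := qs_X_gt0 Q (w t tT).
 exists (Num.bound C) => r r'.
 have E y : ubar t y = u (clamp 0 (X t) `|y|) t.
 rewrite /ubar (w t tT) /=;case: leP => h;first by rewrite clamp_id// normr_ge0.
 by rewrite /clamp (min_idPl (ltW h)) (max_idPr (ltW X0)) (qs_dirichlet Q).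
 have CB : C <= (Num.bound C)%:R := ltW (archi_boundP C0).
 have key a b : `|u (clamp 0 (X t) a) t - u (clamp 0 (X t) b) t| <= C * `|a - b|.
 apply: (@le_trans _ _ (C * `|clamp 0 (X t) a - clamp 0 (X t) b|));last first.
 by rewrite ler_wpM2l// clamp_lip.
 have /andP[a1 a2] := clamp_in a (ltW X0);have /andP[b1 b2] := clamp_in b (ltW X0).
 have [ab|/ltW ab] := leP (clamp 0 (X t) b) (clamp 0 (X t) a).
 by rewrite (ger0_norm (_ : 0 <= clamp 0 (X t) a - _)) ?subr_ge0//;apply: L.
 by rewrite distrC (distrC (clamp 0 (X t) a)) (ger0_norm (_ : 0 <= clamp 0 (X t) b - _)) ?subr_ge0//;apply: L.
 rewrite !E;apply: le_trans (key _ _) _;apply: le_trans (_ : C * `|r - r'| <= _).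
 by rewrite ler_wpM2l// ler_dist_dist.
 by rewrite ler_wpM2r.
- move=> t r /[dup] tT /andP[t0 tT'] e e0;have [|d d0 Hd] := @ubar_t t r (w t tT) _ e e0.
 by move=> _;exact: (qs_dirichlet Q).
 exists (Num.min d (Num.min t (T - t))) => [|s];first by rewrite !lt_min d0 t0 subr_gt0.
 rewrite !lt_min => /andP[sd /andP[s1 s2]];apply: Hd => //.
 by move: s1 s2;rewrite !ltr_norml => /andP[h1 _] /andP[_ h2];apply/andP;split;lra.
- move=> t /[dup] tT /andP[t0 tT'];have [g1 [g2 [E1 E2 D [C C0 HC] c]]] := u_facts (w t tT).
 have X0 := qs_X_gt0 Q (w t tT).
 exists g1, g2;split.
 + move=> r /[dup] rX /andP[r0 rX'];have [D1 D2' _] := D r rX;split=> //.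
 apply: (@der_ext R (u ^~ t) _ r _ (Num.min r (X t - r))) => //;first by rewrite lt_min r0 subr_gt0.
 move=> y;rewrite lt_min !ltr_norml => /andP[/andP[y1 y2] /andP[y3 y4]].
 by rewrite ubarE//;[exact: w|lra|lra].
 + move=> r /[dup] rX /andP[r0 rX'].
 have [|l Hl] := derivable_rel_cont (qs_u_time Q (r := r) (w t tT) _);first by rewrite !ltW.
 have d0 : 0 < X t - r by rewrite subr_gt0.
 have [d3 d30 H3] := X_cont (w t tT) d0.
 pose dm : R := Num.min d3 (Num.min t (T - t)).
 have dm0 : 0 < dm by rewrite !lt_min d30 t0 subr_gt0.
 have inD s : `|s - t| < dm -> 0 <= s < T /\ r <= X s.
 rewrite !lt_min => /andP[s3 /andP[s1 s2]].
 have sT : 0 <= s < T by move: s1 s2;rewrite !ltr_norml => /andP[h1 _] /andP[_ h2];apply/andP;split;lra.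
 by split => //;have := H3 s sT s3;rewrite ltr_norml => /andP[h _];lra.
 have Du : is_derive t 1 (u r) l.
 apply/is_derive_epsP => e e0;have [d d'0 Hd] := Hl e e0.
 exists (Num.min d dm) => [|s];first by rewrite lt_min d'0.
 by rewrite lt_min => /andP[sd /inD sm];exact: Hd.
 have lE : l = 2^-1 * g2 r.
 by rewrite E2 -(qs_heat Q tT rX) derive1E;have [_ ->] := Du.
 rewrite -lE;apply: (@der_ext R (u r) _ t _ dm) => // s /inD[sT rXs].
 by rewrite ubarE// ltW.
 + by exists C => r /HC[].
 + by move=> r /D[].
 + move=> e e0;have := qs_flux Q tT;rewrite -E1 => /cvg_right_eps /(_ e e0)[d d0 Hd].
 exists (Num.min d (X t)) => [|h /andP[h0]];first by rewrite lt_min d0.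
 rewrite lt_min => /andP[hd hX].
 rewrite !ubarE ?w ?lexx ?(ltW h0) ?(ltW hX) ?(ltW X0)//.
 have [x xh||x xh E] := @MVT R (u ^~ t) g1 0 h h0.
 * have xX : 0 < x < X t by move: xh;rewrite in_itv /= => /andP[-> /lt_trans];apply.
 by have [] := D x xX.
 * by apply: continuous_subspaceW c;apply: subset_itvScc => //;exact: ltW.
 rewrite E subr0 -mulrBl normrM (gtr0_norm h0) ler_pM2r//;apply: Hd.
 by move: xh;rewrite in_itv /= add0r => /andP[-> /lt_trans];apply.
- exists (mass X u 0 + eps) => t c d tT c0;apply: le_trans (ubar_I _ (w t tT) c0) _.
 by have := mass_eps (w t tT);rewrite ler_norml => /andP[_];lra.
Qed.

Lemma quasi_rough0 : rough0 X ubar.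
Proof.
have z : 0 <= (0 : R) < T by rewrite lexx.
have pos s (h : R) : 0 < s < h -> h <= T -> 0 <= s < T.
 by move=> /andP[/ltW -> sh] hT;exact: lt_le_trans hT.
split.
- exact: i_meas (ubar_meas z).
- exact: u_bnd.
- by move=> r Xr;apply: ubar0;apply: lt_le_trans Xr (ler_norm _).
- move=> r r0;have [rX|rX] := eqVneq `|r| (X 0);last first.
 have [|d d0 Hd] := @ubar_t 0 r z _ 1 ltr01;first by move=> E;rewrite E eqxx in rX.
 exists (Num.min d T) => [|s /[dup] sd /andP[s0]];first by rewrite lt_min d0.
 rewrite lt_min => /andP[s1 s2];have := Hd s;rewrite subr0 (gtr0_norm s0) (ltW s0) s2 => /(_ isT s1).
 by rewrite ltr_norml => /andP[_];rewrite ltrBlDl => /ltW;rewrite addrC.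
 (* At the edge itself the time derivative is taken only among times with [r <= X s]; at the other
    times the density is [0], so an upper bound survives. *)
 have rX0 : r <= X 0 by rewrite -rX ler_norm.
 have [|l Hl] := derivable_rel_cont (qs_u_time Q (r := r) z _);first by rewrite r0.
 have [d d0 Hd] := Hl 1 ltr01.
 have K0 : 0 < `|l| + 1 by rewrite ltr_wpDl.
 exists (Num.min (Num.min d T) (`|l| + 1)^-1) => [|s /andP[s0]];first by rewrite !lt_min d0 T0 invr_gt0.
 rewrite !lt_min => /andP[/andP[sd sT] sl].
 have sT' : 0 <= s < T by rewrite ltW.
 have [rXs|Xsr] := leP r (X s);last by rewrite (ubar0 (lt_le_trans Xsr (ler_norm _))) addr_ge0// ubar_ge0.
 rewrite !ubarE//;have := Hd s (conj sT' rXs);rewrite subr0 (gtr0_norm s0) => /(_ sd);rewrite mul1r => B.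
 have : s * (`|l| + 1) <= 1 by rewrite -ler_pdivlMr// div1r ltW.
 have : l * s <= `|l| * s by rewrite ler_pM2r// ler_norm.
 by move: B;rewrite ler_norml mulrDr mulr1 (mulrC s) => /andP[_];lra.
- move=> r r0 rX e e0;have [|d d0 Hd] := @ubar_t 0 r z _ e e0.
 by rewrite ger0_norm// => E;rewrite E eqxx in rX.
 exists (Num.min d T) => [|s /andP[s0]];first by rewrite lt_min d0.
 by rewrite lt_min => /andP[s1 s2];apply: Hd;rewrite ?subr0 ?(gtr0_norm s0)// ltW.
Qed.

Lemma quasi_flow : flow j T X (VV ubar).
Proof. exact: rough_flow quasi_rough quasi_rough0. Qed.

End FromQuasi.

(** * Existence of quasi-solutions *)

Section Reflection.
Context {R : realType}.
Notation mu := (@lebesgue_measure R).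
Implicit Types (f : R -> R).

Let mopp : measurable_fun setT (fun x : R => - x).
Proof. by apply: cont_measurable => // x;eexists;exact: derN (derI x). Qed.

Lemma mu_opp (A : set R) : measurable A -> pushforward mu (fun x : R => - x) A = mu A.
Proof.
move=> mA;apply/esym;apply: (@lebesgue_measure_unique R (pushforward mu (fun x : measurableTypeR R => - x : measurableTypeR R))) => //.
move=> _ [[a b] /= _ <-];rewrite /pushforward.
rewrite (_ : (fun x : R => - x) @^-1` `]a, b] = `[- b, - a[%classic);last first.
 by apply/seteqP;split => x /=;rewrite !in_itv /= => /andP[h1 h2];rewrite lerNl ltrNr h1 h2.
by rewrite !lebesgue_measure_itv /= !lte_fin ltrN2 opprK addrC.
Qed.

Lemma i_refl f : itg setT f -> itg setT (fun y => f (- y)).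
Proof.
move=> fi;have mf : measurable_fun setT f := i_meas fi.
apply/integrableP;split;first by apply/measurable_EFinP;exact: (measurableT_comp mf mopp).
have /integrableP[_] := fi;congr (_ < _)%E.
rewrite (eq_measure_integral (pushforward mu (fun x : measurableTypeR R => - x : measurableTypeR R)));last first.
 by move=> A mA _;apply/esym;exact: mu_opp.
rewrite ge0_integral_pushforward//;do ?[exact: mopp].
by apply/measurableT_comp => //;exact/measurable_EFinP.
Qed.

Lemma I_refl f : itg setT f -> \int[mu]_y f (- y) = \int[mu]_y f y.
Proof.
move=> fi;have mf : measurable_fun setT f := i_meas fi.
rewrite /Rintegral;congr fine.
rewrite [RHS](eq_measure_integral (pushforward mu (fun x : measurableTypeR R => - x : measurableTypeR R)));last first.
 by move=> A mA _;apply/esym;exact: mu_opp.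
rewrite integral_pushforward//;do ?[exact: mopp].
- by apply/measurable_EFinP.
- exact: i_refl.
Qed.
End Reflection.

Section Dual.
Context {R : realType}.
Notation mu := (@lebesgue_measure R).
Implicit Types (s t x y z : R) (F phi : R -> R).

Lemma hk_meas t : measurable_fun setT (hk t : R -> R).
Proof. by apply: cont_measurable => // x;eexists;exact: hk_der_x. Qed.

Lemma fine_int F (D : set R) : itg D F -> measurable D ->
 ((\int[mu]_(y in D) F y)%:E = \int[mu]_(y in D) (F y)%:E)%E.
Proof. by move=> Fi mD;rewrite /Rintegral fineK//;exact: integrable_fin_num. Qed.

(** Fubini's theorem, the unit mass of the kernel giving absolute integrability. The test function
    is later [1], for conservation of the integral, or a kernel, for the semigroup law. *)
Lemma heat_dual F phi s (C : R) : 0 < s -> itg setT F ->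
 measurable_fun setT phi -> (forall y, `|phi y| <= C) ->
 itg setT (fun y => heat F s y * phi y) /\
 \int[mu]_y (heat F s y * phi y) = \int[mu]_z (F z * \int[mu]_y (hk s (y - z) * phi y)).
Proof.
move=> s0 iF mphi Hphi;have C0 : 0 <= C by apply: le_trans (Hphi 0).
have mF := i_meas iF.
pose G (p : R * R) : R := F p.1 * hk s (p.2 - p.1) * phi p.2.
have mG : measurable_fun setT (G : measurableTypeR R * measurableTypeR R -> R).
 apply: measurable_funM;first apply: measurable_funM.
 - exact: (measurableT_comp mF measurable_fst).
 - apply: (measurableT_comp (hk_meas s)).
 by apply: measurable_funB;[exact: measurable_snd|exact: measurable_fst].
 - exact: (measurableT_comp mphi measurable_snd).
have hki z : itg setT (fun y => hk s (y - z)).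
 apply: (@i_le R setT _ (fun y => hk s (z - y))) => //;last exact: hk_shift_int.
 apply: (measurableT_comp (hk_meas s));apply: measurable_funB => //.
 by move=> y _;rewrite ger0_norm ?hk_ge0// -hkN opprB.
have hkI z : \int[mu]_y hk s (y - z) = 1.
 by rewrite -(hk_shift_int1 z s0);apply: eq_I => y _;rewrite -hkN opprB.
have iy z : itg setT (fun y => hk s (y - z) * phi y).
 apply: (@i_le R setT _ (fun y => C * hk s (y - z))) => //;last exact: iZ.
 by apply: measurable_funM => //;exact: i_meas (hki z).
 by move=> y _;rewrite normrM ger0_norm ?hk_ge0// mulrC ler_wpM2r ?hk_ge0.
have iGy z : itg setT (fun y => G (z, y)).
 have := iZ (F z) measurableT (iy z);apply: eq_integrable => // y _.
 by rewrite /G /= mulrA.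
have iGz y : itg setT (fun z => G (z, y)).
 have := iZ (phi y) measurableT (heat_int iF y s0);apply: eq_integrable => // z _.
 by rewrite /G /= mulrC.
have lty : (\int[mu]_z \int[mu]_y `|(G (z, y))%:E| < +oo)%E.
 have CF : itg setT (fun z => C * `|F z|) by apply: iZ => //;exact: iabs.
 apply: le_lt_trans (_ : \int[mu]_z (C * `|F z|)%:E < +oo)%E;last first.
 have /integrableP[_] := CF;congr (_ < _)%E;apply: eq_integral => z _.
 by rewrite /= ger0_norm// mulr_ge0.
 apply: ge0_le_integral => //.
 - by move=> z _;apply: integral_ge0.
 - apply: (measurable_fun_fubini_tonelli_F (abse \o (EFin \o (G : measurableTypeR R * measurableTypeR R -> R)))) => //=.
 by apply: measurableT_comp => //;exact/measurable_EFinP.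
 - exact: (measurable_int _ CF).
 - move=> z _;have iG := iabs measurableT (iGy z).
 rewrite [leLHS](_ : _ = (\int[mu]_y `|G (z, y)|)%:E);last by rewrite fine_int.
 rewrite lee_fin.
 apply: (@le_trans _ _ (\int[mu]_y (`|F z| * C * hk s (y - z)))).
 apply: le_I => //;first exact: iZ.
 move=> y _;rewrite /G /= !normrM (ger0_norm (hk_ge0 _ _)) mulrAC ler_wpM2r ?hk_ge0//.
 by rewrite ler_wpM2l.
 by rewrite IZ// hkI mulr1 mulrC.
have iG : (mu \x mu)%E.-integrable setT (EFin \o (G : measurableTypeR R * measurableTypeR R -> R)).
 by apply/integrable12ltyP => //;exact/measurable_EFinP.
have E y : \int[mu]_z G (z, y) = heat F s y * phi y.
 rewrite /heat s0 UU00E mulrC -IZ//;last exact: heat_int.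
 by apply: eq_I => z _;rewrite /G /= mulrC.
have E' z : \int[mu]_y G (z, y) = F z * \int[mu]_y (hk s (y - z) * phi y).
 by rewrite -IZ//;apply: eq_I => y _;rewrite /G /= mulrA.
have K1 : (fun y => (heat F s y * phi y)%:E) = (fun y => \int[mu]_z (G (z, y))%:E)%E.
 by apply/funext => y;rewrite -E fine_int.
have K2 : (fun z => (F z * \int[mu]_y (hk s (y - z) * phi y))%:E) = (fun z => \int[mu]_y (G (z, y))%:E)%E.
 by apply/funext => z;rewrite -E' fine_int.
split.
 have mGe : measurable_fun setT (EFin \o (G : measurableTypeR R * measurableTypeR R -> R)) by exact/measurable_EFinP.
 apply/integrableP;split.
 apply/measurable_EFinP;apply: measurable_funM => //;apply: cont_measurable => // y.
 by eexists;exact: heat_der_x.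
 apply: le_lt_trans ((integrable21ltyP mu mu mGe).1 iG).
 apply: ge0_le_integral => //.
 - apply: measurableT_comp => //;apply/measurable_EFinP;apply: measurable_funM => //;apply: cont_measurable => // y.
 by eexists;exact: heat_der_x.
 - apply: (measurable_fun_fubini_tonelli_G (abse \o (EFin \o (G : measurableTypeR R * measurableTypeR R -> R)))) => //=.
 by apply: measurableT_comp.
 - move=> y _;have -> : (EFin \o (fun y => heat F s y * phi y)) y = (\int[mu]_z (G (z, y))%:E)%E by rewrite /= -E fine_int.
 apply: le_abse_integral => //.
 by apply/measurable_EFinP;exact: i_meas (iGz y).
rewrite /Rintegral;congr fine;rewrite K1 K2;apply/esym;exact: (Fubini iG).
Qed.

Lemma heat_i F s : 0 < s -> itg setT F -> itg setT (heat F s).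
Proof.
move=> s0 iF;have [||H _] := @heat_dual F (fun=> 1) s 1 s0 iF;[exact: measurable_cst|by move=> y;rewrite normr1|].
by apply: eq_integrable H => // y _;rewrite /= mulr1.
Qed.

Lemma heat_I F s : 0 < s -> itg setT F -> \int[mu]_y heat F s y = \int[mu]_y F y.
Proof.
move=> s0 iF;have [||_ H] := @heat_dual F (fun=> 1) s 1 s0 iF;[exact: measurable_cst|by move=> y;rewrite normr1|].
rewrite (_ : \int[mu]_y heat F s y = \int[mu]_y (heat F s y * 1));last by apply: eq_I => y _;rewrite mulr1.
rewrite H;apply: eq_I => z _.
rewrite (_ : \int[mu]_y (hk s (y - z) * 1) = 1) ?mulr1//;apply: etrans (hk_shift_int1 z s0).
by apply: eq_I => y _;rewrite mulr1 -hkN opprB.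
Qed.

(** Completing the square: [m] and [v] are the mean and variance, at time [s], of the Brownian
    bridge going from [z] to [x] in time [s + t]. *)
Lemma hk_conv s t x z : 0 < s -> 0 < t -> \int[mu]_y (hk s (y - z) * hk t (x - y)) = hk (s + t) (x - z).
Proof.
move=> s0 t0;have st0 : 0 < s + t by rewrite addr_gt0.
pose v := s * t / (s + t);have v0 : 0 < v by rewrite divr_gt0// mulr_gt0.
pose m := (t * z + s * x) / (s + t).
have E y : hk s (y - z) * hk t (x - y) = hk (s + t) (x - z) * hk v (m - y).
 rewrite /hk s0 t0 st0 v0;set c := (Num.sqrt (2 * pi))^-1.
 have -> : (Num.sqrt v)^-1 = (Num.sqrt s)^-1 * (Num.sqrt t)^-1 * Num.sqrt (s + t).
 by rewrite /v sqrtrM ?mulr_ge0 ?ltW// sqrtrM ?ltW// sqrtrV ?ltW// invfM invrK invfM.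
 have n0 : Num.sqrt (s + t) != 0 by rewrite gt_eqF// sqrtr_gt0.
 have X : expR (- ((y - z) ^+ 2 / (2 * s))) * expR (- ((x - y) ^+ 2 / (2 * t))) =
 expR (- ((x - z) ^+ 2 / (2 * (s + t)))) * expR (- ((m - y) ^+ 2 / (2 * v))).
 rewrite -!expRD;congr expR;rewrite /m /v;field.
 by rewrite !gt_eqF.
 rewrite mulrACA X [RHS]mulrACA;congr (_ * _);field.
 by rewrite !gt_eqF ?sqrtr_gt0.
rewrite (eq_I (g := fun y => hk (s + t) (x - z) * hk v (m - y)));last by move=> y _;exact: E.
by rewrite IZ ?hk_shift_int1 ?mulr1//;exact: hk_shift_int.
Qed.

Lemma heat_pos (F : R -> R) t x : 0 < t -> heat F t x = UU F 0 0 t x.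
Proof. by rewrite /heat => ->. Qed.

Lemma heat_CK F s t x : 0 < s -> 0 < t -> itg setT F ->
 heat (heat F s) t x = heat F (s + t) x.
Proof.
move=> s0 t0 iF;rewrite (heat_pos (heat F s) x t0) (heat_pos F x (addr_gt0 s0 t0)) (UU00E (heat F s)) (UU00E F).
have [||_ ->] := @heat_dual F (fun y => hk t (x - y)) s (Num.sqrt t)^-1 s0 iF.
- by apply: (measurableT_comp (hk_meas t));apply: measurable_funB.
- by move=> y;rewrite ger0_norm ?hk_ge0//;exact: hk_le_sqrt.
by apply: eq_I => z _;rewrite hk_conv.
Qed.
End Dual.

Lemma FTC2 {R : realType} (f F : R -> R) (a b : R) : a <= b -> (forall x : R, is_derive x 1 F (f x)) ->
 (forall x : R, {for x, continuous f}) -> \int[@lebesgue_measure R]_(x in `[a, b]) f x = F b - F a.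
Proof.
move=> ab D c;have [->|ne] := eqVneq a b;first by rewrite I_set1 subrr.
have ab' : a < b by rewrite lt_neqAle ne.
have cF x : {for x, continuous F} := der_continuous (D x).
have -> : F b - F a = fine ((F b)%:E - (F a)%:E)%E by [].
rewrite /Rintegral (@continuous_FTC2 R f F a b ab')//.
- by apply: continuous_subspaceT.
- split;first by move=> x _;have [] := D x.
 by apply: cvg_at_right_filter;exact: cF.
 by apply: cvg_at_left_filter;exact: cF.
- by move=> x _;rewrite derive1E;have [] := D x.
Qed.

Section Source.
Context {R : realType}.
Notation mu := (@lebesgue_measure R).
Implicit Types (s t x y z u v : R).

(** Distribution function of the centred Gaussian of variance [t]. *)
Definition NN t x : R := \int[mu]_(y in `]-oo, x]) hk t y.

Lemma NN_der_x t x : 0 < t -> is_derive x 1 (NN t) (hk t x).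
Proof.
move=> t0;have iu : mu.-integrable [set` Interval (BInfty R true) (BRight (x + 1))] (EFin \o hk t).
 by apply: integrableS (hk_int t0).
have [|||d1 d2] := @continuous_FTC1 R (hk t) (BInfty R true) x (x + 1) _ iu.
- by rewrite ltrDl.
- by first [exact: ltNyr | (rewrite lteBSide;done) | (rewrite ltBSide;done) | (rewrite /Order.lt /=;done) | done].
- exact: der_continuous (hk_der_x t x).
by rewrite -d2 derive1E;apply: derivableP.
Qed.

Lemma half_line (f : R -> R) x : itg setT f ->
 \int[mu]_y f y = \int[mu]_(y in `]-oo, x]) f y + \int[mu]_(y in `[x, +oo[) f y.
Proof.
move=> fi;have i1 : mu.-integrable `]x, +oo[ (EFin \o f) by apply: integrableS fi.
rewrite -(Rintegral_itv_obnd_cbnd i1).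
rewrite (_ : setT = `]-oo, x] `|` `]x, +oo[);last first.
 apply/esym/seteqP;split => // y _ /=;rewrite !in_itv /= andbT.
 by have [h|h] := leP y x;[left|right].
have iU : mu.-integrable (`]-oo, x] `|` `]x, +oo[) (EFin \o f).
 by apply: integrableS fi => //;apply: measurableU.
apply: Rintegral_setU => //.
apply/disj_setPS => y [] /=;rewrite !in_itv /= andbT => h1 h2.
by move: (lt_le_trans h2 h1);rewrite ltxx.
Qed.

Lemma NN_N t x : 0 < t -> NN t (- x) = 1 - NN t x.
Proof.
move=> t0;have := half_line x (hk_int t0);rewrite hk_int1// => H.
have -> : 1 - NN t x = \int[mu]_(y in `[x, +oo[) hk t y by rewrite H /NN addrAC subrr add0r.
rewrite /NN Rintegral_mkcond [RHS]Rintegral_mkcond -I_refl;last first.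
 have mD : measurable (`]-oo, - x]%classic : set R) by exact: measurable_itv.
 have iD' : mu.-integrable `]-oo, - x] (EFin \o hk t) by apply: integrableS (hk_int t0).
 have := @integrable_mkcond _ (measurableTypeR R) R mu `]-oo, - x] (EFin \o hk t) mD.
 case=> /(_ iD') + _;apply: eq_integrable => // y _.
 by rewrite /= !patchE;case: ifP.
apply: eq_I => y _;rewrite !patchE hkN.
by congr (if _ then _ else _);apply/idP/idP;rewrite !inE /= !in_itv /= !andbT;rewrite ?lerN2 // ?(lerNl, lerNr) ?opprK // => h;lra.
Qed.

Lemma NN0 t : 0 < t -> NN t 0 = 2^-1.
Proof. by move=> t0;have := NN_N 0 t0;rewrite oppr0;lra. Qed.

Lemma NN_ge0 t x : 0 <= NN t x.
Proof. by apply: I_ge0 => y _;exact: hk_ge0. Qed.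

Lemma NN_le1 t x : 0 < t -> NN t x <= 1.
Proof. by move=> t0;have := NN_ge0 t (- x);rewrite NN_N// subr_ge0. Qed.

Lemma NN_sub t x : 0 < t -> 0 <= x -> NN t x = 2^-1 + \int[mu]_(y in `[0, x]) hk t y.
Proof.
move=> t0 x0;rewrite -(NN0 t0) /NN.
have ix : mu.-integrable [set` Interval (BInfty R true) (BRight x)] (EFin \o hk t) by apply: integrableS (hk_int t0).
have i0x : mu.-integrable `]0, x] (EFin \o hk t) by apply: integrableS (hk_int t0).
by have := @Rintegral_itvB R (hk t) _ _ 0 ix;rewrite !bnd_simp => /(_ isT x0);rewrite Rintegral_itv_obnd_cbnd//;lra.
Qed.

(** By the heat equation the time derivative of the kernel is the space derivative of
    [- kk 1 1 / 2], which integrates over [[0, y]] to a boundary term; negative arguments follow by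
    symmetry. *)
Lemma NN_der_t t x : 0 < t -> is_derive t 1 (fun s => NN s x) (- (2^-1) * kk 1 1 t x).
Proof.
move=> t0.
have pos y : 0 <= y -> is_derive t 1 (fun s => NN s y) (- (2^-1) * kk 1 1 t y).
 move=> y0;pose D t' z : R := 2^-1 * kk 2 2 t' z - 2^-1 * kk 0 1 t' z.
 have t20 : 0 < t / 2 by rewrite divr_gt0.
 have T0 : 0 < t * 2 by rewrite mulr_gt0.
 have [C1 C10 HC1] := @kk_bound R 2 2 (t * 2) (t / 2) 1 isT T0 t20 ltr01.
 have [C2 C20 HC2] := @kk_bound R 0 1 (t * 2) (t / 2) 1 isT T0 t20 ltr01.
 have near s : `|s - t| < t / 2 -> t / 2 <= s /\ s <= t * 2.
 by rewrite ltr_norml => /andP[h1 h2];split;lra.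
 have DF : is_derive t 1 (fun s => \int[mu]_(z in `[0, y]) hk s z) (\int[mu]_(z in `[0, y]) D t z).
 apply: (@der_under R `[0, y] (fun s z => hk s z) D (fun=> C1 + C2) t (t / 2)) => //.
 - by move=> s /near[h1 _];apply: integrableS (hk_int (lt_le_trans t20 h1)).
 - move=> s z /near[h1 _] _;have s0 := lt_le_trans t20 h1.
 apply: (@der_ext R (fun s => kk 0 0 s z) _ s _ 1) => //;first by move=> s' _;rewrite kk00.
 by apply: (derE (@kk_der_t R 0 0 s z isT (or_introl s0)));rewrite /D add0r.
 - exact: i_cst.
 - move=> s z /near[h1 h2] _;rewrite /D;apply: le_trans (ler_normB _ _) _.
 have := HC1 s z h2 (or_introl h1);have := HC2 s z h2 (or_introl h1).
 by rewrite !normrM !(gtr0_norm (_ : 0 < 2^-1 :> R))//;lra.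
 have I1 : \int[mu]_(z in `[0, y]) D t z = - (2^-1) * kk 1 1 t y.
 have dF z : is_derive z 1 (fun z => - (2^-1) * kk 1 1 t z) (D t z).
 by apply: (derE (derZ (- 2^-1) (kk_der_x 1 1 t z)));rewrite /D /=;ring.
 have cD z : {for z, continuous (D t)}.
 exact: der_continuous (derB (derZ 2^-1 (kk_der_x 2 2 t z)) (derZ 2^-1 (kk_der_x 0 1 t z))).
 by rewrite (FTC2 y0 dF cD) [X in _ - _ * X]/kk expr1 mul0r mul0r mulr0 subr0.
 rewrite -I1;apply: (@der_ext R (fun s => 2^-1 + \int[mu]_(z in `[0, y]) hk s z) _ t _ (t / 2)) => //.
 by move=> s /near[h1 _];rewrite NN_sub//;lra.
 by apply: (derE (derD (derC 2^-1 t) DF));rewrite add0r.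
have [x0|x0] := leP 0 x;first exact: pos.
have nx : 0 <= - x by lra.
have H := derB (derC 1 t) (pos _ nx).
apply: (@der_ext R (fun s => 1 - NN s (- x)) _ t _ t) => //.
 move=> s;rewrite ltr_norml => /andP[h1 h2];have s0 : 0 < s by lra.
 rewrite (NN_N x s0);move: (NN s x) => u;lra.
by apply: (derE H);rewrite /kk hkN;ring.
Qed.

Variable j : R.
Hypothesis j0 : 0 < j.

(* [sS - 2 j |x|] solves the heat equation on the half-line with zero initial datum and flux
 [- 2 j] at the origin; [sS] itself is even and smooth. *)
Definition sS t x : R := 4 * j * (t * hk t x + x * (NN t x - 2^-1)).
Definition S1 t x : R := 4 * j * (NN t x - 2^-1).
Definition SS t x : R := sS t x - 2 * j * `|x|.

Lemma sS_N t x : 0 < t -> sS t (- x) = sS t x.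
Proof. by move=> t0;rewrite /sS hkN NN_N//;field. Qed.

Lemma SS_N t x : 0 < t -> SS t (- x) = SS t x.
Proof. by move=> t0;rewrite /SS sS_N// normrN. Qed.

Lemma SSE t x : 0 <= x -> SS t x = 4 * j * (t * hk t x - x * (1 - NN t x)).
Proof. by move=> x0;rewrite /SS /sS ger0_norm//;field. Qed.

Lemma sS_der_x t x : 0 < t -> is_derive x 1 (sS t) (S1 t x).
Proof.
move=> t0;have tn : t != 0 by rewrite gt_eqF.
have := derZ (4 * j) (derD (derZ t (hk_der_x t x)) (derM (derI x) (derB (NN_der_x x t0) (derC 2^-1 x)))).
by move=> H;apply: (derE H);rewrite /S1;field.
Qed.

Lemma S1_der_x t x : 0 < t -> is_derive x 1 (S1 t) (4 * j * hk t x).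
Proof.
move=> t0;have := derZ (4 * j) (derB (NN_der_x x t0) (derC 2^-1 x)).
by move=> H;apply: (derE H);rewrite subr0.
Qed.

Lemma sS_der_t t x : 0 < t -> is_derive t 1 (fun s => sS s x) (2^-1 * (4 * j * hk t x)).
Proof.
move=> t0;have tn : t != 0 by rewrite gt_eqF.
have D0 : is_derive t 1 (fun s => hk s x) (2^-1 * kk 2 2 t x - 2^-1 * kk 0 1 t x).
 apply: (@der_ext R (fun s => kk 0 0 s x) _ t _ 1) => //;first by move=> s _;rewrite kk00.
 by apply: (derE (@kk_der_t R 0 0 t x isT (or_introl t0)));rewrite add0r.
have := derZ (4 * j) (derD (derM (derI t) D0) (derZ x (derB (NN_der_t x t0) (derC 2^-1 t)))).
by move=> H;apply: (derE H);rewrite /kk;field.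
Qed.

Lemma SS_le t x : 0 < t -> SS t x <= 4 * j * t * hk t x.
Proof.
move=> t0;rewrite (_ : SS t x = SS t `|x|);last first.
 by have [x0|/ltW x0] := leP 0 x;[rewrite ger0_norm|rewrite ler0_norm// SS_N].
rewrite SSE// (_ : hk t x = hk t `|x|);last by rewrite /hk real_normK ?num_real.
rewrite -(mulrA (4 * j) t);apply: ler_wpM2l;first by rewrite mulr_ge0// ltW.
by rewrite gerBl mulr_ge0// subr_ge0;exact: NN_le1.
Qed.

(* Dominated by the mass of the tail: [x ^ 2 <= y ^ 2] on it, and Gaussians have second moments. *)
Lemma NN_tail t x : 0 < t -> 0 < x -> 1 - NN t x <= 8 * t / x ^+ 2.
Proof.
move=> t0 x0;have := half_line x (hk_int t0);rewrite hk_int1// => H.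
have -> : 1 - NN t x = \int[mu]_(y in `[x, +oo[) hk t y by rewrite H /NN addrAC subrr add0r.
have t20 : 0 < 2 * t by rewrite mulr_gt0.
have i2 := iZ (8 * t / x ^+ 2) measurableT (hk_int t20).
have mI : measurable (`[x, +oo[%classic : set R) by exact: measurable_itv.
have x2 : 0 < x ^+ 2 by rewrite exprn_gt0.
apply: (@le_trans _ _ (\int[mu]_(y in `[x, +oo[) (8 * t / x ^+ 2 * hk (2 * t) y))).
 apply: le_I => //;[by apply: integrableS (hk_int t0)|by apply: integrableS i2|].
 move=> y;rewrite /= in_itv /= andbT => xy.
 rewrite mulrAC ler_pdivlMr// mulrC;apply: le_trans (hk_sqr y t0).
 by rewrite ler_wpM2r ?hk_ge0// ler_pXn2r ?nnegrE// ltW// (lt_le_trans x0).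
rewrite IZ//;last by apply: integrableS (hk_int t20).
have c0 : 0 <= 8 * t / x ^+ 2 by rewrite divr_ge0 ?mulr_ge0// ltW.
have H2 := half_line x (hk_int t20);rewrite hk_int1// in H2.
have G : 0 <= \int[mu]_(y in `]-oo, x]) hk (2 * t) y by apply: I_ge0 => y _;exact: hk_ge0.
apply: ler_piMr => //;move: G H2;move: (\int[mu]_(_ in _) _) (\int[mu]_(_ in _) _) => u1 u2;lra.
Qed.

(** Inequalities for the flux potential are proved by differentiating in time, where the derivative
    is explicit and has a sign, and by checking the limit at [t = 0]. *)
Lemma pos_from0 (f df : R -> R) : (forall t, 0 < t -> is_derive t 1 f (df t)) ->
 (forall t, 0 < t -> 0 <= df t) ->
 (forall e : R, 0 < e -> exists2 d : R, 0 < d & forall t, 0 < t < d -> - e <= f t) ->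
 forall t, 0 < t -> 0 <= f t.
Proof.
move=> D P L t t0;rewrite -(opprK (f t)) oppr_ge0;apply/ler_addgt0Pr => e e0;rewrite add0r.
have [d d0 Hd] := L e e0;pose s : R := Num.min d t / 2.
have m0 : 0 < Num.min d t by rewrite lt_min d0.
have s0 : 0 < s by rewrite divr_gt0.
have : s < Num.min d t by rewrite /s;lra.
rewrite lt_min => /andP[sd st];have := Hd s;rewrite s0 sd => /(_ isT) h.
have [|c /andP[c1 _] E] := @MVT_le R f df s t (ltW st).
 by move=> x /andP[h1 _];apply: D;exact: lt_le_trans h1.
have : 0 <= df c * (t - s) by rewrite mulr_ge0 ?P ?subr_ge0 ?(ltW st)//;exact: lt_le_trans c1.
by rewrite -E;lra.
Qed.

Lemma SS_small x e : 0 < x -> 0 < e -> exists2 d : R, 0 < d & forall t, 0 < t < d ->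
 `|SS t x| <= e /\ `|S1 t x - 2 * j| <= e.
Proof.
move=> x0 e0;have x2 : 0 < x ^+ 2 by rewrite exprn_gt0.
have xi : 0 < x^-1 by rewrite invr_gt0.
have [C C0 HC] := @kk_bound R 0 0 1 1 x isT ltr01 ltr01 x0.
pose K : R := 4 * j * (C + (x + 1) * (8 / x ^+ 2)).
have K0 : 0 <= K.
 apply: mulr_ge0;first by rewrite mulr_ge0// ltW.
 by apply: addr_ge0 => //;apply: mulr_ge0;[rewrite addr_ge0// ltW|rewrite divr_ge0// ltW].
have K1 : 0 < K + 1 by rewrite ltr_wpDl.
exists (Num.min 1 (e / (K + 1))) => [|t /andP[t0]];first by rewrite lt_min ltr01 divr_gt0.
rewrite lt_min => /andP[t1 te].
have Ke : K * t <= e.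
 apply: (@le_trans _ _ ((K + 1) * t));first by rewrite ler_pM2r// lerDl.
 by rewrite mulrC -ler_pdivlMr// ltW.
have h0 := hk_ge0 t x.
have hC : hk t x <= C.
 by have := HC t x (ltW t1) (or_intror (ler_norm x));rewrite kk00 ger0_norm.
have q0 : 0 <= 1 - NN t x by rewrite subr_ge0;exact: NN_le1.
have q1 := NN_tail t0 x0.
have tC : t * hk t x <= C * t by rewrite mulrC ler_pM2r.
have tC0 : 0 <= t * hk t x by rewrite mulr_ge0// ltW.
have xq0 : 0 <= x * (1 - NN t x) by rewrite mulr_ge0// ltW.
have xq : x * (1 - NN t x) <= x * (8 / x ^+ 2) * t.
 by rewrite -mulrA ler_pM2l// mulrAC.
have q8 : 0 <= 8 / x ^+ 2 * t by rewrite mulr_ge0 ?divr_ge0// ltW.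
have Kexp : K * t = 4 * j * (C * t + (x * (8 / x ^+ 2) * t + 8 / x ^+ 2 * t)) by rewrite /K;ring.
have j4 : 0 <= 4 * j by rewrite mulr_ge0// ltW.
have Ct : 0 <= C * t by rewrite mulr_ge0// ltW.
have xt : 0 <= x * (8 / x ^+ 2) * t by apply: le_trans xq.
split;apply: le_trans Ke;rewrite Kexp.
 rewrite SSE ?(ltW x0)// normrM (ger0_norm j4) ler_wpM2l// ler_norml;apply/andP;split;lra.
rewrite (_ : S1 t x - 2 * j = 4 * j * (- (1 - NN t x)));last by rewrite /S1;field.
rewrite normrM (ger0_norm j4) ler_wpM2l// normrN ger0_norm//.
by move: q1;rewrite mulrAC;lra.
Qed.

Lemma SS_ge0_pos t x : 0 < t -> 0 < x -> 0 <= SS t x.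
Proof.
move=> t0 x0;apply: (@pos_from0 (fun t => SS t x) (fun t => 2^-1 * (4 * j * hk t x) - 0));[move=> s s0|move=> s s0|move=> e e0|exact: t0].
- exact: derB (sS_der_t x s0) (derC (2 * j * `|x|) s).
- by rewrite subr0 !mulr_ge0 ?hk_ge0// ltW.
- have [d d0 Hd] := SS_small x0 e0;exists d => // s /Hd[+ _].
 by rewrite ler_norml => /andP[].
Qed.

Lemma SS_ge0 t x : 0 < t -> 0 <= SS t x.
Proof.
move=> t0;have [x0|x0|->] := ltrgt0P x;first exact: SS_ge0_pos.
 by rewrite -SS_N// SS_ge0_pos// oppr_gt0.
by rewrite SSE// mul0r subr0 !mulr_ge0 ?hk_ge0// ltW.
Qed.

(** The logarithmic slope of [SS] is at most [- x / t]. Heuristically [SS] superposes kernels of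
    ages [s <= t], whose logarithmic slopes are [- x / s]; the proof differentiates the expression
    in time. *)
Lemma SS_slope t x : 0 < t -> 0 < x -> t * (S1 t x - 2 * j) + x * SS t x <= 0.
Proof.
move=> t0 x0;rewrite -oppr_ge0.
pose f t := - (t * (S1 t x - 2 * j) + x * SS t x).
have fE s : f s = 4 * j * (s * (1 - NN s x) - x * (s * hk s x - x * (1 - NN s x))).
 by rewrite /f SSE ?(ltW x0)// /S1;field.
apply: (@pos_from0 f (fun t => 4 * j * (1 - NN t x)));[move=> s s0|move=> s s0|move=> e e0|exact: t0].
- have sn : s != 0 by rewrite gt_eqF.
 have D0 : is_derive s 1 (fun s => SS s x) (2^-1 * (4 * j * hk s x) - 0).
 exact: derB (sS_der_t x s0) (derC (2 * j * `|x|) s).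
 have D1 : is_derive s 1 (fun s => S1 s x - 2 * j) (4 * j * (- (2^-1) * kk 1 1 s x - 0) - 0).
 exact: derB (derZ (4 * j) (derB (NN_der_t x s0) (derC 2^-1 s))) (derC (2 * j) s).
 have := derN (derD (derM (derI s) D1) (derZ x D0)).
 by move=> H;apply: (derE H);rewrite /S1 /kk;field.
- by rewrite !mulr_ge0 ?(ltW j0)// subr_ge0;exact: NN_le1.
- have K0 : 0 < 1 + x by rewrite ltr_wpDr// ltW.
 have eK : 0 < e / (1 + x) by rewrite divr_gt0.
 have [d d0 Hd] := SS_small x0 eK;exists (Num.min d 1) => [|s /andP[s0]];first by rewrite lt_min d0 ltr01.
 rewrite lt_min => /andP[sd s1];have [] := Hd s;first by rewrite s0.
 move=> h1 h2;have A1 : s * (S1 s x - 2 * j) <= e / (1 + x).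
 apply: le_trans (ler_norm _) _;rewrite normrM (gtr0_norm s0) -[leRHS]mul1r.
 by apply: ler_pM => //;exact: ltW.
 have A2 : x * SS s x <= x * (e / (1 + x)) by rewrite ler_pM2l//;apply: le_trans (ler_norm _) h1.
 rewrite /f lerN2;apply: (@le_trans _ _ (e / (1 + x) + x * (e / (1 + x))));first exact: lerD.
 by rewrite le_eqVlt;apply/orP;left;apply/eqP;field;rewrite gt_eqF.
Qed.

Lemma SS_i t : 0 < t -> itg setT (SS t).
Proof.
move=> t0;apply: (@i_le R setT _ (fun y => 4 * j * t * hk t y)) => //.
- apply: measurable_funB.
 by apply: cont_measurable => // x;eexists;exact: sS_der_x.
 apply: measurable_funM => //;exact: measurableT_comp.
- by move=> y _;rewrite ger0_norm ?SS_ge0//;exact: SS_le.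
- by apply: iZ => //;exact: hk_int.
Qed.

(** Semigroup law for the flux potential. As functions of the first time [u], the integral and
    [sS (u + t) x] have the same derivative by [hk_conv], so their difference [phi] is constant; its
    value is read off as [u] tends to [0], where the integral is of order [u]. *)
Lemma SS_CK s t x : 0 < s -> 0 < t -> heat (SS s) t x + SS t x = SS (s + t) x.
Proof.
move=> s0 t0.
have hki y : hk t (x - y) <= (Num.sqrt t)^-1 := hk_le_sqrt (x - y) t0.
have mh : measurable_fun setT (fun y => hk t (x - y)).
 by apply: (measurableT_comp (hk_meas t));apply: measurable_funB.
have t0' : 0 <= (Num.sqrt t)^-1 by rewrite invr_ge0.
have prodi (f : R -> R) : itg setT f -> itg setT (fun y => f y * hk t (x - y)).
 move=> fi;apply: (@i_le R setT _ (fun y => (Num.sqrt t)^-1 * `|f y|)) => //.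
 - by apply: measurable_funM => //;exact: i_meas fi.
 - by move=> y _;rewrite normrM mulrC (ger0_norm (hk_ge0 _ _)) ler_wpM2r.
 - by apply: iZ => //;exact: iabs.
have hE u : heat (SS u) t x = \int[mu]_y (SS u y * hk t (x - y)) by rewrite /heat t0 UU00E.
pose phi u : R := \int[mu]_y (SS u y * hk t (x - y)) - sS (u + t) x.
have D u : 0 < u -> is_derive u 1 phi 0.
 move=> u0;have u20 : 0 < u / 2 by rewrite divr_gt0.
 have near v : `|v - u| < u / 2 -> u / 2 <= v by rewrite ltr_norml => /andP[h1 h2];lra.
 have D1 : is_derive u 1 (fun v => \int[mu]_y (SS v y * hk t (x - y)))
 (\int[mu]_y ((2^-1 * (4 * j * hk u y) - 0) * hk t (x - y))).
 apply: (@der_under R setT (fun v y => SS v y * hk t (x - y)) (fun v y => (2^-1 * (4 * j * hk v y) - 0) * hk t (x - y))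
 (fun y => 2 * j * (Num.sqrt (u / 2))^-1 * hk t (x - y)) u (u / 2) measurableT u20).
 - by move=> v /near v0;apply: prodi;apply: SS_i;exact: lt_le_trans v0.
 - move=> v y /near v0 _;have vp : 0 < v by exact: lt_le_trans v0.
 have := derM (derB (sS_der_t y vp) (derC (2 * j * `|y|) v)) (derC (hk t (x - y)) v).
 by move=> H;apply: (derE H);rewrite mulr0 ?addr0 ?add0r.
 - by apply: iZ => //;exact: hk_shift_int.
 - move=> v y /near v0 _;have vp : 0 < v by exact: lt_le_trans v0.
 rewrite subr0 normrM (ger0_norm (hk_ge0 t _)) ler_wpM2r ?hk_ge0//.
 rewrite (_ : 2^-1 * (4 * j * hk v y) = 2 * j * hk v y);last by field.
 rewrite ger0_norm ?mulr_ge0 ?hk_ge0 ?(ltW j0)// ler_wpM2l ?mulr_ge0 ?(ltW j0)//.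
 apply: le_trans (hk_le_sqrt y vp) _;rewrite lef_pV2 ?posrE ?sqrtr_gt0//.
 by rewrite ler_wsqrtr.
 have I1 : \int[mu]_y ((2^-1 * (4 * j * hk u y) - 0) * hk t (x - y)) = 2^-1 * (4 * j * hk (u + t) x).
 have := hk_conv x 0 u0 t0;rewrite subr0 => <-;rewrite mulrA -IZ//.
 by apply: eq_I => y _;rewrite !subr0;ring.
 have := prodi _ (hk_int u0);apply: eq_integrable => // y _.
 by rewrite /= subr0.
 have ut : 0 < u + t by rewrite addr_gt0.
 have D2 : is_derive u 1 (fun v => sS (v + t) x) (2^-1 * (4 * j * hk (u + t) x) * (1 + 0)).
 exact: (@der_comp R (fun v => sS v x) (fun v => v + t) u _ _ (sS_der_t x ut) (derD (derI u) (derC t u))).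
 by rewrite I1 in D1;apply: (derE (derB D1 D2));rewrite addr0 mulr1 subrr.
suff E : phi s = - sS t x.
 rewrite hE -[\int[mu]_y _](subrK (sS (s + t) x)) -/(phi s) E /SS;ring.
apply/eqP;rewrite -subr_eq0 -normr_le0;apply/ler_addgt0Pr => e e0;rewrite add0r.
have e20 : 0 < e / 2 by rewrite divr_gt0.
have [d d0 Hd] := is_derive_cont (sS_der_t x t0) e20.
pose K : R := 4 * j * (Num.sqrt t)^-1.
have K0 : 0 <= K by rewrite !mulr_ge0// ltW.
have K1 : 0 < K + 1 by rewrite ltr_wpDl.
pose u : R := Num.min (Num.min d s) (e / 2 / (K + 1)) / 2.
have m0 : 0 < Num.min (Num.min d s) (e / 2 / (K + 1)) by rewrite !lt_min d0 s0 !divr_gt0.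
have u0 : 0 < u by rewrite divr_gt0.
have : u < Num.min (Num.min d s) (e / 2 / (K + 1)) by rewrite /u;lra.
clearbody u;rewrite !lt_min => /andP[/andP[ud us] ue].
have s1 : s < s + 1 by rewrite ltrDl.
have D' v : 0 < v < s + 1 -> is_derive v 1 phi 0 by move=> /andP[v0 _];exact: D.
rewrite -(zero_der_cst D' u0 (ltW us) s1).
have ut : 0 < u + t by rewrite addr_gt0.
have A1 : 0 <= \int[mu]_y (SS u y * hk t (x - y)) by apply: I_ge0 => y _;rewrite mulr_ge0 ?SS_ge0 ?hk_ge0.
have A2 : \int[mu]_y (SS u y * hk t (x - y)) <= K * u.
 apply: (@le_trans _ _ (\int[mu]_y (4 * j * u * (hk u (y - 0) * hk t (x - y))))).
 apply: le_I => //;first exact: prodi (SS_i u0).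
 apply: iZ => //;have := prodi _ (hk_int u0);apply: eq_integrable => // y _.
 by rewrite /= subr0.
 by move=> y _;rewrite subr0 mulrA ler_wpM2r ?hk_ge0//;exact: SS_le.
 rewrite IZ//;last first.
 by have := prodi _ (hk_int u0);apply: eq_integrable => // y _;rewrite /= subr0.
 rewrite hk_conv// subr0 (_ : K * u = 4 * j * u * (Num.sqrt t)^-1);last by rewrite /K;ring.
 apply: ler_wpM2l;first by rewrite !mulr_ge0// ltW.
 apply: le_trans (hk_le_sqrt x ut) _;rewrite lef_pV2 ?posrE ?sqrtr_gt0//.
 by rewrite ler_wsqrtr// lerDr ltW.
have A3 : K * u <= e / 2.
 apply: (@le_trans _ _ ((K + 1) * u));first by rewrite ler_pM2r// lerDl.
 by rewrite mulrC -ler_pdivlMr// ltW.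
have A4 := Hd (u + t);rewrite addrK (gtr0_norm u0) in A4;have {A4} := A4 ud.
rewrite /phi;move: A1 A2 A3;move: (\int[mu]_y _) (sS _ _) (sS _ _) (K * u) => I1 v1 v2 Ku A1 A2 A3.
by rewrite ltr_norml => /andP[h1 h2];rewrite ler_norml;apply/andP;split;lra.
Qed.
End Source.

Section Sign.
Context {R : realType}.
Implicit Types (x y p d e : R).
Variables (phi phi' : R -> R).

Lemma der_lt_right x (a : R) : is_derive x 1 phi a -> a < 0 ->
 exists2 d : R, 0 < d & forall y, x < y < x + d -> phi y < phi x.
Proof.
move=> /is_derive_epsP H a0;have e0 : 0 < - a / 2 by rewrite divr_gt0// oppr_gt0.
have [d d0 Hd] := H _ e0;exists d => // y /andP[xy yd].
have yx : 0 < y - x by rewrite subr_gt0.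
have := Hd y;rewrite (gtr0_norm yx) ltrBlDl => /(_ yd);rewrite ler_norml => /andP[_ h].
have : a * (y - x) < 0 by rewrite nmulr_rlt0.
lra.
Qed.

Lemma stay_neg p : (forall x, p < x -> is_derive x 1 phi (phi' x)) ->
 (forall x, p < x -> phi x = 0 -> phi' x < 0) ->
 (exists2 d : R, 0 < d & forall y, p < y < p + d -> phi y < 0) -> forall y, p < y -> phi y < 0.
Proof.
move=> D Z [d d0 Hd] y1 py1;rewrite ltNge;apply/negP => y1p.
pose S := [set z : R | p < z /\ 0 <= phi z].
have Si : has_inf S by split;[exists y1|exists p => z [/ltW]].
pose z0 := inf S.
have lb z : S z -> z0 <= z by move=> Sz;apply: ge_inf => //;case: Si.
have pz : p + d <= z0.
 apply: lb_le_inf;first by exists y1.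
 by move=> z [pz fz];rewrite leNgt;apply/negP => zd;have := Hd z;rewrite pz zd ltNge fz => /(_ isT).
have pz0 : p < z0 by apply: lt_le_trans pz;rewrite ltrDl.
have left z : p < z -> z < z0 -> phi z < 0.
 by move=> pz' zz0;rewrite ltNge;apply/negP => fz;have := lb z (conj pz' fz);rewrite leNgt zz0.
have c := is_derive_cont (D z0 pz0).
have f0 : phi z0 = 0.
 apply/eqP;rewrite eq_le;apply/andP;split;rewrite leNgt;apply/negP => f0.
 have [h h0 Hh] := c _ f0;pose z : R := Num.max ((p + z0) / 2) (z0 - h / 2).
 have z1 : z < z0 by rewrite /z gt_max;apply/andP;split;lra.
 have z2 : p < z by rewrite /z lt_max;apply/orP;left;lra.
 have z3 : `|z - z0| < h.
 by rewrite ltr0_norm ?subr_lt0// opprB ltrBlDl -ltrBlDr /z lt_max;apply/orP;right;lra.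
 have := Hh z z3;rewrite ltr_norml => /andP[h1 _];have := left z z2 z1;lra.
 have nf : 0 < - phi z0 by rewrite oppr_gt0.
 have [h h0 Hh] := c _ nf;have [z Sz zh] := inf_adherent h0 Si.
 have z3 : `|z - z0| < h by rewrite ger0_norm ?subr_ge0 ?lb// ltrBlDl.
 have := Hh z z3;rewrite ltr_norml => /andP[_ h1];case: Sz => _;lra.
have [h h0 Hh] := der_lt_left (D z0 pz0) (Z z0 pz0 f0).
pose z : R := Num.max ((p + z0) / 2) (z0 - h / 2).
have z1 : z < z0 by rewrite /z gt_max;apply/andP;split;lra.
have z2 : p < z by rewrite /z lt_max;apply/orP;left;lra.
have := Hh z;rewrite z1 andbT f0 => /(_ _);rewrite /z lt_max (_ : z0 - h < z0 - h / 2) ?orbT;last by lra.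
by move=> /(_ isT);rewrite -/z ltNge ltW// left.
Qed.

(** A function that crosses zero only downwards cannot come back: [stay_neg] applies just after the
    first zero. *)
Lemma single_zero : (forall x, 0 < x -> is_derive x 1 phi (phi' x)) ->
 (forall x, 0 < x -> phi x = 0 -> phi' x < 0) ->
 (forall e, 0 < e -> exists2 d : R, 0 < d & forall y, 0 <= y < d -> `|phi y - phi 0| < e) ->
 0 < phi 0 -> (exists2 x, 0 < x & phi x < 0) ->
 exists X : R, [/\ 0 < X, phi X = 0, forall y, 0 <= y < X -> 0 < phi y & forall y, X < y -> phi y < 0].
Proof.
move=> D Z c0 p0 [x1 x10 fx1].
pose S := [set z : R | 0 <= z /\ phi z <= 0].
have Sx1 : S x1 by split;exact: ltW.
have Si : has_inf S by split;[exists x1|exists 0 => z []].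
pose X := inf S.
have lb z : S z -> X <= z by move=> Sz;apply: ge_inf => //;case: Si.
have X0 : 0 < X.
 have [d d0 Hd] := c0 _ p0;apply: (lt_le_trans d0);apply: lb_le_inf;first by exists x1.
 move=> z [z0 fz];rewrite leNgt;apply/negP => zd.
 by have := Hd z;rewrite z0 zd => /(_ isT);rewrite ltr_norml => /andP[h1 _];lra.
have left z : 0 <= z -> z < X -> 0 < phi z.
 by move=> z0 zX;rewrite ltNge;apply/negP => fz;have := lb z (conj z0 fz);rewrite leNgt zX.
have c := is_derive_cont (D X X0).
have f0 : phi X = 0.
 apply/eqP;rewrite eq_le;apply/andP;split;rewrite leNgt;apply/negP => f0.
 have [h h0 Hh] := c _ f0;have [z Sz zh] := inf_adherent h0 Si.
 have z3 : `|z - X| < h by rewrite ger0_norm ?subr_ge0 ?lb// ltrBlDl.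
 have := Hh z z3;rewrite ltr_norml => /andP[h1 _];case: Sz => _;lra.
 have nf : 0 < - phi X by rewrite oppr_gt0.
 have [h h0 Hh] := c _ nf;pose z : R := Num.max (X / 2) (X - h / 2).
 have z1 : z < X by rewrite /z gt_max;apply/andP;split;lra.
 have z2 : 0 <= z by rewrite /z le_max;apply/orP;left;lra.
 have z3 : `|z - X| < h.
 by rewrite ltr0_norm ?subr_lt0// opprB ltrBlDl -ltrBlDr /z lt_max;apply/orP;right;lra.
 have := Hh z z3;rewrite ltr_norml => /andP[_ h1];have := left z z2 z1;lra.
exists X;split => // [y /andP[y0 yX]|];first exact: left.
apply: stay_neg => [x Xx|x Xx|].
- by apply: D;exact: lt_trans Xx.
- by apply: Z;exact: lt_trans Xx.
- by have := der_lt_right (D X X0) (Z X X0 f0);rewrite f0.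
Qed.
End Sign.

(** * Total positivity of the Gaussian and the single sign change *)

Section TotalPositivity.
Context {R : realType}.
Notation mu := (@lebesgue_measure R).
Implicit Types (x y a b t : R).

Lemma hk_gt0 t x : 0 < t -> 0 < hk t x.
Proof. by move=> t0;rewrite /hk t0 !mulr_gt0 ?expR_gt0// invr_gt0 sqrtr_gt0// mulr_gt0// pi_gt0. Qed.

Lemma sq_le x a : 0 <= x * a -> (x - a) ^+ 2 <= (x + a) ^+ 2.
Proof. nra. Qed.

Lemma sq_lt x a : 0 < x * a -> (x - a) ^+ 2 < (x + a) ^+ 2.
Proof. nra. Qed.

Lemma hk_mono t x y : x ^+ 2 <= y ^+ 2 -> hk t y <= hk t x.
Proof.
move=> xy;rewrite /hk;case: ifPn => // t0;apply: ler_wpM2l;first by rewrite mulr_ge0// invr_ge0.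
by rewrite ler_expR lerN2 ler_pM2r// invr_gt0 mulr_gt0.
Qed.

Lemma hk_mono0 t x y : 0 <= x -> x <= y -> hk t y <= hk t x.
Proof. by move=> x0 xy;apply: hk_mono;rewrite ler_pXn2r// nnegrE// (le_trans x0). Qed.

Lemma hk_lt t x y : 0 < t -> x ^+ 2 < y ^+ 2 -> hk t y < hk t x.
Proof.
move=> t0 xy;rewrite /hk t0 ltr_pM2l;last first.
 by rewrite mulr_gt0 ?invr_gt0 ?sqrtr_gt0// mulr_gt0// pi_gt0.
by rewrite ltr_expR ltrN2 ltr_pM2r// invr_gt0 mulr_gt0.
Qed.

(** A two-by-two minor of the Gaussian kernel: the exponents of the two products differ by a
    multiple of [x * (a - b)]. *)
Lemma hk_cross t x a b : 0 < t -> 0 <= x -> b <= a ->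
 hk t (x - b) * hk t (x + a) <= hk t (x + b) * hk t (x - a).
Proof.
move=> t0 x0 ba;rewrite /hk t0 !(mulrACA _ (expR _));apply: ler_wpM2l.
 by rewrite !mulr_ge0// invr_ge0.
rewrite -!expRD ler_expR -!opprD lerN2 -!mulrDl ler_pM2r ?invr_gt0 ?mulr_gt0//.
have : 0 <= x * (a - b) by rewrite mulr_ge0// subr_ge0.
by clear;nra.
Qed.

(* [y D(y) / K(y) = y tanh (x y / t)] is nondecreasing. *)
Lemma hk_tanh t x a b : 0 < t -> 0 < x -> 0 <= b -> b <= a ->
 b * (hk t (x - b) - hk t (x + b)) * (hk t (x - a) + hk t (x + a)) <=
 a * (hk t (x - a) - hk t (x + a)) * (hk t (x - b) + hk t (x + b)).
Proof.
move=> t0 x0 b0 ba;have C := hk_cross t0 (ltW x0) ba.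
have Db : 0 <= hk t (x - b) - hk t (x + b) by rewrite subr_ge0 hk_mono// sq_le// mulr_ge0// ltW.
have Da : 0 <= hk t (x - a) - hk t (x + a).
 by rewrite subr_ge0 hk_mono// sq_le// mulr_ge0 ?(ltW x0)// (le_trans b0).
have Ka : 0 <= hk t (x - a) + hk t (x + a) by rewrite addr_ge0 ?hk_ge0.
rewrite -!mulrA;apply: ler_pM => //;first exact: mulr_ge0.
by move: C;clear;lra.
Qed.

Variables (j : R) (f : R -> R) (a t : R).
Hypotheses (j0 : 0 < j) (fi : itg setT f) (fN : forall y, f (- y) = f y).
Hypotheses (a0 : 0 < a) (t0 : 0 < t).
Hypotheses (f_pos : forall y, `|y| <= a -> 0 <= f y) (f_neg : forall y, a < `|y| -> f y <= 0).

Lemma SS_gt0 x : 0 < x -> 0 < SS j t x.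
Proof.
move=> x0;have t20 : 0 < t / 2 by rewrite divr_gt0.
have tt : t / 2 <= t by lra.
have [|c /andP[c1 c2] E] := @MVT_le R (fun s => SS j s x) (fun s => 2^-1 * (4 * j * hk s x) - 0) (t / 2) t tt.
 move=> s /andP[s1 _];exact: derB (sS_der_t j x (lt_le_trans t20 s1)) (derC (2 * j * `|x|) s).
have := SS_ge0 j0 x t20;have : 0 < (2^-1 * (4 * j * hk c x) - 0) * (t - t / 2).
 rewrite subr0;apply: mulr_gt0;last by rewrite subr_gt0 ltr_pdivrMr// mulr_natr mulr2n ltrDl.
 have c0 := lt_le_trans t20 c1;have j4 : 0 < 4 * j by rewrite mulr_gt0.
 by rewrite pmulr_rgt0 ?invr_gt0//;exact: mulr_gt0 j4 (hk_gt0 x c0).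
by rewrite -E;move: (SS _ _ _) (SS _ _ _) => u1 u2;lra.
Qed.

(** [h] compares the logarithmic [x]-derivative of the kernel at [y] with that of the even kernel
    [k] at the sign change [a]. By [hk_tanh] the symmetrized [h] changes sign at [|y| = a]
    oppositely to [f], so the integral of [f * h] is at most [0], which bounds the slope of the heat
    part by [kd / k] times its value. At a zero that value is [- SS]; [SS_slope] bounds the slope of
    the flux part, and strictness comes from [0 < a * D]. *)
Lemma TP x : 0 < x -> heat f t x + SS j t x = 0 -> - UU f 1 1 t x + (S1 j t x - 2 * j) < 0.
Proof.
move=> x0 W0;have tn : t != 0 by rewrite gt_eqF.
pose k := hk t (x - a) + hk t (x + a).
pose D := hk t (x - a) - hk t (x + a).
pose kd := - (x / t) * k + (a / t) * D.
have k0 : 0 < k by rewrite addr_gt0 ?hk_gt0.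
have D0 : 0 <= D by rewrite subr_ge0 hk_mono// sq_le// mulr_ge0// ltW.
pose h y := - ((x - y) / t) * hk t (x - y) * k - hk t (x - y) * kd.
have adm1 : adm f t x by left.
have i0 := heat_int fi x t0.
have i1 : itg setT (fun y => f y * kk 1 1 t (x - y)) by exact: UU_int.
have i2 : itg setT (fun y => f y * h y).
 have := iB measurableT (iZ (- k) measurableT i1) (iZ kd measurableT i0).
 by apply: eq_integrable => // y _;rewrite /= /h /kk;congr EFin;field.
have E1 : - UU f 1 1 t x * k - heat f t x * kd = \int[mu]_y (f y * h y).
 rewrite /heat t0 UU00E /UU mulNr -mulrN mulrC (mulrC _ kd) -!IZ// -IB//;[|exact: iZ..].
 by apply: eq_I => y _;rewrite /h /kk;field.
have Ir := I_refl i2;have ir := i_refl i2.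
have le0 : \int[mu]_y (f y * h y) <= 0.
 suff H : \int[mu]_y (f y * h y + f (- y) * h (- y)) <= 0.
 have H2 : \int[mu]_y (f y * h y + f (- y) * h (- y)) = \int[mu]_y (f y * h y) + \int[mu]_y (f y * h y).
 by rewrite (ID measurableT i2 ir) Ir.
 by move: H;rewrite H2 -mulr2n -mulr_natr pmulr_lle0.
 rewrite -oppr_ge0 -mulN1r -(IZ (-1) measurableT (iD measurableT i2 ir)).
 apply: I_ge0 => y _;rewrite fN -mulrDr.
 have -> : h y + h (- y) = t^-1 * (`|y| * (hk t (x - `|y|) - hk t (x + `|y|)) * k - a * D * (hk t (x - `|y|) + hk t (x + `|y|))).
 rewrite /h opprK /kd;have [y0|y0] := leP 0 y.
 by rewrite (ger0_norm y0);field.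
 by rewrite (ltr0_norm y0) opprK;field.
 rewrite mulN1r -mulrN;have [ya|ay] := leP `|y| a.
 apply: mulr_ge0;first exact: f_pos.
 rewrite -mulrN opprB;apply: mulr_ge0;first by rewrite invr_ge0 ltW.
 by rewrite subr_ge0;exact: hk_tanh.
 rewrite -mulrNN opprK;apply: mulr_ge0;first by rewrite oppr_ge0 f_neg.
 apply: mulr_ge0;first by rewrite invr_ge0 ltW.
 by rewrite subr_ge0;apply: hk_tanh;[exact: t0|exact: x0|exact: ltW|exact: ltW].
have S := SS_slope j0 t0 x0;have Sp := SS_gt0 x0.
have Hh : heat f t x = - SS j t x by apply/eqP;rewrite -subr_eq0 opprK W0.
have aD : 0 < a * D.
 apply: mulr_gt0;first exact: a0.
 by rewrite subr_gt0;apply: (hk_lt t0);exact: sq_lt (mulr_gt0 x0 a0).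
rewrite Hh in E1;rewrite -E1 in le0.
have A1 : (t * (S1 j t x - 2 * j) + x * SS j t x) * k <= 0 by rewrite pmulr_lle0.
have A2 : 0 < SS j t x * (a * D) by rewrite mulr_gt0.
have kdE : t * kd = - x * k + a * D by rewrite /kd;field.
rewrite -(pmulr_llt0 _ k0) -(pmulr_rlt0 _ t0).
have A3 : t * (- UU f 1 1 t x * k - - SS j t x * kd) <= 0 by rewrite pmulr_rle0.
move: A1 A2 A3 kdE;move: (UU _ _ _ _ _) (S1 _ _ _) (SS _ _ _) (a * D) => u s1 s2 aDD.
clearbody kd k;clear -t0;nra.
Qed.

(** Far out, the negative part of the datum on [[b1, b2]] outweighs the positive part in [[- a, a]]
    and the source: the ratio of the kernels at [b1] and [a] is [expR z], with [z] linear in [x]. *)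
Lemma neg_far b1 b2 (c0 : R) : a < b1 -> b1 < b2 -> 0 < c0 -> (forall y, b1 <= y <= b2 -> f y <= - c0) ->
 exists2 x, 0 < x & heat f t x + SS j t x < 0.
Proof.
move=> ab1 b12 c00 Hf;have a0' := a0;have t0' := t0;have j0' := j0.
have K0 : 0 <= L1norm f + 4 * j * t by rewrite addr_ge0 ?I_ge0// !mulr_ge0// ltW.
pose K := L1norm f + 4 * j * t;pose c := c0 * (b2 - b1).
have cp : 0 < c by rewrite mulr_gt0// subr_gt0.
have ba : 0 < b1 - a by rewrite subr_gt0.
(* The last term forces [K / c <= z], so that the ratio of kernels is at least [1 + K / c]. *)
pose x : R := b2 + a + b1 + (K / c) * t / (b1 - a).
have Kc : 0 <= K / c by rewrite divr_ge0// ltW.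
have q0 : 0 <= (K / c) * t / (b1 - a) by apply: divr_ge0;[apply: mulr_ge0;[exact: Kc|exact: ltW]|exact: ltW].
have xb : b2 <= x by rewrite /x;lra.
have x0 : 0 < x by lra.
have xa : 0 <= x - a by rewrite subr_ge0 (le_trans _ xb)// ltW// (lt_trans ab1).
exists x => //.
have hxa : hk t (x - a) <= hk t (x - b1) * (1 + K / c)^-1.
 pose z := (b1 - a) * (2 * x - a - b1) / (2 * t).
 have zK : K / c <= z.
 rewrite /z ler_pdivlMr ?mulr_gt0// -ler_pdivrMl//.
 have -> : (b1 - a)^-1 * (K / c * (2 * t)) = 2 * ((K / c) * t / (b1 - a)) by field;do ?[apply/andP;split];rewrite gt_eqF.
 rewrite /x;lra.
 have -> : hk t (x - a) = hk t (x - b1) * expR (- z).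
 rewrite /hk t0 -[RHS]mulrA -expRD;congr (_ * expR _);by rewrite /z;field;do ?[apply/andP;split];rewrite gt_eqF.
 apply: ler_wpM2l;first exact: hk_ge0.
 rewrite expRN lef_pV2 ?posrE ?expR_gt0//;last by rewrite ltr_wpDr.
 by apply: le_trans (expR_ge1Dx z);rewrite lerD2l.
pose G y : R := if b1 <= y <= b2 then - c0 * hk t (x - b1) else 0.
have Gi0 : itg `[b1, b2] G.
 apply: eq_integrable (i_cst b1 b2 (- c0 * hk t (x - b1))) => //.
 by move=> y;rewrite inE /= in_itv /= /G => ->.
have Gout y : ~ `[b1, b2]%classic y -> G y = 0.
 by rewrite /= in_itv /= /G;case: ifPn.
have Gi : itg setT G by apply: (i_supp _ Gout Gi0);exact: measurable_itv.
have GI : \int[mu]_y G y = - c * hk t (x - b1).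
 rewrite (I_supp Gout) (@eq_I _ _ _ (fun=> - c0 * hk t (x - b1))).
 by rewrite I_cst ?(ltW b12)// /c;ring.
 by move=> y;rewrite /= in_itv /= /G => ->.
have fai := iZ (hk t (x - a)) measurableT (iabs measurableT fi).
have B : heat f t x <= hk t (x - a) * L1norm f - c * hk t (x - b1).
 rewrite (_ : - (c * hk t (x - b1)) = \int[mu]_y G y);last by rewrite GI mulNr.
 rewrite /heat t0 UU00E /L1norm -IZ//;last exact: iabs.
 rewrite -ID//;apply: le_I => //;[exact: heat_int|exact: iD|].
 move=> y _;rewrite /G;have [hy|hy] := boolP (b1 <= y <= b2).
 have fy := Hf y hy;have [h1 h2] := andP hy.
 have hm : hk t (x - b1) <= hk t (x - y) by apply: hk_mono0;[rewrite subr_ge0 (le_trans h2)|rewrite lerD2l lerN2].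
 have A1 : f y * hk t (x - y) <= - c0 * hk t (x - b1).
 have h00 := hk_ge0 t (x - b1);apply: (@le_trans _ _ (- c0 * hk t (x - y))).
 by rewrite ler_wpM2r ?hk_ge0.
 by rewrite !mulNr lerN2 ler_pM2l.
 by apply: le_trans A1 _;rewrite lerDr mulr_ge0 ?hk_ge0.
 rewrite addr0;have [ya|ay] := leP `|y| a;last first.
 apply: (@le_trans _ _ 0);last by rewrite mulr_ge0 ?hk_ge0.
 by rewrite mulr_le0_ge0 ?hk_ge0// f_neg.
 rewrite mulrC;apply: ler_pM => //;[exact: hk_ge0|exact: f_pos| |exact: ler_norm].
 by move: ya;rewrite ler_norml => /andP[y1 y2];apply: hk_mono0;[exact: xa|rewrite lerD2l lerN2].
have S : SS j t x <= 4 * j * t * hk t (x - a).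
 apply: le_trans (SS_le j0 x t0) _;rewrite ler_wpM2l ?mulr_ge0 ?(ltW j0) ?(ltW t0)//.
 by apply: hk_mono0;[exact: xa|rewrite gerBl ltW].
have hb := hk_gt0 (x - b1) t0.
have KK : K * hk t (x - a) <= K * (hk t (x - b1) * (1 + K / c)^-1) by rewrite ler_wpM2l.
have c1 : 0 < 1 + K / c by rewrite ltr_wpDr.
have fin : K * (hk t (x - b1) * (1 + K / c)^-1) < c * hk t (x - b1).
 rewrite mulrCA mulrC ltr_pM2r// ltr_pdivrMr// mulrDr mulr1 mulrCA divff ?gt_eqF// mulr1.
 by rewrite ltrDr.
move: B S KK fin;rewrite (_ : K * hk t (x - a) = hk t (x - a) * L1norm f + 4 * j * t * hk t (x - a));last by rewrite /K;ring.
move: (hk t (x - a) * _) (4 * j * t * _) (c * _) => u1 u2 u3;lra.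
Qed.
End TotalPositivity.

(** * Caloric functions near the free boundary *)

Section Cal.
Context {R : realType}.
Notation mu := (@lebesgue_measure R).
Implicit Types (t x c d e k : R) (w v : R -> R -> R).

Definition jc w t x := forall e, 0 < e -> exists2 d : R, 0 < d & forall t' x' : R, `|t' - t| < d -> `|x' - x| < d ->
 `|w t' x' - w t x| < e.

(** [w] is caloric in a full neighbourhood of the point, with jointly continuous first and second
    space derivatives: the regularity that the implicit function argument uses, stable under linear
    combinations and shifts in time. *)
Definition cal w w1 w2 t x := exists2 d : R, 0 < d & forall t' x' : R, `|t' - t| < d -> `|x' - x| < d ->
 [/\ is_derive x' 1 (w t') (w1 t' x'), is_derive x' 1 (w1 t') (w2 t' x'),
 is_derive t' 1 (fun s => w s x') (2^-1 * w2 t' x'), jc w1 t' x' & jc w2 t' x'].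

Lemma jc_lin w v t x k : jc w t x -> jc v t x -> jc (fun t x => w t x + k * v t x) t x.
Proof.
move=> A B e e0;have k0 : 0 < `|k| + 1 by rewrite ltr_wpDl.
have e20 : 0 < e / 2 by rewrite divr_gt0.
have e2k : 0 < e / 2 / (`|k| + 1) by rewrite divr_gt0.
have [d1 d10 H1] := A _ e20;have [d2 d20 H2] := B _ e2k.
exists (Num.min d1 d2) => [|t' x'];first by rewrite lt_min d10.
rewrite !lt_min => /andP[a1 a2] /andP[b1 b2].
have B1 := H1 t' x' a1 b1;have := H2 t' x' a2 b2;rewrite ltr_pdivlMr// mulrDr mulr1 => B2.
rewrite (_ : _ - _ = (w t' x' - w t x) + k * (v t' x' - v t x));last by ring.
apply: le_lt_trans (ler_normD _ _) _;rewrite normrM mulrC.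
by have := normr_ge0 (v t' x' - v t x);lra.
Qed.

Lemma cal_lin w w1 w2 v v1 v2 t x k : cal w w1 w2 t x -> cal v v1 v2 t x ->
 cal (fun t x => w t x + k * v t x) (fun t x => w1 t x + k * v1 t x) (fun t x => w2 t x + k * v2 t x) t x.
Proof.
move=> [d1 d10 H1] [d2 d20 H2];exists (Num.min d1 d2) => [|t' x'];first by rewrite lt_min d10.
rewrite !lt_min => /andP[a1 a2] /andP[b1 b2].
have [A1 A2 A3 A4 A5] := H1 t' x' a1 b1;have [B1 B2 B3 B4 B5] := H2 t' x' a2 b2.
split;[exact: derD A1 (derZ k B1)|exact: derD A2 (derZ k B2)| |exact: jc_lin|exact: jc_lin].
by apply: (derE (derD A3 (derZ k B3)));ring.
Qed.

Lemma jc_shift w t x c : jc w (t - c) x -> jc (fun t x => w (t - c) x) t x.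
Proof.
move=> H e e0;have [d d0 Hd] := H e e0;exists d => // t' x' tt xx;apply: Hd => //.
by rewrite opprB addrA subrK.
Qed.

Lemma cal_shift w w1 w2 t x c : cal w w1 w2 (t - c) x ->
 cal (fun t x => w (t - c) x) (fun t x => w1 (t - c) x) (fun t x => w2 (t - c) x) t x.
Proof.
move=> [d d0 H];exists d => // t' x' tt xx.
have [|A1 A2 A3 A4 A5] := H (t' - c) x' _ xx;first by rewrite opprB addrA subrK.
split=> //;[|exact: jc_shift A4|exact: jc_shift A5].
have := @der_comp R (fun s => w s x') (fun s => s - c) t' _ _ A3 (derB (derI t') (derC c t')).
by move=> H';apply: (derE H');rewrite subr0 mulr1.
Qed.

Lemma cal_UU (F : R -> R) t x : itg setT F -> adm F t x ->
 cal (fun t x => UU F 0 0 t x) (fun t x => - UU F 1 1 t x) (fun t x => UU F 2 2 t x - UU F 0 1 t x) t x.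
Proof.
move=> Fi ad;have [C _ [d d0 Hd]] := @adm_bound R F 0 0 t x isT ad.
exists d => // t' x' tt xx;have [a _] := Hd t' x' tt xx.
have c a' b' : (a' <= b'.*2)%N -> jc (UU F a' b') t' x'.
 by move=> ab e e0;exact: (UU_cont Fi ab a).
have lin a' b' a2 b2 k : jc (UU F a' b') t' x' -> jc (UU F a2 b2) t' x' -> jc (fun t x => UU F a' b' t x + k * UU F a2 b2 t x) t' x'.
 exact: jc_lin.
split.
- by apply: (derE (@UU_der_x R F Fi 0%N 0%N t' x' isT a));rewrite mul0r add0r.
- by apply: (derE (derN (@UU_der_x R F Fi 1%N 1%N t' x' isT a)));rewrite mul1r opprB.
- by apply: (derE (@UU_der_t R F Fi 0%N 0%N t' x' isT a));rewrite add0r mulrBr.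
- move=> e e0;have [h h0 Hh] := c 1%N 1%N isT e e0;exists h => // s y sy yx.
 by rewrite -opprD normrN;exact: Hh.
- move=> e e0;have [h h0 Hh] := lin 2%N 2%N 0%N 1%N (-1) (c 2%N 2%N isT) (c 0%N 1%N isT) e e0.
 by exists h => // s y sy yx;have := Hh s y sy yx;rewrite !mulN1r.
Qed.

Lemma UU_neg (F : R -> R) a b t x : t <= 0 -> UU F a b t x = 0.
Proof.
move=> t0;rewrite /UU (@eq_I _ _ _ (fun=> 0)) ?Rintegral_cst ?mul0r// => y _.
by rewrite kk_neg// mulr0.
Qed.

Lemma cal_UU_neg (F : R -> R) t x : t < 0 ->
 cal (fun t x => UU F 0 0 t x) (fun t x => - UU F 1 1 t x) (fun t x => UU F 2 2 t x - UU F 0 1 t x) t x.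
Proof.
move=> t0;have nt : 0 < - t by rewrite oppr_gt0.
exists (- t) => // t' x' tt _;have t'0 : t' < 0 by move: tt;rewrite ltr_norml => /andP[_];lra.
have z s y a b : s <= 0 -> UU F a b s y = 0 by exact: UU_neg.
have nt' : 0 < - t' by rewrite oppr_gt0.
have near s : `|s - t'| < - t' -> s <= 0 by rewrite ltr_norml => /andP[_];lra.
have j0 (f : R -> R -> R) : (forall s y, s <= 0 -> f s y = 0) -> jc f t' x'.
 move=> f0 e e0;exists (- t') => // s y /near s0 _.
 by rewrite !f0 ?subrr ?normr0// ltW.
split.
- apply: (@der_ext R (fun=> 0) _ x' _ 1) => //;first by move=> y _;rewrite z// ltW.
 by apply: (derE (derC 0 x'));rewrite z ?oppr0// ltW.
- apply: (@der_ext R (fun=> 0) _ x' _ 1) => //;first by move=> y _;rewrite z ?oppr0// ltW.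
 by apply: (derE (derC 0 x'));rewrite !z ?subrr// ltW.
- apply: (@der_ext R (fun=> 0) _ t' _ (- t')) => //;first by move=> s /near s0;rewrite z.
 by apply: (derE (derC 0 t'));rewrite !z ?subrr ?mulr0// ltW.
- by apply: j0 => s y s0;rewrite z// oppr0.
- by apply: j0 => s y s0;rewrite !z// subrr.
Qed.

Lemma jc_der (f fx : R -> R -> R) (ft : R -> R) t x (C d : R) : 0 < d ->
 (forall t' x', `|t' - t| < d -> `|x' - x| < d -> is_derive x' 1 (f t') (fx t' x') /\ `|fx t' x'| <= C) ->
 (forall t', `|t' - t| < d -> is_derive t' 1 (fun s => f s x) (ft t') /\ `|ft t'| <= C) -> jc f t x.
Proof.
move=> d0 Hx Ht e e0.
have xx : `|x - x| < d by rewrite subrr normr0.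
have tt : `|t - t| < d by rewrite subrr normr0.
have C0 : 0 <= C by apply: le_trans (Hx t x tt xx).2.
have K0 : 0 < C + 1 by rewrite ltr_wpDl.
have e20 : 0 < e / 2 / (C + 1) by rewrite !divr_gt0.
exists (Num.min d (e / 2 / (C + 1))) => [|t' x'];first by rewrite lt_min d0 e20.
rewrite !lt_min => /andP[t1 t2] /andP[x1 x2].
have B1 := @MVT_lip R (f t') (fx t') C x d (fun y h => (Hx t' y t1 h).1) (fun y h => (Hx t' y t1 h).2) x' x1.
have B2 := @MVT_lip R (fun s => f s x) ft C t d (fun y h => (Ht y h).1) (fun y h => (Ht y h).2) t' t1.
rewrite (_ : _ - _ = (f t' x' - f t' x) + (f t' x - f t x));last by ring.
apply: le_lt_trans (ler_normD _ _) _.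
have half u : 0 <= u -> u < e / 2 / (C + 1) -> C * u < e / 2.
 by move=> u0;rewrite ltr_pdivlMr// mulrDr mulr1 (mulrC u) => h;apply: le_lt_trans h;rewrite lerDl.
have h1 := half _ (normr_ge0 (x' - x)) x2;have h2 := half _ (normr_ge0 (t' - t)) t2.
rewrite (splitr e);apply: ltrD;[exact: le_lt_trans B1 h1|exact: le_lt_trans B2 h2].
Qed.

Lemma cal_S (j : R) t x : 0 < t -> cal (sS j) (S1 j) (fun t x => 4 * j * hk t x) t x.
Proof.
move=> t0;have t20 : 0 < t / 2 by rewrite divr_gt0.
exists (t / 2);first exact: t20.
move=> t' x' tt _;have t'0 : 0 < t' by move: tt;rewrite ltr_norml => /andP[];lra.
have T0 : 0 < t' * 2 by rewrite mulr_gt0.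
have t'20 : 0 < t' / 2 by rewrite divr_gt0.
have near s : `|s - t'| < t' / 2 -> t' / 2 <= s /\ s <= t' * 2 by rewrite ltr_norml => /andP[h1 h2];split;lra.
have bd a b : (a <= b.*2)%N -> exists2 C : R, 0 <= C & forall s y, `|s - t'| < t' / 2 -> `|kk a b s y| <= C.
 move=> ab;have [C C0 HC] := kk_bound ab T0 t'20 ltr01;exists C => // s y /near[h1 h2].
 by apply: HC => //;left.
have [C0 C00 H0] := bd 0%N 0%N isT;have [C1 C10 H1] := bd 1%N 1%N isT.
have [C2 C20 H2] := bd 2%N 2%N isT;have [C3 C30 H3] := bd 0%N 1%N isT.
have pos s : `|s - t'| < t' / 2 -> 0 < s by move=> /near[h _];exact: lt_le_trans h.
have jhk : jc (fun t x => hk t x) t' x'.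
 apply: (@jc_der (fun t x => hk t x) (fun t x => - kk 1 1 t x) (fun s => 2^-1 * kk 2 2 s x' - 2^-1 * kk 0 1 s x') t' x' (C1 + C2 + C3) (t' / 2)) => //.
 move=> s y hs _;split;first by apply: (derE (hk_der_x s y));rewrite /kk expr1 mulNr.
 by rewrite normrN;apply: le_trans (H1 s y hs) _;rewrite -addrA lerDl addr_ge0.
 move=> s hs;split.
 apply: (@der_ext R (fun s => kk 0 0 s x') _ s _ 1) => //;first by move=> u _;rewrite kk00.
 by apply: (derE (@kk_der_t R 0 0 s x' isT (or_introl (pos s hs))));rewrite add0r.
 have h2 := H2 s x' hs;have h3 := H3 s x' hs.
 apply: le_trans (ler_normB _ _) _;rewrite normrM [X in _ + X <= _]normrM gtr0_norm;last by rewrite invr_gt0.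
 move: h2 h3 C00 C10 C20 C30;move: (`|kk 2 2 s x'|) (`|kk 0 1 s x'|) (normr_ge0 (kk 2 2 s x')) (normr_ge0 (kk 0 1 s x')) => u v;lra.
split.
- exact: sS_der_x.
- exact: S1_der_x.
- exact: sS_der_t.
- have B s y : `|s - t'| < t' / 2 -> `|4 * j * hk s y| <= `|4 * j| * (C0 + C1) /\ `|4 * j * (- (2^-1) * kk 1 1 s y - 0)| <= `|4 * j| * (C0 + C1).
 move=> hs;have h0 := H0 s y hs;have h1 := H1 s y hs;rewrite kk00 in h0;rewrite subr0.
 split;rewrite normrM;apply: ler_wpM2l => //;first by apply: le_trans h0 _;rewrite lerDl.
 rewrite normrM normrN [`|2^-1|]gtr0_norm;last by rewrite invr_gt0.
 move: h1 C00 C10;move: (`|kk 1 1 s y|) (normr_ge0 (kk 1 1 s y)) => v;lra.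
 apply: (@jc_der _ (fun t x => 4 * j * hk t x) (fun s => 4 * j * (- (2^-1) * kk 1 1 s x' - 0)) t' x' _ (t' / 2) t'20).
 by move=> s y hs _;split;[exact: S1_der_x (pos s hs)|exact: (B s y hs).1].
 move=> s hs;split;last exact: (B s x' hs).2.
 exact: derZ (derB (NN_der_t x' (pos s hs)) (derC 2^-1 s)).
- have j0' : jc (fun _ _ => 0) t' x' by move=> e1 e10;exists 1 => // *;rewrite subrr normr0.
 move=> e e0;have [h h0 Hh] := @jc_lin (fun _ _ => 0) (fun t x => hk t x) t' x' (4 * j) j0' jhk e e0.
 by exists h => // s y sy yx;have := Hh s y sy yx;rewrite !add0r.
Qed.
End Cal.

Section StepTools.
Context {R : realType}.
Notation mu := (@lebesgue_measure R).
Implicit Types (t x c d e k y s : R) (f F G g : R -> R).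

Lemma der_uniq F x (a b : R) : is_derive x 1 F a -> is_derive x 1 F b -> a = b.
Proof. by case=> _ <-;case=> _ <-. Qed.

Lemma heat_lin F G t x k : 0 < t -> itg setT F -> itg setT G ->
 heat (fun y => F y + k * G y) t x = heat F t x + k * heat G t x.
Proof.
move=> t0 iF iG;rewrite /heat t0 !UU00E -IZ//;last exact: heat_int.
rewrite -ID//;[|exact: heat_int|exact: iZ (heat_int iG x t0)].
by apply: eq_I => y _;rewrite mulrDl mulrA.
Qed.

Lemma heat_mono F G t x : 0 < t -> itg setT F -> itg setT G ->
 (forall y, F y <= G y) -> heat F t x <= heat G t x.
Proof.
move=> t0 iF iG FG;rewrite /heat t0 !UU00E;apply: le_I => //;[exact: heat_int|exact: heat_int|].
by move=> y _;apply: ler_wpM2r;[exact: hk_ge0|exact: FG].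
Qed.

Lemma heatN F t x : itg setT F -> 0 < t -> (forall y, F (- y) = F y) ->
 heat F t (- x) = heat F t x.
Proof.
move=> iF t0 FN;rewrite /heat t0 !UU00E -[RHS]I_refl;last exact: heat_int.
by apply: eq_I => y _;rewrite FN -hkN opprB !opprK addrC.
Qed.

Lemma max0E (a : R) : Num.max a 0 = 2^-1 * (a + `|a|).
Proof. by case: (lerP a 0) => h;[rewrite ler0_norm// subrr mulr0|rewrite gtr0_norm//;lra]. Qed.

(** For an even [F] this is twice the positive mass on the half-line. *)
Definition PP F := \int[mu]_y (Num.max (F y) 0).

Lemma i_pos F : itg setT F -> itg setT (fun y => Num.max (F y) 0).
Proof.
move=> iF;rewrite (_ : (fun y => Num.max (F y) 0) = (fun y => 2^-1 * (F y + `|F y|)));last first.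
 by apply/funext => y;exact: max0E.
by apply: iZ => //;apply: iD => //;exact: iabs.
Qed.

Lemma i_if (c : R -> bool) f : measurable [set y | c y] -> itg setT f ->
 itg setT (fun y => if c y then f y else 0).
Proof.
move=> mc fi;apply: (@i_supp _ [set y | c y]) => //;first by move=> y /negP/negbTE ->.
apply: (@eq_integrable _ _ _ mu _ mc (EFin \o f));first by move=> y;rewrite inE /= => ->.
exact: integrableS fi.
Qed.

Lemma box_set (K : R) : [set y : R | `|y| <= K] = `[- K, K]%classic.
Proof. by apply/seteqP;split => y /=;rewrite in_itv/= ler_norml. Qed.

Lemma i_box (K k : R) : itg setT (fun y => if `|y| <= K then k else 0).
Proof.
have mb : measurable `[- K, K]%classic by exact: measurable_itv.
apply: (@i_supp _ `[- K, K]%classic) => //.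
 by move=> y /=;rewrite in_itv/= -ler_norml => /negP/negbTE ->.
apply: (@eq_integrable _ _ _ mu _ mb (EFin \o (fun=> k)));last exact: i_cst.
by move=> y;rewrite inE /= in_itv/= -ler_norml => ->.
Qed.

Lemma Ipos F (a b c : R) : itg setT F -> (forall y, 0 <= F y) -> a < b -> 0 < c ->
 (forall y, a <= y <= b -> c <= F y) -> 0 < \int[mu]_y F y.
Proof.
move=> iF F0 ab c0 Fc;have mb : measurable `[a, b]%classic by exact: measurable_itv.
have bE : \int[mu]_y (if a <= y <= b then c else 0) = c * (b - a).
 rewrite (@I_supp R `[a, b]%classic);last by move=> y /=;rewrite in_itv/= => /negP/negbTE ->.
 rewrite -I_cst ?ltW//;apply: eq_I => y /=;rewrite in_itv/= => h;by rewrite h.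
apply: (@lt_le_trans _ _ (c * (b - a)));first by rewrite mulr_gt0 ?subr_gt0.
rewrite -bE;apply: le_I => //;last by move=> y _;case: ifP => // /Fc.
apply: (@i_supp _ `[a, b]%classic) => //;first by move=> y /=;rewrite in_itv/= => /negP/negbTE ->.
apply: (@eq_integrable _ _ _ mu _ mb (EFin \o (fun=> c)));last exact: i_cst.
by move=> y;rewrite inE /= in_itv/= => ->.
Qed.

Variable j : R.
Hypothesis j0 : 0 < j.

Lemma SS_I s : 0 < s -> \int[mu]_y SS j s y <= 4 * j * s.
Proof.
move=> s0;apply: (@le_trans _ _ (\int[mu]_y (4 * j * s * hk s y))).
 apply: le_I => //;[exact: SS_i|exact: iZ (hk_int s0)|by move=> y _;exact: SS_le].
by rewrite IZ ?hk_int1 ?mulr1//;exact: hk_int.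
Qed.

(** The heat flow does not increase the mass of the positive part, and the source adds at most its
    own integral. Both the upper and the lower mass estimates between grid times rest on this
    inequality. *)
Lemma PP_up F s : 0 < s -> itg setT F ->
 PP (fun x => heat F s x + SS j s x) <= PP F + 4 * j * s.
Proof.
move=> s0 iF;have iP := i_pos iF;have iS := SS_i j0 s0;have iH := heat_i s0 iP.
apply: (@le_trans _ _ (\int[mu]_y (heat (fun y => Num.max (F y) 0) s y + SS j s y))).
 apply: le_I => //;[exact: i_pos (iD _ (heat_i s0 iF) iS)|exact: iD|move=> y _].
 rewrite ge_max;apply/andP;split.
 by apply: lerD => //;apply: heat_mono => // z;rewrite le_max lexx.
 by apply: addr_ge0;[apply: heat_ge0 => z;rewrite le_max lexx orbT|exact: SS_ge0].
by rewrite ID// heat_I//;apply: lerD => //;exact: SS_I.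
Qed.

Lemma flowS F s t x : 0 < s -> 0 < t -> itg setT F ->
 heat (fun x => heat F s x + SS j s x) t x + SS j t x = heat F (s + t) x + SS j (s + t) x.
Proof.
move=> s0 t0 iF;have := @heat_lin (heat F s) (SS j s) t x 1 t0 (heat_i s0 iF) (SS_i j0 s0).
rewrite (_ : (fun y => heat F s y + 1 * SS j s y) = (fun x => heat F s x + SS j s x));last first.
 by apply/funext => y;rewrite mul1r.
by move=> ->;rewrite mul1r (@heat_CK R F s t x s0 t0 iF) -addrA (@SS_CK R j j0 s t x s0 t0).
Qed.

(** The data to which total positivity applies, with a stretch [sg_far] where [f] is bounded away
    from [0] from below; it makes the solution negative far out at every later time. *)
Record sign_change f (a : R) : Prop := Sgn {
 sg_i : itg setT f;
 sg_N : forall y, f (- y) = f y;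
 sg_a : 0 < a;
 sg_pos : forall y, `|y| <= a -> 0 <= f y;
 sg_neg : forall y, a < `|y| -> f y <= 0;
 sg_far : exists b1 b2 c0 : R, [/\ a < b1, b1 < b2, 0 < c0 & forall y, b1 <= y <= b2 -> f y <= - c0] }.

Implicit Types (w v : R -> R -> R).
(** After [t0], [w] is the heat potential of [f] plus the smooth part [sS] of the flux potential.
    The density is [w - 2 * j * |x|]; keeping its corner at the origin out of [w] leaves a function
    that is caloric on the whole line. *)
Definition rep w w1 w2 t0 f := forall t x, t0 < t ->
 w t x = heat f (t - t0) x + sS j (t - t0) x /\ cal w w1 w2 t x.
Definition PW w t := \int[mu]_y (Num.max (w t y - 2 * j * `|y|) 0).
Definition zero w w1 t (X : R) := [/\ 0 < X, w t X - 2 * j * X = 0, w1 t X - 2 * j < 0,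
 forall y, 0 <= y < X -> 0 < w t y - 2 * j * y & forall y, X < y -> w t y - 2 * j * y < 0].
(** A slice with a single transversal zero, regular up to that zero; [w1 t 0 = 0] is what gives the
    density the flux [- 2 * j] at the origin. *)
Definition good_slice w w1 w2 t := [/\ exists X : R, zero w w1 t X /\ (forall x, 0 <= x <= X -> cal w w1 w2 t x),
 forall x, w t (- x) = w t x & w1 t 0 = 0].

Lemma PW_rep w w1 w2 t0 f t : rep w w1 w2 t0 f -> t0 < t ->
 PW w t = PP (fun x => heat f (t - t0) x + SS j (t - t0) x).
Proof.
by move=> H tt;apply: eq_I => y _;rewrite (H t y tt).1 /SS addrA.
Qed.

Lemma rep_even w w1 w2 t0 f t x : rep w w1 w2 t0 f -> itg setT f -> (forall y, f (- y) = f y) ->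
 t0 < t -> w t (- x) = w t x.
Proof.
move=> H fi fN tt;have s0 : 0 < t - t0 by rewrite subr_gt0.
by rewrite !(H t _ tt).1 heatN// sS_N.
Qed.

Lemma rep_good w w1 w2 t0 f a t : sign_change f a -> rep w w1 w2 t0 f -> t0 < t -> 0 < PW w t -> good_slice w w1 w2 t.
Proof.
move=> [fi fN a0 fp fn ff] H tt P0;have s0 : 0 < t - t0 by rewrite subr_gt0.
have wN x : w t (- x) = w t x by exact: rep_even H fi fN tt.
have dw x : is_derive x 1 (w t) (w1 t x).
 by have [d d0 Hd] := (H t x tt).2;have [] := Hd t x;rewrite ?subrr ?normr0.
have w1E x : w1 t x = - UU f 1 1 (t - t0) x + S1 j (t - t0) x.
 apply: (der_uniq (dw x)).
 apply: (@der_ext R (fun y => heat f (t - t0) y + sS j (t - t0) y) _ x _ 1) => //.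
 by move=> y _;rewrite (H t y tt).1.
 exact: derD (heat_der_x fi x s0) (sS_der_x j x s0).
have w10 : w1 t 0 = 0.
 have dw0 : is_derive (- 0 : R) 1 (w t) (w1 t 0) by rewrite oppr0;exact: dw.
 have := @der_comp R (w t) (fun y => - y) 0 _ _ dw0 (derN (derI 0)).
 move=> D;have := der_uniq (dw 0) (@der_ext R _ (w t) 0 _ 1 ltr01 (fun y _ => wN y) D).
 by move=> E;move: E;rewrite mulrN1;move: (w1 t 0) => u;lra.
pose phi y := w t y - 2 * j * y;pose phi' y := w1 t y - 2 * j.
have dphi y : is_derive y 1 phi (phi' y) by apply: (derE (derB (dw y) (derZ (2 * j) (derI y))));rewrite mulr1.
have phiE y : 0 < y -> phi y = heat f (t - t0) y + SS j (t - t0) y.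
 by move=> y0;rewrite /phi (H t y tt).1 /SS (gtr0_norm y0) addrA.
have key x : 0 < x -> phi x = 0 -> phi' x < 0.
 move=> x0;rewrite phiE// => /(@TP R j f a (t - t0) j0 fi fN a0 s0 fp fn x x0).
 by rewrite /phi' w1E addrA.
(* A density nonpositive at the origin, where its slope is [- 2 * j], would be negative for all
   [y > 0], since it crosses zero only downwards; its positive part would then carry no mass. *)
have phi00 : 0 < phi 0.
 rewrite ltNge;apply/negP => p0.
 have neg : forall y, 0 < y -> phi y < 0.
 apply: (@stay_neg R phi phi' 0 (fun x _ => dphi x) key).
 have : phi' 0 < 0 by rewrite /phi' w10 sub0r oppr_lt0 mulr_gt0.
 move=> /(der_lt_right (dphi 0)) [d d0 Hd];exists d => // y yy;exact: lt_le_trans (Hd y yy) p0.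
 move: P0;rewrite /PW (@eq_I _ _ _ (fun=> 0));first by rewrite (@Rintegral_cst _ _ _ mu) ?mul0r ?ltxx.
 move=> y _;apply/eqP;rewrite eq_le le_max lexx orbT andbT ge_max lexx andbT.
 have -> : w t y = w t `|y| by case: (ger0P y) => // _;rewrite wN.
 have [->|yn] := eqVneq y 0;first by rewrite normr0.
 by apply: ltW;apply: neg;rewrite normr_gt0.
have [b1 [b2 [c0 [ab bb c00 Hb]]]] := ff.
have [x x0 nx] := @neg_far R j f a (t - t0) j0 fi a0 s0 fp fn b1 b2 c0 ab bb c00 Hb.
have [||X [X0 XE Xp Xn]] := @single_zero R phi phi' (fun x _ => dphi x) key _ phi00.
- move=> e e0;have [d d0 Hd] := is_derive_cont (dphi 0) e0;exists d => // y /andP[y0 yd].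
 by apply: Hd;rewrite subr0 ger0_norm.
- by exists x => //;rewrite phiE.
split=> //;exists X;split;last by move=> y _;exact: (H t y tt).2.
split=> //;exact: key.
Qed.
End StepTools.

Section Iterate.
Context {R : realType}.
Notation mu := (@lebesgue_measure R).
Implicit Types (t x c d e k y s : R) (f F G g : R -> R) (w v : R -> R -> R).
Variable j : R.
Hypothesis j0 : 0 < j.

Lemma SS_I_gt0 s : 0 < s -> 0 < \int[mu]_y SS j s y.
Proof.
move=> s0;have S1p := SS_gt0 j0 s0 ltr01.
have e0 : 0 < SS j s 1 / 2 by rewrite divr_gt0.
have D := derB (sS_der_x j 1 s0) (derZ (2 * j) (derI 1)).
have [d d0 Hd] := is_derive_cont D e0.
apply: (@Ipos R _ 1 (1 + d / 2) (SS j s 1 / 2)) => //;first exact: SS_i.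
- by move=> y;exact: SS_ge0.
- by rewrite ltrDl divr_gt0.
- move=> y /andP[y1 y2];have y0 : 0 < y by exact: lt_le_trans y1.
 have /Hd : `|y - 1| < d by rewrite ger0_norm ?subr_ge0//;lra.
 rewrite ltr_norml => /andP[h _];move: h;rewrite /SS (gtr0_norm y0) normr1 => h.
 by move: h;move: (sS j s y) (sS j s 1) => u u';lra.
Qed.

Lemma max0_cut (a b : R) : 0 <= b -> Num.max (a + b) 0 <= Num.max a 0 + b.
Proof. by move=> b0;rewrite ge_max lerD2r le_max lexx/= addr_ge0// le_max lexx orbT. Qed.

(** The positive mass of [G - B * H] is continuous in [B], equals [PP G] at [B = 0], and tends to
    [0] as [B] grows because [H] is positive everywhere; the intermediate value theorem gives
    [B]. *)
Lemma mass_tune G H P0 : itg setT G -> itg setT H ->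
 (forall y, 0 < H y) -> 0 < P0 -> P0 < PP G -> exists2 B : R, 0 < B & PP (fun y => G y - B * H y) = P0.
Proof.
move=> iG iH H0 P00 PG;pose q B := PP (fun y => G y - B * H y).
have iq B : itg setT (fun y => G y - B * H y) by apply: iB => //;exact: iZ.
have q0 : q 0 = PP G by apply: eq_I => y _;rewrite mul0r subr0.
have qlip A B : q A <= q B + `|A - B| * \int[mu]_y H y.
 rewrite -IZ// -ID//;[|exact: i_pos|exact: iZ].
 apply: le_I => //;[exact: i_pos|exact: iD (i_pos (iq B)) (iZ _ _ iH)|move=> y _].
 apply: le_trans (max0_cut _ (mulr_ge0 (normr_ge0 _) (ltW (H0 y)))).
 rewrite ge_max [X in _ && X]le_max lexx orbT andbT le_max;apply/orP;left.
 have hAB : B - A <= `|A - B| by rewrite -normrN opprB ler_norm.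
 have := ler_wpM2r (ltW (H0 y)) hAB;rewrite mulrBl.
 by move: (A * H y) (B * H y) (`|A - B| * H y) => *;lra.
have [mG mH] := (i_meas iG, i_meas iH).
have [|||||_ Hd] := (@dct_seq R setT (fun n y => Num.max (G y - n%:R * H y) 0) (fun=> 0) (fun y => `|G y|) measurableT).
- by move=> n;exact: i_meas (i_pos (iq n%:R)).
- exact: measurable_cst.
- apply: aeW => y _;apply/cvgrPdist_lt => e e0.
 have [M HM] : exists M, forall n, (M <= n)%N -> G y - n%:R * H y <= 0.
 exists (Num.truncn (`|G y| / H y)).+1 => n Mn;rewrite subr_le0.
 have : `|G y| / H y < n%:R.
 by apply: lt_le_trans (_ : (Num.truncn (`|G y| / H y)).+1%:R <= _);[exact: truncnS_gt|rewrite ler_nat].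
 by rewrite ltr_pdivrMr// => h;apply: le_trans (ler_norm _) (ltW h).
 exists M => // n /= Mn;rewrite max_r ?subrr ?normr0//;exact: HM.
- exact: iabs.
- move=> n y _;rewrite ger0_norm;last by rewrite le_max lexx orbT.
 rewrite ge_max normr_ge0 andbT;apply: le_trans (ler_norm (G y));rewrite lerBlDr lerDl.
 by rewrite mulr_ge0 ?ler0n// ltW.
have P02 : 0 < P0 / 2 by rewrite divr_gt0.
have [n0 /(_ n0 (leqnn _)) h] := Hd _ P02.
have qn : q n0%:R <= P0 / 2.
 apply: le_trans h;rewrite le_eqVlt;apply/orP;left;apply/eqP;apply: eq_I => y _.
 by rewrite subr0 ger0_norm// le_max lexx orbT.
have cq : continuous q.
 move=> A;apply/cont_epsP => e e0;have I0 : 0 <= \int[mu]_y H y by apply: I_ge0 => y _;exact: ltW.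
 have I1 : 0 < \int[mu]_y H y + 1 by rewrite ltr_wpDl.
 exists (e / (\int[mu]_y H y + 1)) => [|B];first by rewrite divr_gt0.
 rewrite ltr_pdivlMr// => AB;have h1 := qlip A B;have h2 := qlip B A;rewrite (distrC A B) in h1.
 rewrite ltr_norml;have := normr_ge0 (B - A).
 by move: AB h1 h2;move: (`|B - A|) (q A) (q B) (\int[mu]_y H y) => u qa qb I AB h1 h2 u0;rewrite mulrDr mulr1 in AB;apply/andP;split;lra.
have n0p : (0 : R) <= n0%:R by rewrite ler0n.
have [||B] := @IVT R q 0 n0%:R P0 n0p.
- by apply: continuous_subspaceT.
- have l1 : q n0%:R < q 0 by rewrite q0;move: qn PG P00;move: (q _) (PP G) => u v';lra.
 rewrite min_r ?max_l ?(ltW l1)//;move: qn PG P00;rewrite q0;move: (q n0%:R) (PP G) => u v';lra.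
rewrite in_itv/= => /andP[B0 _] qB;exists B => //;rewrite lt_neqAle B0 andbT.
by apply/negP => /eqP E;move: PG;rewrite -q0 E qB ltxx.
Qed.

Lemma heat_box_gt0 (K h x : R) : 0 < K -> 0 < h ->
 0 < heat (fun y => (if `|y| <= K + 1 then 1 else 0) - (if `|y| <= K then 1 else 0)) h x.
Proof.
move=> K0 h0;have ic := iB measurableT (i_box (K + 1) 1) (i_box K 1).
rewrite /heat h0 UU00E;apply: (@Ipos R _ (K + 1 / 2) (K + 1) (hk h (`|x| + (K + 1)))).
- exact: heat_int.
- move=> y;apply: mulr_ge0;last exact: hk_ge0.
 case: ifP => h1;case: ifP => h2;rewrite ?subrr ?subr0 ?ler01//.
 by move: h1;rewrite (le_trans h2) ?lerDl.
- lra.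
- exact: hk_gt0.
move=> y /andP[y1 y2];have y0 : 0 < y by apply: lt_le_trans y1;rewrite addr_gt0.
rewrite (gtr0_norm y0) y2 ifF ?subr0 ?mul1r;last by apply/negbTE;rewrite -ltNge;lra.
apply: hk_mono;rewrite -(real_normK (num_real (x - y))) ler_sqr ?nnegrE ?addr_ge0//;last by lra.
by apply: le_trans (ler_normB _ _) _;rewrite lerD2l gtr0_norm.
Qed.

(** Only the negative part of [W] is changed, hence not its positive mass. When [W] is erased beyond
    [X + eta], the negative mass left in the thin layer is at most half of what the source brings in
    during [h], so the positive mass would exceed [P0] at time [h]. A bump of depth [B] beyond the
    layer brings it back to [P0] exactly. The untouched layer keeps the change away from
    [[- X, X]]. *)
Lemma cut_datum (W : R -> R) (X h P0 : R) : itg setT W -> (forall y, W (- y) = W y) -> 0 < X ->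
 (forall y, `|y| <= X -> 0 <= W y) -> (forall y, X < `|y| -> W y < 0) -> PP W = P0 -> 0 < P0 -> 0 < h ->
 exists (eta : R) (f : R -> R), [/\ 0 < eta, sign_change f X, forall y, `|y| <= X + eta -> f y = W y, PP f = P0 &
 PP (fun x => heat f h x + SS j h x) = P0].
Proof.
move=> iW WN X0 Wp Wn PPW P00 h0.
have mB K : measurable [set y : R | `|y| <= K] by rewrite box_set;exact: measurable_itv.
have iWK K : itg setT (fun y => if `|y| <= K then W y else 0).
 exact: (i_if (mB K) iW).
have SI := SS_I_gt0 h0.
have [eta eta0 gI] : exists2 eta : R, 0 < eta &
 P0 - (\int[mu]_y SS j h y) / 2 <= \int[mu]_y (if `|y| <= X + eta then W y else 0).
 have [|||||_ Hd] := (@dct_seq R setT (fun n y => if `|y| <= X + n.+1%:R^-1 then W y else 0) (fun y => Num.max (W y) 0) (fun y => `|W y|) measurableT).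
 - by move=> n;exact: i_meas (iWK _).
 - exact: i_meas (i_pos iW).
 - apply: aeW => y _;apply/cvgrPdist_lt => e e0;have [yX|yX] := leP `|y| X.
 exists 0%N => // n _ /=;rewrite (le_trans yX) ?lerDl// max_l ?subrr ?normr0//;exact: Wp.
 have [N HN] := ltr_add_invr yX.
 exists N => // n /= Nn;rewrite leNgt ifF.
 by rewrite max_r ?subrr ?normr0// ltW// Wn.
 apply/negbTE;rewrite negbK;apply: le_lt_trans HN;rewrite lerD2l lef_pV2 ?posrE ?ltr0n// ler_nat.
 exact: Nn.
 - exact: iabs.
 - by move=> n y _;case: ifP => _;rewrite ?normr0.
 have SI2 : 0 < (\int[mu]_y SS j h y) / 2 by rewrite divr_gt0.
 have [N HN] := Hd _ SI2;exists (N.+1%:R^-1);first by rewrite invr_gt0 ltr0n.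
 have := HN N (leqnn _);rewrite -PPW /PP => hN.
 rewrite lerBlDr -lerBlDl -IB//;last exact: i_pos.
 apply: le_trans hN;apply: le_I => //;[exact: iB (i_pos iW) (iWK _)|exact: iabs (iB _ (iWK _) (i_pos iW))|].
 by move=> y _;rewrite distrC;exact: ler_norm.
pose K := X + eta;pose g y := if `|y| <= K then W y else 0.
pose chi (y : R) := (if `|y| <= K + 1 then 1 else 0) - (if `|y| <= K then 1 else 0) : R.
have K0 : 0 < K by rewrite addr_gt0.
have XK : X < K by rewrite ltrDl.
have ig : itg setT g by exact: iWK.
have ic : itg setT chi by exact: iB (i_box _ _) (i_box _ _).
have chi0 y : `|y| <= K -> chi y = 0.
 by move=> yK;rewrite /chi yK (le_trans yK) ?lerDl// subrr.
have chi_ge y : 0 <= chi y.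
 rewrite /chi;case: ifP => h1;case: ifP => h2;rewrite ?subrr ?subr0 ?ler01//.
 by move: h1;rewrite (le_trans h2) ?lerDl.
pose G y := heat g h y + SS j h y.
have iG : itg setT G by apply: iD => //;[exact: heat_i|exact: SS_i].
have PG : P0 < PP G.
 apply: (@lt_le_trans _ _ (\int[mu]_y G y));last first.
 by apply: le_I => //;[exact: i_pos|move=> y _;rewrite le_max lexx].
 rewrite ID//;[|exact: heat_i|exact: SS_i].
 rewrite heat_I//;move: gI SI;rewrite -/K -/g.
 by move: (\int[mu]_y SS j h y) (\int[mu]_y _) => u u';lra.
have [B B0 qB] := mass_tune iG (heat_i h0 ic) (fun x => heat_box_gt0 x K0 h0) P00 PG.
pose fB y := g y + (- B) * chi y.
have ifB : itg setT fB by apply: iD => //;exact: iZ.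
have sfB : sign_change fB X.
 split=> //.
 - by move=> y;rewrite /fB /g /chi !normrN WN.
 - move=> y yX;have yK : `|y| <= K by exact: le_trans yX (ltW XK).
 by rewrite /fB chi0// mulr0 addr0 /g yK;exact: Wp.
 - move=> y yX;rewrite /fB;have [yK|yK] := leP `|y| K.
 by rewrite chi0// mulr0 addr0 /g yK ltW// Wn.
 by rewrite /g [`|y| <= K]leNgt yK add0r mulNr oppr_le0 mulr_ge0 ?chi_ge// ltW.
 - exists (K + 1 / 2), (K + 1), B;split=> //.
 - by rewrite (lt_trans XK)// ltrDl divr_gt0.
 - by rewrite ltrD2l ltr_pdivrMr// mul1r ltr1n.
 move=> y /andP[y1 y2].
 have y0 : 0 < y by apply: lt_le_trans y1;rewrite addr_gt0.
 have yK : K < y by apply: lt_le_trans y1;rewrite ltrDl divr_gt0.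
 by rewrite /fB /g /chi (gtr0_norm y0) y2 [y <= K]leNgt yK/= add0r subr0 mulr1.
have PPf : PP fB = P0.
 rewrite -PPW;apply: eq_I => y _;have [yX|yX] := leP `|y| X.
 by rewrite /fB chi0 ?(le_trans yX (ltW XK))// mulr0 addr0 /g (le_trans yX (ltW XK)).
 by rewrite !max_r//;[exact: ltW (Wn _ yX)|exact: sg_neg sfB _ yX].
exists eta, fB;split=> //.
 by move=> y yK;rewrite /fB chi0// mulr0 addr0 /g yK.
rewrite -qB;apply: eq_I => y _;rewrite (@heat_lin R g chi h y (- B) h0 ig ic) /G mulNr.
by congr (Num.max _ _);rewrite addrAC.
Qed.

Let arith1 (a b c s1 s2 k : R) : a + (s1 - k) = b + (s2 - k) -> b + s2 + (-1) * (a + (-1) * c) = c + s1.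
Proof. lra. Qed.

(** The removed part [m] of the datum lives beyond [X + eta], so its potential started at [t1]
    vanishes up to [t1] and is smooth across [t1] where [|x| <= X]. Subtracting it for all times
    changes the datum at [t1] without creating a singularity at the free boundary. *)
Lemma rep_cut w w1 w2 t0 t1 f g (X eta : R) : rep j w w1 w2 t0 f -> itg setT f -> t0 < t1 ->
 itg setT g -> 0 < eta ->
 (forall y, `|y| <= X + eta -> g y = heat f (t1 - t0) y + SS j (t1 - t0) y) ->
 exists v v1 v2 : R -> R -> R, [/\
 forall t x, t <= t1 -> [/\ v t x = w t x, v1 t x = w1 t x & v2 t x = w2 t x],
 forall t x, t <= t1 -> cal w w1 w2 t x -> t < t1 \/ `|x| <= X -> cal v v1 v2 t x &
 rep j v v1 v2 t1 g].
Proof.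
move=> H fi tt ig eta0 gE;have s0 : 0 < t1 - t0 by rewrite subr_gt0.
have [W WE] : exists W : R -> R, W = fun y => heat f (t1 - t0) y + SS j (t1 - t0) y by eexists.
have iW : itg setT W by rewrite WE;exact: iD (heat_i s0 fi) (SS_i j0 s0).
have {}gE y : `|y| <= X + eta -> g y = W y by rewrite WE;exact: gE.
have [m mE] : exists m : R -> R, m = fun y => W y + (-1) * g y by eexists.
have im : itg setT m by rewrite mE;exact: iD measurableT iW (iZ (-1) measurableT ig).
have m0 y : m y != 0 -> X + eta < `|y|.
 rewrite ltNge;apply: contra => yK;apply/eqP;rewrite mE /= gE// mulN1r;exact: subrr.
have calv t x : cal w w1 w2 t x -> t < t1 \/ adm m (t - t1) x -> cal (fun t x => w t x + (-1) * UU m 0 0 (t - t1) x)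
 (fun t x => w1 t x + (-1) * (- UU m 1 1 (t - t1) x)) (fun t x => w2 t x + (-1) * (UU m 2 2 (t - t1) x - UU m 0 1 (t - t1) x)) t x.
 move=> cw ht;apply: (cal_lin (-1) cw).
 apply: (@cal_shift R (fun t x => UU m 0 0 t x) (fun t x => - UU m 1 1 t x) (fun t x => UU m 2 2 t x - UU m 0 1 t x) t x t1).
 by case: ht => ht;[apply: cal_UU_neg;rewrite subr_lt0|exact: cal_UU].
exists (fun t x => w t x + (-1) * UU m 0 0 (t - t1) x), (fun t x => w1 t x + (-1) * (- UU m 1 1 (t - t1) x)),
 (fun t x => w2 t x + (-1) * (UU m 2 2 (t - t1) x - UU m 0 1 (t - t1) x));split.
- move=> t x tt1;have u0 : t - t1 <= 0 by rewrite subr_le0.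
 by rewrite !(UU_neg _ _ _ _ u0) !(subrr, oppr0, mulr0, addr0).
- move=> t x tt1 cw;case=> ht;apply: (calv t x cw);first by left.
 move: tt1;rewrite le_eqVlt => /orP[/eqP E|tlt];last by left.
 right;right;exists eta;first exact: eta0.
 move=> y /m0 yK;rewrite distrC;apply: le_trans (lerB_dist _ _);rewrite lerBrDl.
 by apply: le_trans (ltW yK);rewrite lerD2r.
move=> t x t1t;have u0 : 0 < t - t1 by rewrite subr_gt0.
have t0t := lt_trans tt t1t;split;last by apply: (calv t x (H t x t0t).2);right;left.
have E1 := @flowS R j j0 f (t1 - t0) (t - t1) x s0 u0 fi;rewrite -WE in E1.
have tE : t1 - t0 + (t - t1) = t - t0 by ring.
have E2 := @heat_lin R W g (t - t1) x (-1) u0 iW ig;rewrite -mE in E2.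
have E3 : heat m (t - t1) x = UU m 0 0 (t - t1) x by rewrite /heat u0.
rewrite tE in E1;rewrite (H t x t0t).1 -E3 E2;apply: arith1 (2 * j * `|x|) _;exact: E1.
Qed.

Let arith2 (a b c d e k : R) : a <= b -> e <= k -> b <= c + e -> d = a -> d - k <= c.
Proof. lra. Qed.
Let arith3 (a k k' p : R) : a <= p + k' -> k' <= k -> p - k <= a -> - k <= a - p <= k.
Proof. by move=> h1 h2 h3;apply/andP;split;lra. Qed.

(** The upper mass bound is [PP_up] from [t1] to [t]; the lower one is [PP_up] from [t] to [t1 + h],
    where the mass is again [P0]. *)
Lemma step w w1 w2 t0 f a t1 (X h P0 : R) : rep j w w1 w2 t0 f -> sign_change f a -> t0 < t1 -> zero j w w1 t1 X ->
 PW j w t1 = P0 -> 0 < h -> 4 * j * h < P0 ->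
 exists v v1 v2 : R -> R -> R, exists g : R -> R, exists b : R, [/\
 forall t x, t <= t1 -> [/\ v t x = w t x, v1 t x = w1 t x & v2 t x = w2 t x],
 forall t x, t <= t1 -> cal w w1 w2 t x -> t < t1 \/ `|x| <= X -> cal v v1 v2 t x,
 rep j v v1 v2 t1 g /\ sign_change g b,
 forall t, t1 < t <= t1 + h -> good_slice j v v1 v2 t /\ `|PW j v t - P0| <= 4 * j * h &
 PW j v (t1 + h) = P0].
Proof.
move=> H [fi fN _ _ _ _] tt [X0 XE _ Xp Xn] PE h0 hP.
have s0 : 0 < t1 - t0 by rewrite subr_gt0.
have P00 : 0 < P0 by apply: lt_trans hP;rewrite !mulr_gt0.
have wN x : w t1 (- x) = w t1 x by exact: rep_even H fi fN tt.
have [W WD] : exists W : R -> R, W = fun y => heat f (t1 - t0) y + SS j (t1 - t0) y by eexists.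
have iW : itg setT W by rewrite WD;exact: iD (heat_i s0 fi) (SS_i j0 s0).
have WN y : W (- y) = W y by rewrite WD heatN// SS_N.
have WE y : w t1 y - 2 * j * `|y| = W y by rewrite (H t1 y tt).1 WD /SS addrA.
have WA y : W y = w t1 `|y| - 2 * j * `|y|.
 by rewrite -WE;case: (ger0P y) => // _;rewrite wN.
have Wp y : `|y| <= X -> 0 <= W y.
 rewrite WA le_eqVlt => /orP[/eqP ->|yX];first by rewrite XE.
 by apply: ltW;apply: Xp;rewrite normr_ge0.
have Wn y : X < `|y| -> W y < 0 by rewrite WA;exact: Xn.
have PPW : PP W = P0 by rewrite -PE;apply: eq_I => y _;rewrite WE.
have [eta [g [eta0 sg gE Pg Pgh]]] := cut_datum iW WN X0 Wp Wn PPW P00 h0.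
have ig := sg_i sg.
have gE' y : `|y| <= X + eta -> g y = heat f (t1 - t0) y + SS j (t1 - t0) y by move=> /gE ->;rewrite WD.
have [v [v1 [v2 [S1 S2 S3]]]] := rep_cut H fi tt ig eta0 gE'.
have PWv t : t1 < t -> PW j v t = PP (fun x => heat g (t - t1) x + SS j (t - t1) x) := fun h => PW_rep S3 h.
have t1h : t1 < t1 + h by rewrite ltrDl.
have last : PW j v (t1 + h) = P0.
 by rewrite (PWv _ t1h) (_ : t1 + h - t1 = h) ?Pgh// addrAC subrr add0r.
exists v, v1, v2, g, X;split;[exact: S1|exact: S2|by split| |exact: last].
move=> t /andP[t1t tth];have u0 : 0 < t - t1 by rewrite subr_gt0.
have up := PP_up j0 u0 ig;rewrite -(PWv _ t1t) Pg in up.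
have jh s : s <= h -> 4 * j * s <= 4 * j * h by move=> sh;rewrite ler_pM2l// mulr_gt0.
have low : P0 - 4 * j * h <= PW j v t.
 move: tth;rewrite le_eqVlt => /orP[/eqP ->|tth].
 by rewrite last gerBl !mulr_ge0 ?ltW.
 have r0 : 0 < t1 + h - t by rewrite subr_gt0.
 have iF : itg setT (fun x => heat g (t - t1) x + SS j (t - t1) x).
 exact: iD measurableT (heat_i u0 ig) (SS_i j0 u0).
 have hP' := PP_up j0 r0 iF;rewrite -(PWv _ t1t) in hP'.
 have tE : t - t1 + (t1 + h - t) = t1 + h - t1 by ring.
 have E : PW j v (t1 + h) = PP (fun x => heat (fun x => heat g (t - t1) x + SS j (t - t1) x) (t1 + h - t) x + SS j (t1 + h - t) x).
 rewrite (PWv _ t1h);congr PP;apply/funext => y.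
 by rewrite (@flowS R j j0 g (t - t1) (t1 + h - t) y u0 r0 ig) tE.
 have rh : t1 + h - t <= h by rewrite lerBlDr addrC lerD2l ltW.
 by apply: (arith2 (lexx _) (jh _ rh) hP');rewrite -E last.
split;last first.
 have th : t - t1 <= h by rewrite lerBlDl.
 by rewrite ler_norml;exact: arith3 up (jh _ th) low.
by apply: (rep_good j0 sg S3 t1t);apply: lt_le_trans low;rewrite subr_gt0.
Qed.
End Iterate.

Section Tools6.
Context {R : realType}.
Implicit Types (f g : R -> R) (x y a b l X : R).

Lemma eps_cvg_right f a l : (forall e : R, 0 < e -> exists2 d : R, 0 < d & forall s, a < s < a + d -> `|f s - l| < e) ->
 f s @[s --> a^'+] --> l.
Proof.
move=> H;apply/cvgrPdist_lt => e e0;have [d d0 Hd] := H e e0.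
exists d => //= s sd' sa;have sd2 : `|a - s| < d := sd';rewrite distrC;apply: Hd.
by move: sd2;rewrite distrC ltr_norml => /andP[_ sd];rewrite sa -ltrBlDl.
Qed.

Lemma eps_cvg_left f a l : (forall e : R, 0 < e -> exists2 d : R, 0 < d & forall s, a - d < s < a -> `|f s - l| < e) ->
 f s @[s --> a^'-] --> l.
Proof.
move=> H;apply/cvgrPdist_lt => e e0;have [d d0 Hd] := H e e0.
exists d => //= s sd' sa;have sd2 : `|a - s| < d := sd';rewrite distrC;apply: Hd.
by move: sd2;rewrite ltr_norml => /andP[_ sd];rewrite sa andbT ltrBlDr -ltrBlDl.
Qed.

Lemma cvg_both f a l : (forall e : R, 0 < e -> exists2 d : R, 0 < d & forall s, `|s - a| < d -> `|f s - l| < e) ->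
 f s @[s --> a^'+] --> l /\ f s @[s --> a^'-] --> l.
Proof.
move=> H;split;[apply: eps_cvg_right|apply: eps_cvg_left] => e /H[d d0 Hd];exists d => // s /andP[s1 s2];apply: Hd.
 by rewrite gtr0_norm ?subr_gt0// ltrBlDl.
by rewrite distrC gtr0_norm ?subr_gt0// ltrBlDr -ltrBlDl.
Qed.

Lemma der1 f x l : is_derive x 1 f l -> (f^`() x)%classic = l.
Proof. by move=> H;rewrite derive1E;case: H => _ <-. Qed.

(** The derivatives are assumed in full neighbourhoods of the end points too, so the one-sided
    limits at the boundary are values of continuous functions. *)
Lemma C2_of f (g1 g2 : R -> R) X : 0 < X -> (forall x, 0 <= x <= X -> exists2 d : R, 0 < d & forall y, `|y - x| < d ->
 [/\ is_derive y 1 f (g1 y), is_derive y 1 g1 (g2 y) & {for y, continuous g2}]) ->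
 C2_up_to_boundary 0 X f /\ forall x, 0 <= x <= X -> [/\ (f^`() x)%classic = g1 x,
 (f^`(2) x)%classic = g2 x & (f^`() r @[r --> x^'+] --> g1 x)%classic].
Proof.
move=> X0 H.
have H1 x : 0 <= x <= X -> exists2 d : R, 0 < d & forall y, `|y - x| < d ->
 [/\ (f^`() y)%classic = g1 y, (f^`(2) y)%classic = g2 y & is_derive y 1 (f^`())%classic (g2 y)].
 move=> /H[d d0 Hd];exists d => // y yd;have [A1 A2 A3] := Hd y yd.
 have D : is_derive y 1 (f^`())%classic (g2 y).
 apply: (@der_ext R g1 _ y _ (d - `|y - x|)) A2;first by rewrite subr_gt0.
 move=> z zd;rewrite (der1 (_ : is_derive z 1 f (g1 z)))//.
 have [] // := Hd z;rewrite (_ : z - x = (z - y) + (y - x));last by ring.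
 by apply: le_lt_trans (ler_normD _ _) _;rewrite -ltrBrDr.
 by split=> //;[exact: der1 A1|exact: der1 D].
have xx x : `|x - x| < 1 by rewrite subrr normr0.
have in0 : 0 <= (0 : R) <= X by rewrite lexx ltW.
have inX : 0 <= X <= X by rewrite lexx ltW.
have ioo x : x \in `]0, X[%R -> 0 <= x <= X by rewrite in_itv/= => /andP[/ltW -> /ltW ->].
have ioo' x : x \in `]0, X[%classic -> 0 <= x <= X by rewrite inE/=;exact: ioo.
have L0 x : 0 <= x <= X -> f s @[s --> x^'+] --> f x /\ f s @[s --> x^'-] --> f x.
 move=> /H[d d0 Hd];apply: cvg_both => e e0;have [|A _ _] := Hd x;first by rewrite subrr normr0.
 exact: (is_derive_cont A e0).
have L1 x : 0 <= x <= X -> (f^`() s @[s --> x^'+] --> g1 x)%classic /\ (f^`() s @[s --> x^'-] --> g1 x)%classic.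
 move=> xX;have [d d0 Hd] := H x xX;have [h h0 Hh] := H1 x xX;apply: cvg_both => e e0.
 have [|_ A _] := Hd x;first by rewrite subrr normr0.
 have [k k0 Hk] := is_derive_cont A e0;exists (Num.min k h) => [|s];first by rewrite lt_min k0.
 by rewrite lt_min => /andP[s1 s2];have [-> _ _] := Hh s s2;exact: Hk.
have L2 x : 0 <= x <= X -> (f^`(2) s @[s --> x^'+] --> g2 x)%classic /\ (f^`(2) s @[s --> x^'-] --> g2 x)%classic.
 move=> xX;have [d d0 Hd] := H x xX;have [h h0 Hh] := H1 x xX;apply: cvg_both => e e0.
 have [|_ _ A] := Hd x;first by rewrite subrr normr0.
 have [k k0 Hk] := (cont_epsP _ _).1 A e e0;exists (Num.min k h) => [|s];first by rewrite lt_min k0.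
 by rewrite lt_min => /andP[s1 s2];have [_ -> _] := Hh s s2;exact: Hk.
split;last first.
 move=> x xX;have [h h0 Hh] := H1 x xX;have [|E1 E2 _] := Hh x;first by rewrite subrr normr0.
 by split=> //;exact: (L1 x xX).1.
split.
- split;[|exact: (L0 0 in0).1|exact: (L0 X inX).2].
 move=> x /ioo xX;have [d d0 Hd] := H x xX;have [|A _ _] := Hd x;first by rewrite subrr normr0.
 by case: A.
- move=> x /ioo' xX;have [d d0 Hd] := H1 x xX;have [|_ _ A] := Hd x;first by rewrite subrr normr0.
 by case: A.
- move=> x /ioo' xX;have [d d0 Hd] := H x xX;have [h h0 Hh] := H1 x xX.
 apply/cont_epsP => e e0;have [|_ _ A] := Hd x;first by rewrite subrr normr0.
 have [k k0 Hk] := (cont_epsP _ _).1 A e e0;exists (Num.min k h) => [|s];first by rewrite lt_min k0.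
 rewrite lt_min => /andP[s1 s2];have [_ -> _] := Hh s s2.
 by have [|_ -> _] := Hh x;[rewrite subrr normr0|exact: Hk].
- by split;apply/cvg_ex;[exists (g1 0);exact: (L1 0 in0).1|exists (g1 X);exact: (L1 X inX).2].
- by split;apply/cvg_ex;[exists (g2 0);exact: (L2 0 in0).1|exists (g2 X);exact: (L2 X inX).2].
Qed.

Lemma MVT2 f (df : R -> R) x y : (forall z, `|z - x| <= `|y - x| -> is_derive z 1 f (df z)) ->
 exists2 c : R, `|c - x| <= `|y - x| & f y - f x = df c * (y - x).
Proof.
move=> H;have [xy|/ltW yx] := leP x y.
 have [|c /andP[c1 c2] E] := @MVT_le R f df x y xy.
 by move=> z /andP[z1 z2];apply: H;rewrite !ger0_norm ?subr_ge0// lerD2r.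
 by exists c => //;rewrite !ger0_norm ?subr_ge0// lerD2r.
have [|c /andP[c1 c2] E] := @MVT_le R f df y x yx.
 by move=> z /andP[z1 z2];apply: H;rewrite !ler0_norm ?subr_le0// lerN2 lerD2r.
exists c;first by rewrite !ler0_norm ?subr_le0// lerN2 lerD2r.
by rewrite -opprB E -mulrN opprB.
Qed.

Lemma quot_eps (A B e : R) : B != 0 -> 0 < e -> exists2 d : R, 0 < d & forall A' B' : R,
 `|A' - A| < d -> `|B' - B| < d -> `|A' / B' - A / B| < e.
Proof.
move=> Bn e0;have b0 : 0 < `|B| by rewrite normr_gt0.
have s0 : 0 < `|A| + `|B| + 1 by rewrite ltr_wpDl ?addr_ge0.
have k0 : 0 < e * `|B| ^+ 2 / 2 / (`|A| + `|B| + 1) by rewrite !divr_gt0 ?mulr_gt0 ?exprn_gt0.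
exists (Num.min (`|B| / 2) (e * `|B| ^+ 2 / 2 / (`|A| + `|B| + 1)));first by rewrite lt_min k0 divr_gt0.
move=> A' B';rewrite !lt_min => /andP[_ a2] /andP[b1 b2].
have hB : `|B| / 2 < `|B'|.
 have := lerB_dist B (B - B');rewrite (_ : B - (B - B') = B');last by ring.
 rewrite (distrC B) => h.
 by move: h b1;move: (`|B|) (`|B'|) (`|B' - B|) => *;lra.
have Bn' : B' != 0 by rewrite -normr_gt0;apply: lt_trans hB;rewrite divr_gt0.
have bb0 : 0 < `|B'| * `|B| by rewrite mulr_gt0 ?normr_gt0.
rewrite (_ : _ - _ = ((A' - A) * B - A * (B' - B)) / (B' * B));last by field;rewrite Bn.
rewrite normrM normfV normrM ltr_pdivrMr//.
apply: le_lt_trans (ler_normB _ _) _;rewrite !normrM.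
apply: (@lt_le_trans _ _ (e * `|B| ^+ 2 / 2));last first.
 by rewrite (_ : e * `|B| ^+ 2 / 2 = e * (`|B| / 2 * `|B|));[rewrite ler_pM2l// ler_pM2r// ltW|ring].
move: a2 b2;rewrite !ltr_pdivlMr//;move: (`|A' - A|) (`|B' - B|) (normr_ge0 (A' - A)) (normr_ge0 (B' - B)) => u v u0 v0.
have := normr_ge0 A;move: (e * `|B| ^+ 2) => q;move: (`|A|) (`|B|) b0 => pa pb pb0 pa0 h1 h2.
have [uv|uv] := leP u v.
 by apply: le_lt_trans h2;nra.
by apply: le_lt_trans h1;nra.
Qed.
End Tools6.

(** * The free boundary as an implicit function *)

Section Curve.
Context {R : realType}.
Notation mu := (@lebesgue_measure R).
Implicit Types (t x c d e k y s r : R).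
Variables (j a b : R) (w w1 w2 : R -> R -> R).
Hypotheses (j0 : 0 < j) (ab : a < b) (HG : forall t, a <= t <= b -> good_slice j w w1 w2 t).

Definition Xi t := xget 0 [set X : R | zero j w w1 t X /\ (forall x, 0 <= x <= X -> cal w w1 w2 t x)].

Lemma XiP t : a <= t <= b -> zero j w w1 t (Xi t) /\ (forall x, 0 <= x <= Xi t -> cal w w1 w2 t x).
Proof.
move=> /HG[[X HX] _ _].
exact: (@xgetPex R 0 [set X : R | zero j w w1 t X /\ (forall x, 0 <= x <= X -> cal w w1 w2 t x)] (ex_intro _ X HX)).
Qed.

Lemma cal_self t x : cal w w1 w2 t x -> [/\ is_derive x 1 (fun y => w t y - 2 * j * y) (w1 t x - 2 * j),
 is_derive t 1 (fun s => w s x - 2 * j * x) (2^-1 * w2 t x), jc w1 t x & jc w2 t x].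
Proof.
move=> [d d0 Hd];have [||A1 _ A3 A4 A5] := Hd t x;rewrite ?subrr ?normr0//.
split=> //.
- by apply: (derE (derB A1 (derZ (2 * j) (derI x))));rewrite mulr1.
- by apply: (derE (derB A3 (derC (2 * j * x) t)));rewrite subr0.
Qed.

(** The density is positive at [Xi t - m] and negative at [Xi t + m]. These two signs persist for
    nearby times and trap the zero. *)
Lemma Xi_cont t e : a <= t <= b -> 0 < e -> exists2 d : R, 0 < d & forall s, a <= s <= b ->
 `|s - t| < d -> `|Xi s - Xi t| < e.
Proof.
move=> tab e0;have [[X0 XE Xs Xp Xn] Xc] := XiP tab.
have [|d1 d10 Hd] := Xc (Xi t);first by rewrite lexx ltW.
pose m := Num.min e (Num.min d1 (Xi t)) / 2.
have m0 : 0 < m by rewrite divr_gt0// !lt_min e0 d10 X0.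
have [me [md mX]] : m < e /\ m < d1 /\ m < Xi t.
 have h : m * 2 = Num.min e (Num.min d1 (Xi t)) by rewrite /m divfK.
 have m2 : m < m * 2 by lra.
 by move: m2;rewrite h !lt_min => /andP[-> /andP[-> ->]].
have dt x : `|x - Xi t| = m -> forall e', 0 < e' -> exists2 d : R, 0 < d & forall s, `|s - t| < d ->
 `|(w s x - 2 * j * x) - (w t x - 2 * j * x)| < e'.
 move=> xm e' e'0;have [||_ _ A _ _] := Hd t x;[by rewrite subrr normr0|by rewrite xm|].
 exact: (is_derive_cont (derB A (derC (2 * j * x) t)) e'0).
have p1 : 0 < w t (Xi t - m) - 2 * j * (Xi t - m) by apply: Xp;rewrite subr_ge0 (ltW mX) ltrBlDr ltrDl.
have p2 : w t (Xi t + m) - 2 * j * (Xi t + m) < 0 by apply: Xn;rewrite ltrDl.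
have np2 : 0 < - (w t (Xi t + m) - 2 * j * (Xi t + m)) by rewrite oppr_gt0.
have e1 : `|Xi t - m - Xi t| = m by rewrite addrAC subrr sub0r normrN gtr0_norm.
have e2 : `|Xi t + m - Xi t| = m by rewrite addrAC subrr add0r gtr0_norm.
have [h1 h10 H1] := dt _ e1 _ p1;have [h2 h20 H2] := dt _ e2 _ np2.
exists (Num.min h1 h2) => [|s sab];first by rewrite lt_min h10.
rewrite lt_min => /andP[/H1 A /H2 B];have [[Y0 YE _ Yp Yn] _] := XiP sab.
apply: le_lt_trans me;rewrite ler_norml.
have C1 : Xi t - m <= Xi s.
 rewrite leNgt;apply/negP => /Yn;move: A;rewrite ltr_norml => /andP[A _];move: A.
 by move: (w s _ - _) (w t _ - _) => u v;lra.
have C2 : Xi s <= Xi t + m.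
 rewrite leNgt;apply/negP => h;have hh : 0 <= Xi t + m < Xi s by rewrite h ltW// addr_gt0.
 have := Yp _ hh.
 move: B;rewrite ltr_norml => /andP[_ B];move: B.
 by move: (w s _ - _) (w t _ - _) => u v;lra.
by rewrite lerBrDl C1 lerBlDl C2.
Qed.

(** Implicit differentiation of [w t x - 2 * j * x = 0], the time derivative being [2^-1 * w2] by
    the heat equation. *)
Definition dX t := - (2^-1 * w2 t (Xi t)) / (w1 t (Xi t) - 2 * j).

(** Control of the derivatives on the whole segment between [Xi t] and [Xi s], where the mean value
    theorem places its intermediate point. *)
Lemma stage_cont t e : a <= t <= b -> 0 < e -> exists2 d : R, 0 < d & forall s x, a <= s <= b ->
 `|s - t| < d -> `|x - Xi t| <= `|Xi s - Xi t| -> [/\ `|w1 s x - w1 t (Xi t)| < e, `|w2 s x - w2 t (Xi t)| < e &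
 cal w w1 w2 s x].
Proof.
move=> tab e0;have [[X0 _ _ _ _] Xc] := XiP tab.
have XX : 0 <= Xi t <= Xi t by rewrite lexx ltW.
have [_ _ c1 c2] := cal_self (Xc _ XX);have [d0 d00 Hd0] := Xc _ XX.
have [d1 d10 H1] := c1 e e0;have [d2 d20 H2] := c2 e e0.
pose m := Num.min d0 (Num.min d1 d2).
have m0 : 0 < m by rewrite !lt_min d00 d10.
have m20 : 0 < m / 2 by rewrite divr_gt0.
have [h h0 Hh] := Xi_cont tab m20.
exists (Num.min h (m / 2)) => [|s x sab];first by rewrite lt_min h0.
rewrite lt_min => /andP[s1 s2] xX;have x1 := le_lt_trans xX (Hh s sab s1).
have mm : m / 2 < m by lra.
move: (lt_trans s2 mm) (lt_trans x1 mm);rewrite !lt_min => /andP[sa /andP[sb sc]] /andP[xa /andP[xb xc]].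
split;[exact: H1|exact: H2|].
exists (Num.min (d0 - `|s - t|) (d0 - `|x - Xi t|));first by rewrite lt_min !subr_gt0 sa.
move=> s' x';rewrite !lt_min => /andP[k1 _] /andP[_ k2];apply: Hd0.
 rewrite (_ : s' - t = (s' - s) + (s - t));last by ring.
 by apply: le_lt_trans (ler_normD _ _) _;rewrite -ltrBrDr.
rewrite (_ : x' - Xi t = (x' - x) + (x - Xi t));last by ring.
by apply: le_lt_trans (ler_normD _ _) _;rewrite -ltrBrDr.
Qed.

Lemma dX_cont t e : a <= t <= b -> 0 < e -> exists2 d : R, 0 < d & forall s, a <= s <= b ->
 `|s - t| < d -> `|dX s - dX t| < e.
Proof.
move=> tab e0;have [[_ _ Xs _ _] _] := XiP tab.
have Bn : w1 t (Xi t) - 2 * j != 0 by rewrite lt_eqF.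
have [d d0 Hd] := quot_eps (- (2^-1 * w2 t (Xi t))) Bn e0.
have [h h0 Hh] := stage_cont tab d0;exists h => // s sab st.
have [A1 A2 _] := Hh s (Xi s) sab st (lexx _);apply: Hd.
 rewrite -opprD normrN -mulrBr normrM gtr0_norm;last by rewrite invr_gt0.
 by have := normr_ge0 (w2 s (Xi s) - w2 t (Xi t));lra.
by rewrite (_ : _ - _ = w1 s (Xi s) - w1 t (Xi t))//;ring.
Qed.

Lemma Xi_der t e : a <= t <= b -> 0 < e -> exists2 d : R, 0 < d & forall s, a <= s <= b ->
 `|s - t| < d -> `|Xi s - Xi t - dX t * (s - t)| <= e * `|s - t|.
Proof.
move=> tab e0;have [[X0 XE Xs _ _] Xc] := XiP tab.
have XX : 0 <= Xi t <= Xi t by rewrite lexx ltW.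
have [_ Dt _ _] := cal_self (Xc _ XX).
pose p := w1 t (Xi t) - 2 * j;pose q := 2^-1 * w2 t (Xi t).
have p0 : 0 < - p by rewrite oppr_gt0.
(* One more than the Lipschitz constant obtained in [Dle2]; the choice of [e1] then gives
   [e1 * C <= e * - p], which closes the estimate. *)
pose C := 2 * (`|q| + 1) / - p + 1.
have C0 : 0 < C by rewrite addr_gt0// divr_gt0// mulr_gt0// ltr_wpDl.
pose e1 := Num.min 1 (Num.min (- p / 2) (e * - p / C)).
have e10 : 0 < e1 by rewrite !lt_min ltr01 !divr_gt0 ?mulr_gt0.
have [g1 [g2 g3]] : e1 <= 1 /\ e1 <= - p / 2 /\ e1 * C <= e * - p.
 by rewrite -ler_pdivlMr//;split;[rewrite ge_min lexx|split;rewrite !ge_min lexx ?orbT].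
have [d1 d10 H1] := (is_derive_epsP _ _ _).1 Dt e1 e10.
have [d2 d20 H2] := stage_cont tab e10.
exists (Num.min d1 d2) => [|s sab];first by rewrite lt_min d10.
rewrite lt_min => /andP[s1 s2];have [[Y0 YE _ _ _] _] := XiP sab.
have [|c cX Ec] := @MVT2 R (fun y => w s y - 2 * j * y) (fun y => w1 s y - 2 * j) (Xi t) (Xi s).
 by move=> z zX;have [_ _ /cal_self[]] := H2 s z sab s2 zX.
have [A1 _ _] := H2 s c sab s2 cX;have B1 := H1 s s1.
move: Ec B1;rewrite YE XE sub0r subr0 -/q => Ec B1.
have P1 : `|(w1 s c - 2 * j) - p| < e1 by rewrite (_ : _ - _ = w1 s c - w1 t (Xi t))// /p;ring.
have E0 : dX t = - q / p by [].
move: Ec B1 P1;move: (w1 s c - 2 * j) (w s (Xi t) - 2 * j * Xi t) => ps ph Ec B1 P1.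
set D := Xi s - Xi t in Ec *;set h := s - t in B1 *.
have pn : p != 0 by rewrite -oppr_eq0 gt_eqF.
have psn : - p / 2 <= `|ps|.
 have := lerB_dist p (p - ps);rewrite (_ : p - (p - ps) = ps);last by ring.
 rewrite (distrC p) (ltr0_norm (_ : p < 0)) -?oppr_gt0// => hh.
 by move: hh P1 g2;move: (`|ps|) (`|ps - p|) => *;lra.
have Dle : - p / 2 * `|D| <= (`|q| + 1) * `|h|.
 apply: (@le_trans _ _ (`|ps| * `|D|));first by rewrite ler_wpM2r.
 rewrite -normrM -Ec normrN (_ : ph = (ph - q * h) + q * h);last by ring.
 apply: le_trans (ler_normD _ _) _;rewrite mulrDl mul1r addrC normrM lerD2l.
 by apply: le_trans B1 _;rewrite ler_piMl.
have key : `|p * (D - dX t * h)| <= e1 * `|D| + e1 * `|h|.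
 rewrite (_ : p * (D - dX t * h) = - ((ps - p) * D) - (ph - q * h));last first.
 have -> : p * (D - dX t * h) = p * D + q * h by rewrite E0;field.
 rewrite (_ : - ((ps - p) * D) = p * D - ps * D);last by ring.
 by rewrite -Ec;ring.
 apply: le_trans (ler_normB _ _) _;rewrite normrN normrM;apply: lerD => //.
 by apply: ler_wpM2r => //;exact: ltW.
have Dle2 : `|D| <= 2 * (`|q| + 1) / - p * `|h|.
 rewrite mulrAC ler_pdivlMr//;move: Dle;move: (`|D|) ((`|q| + 1)) (`|h|) => *;nra.
move: key;rewrite normrM (ltr0_norm (_ : p < 0)) -?oppr_gt0// => key.
rewrite -(ler_pM2l p0);apply: le_trans key _;rewrite -mulrDr.
apply: (@le_trans _ _ (e1 * (C * `|h|))).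
 by apply: ler_wpM2l;[exact: ltW|rewrite /C mulrDl mul1r lerD2r].
rewrite mulrA (_ : - p * (e * `|h|) = e * - p * `|h|);last by ring.
by apply: ler_wpM2r.
Qed.
End Curve.

Section Rho.
Context {R : realType}.
Notation mu := (@lebesgue_measure R).

Lemma iSubE (E D : set R) (f : R -> R) : measurable E -> measurable D -> D `<=` E ->
 mu.-integrable E (EFin \o f) -> itg D f.
Proof. by move=> mE mD DE;exact: integrableS. Qed.

Lemma iSub (D : set R) (f : R -> R) : measurable D -> itg setT f -> itg D f.
Proof. by move=> mD;exact: iSubE. Qed.

Lemma ae_and (P Q : R -> Prop) : {ae mu, forall x, P x} -> {ae mu, forall x, Q x} -> {ae mu, forall x, P x /\ Q x}.
Proof.
move=> p q;apply: negligibleS (negligibleU p q) => x /= /not_andP[h|h];[by left|by right].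
Qed.

(** Passes to a representative that is bounded everywhere and vanishes outside a bounded interval.
    Finiteness of the edge provides a point [r] with zero tail; positivity of the edge rules out
    zero total mass. *)
Lemma rho_facts (rho0 : R -> R) : Linfty_L1_nonneg rho0 -> (0 < right_edge rho0)%E -> (right_edge rho0 < +oo)%E ->
 exists (r0 : R -> R) (R0 B : R), [/\ 0 < R0, 0 <= B /\ (forall y, 0 <= r0 y <= B),
 forall y, ~ (0 <= y <= R0) -> r0 y = 0, itg setT r0 & 0 < \int[mu]_(y in `[0, R0]) r0 y] /\
 {ae mu, forall y, Rplus y -> rho0 y = r0 y} /\ measurable_fun (@Rplus R) rho0.
Proof.
move=> [Hoo H1 Hp] e0 e1;set rho := rho0 \_ (@Rplus R) in Hoo H1.
have irho : itg setT rho by exact: (Lfun1_integrable mu rho).1 H1.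
have mrho := i_meas irho.
have rE y : 0 <= y -> rho y = rho0 y.
 by move=> y0;rewrite /rho patchE ifT// inE /Rplus /= in_itv/= andbT.
have [B B0 HB] : exists2 B : R, 0 <= B & {ae mu, forall y, `|rho y| <= B}.
 have mT : (0 < mu setT)%E.
 apply: (@lt_le_trans _ _ (mu `[0, 1]%classic)).
 by rewrite lebesgue_measure_itv/= lte_fin ltr01 sube0 lte_fin ltr01.
 by apply: le_measure;rewrite ?inE//;exact: measurable_itv.
 have := sub_Lfun_finLfun Hoo;rewrite inE /= /finite_norm unlock mT => Hs.
 have := @ess_sup_ge _ _ _ mu (abse \o (EFin \o rho));move: Hs.
 case: (ess_sup _ _) => [s _ h| |_ h] //.
 exists `|s| => //;apply: aeS h => y /=;rewrite lee_fin => h;exact: le_trans h (ler_norm s).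
 by exists 0 => //;apply: aeS h => y /=;rewrite leeNy_eq.
have [x [r [r0 rI] <-] _] := @ereal_inf_lt R _ _ e1.
have sub : `[r, +oo[%classic `<=` @Rplus R.
 by move=> y /=;rewrite /Rplus /= !in_itv/= !andbT;exact: le_trans.
have mD : measurable (`[r, +oo[%classic : set R) by exact: measurable_itv.
have mDr : measurable_fun `[r, +oo[%classic rho0.
 apply: (eq_measurable_fun rho);last exact: measurable_funS mrho.
 by move=> y;rewrite inE /= in_itv/= andbT => yr;apply: rE;exact: le_trans yr.
have mE : measurable_fun `[r, +oo[%classic (EFin \o rho0) by exact: measurableT_comp.
have tail : {ae mu, forall y, `[r, +oo[%classic y -> rho0 y = 0}.
 have h0 : (\int[mu]_(y in `[r, +oo[%classic) `|(EFin \o rho0) y|)%E = 0%E.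
 rewrite -rI;apply: ae_eq_integral => //;first exact: measurableT_comp.
 apply: aeS Hp => y h /= yr;rewrite ger0_norm//;apply: h;exact: sub.
 have := (@ae_eq_integral_abs _ _ _ mu _ mD _ mE).1 h0.
 by apply: aeS => y h yr;have := h yr => -[].
pose clip y := Num.min B (Num.max 0 (rho y)).
have clip0 y : 0 <= clip y by rewrite le_min B0 le_max lexx.
have iclip : itg setT clip.
 apply: (i_le measurableT) (iabs measurableT irho).
 by apply: measurable_minr => //;exact: measurable_maxr.
 move=> y _;rewrite ger0_norm// /clip ge_min;apply/orP;right.
 by rewrite ge_max normr_ge0 ler_norm.
(* One unit beyond [r], so that the interval is nondegenerate even when [r = 0]. *)
pose r1 y := if 0 <= y <= r + 1 then clip y else 0.
have R0 : 0 < r + 1 by rewrite ltr_wpDl.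
have mc : measurable [set y : R | 0 <= y <= r + 1].
 rewrite (_ : [set y : R | _] = `[0, r + 1]%classic);first exact: measurable_itv.
 by apply/seteqP;split => y /=;rewrite in_itv.
have ir1 : itg setT r1 by exact: i_if.
have out y : ~ (0 <= y <= r + 1) -> r1 y = 0 by rewrite /r1 => /negP/negbTE ->.
have r1E : {ae mu, forall y, Rplus y -> rho0 y = r1 y}.
 apply: aeS (ae_and (ae_and Hp HB) tail) => y [[h1 h2] h3] yp.
 have y0 : 0 <= y by move: yp;rewrite /Rplus /= in_itv/= andbT.
 have p0 := h1 yp;rewrite /r1 y0 /=;have [yR|yR] := leP y (r + 1).
 rewrite /clip rE// max_r// min_r//;move: h2;rewrite rE//;exact: le_trans (ler_norm _).
 by apply: h3;rewrite /= in_itv/= andbT;apply: ltW;apply: lt_trans yR;rewrite ltrDl.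
have mr : measurable_fun (@Rplus R) rho0.
 apply: (eq_measurable_fun rho);last by apply: measurable_funS mrho => //;exact: measurable_itv.
 by move=> y;rewrite inE /Rplus /= in_itv/= andbT => yr;exact: rE.
exists r1, (r + 1), B;split;last by split.
split=> //.
- split=> // y;rewrite /r1;case: ifP => _;last by rewrite lexx.
 by rewrite clip0 /clip ge_min lexx.
- rewrite lt_neqAle;apply/andP;split;last first.
 by apply: I_ge0 => y _;rewrite /r1;case: ifP.
 apply/eqP => Z;move: e0;rewrite ltNge => /negP;apply.
 apply: ge_ereal_inf;exists 0%E => //;exists 0 => //;split=> //.
 have mP : measurable (`[0, +oo[%classic : set R) by exact: measurable_itv.
 have mrE : measurable_fun (`[0, +oo[%classic : set R) (EFin \o rho0) by exact: measurableT_comp.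
 have mr1 : measurable_fun (`[0, +oo[%classic : set R) (EFin \o r1).
 by apply: measurableT_comp => //;exact: measurable_funS (i_meas ir1).
 have aeE : ae_eq mu (`[0, +oo[%classic : set R) (EFin \o rho0) (EFin \o r1).
 by apply: aeS r1E => y h yp;rewrite /= h.
 rewrite (@ae_eq_integral _ _ _ mu _ _ (EFin \o rho0) mP mrE mr1 aeE) -fine_int//;last exact: integrableS ir1.
 rewrite -(@I_supp R `[0, +oo[%classic r1);last first.
 move=> y h;apply: out => /andP[y0 _];apply: h;by rewrite /= in_itv/= y0.
 rewrite (@I_supp R `[0, r + 1]%classic r1) -?Z//.
Qed.
End Rho.

(** * Quasi-solutions from good slices *)

Section QuasiOf.
Context {R : realType}.
Notation mu := (@lebesgue_measure R).
Implicit Types (t x c d e k y s r : R).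
Variables (j a b T eps P0 K : R) (rho0 : R -> R) (w w1 w2 : R -> R -> R).
Hypotheses (j0 : 0 < j) (ab : a < b) (HG : forall t, a <= t <= b -> good_slice j w w1 w2 t).
Hypotheses (T0 : 0 < T) (aTb : a + T < b) (eps0 : 0 < eps) (Ke : K <= eps).
Hypothesis HP : forall t, a <= t <= b -> `|PW j w t - P0| <= K.
Hypothesis Hini : (\int[mu]_(r in @Rplus R) `|Num.max (w a r - 2 * j * r) 0 - rho0 r|%:E <= eps%:E)%E.

Local Notation xi := (Xi j w w1 w2).
(** Time is shifted by [a] and clamped, which makes the curve continuous on the whole line. *)
Definition Xq t := xi (clamp a b (t + a)).
Definition uq r t := w (t + a) r - 2 * j * r.

Let P t (h : a <= t <= b) := XiP HG h.

Lemma half_mass t : a <= t <= b -> PW j w t = 2 * \int[mu]_(y in `[0, xi t]) (w t y - 2 * j * y).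
Proof.
move=> tab;have [[X0 XE _ Xp Xn] Xc] := P tab;have [_ wN _] := HG tab.
set X := xi t in X0 XE Xp Xn Xc *;pose val y := w t y - 2 * j * y.
have mI : measurable (`[0, X]%classic : set R) by exact: measurable_itv.
have iv : itg `[0, X]%classic val.
 apply: continuous_compact_integrable;first exact: segment_compact.
 have cv : {in (`[0, X]%classic : set R), continuous val}.
 move=> y;rewrite inE /= in_itv/= => /Xc/(cal_self j)[D _ _ _].
 by apply/cont_epsP => e e0;exact: (is_derive_cont D e0).
 exact: continuous_in_subspaceT.
pose h y := if 0 <= y <= X then val y else 0.
have ih : itg setT h.
 apply: (@i_supp _ `[0, X]%classic) => //.
 by move=> y /=;rewrite in_itv/= /h => /negP/negbTE ->.
 apply: (@eq_integrable _ _ _ mu _ mI (EFin \o val)) => //.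
 by move=> y;rewrite inE /= in_itv/= /h => ->.
(* Corrects for the origin, which is counted both in [h y] and in [h (- y)]. *)
pose z y := if (0 <= y <= 0) then h y else 0.
have s0 : [set y : R | 0 <= y <= 0] = `[0, 0]%classic by apply/seteqP;split => y /=;rewrite in_itv.
have iz : itg setT z.
 by apply: i_if => //;rewrite s0;exact: measurable_itv.
have Iz : \int[mu]_y z y = 0.
 rewrite (@I_supp R `[0, 0]%classic);first exact: I_set1.
 by move=> y /=;rewrite in_itv/= /z => /negP/negbTE ->.
have E y : Num.max (w t y - 2 * j * `|y|) 0 = h y + h (- y) - z y.
 have pos u : 0 < u -> Num.max (val u) 0 = h u + h (- u) - z u.
 move=> u0;rewrite /z (lt_geF u0) andbF subr0 /h [0 <= - u]oppr_ge0 (lt_geF u0)/= addr0 (ltW u0)/=.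
 have [uX|uX] := leP u X;last by rewrite max_r// ltW// Xn.
 rewrite max_l//;have [E0|uX'] := eqVneq u X;first by rewrite /val E0 XE.
 by apply: ltW;apply: Xp;rewrite (ltW u0) lt_neqAle uX' uX.
 have [y0|y0|->] := ltgtP y 0.
 - have ny : 0 < - y by rewrite oppr_gt0.
 have := pos _ ny;rewrite opprK /val wN (ltr0_norm y0) => ->.
 have zy u : u != 0 -> z u = 0.
 by move=> un;rewrite /z;case: ifP => // h0;move: un;rewrite eq_le andbC h0.
 rewrite !zy ?oppr_eq0 ?lt_eqF// !subr0;exact: addrC.
 - by rewrite (gtr0_norm y0) -/(val y) pos.
 - rewrite normr0 oppr0 /z lexx /= addrK /h lexx (ltW X0)/= /val max_l//.
 by apply: ltW;apply: Xp;rewrite lexx.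
rewrite /PW (@eq_I _ _ _ (fun y => h y + h (- y) - z y));last by move=> y _;exact: E.
have iN := i_refl ih.
rewrite IB//;last exact: iD.
rewrite ID// I_refl// Iz subr0 (_ : \int[mu]_y h y = \int[mu]_(y in `[0, X]) val y).
 by ring.
rewrite (@I_supp R `[0, X]%classic);last by move=> y /=;rewrite in_itv/= /h => /negP/negbTE ->.
by apply: eq_I => y /=;rewrite in_itv/= /h => ->.
Qed.

Lemma XqE t : 0 <= t <= b - a -> Xq t = xi (t + a).
Proof. by move=> /andP[t1 t2];rewrite /Xq clamp_id// lerDr t1 -lerBrDr. Qed.

Lemma shift_in t : 0 <= t < T -> a <= t + a <= b.
Proof.
move=> /andP[t1 t2];rewrite lerDr t1/=;apply: ltW;apply: lt_trans aTb.
by rewrite addrC ltrD2l.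
Qed.

Lemma time_in' t : 0 <= t < T -> 0 <= t <= b - a.
Proof. by move=> h;have := shift_in h;rewrite lerDr -lerBrDr. Qed.

Lemma Xq_cont : continuous Xq.
Proof.
move=> t;apply/cont_epsP => e e0;have cab := clamp_in (t + a) (ltW ab).
have [d d0 Hd] := Xi_cont HG cab e0;exists d => // s st;apply: Hd;first exact: clamp_in (ltW ab).
by apply: le_lt_trans (clamp_lip _ _ _ _) _;rewrite opprD addrACA subrr addr0.
Qed.

Lemma Xq_der t : 0 < t < b - a -> is_derive t 1 Xq (dX j w w1 w2 (t + a)).
Proof.
move=> /andP[t1 t2];have tab : a <= t + a <= b by rewrite lerDr -lerBrDr (ltW t1) ltW.
apply/is_derive_epsP => e e0;have [d d0 Hd] := Xi_der HG tab e0.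
exists (Num.min d (Num.min t (b - a - t))) => [|s];first by rewrite !lt_min d0 t1 subr_gt0.
rewrite !lt_min => /and3P[s1 s2 s3];have s0 : 0 <= s <= b - a.
 move: s2 s3;rewrite !ltr_norml => /andP[s2 _] /andP[_ s3];apply/andP;split;lra.
have t0 : 0 <= t <= b - a by rewrite !ltW.
have sab : a <= s + a <= b by rewrite lerDr -lerBrDr.
have E : s + a - (t + a) = s - t by ring.
by have := Hd (s + a) sab;rewrite E -!XqE//;exact.
Qed.

Lemma quasi_of_good : quasi_solution j rho0 T eps Xq uq.
Proof.
have XE t : 0 <= t < T -> Xq t = xi (t + a) by move=> h;rewrite XqE// time_in'.
have aT : T < b - a by rewrite ltrBrDl.
have Z t : 0 <= t < T -> [/\ 0 < Xq t, w (t + a) (Xq t) - 2 * j * (Xq t) = 0,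
 forall y, 0 <= y < Xq t -> 0 < w (t + a) y - 2 * j * y,
 forall y, Xq t < y -> w (t + a) y - 2 * j * y < 0 & forall x, 0 <= x <= Xq t -> cal w w1 w2 (t + a) x].
 by move=> h;rewrite XE//;have [[? ? ? ? ?] ?] := P (shift_in h).
have C2 t (h : 0 <= t < T) : C2_up_to_boundary 0 (Xq t) (uq ^~ t) /\ forall x, 0 <= x <= Xq t ->
 [/\ ((uq ^~ t)^`() x)%classic = w1 (t + a) x - 2 * j, ((uq ^~ t)^`(2) x)%classic = w2 (t + a) x &
 ((uq ^~ t)^`() r @[r --> x^'+] --> w1 (t + a) x - 2 * j)%classic].
 have [X0 _ _ _ Xc] := Z t h.
 apply: (@C2_of R (uq ^~ t) (fun x => w1 (t + a) x - 2 * j) (fun x => w2 (t + a) x) (Xq t) X0).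
 move=> x xX;have [d d0 Hd] := Xc x xX;exists d => // y yx.
 have [|A1 A2 A3 A4 A5] := Hd (t + a) y _ yx;first by rewrite subrr normr0.
 split.
 - by apply: (derE (derB A1 (derZ (2 * j) (derI y))));rewrite mulr1.
 - by apply: (derE (derB A2 (derC (2 * j) y)));rewrite subr0.
 - apply/cont_epsP => e e0;have [k k0 Hk] := A5 e e0;exists k => // z zy.
 by apply: Hk => //;rewrite subrr normr0.
have UT t r : 0 <= t < T -> 0 <= r <= Xq t -> is_derive t 1 (uq r) (2^-1 * w2 (t + a) r).
 move=> h hr;have [_ _ _ _ Xc] := Z t h;have [_ D _ _] := cal_self j (Xc r hr).
 have := @der_comp R (fun s => w s r - 2 * j * r) (fun s => s + a) t _ _ D (derD (derI t) (derC a t)).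
 by move=> H;apply: (derE H);rewrite addr0 mulr1.
have der t : 0 < t < T -> is_derive t 1 Xq (dX j w w1 w2 (t + a)).
 by move=> /andP[t1 t2];apply: Xq_der;rewrite t1 (lt_trans t2 aT).
have E1 t : 0 < t < T -> (Xq^`() t)%classic = dX j w w1 w2 (t + a) by move=> /der;exact: der1.
have near t : 0 <= t < T -> forall e, 0 < e -> exists2 d : R, 0 < d & forall s, 0 < s < T -> `|s - t| < d ->
 `|(Xq^`() s)%classic - dX j w w1 w2 (t + a)| < e.
 move=> h e e0;have [d d0 Hd] := dX_cont HG (shift_in h) e0;exists d => // s hs st.
 rewrite E1//;apply: Hd;last by rewrite (_ : s + a - (t + a) = s - t)//;ring.
 by apply: shift_in;case/andP: hs => [/ltW -> ->].
have oo t : 0 < t < T -> 0 <= t < T by move=> /andP[/ltW -> ->].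
split=> //.
- by move=> t /Z[].
- have dab : forall t, a <= t <= b -> forall e, 0 < e -> exists2 d : R, 0 < d & forall s, a <= s <= b -> `|s - t| < d ->
 Num.norm (`|dX j w w1 w2 s| - `|dX j w w1 w2 t|) < e.
 move=> t tab e e0;have [d d0 Hd] := dX_cont HG tab e0;exists d => // s sab st.
 by apply: le_lt_trans (ler_dist_dist _ _) _;exact: Hd.
 have [c cab Hc] := @EVT_eps R a b (fun t => `|dX j w w1 w2 t|) (ltW ab) dab.
 have ba0 : 0 < b - a by rewrite subr_gt0.
 have L := @lip_closed R Xq (fun t => dX j w w1 w2 (t + a)) (b - a) (`|dX j w w1 w2 c|) (normr_ge0 _) Xq_der.
 have L2 : forall s t : R, 0 <= s -> s <= t -> t <= b - a -> `|Xq t - Xq s| <= `|dX j w w1 w2 c| * (t - s).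
 apply: L;last by apply: continuous_subspaceT;exact: Xq_cont.
 by move=> t /andP[t1 t2];apply: Hc;rewrite lerDr -lerBrDr !ltW.
 exists `|dX j w w1 w2 c|;split;first exact: num_real.
 move=> k Lk [s t] /= [hs ht].
 have hs' : 0 <= s < T by move: hs;rewrite in_itv.
 have ht' : 0 <= t < T by move: ht;rewrite in_itv.
 have [/andP[s1 s2] /andP[t1 t2]] := (time_in' hs', time_in' ht').
 apply: (@le_trans _ _ (`|dX j w w1 w2 c| * `|s - t|));last by apply: ler_wpM2r => //;exact: ltW.
 have [st|/ltW ts] := leP s t;last by rewrite (ger0_norm (_ : 0 <= s - t)) ?subr_ge0//;exact: L2.
 by rewrite distrC (distrC s) (ger0_norm (_ : 0 <= t - s)) ?subr_ge0//;exact: L2.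
(* No exceptional time is required: the cuts at the grid times leave the curve [C^1]. *)
- exists [::];split=> //.
 + move=> t ht _;split;first by case: (der t ht).
 apply/cont_epsP => e e0;have [d d0 Hd] := near t (oo t ht) e e0;case/andP: (ht) => t1 t2.
 exists (Num.min d (Num.min t (T - t))) => [|s];first by rewrite !lt_min d0 t1 subr_gt0.
 rewrite !lt_min => /and3P[s1 s2 s3];rewrite [X in _ - X]E1//;apply: Hd => //.
 by move: s2 s3;rewrite !ltr_norml => /andP[s2 _] /andP[_ s3];apply/andP;split;lra.
 + have h0 : 0 <= (0 : R) < T by rewrite lexx.
 apply/cvg_ex;exists (dX j w w1 w2 (0 + a));apply: eps_cvg_right => e e0.
 have [d d0 Hd] := near 0 h0 e e0;exists (Num.min d T) => [|s];first by rewrite lt_min d0.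
 rewrite add0r lt_min => /and3P[s1 s2 s3];apply: Hd;first by rewrite s1.
 by rewrite subr0 gtr0_norm.
- move=> r t h /andP[r0];have [_ XZ Xp _ _] := Z t h.
 rewrite /uq le_eqVlt => /orP[/eqP ->|rX];first by rewrite XZ.
 by apply: ltW;apply: Xp;rewrite r0.
- by move=> t h;exact: (C2 t h).1.
- move=> r t h hr;exists (2^-1 * w2 (t + a) r);have D := UT t r h hr.
 apply/cvgrPdist_le => e e0;have [d d0 Hd] := (is_derive_epsP _ _ _).1 D e e0.
 exists d => //= s sd sn _;have sd2 : `|t - s| < d := sd;rewrite distrC in sd2.
 have st : s - t != 0 by rewrite subr_eq0.
 have E : uq r s - uq r t - 2^-1 * w2 (t + a) r * (s - t) = ((uq r s - uq r t) / (s - t) - 2^-1 * w2 (t + a) r) * (s - t).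
 by rewrite mulrBl divfK.
 by have := Hd s sd2;rewrite E normrM ler_pM2r ?normr_gt0// distrC.
- move=> r t ht /andP[r1 r2];have h := oo t ht;have hr : 0 <= r <= Xq t by rewrite !ltW.
 by rewrite (der1 (UT t r h hr));have [_ -> _] := (C2 t h).2 r hr.
- move=> t ht;have h := oo t ht;have [X0 _ _ _ _] := Z t h.
 have h0 : 0 <= (0 : R) <= Xq t by rewrite lexx ltW.
 have [_ _] := (C2 t h).2 0 h0;have [_ _ ->] := HG (shift_in h);by rewrite sub0r.
- by move=> t ht;have [_ E _ _ _] := Z t (oo t ht);rewrite /uq E.
- have h0 : 0 <= (0 : R) < T by rewrite lexx.
 have [X0 XZ Xp Xn _] := Z 0 h0;rewrite add0r in XZ Xp Xn.
 apply: le_trans Hini;rewrite le_eqVlt;apply/orP;left;apply/eqP;apply: eq_integral => r.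
 rewrite inE /Rplus /= in_itv/= andbT => r0;congr (`|_ - _|%:E).
 rewrite /zero_ext patchE;case: ifPn.
 rewrite inE /= in_itv/= r0 /= /uq add0r => rX;rewrite max_l//.
 move: rX;have [->|rn] := eqVneq r (Xq 0);first by rewrite XZ.
 by move=> rX;apply: ltW;apply: Xp;rewrite r0 lt_neqAle rn rX.
 rewrite notin_setE /= in_itv/= r0 /= => /negP;rewrite -ltNge => /Xn/ltW h;by rewrite max_r.
(* The whole-line masses differ from [P0] by at most [K] and are twice the half-line masses, which
   absorbs the factor two of the triangle inequality. *)
- apply: ge_ereal_sup => _ [t /= ht <-];rewrite lee_fin;apply: le_trans Ke.
 have h : 0 <= t < T by move: ht;rewrite in_itv.
 have h0 : 0 <= (0 : R) < T by rewrite lexx.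
 have M s : 0 <= s < T -> PW j w (s + a) = 2 * mass Xq uq s.
 by move=> hs;rewrite (half_mass (shift_in hs)) /mass (XE s hs).
 have A := HP (shift_in h);have B := HP (shift_in h0).
 rewrite !M// in A B;move: A B;move: (mass _ _ _) (mass _ _ _) => m m0.
 rewrite !ler_norml => /andP[A1 A2] /andP[B1 B2];apply/andP;split;lra.
Qed.
End QuasiOf.

Section Exist.
Context {R : realType}.
Notation mu := (@lebesgue_measure R).
Implicit Types (t x c d e k y s r : R) (w v : R -> R -> R) (f g : R -> R).
Variable j : R.
Hypothesis j0 : 0 < j.

Lemma I_sub (D : set R) f : measurable D -> itg setT f -> (forall y, 0 <= f y) ->
 \int[mu]_(y in D) f y <= \int[mu]_y f y.
Proof.
move=> mD fi f0;rewrite -lee_fin (fine_int (iSub mD fi) mD) (fine_int fi measurableT).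
apply: ge0_subset_integral => //;first by apply: measurableT_comp => //;exact: i_meas.
by move=> y _;rewrite lee_fin.
Qed.

(** Slices before the new grid time [t1] are inherited unchanged. The slice at [t1] stays good
    because the modification is smooth there for [|x| <= X]. *)
Lemma iterate w w1 w2 t0 f (a dl h P0 : R) : rep j w w1 w2 t0 f -> sign_change f a -> t0 < dl -> good_slice j w w1 w2 dl ->
 PW j w dl = P0 -> 0 < h -> 4 * j * h < P0 -> forall n : nat, exists v v1 v2 : R -> R -> R, exists (s0 : R) (g : R -> R) (b : R),
 [/\ rep j v v1 v2 s0 g, sign_change g b, s0 < dl + n%:R * h,
 forall t, dl <= t <= dl + n%:R * h -> good_slice j v v1 v2 t /\ `|PW j v t - P0| <= 4 * j * h &
 PW j v (dl + n%:R * h) = P0 /\ forall x, v dl x = w dl x].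
Proof.
move=> rw sf tdl gw PE h0 hP;have jh0 : 0 <= 4 * j * h by rewrite !mulr_ge0// ltW.
elim=> [|n [v [v1 [v2 [s0 [g [b [rv sg sn Hv [Pn v0]]]]]]]]].
 exists w, w1, w2, t0, f, a;rewrite mul0r addr0;split=> // t;rewrite andbC -eq_le => /eqP ->.
 by rewrite PE subrr normr0.
have n0 : 0 <= n%:R * h by rewrite mulr_ge0 ?ler0n// ltW.
set t1 := dl + n%:R * h in sn Hv Pn.
have t1E : dl + n.+1%:R * h = t1 + h by rewrite -addn1 natrD mulrDl mul1r addrA.
have in1 : dl <= t1 <= t1 by rewrite lexx andbT lerDl.
have [[[X [ZX cX]] eX w0X] _] := Hv t1 in1.
have [u [u1 [u2 [g' [b' [S1 S2 [S3 S3'] S4 S5]]]]]] := step j0 rv sg sn ZX Pn h0 hP.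
exists u, u1, u2, t1, g', b';rewrite t1E;split;[exact: S3|exact: S3'|by rewrite ltrDl| |split].
- move=> t /andP[ta tb];have [tt|tt] := leP t t1;last by apply: S4;rewrite tt tb.
 have PWE : PW j u t = PW j v t by apply: eq_I => y _;have [-> _ _] := S1 t y tt.
 rewrite PWE;have tin : dl <= t <= t1 by rewrite ta tt.
 have [[[Y [ZY cY]] eY w0Y] PY] := Hv t tin;split;last exact: PY.
 have tr Z : zero j v v1 t Z -> (forall x, 0 <= x <= Z -> cal u u1 u2 t x) -> good_slice j u u1 u2 t.
 move=> [z1 z2 z3 z4 z5] cz;split.
 - exists Z;split;last exact: cz.
 have [E1 E2 _] := S1 t Z tt;split;[exact: z1|by rewrite E1|by rewrite E2| |].
 by move=> y hy;have [-> _ _] := S1 t y tt;exact: z4.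
 by move=> y hy;have [-> _ _] := S1 t y tt;exact: z5.
 - by move=> x;have [-> _ _] := S1 t x tt;have [-> _ _] := S1 t (- x) tt;exact: eY.
 - by have [_ -> _] := S1 t 0 tt.
 have [E|tn] := eqVneq t t1.
 move: tr;rewrite E => tr;apply: (tr X ZX) => x hx;apply: S2 => //;first exact: cX.
 by right;case/andP: hx => x0 xX;rewrite ger0_norm.
 apply: (tr Y ZY) => x hx;apply: S2 => //;first exact: cY.
 by left;rewrite lt_neqAle tn.
- exact: S5.
- by move=> x;have [-> _ _] := S1 dl x (andP in1).1;exact: v0.
Qed.

Variable rho0 : R -> R.
Hypotheses (HL : Linfty_L1_nonneg rho0) (e0 : (0 < right_edge rho0)%E) (e1 : (right_edge rho0 < +oo)%E).

(** The datum is an even approximation of [rho0], continuous on [[- R0, R0]], minus a small bump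
    beyond [R0] that creates the sign change. The quasi-solution will start at a small time
    [dl > 0], when the caloric function is already smooth. *)
Lemma initial_stage e : 0 < e -> exists w w1 w2 : R -> R -> R, exists (dl : R) (f : R -> R) (a : R),
 [/\ rep j w w1 w2 0 f, sign_change f a, 0 < dl, 0 < PW j w dl &
 (\int[mu]_(r in @Rplus R) `|Num.max (w dl r - 2 * j * r) 0 - rho0 r|%:E <= e%:E)%E].
Proof.
move=> ep;have [r0 [R0 [B [[R00 [B0 Hr0] out ir0 I0] [ae0 mrho]]]]] := rho_facts HL e0 e1.
(* Four errors of size [q] are made: the continuous approximation, the smoothing by the heat flow,
   the bump and the source. The comparison with the mass [m] keeps the integral of the datum
   positive. *)
set m := (X in 0 < X) in I0;pose q := Num.min e m / 4.
have q0 : 0 < q by rewrite divr_gt0// lt_min ep.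
have [qe qm] : q * 4 <= e /\ q * 4 <= m.
 by rewrite /q divfK//;split;rewrite ge_min lexx ?orbT.
have mI : measurable (`[0, R0]%classic : set R) by exact: measurable_itv.
have ir0I := iSub mI ir0.
have fI : (mu (`[0%R, R0]%classic : set R) < +oo)%E by rewrite lebesgue_measure_itv/= lte_fin R00 ltry.
have [g_ [cg ig hg]] := approximation_continuous_integrable mI fI ir0I.
have [n hn] : exists n, \int[mu]_(y in `[0, R0]) `|r0 y - g_ n y| <= q.
 have [_ /cvgrPdist_le/(_ _ q0)[N _ HN]] := (fine_cvgP _ _).1 hg.
 exists N;have := HN N (leqnn _);rewrite /= sub0r normrN => h;exact: le_trans (ler_norm _) h.
set g := g_ n in hn;have {}cg := cg n;have {}ig := ig n.
have cG x e' : 0 < e' -> exists2 d : R, 0 < d & forall y, `|y - x| < d -> `|Num.max (g `|y|) 0 - Num.max (g `|x|) 0| < e'.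
 move=> e'0;have [d d0 Hd] := (cont_epsP _ _).1 (cg `|x|) e' e'0;exists d => // y yx.
 apply: le_lt_trans (max0_lip _ _) _;apply: Hd;exact: le_lt_trans (ler_dist_dist _ _) yx.
have [c _ Hc] : exists2 c : R, 0 <= c <= R0 & forall x, 0 <= x <= R0 -> `|g x| <= `|g c|.
 apply: (@EVT_eps R 0 R0 (fun y => `|g y|) (ltW R00)) => x _ e' e'0.
 have [d d0 Hd] := (cont_epsP _ _).1 (cg x) e' e'0;exists d => // y _ yx.
 exact: le_lt_trans (ler_dist_dist _ _) (Hd y yx).
pose g0 y := if `|y| <= R0 then Num.max (g `|y|) 0 else 0.
have g0p y : 0 <= g0 y by rewrite /g0;case: ifP => // _;rewrite le_max lexx orbT.
have g0b y : `|g0 y| <= `|g c|.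
 rewrite ger0_norm// /g0;case: ifP => // yR;rewrite ge_max normr_ge0 andbT.
 by apply: le_trans (ler_norm _) (Hc _ _);rewrite normr_ge0.
have g0N y : g0 (- y) = g0 y by rewrite /g0 normrN.
have mS : measurable (`[- R0, R0]%classic : set R) by exact: measurable_itv.
have oS y : ~ `[- R0, R0]%classic y -> g0 y = 0.
 by rewrite /= in_itv/= -ler_norml /g0 => /negP/negbTE ->.
have ig0 : itg setT g0.
 apply: (@i_supp _ `[- R0, R0]%classic) => //.
 apply: (@eq_integrable _ _ _ mu _ mS (EFin \o (fun y => Num.max (g `|y|) 0))).
 by move=> y;rewrite inE /= in_itv/= -ler_norml /g0 => ->.
 apply: continuous_compact_integrable;first exact: segment_compact.
 by apply: continuous_subspaceT => x;apply/cont_epsP => e' e'0;exact: cG.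
have ig0I := iSub mI ig0.
have h0 : \int[mu]_(y in `[0, R0]) `|g0 y - r0 y| <= q.
 apply: le_trans hn;apply: le_I => //;[exact: iabs (iB _ ig0I ir0I)|exact: iabs (iB _ ir0I ig)|move=> y].
 rewrite /= in_itv/= => /andP[y0 yR];have [r00 _] := andP (Hr0 y).
 rewrite /g0 (ger0_norm y0) yR -{1}(max_l r00) (distrC (r0 y));exact: max0_lip.
have G0 : m - q <= \int[mu]_y g0 y.
 have nR : - R0 <= 0 by rewrite oppr_le0 ltW.
 rewrite (@I_supp R `[- R0, R0]%classic g0 oS) (I_split nR (ltW R00) (iSub mS ig0)).
 rewrite -[leLHS]add0r;apply: lerD;first by apply: I_ge0.
 rewrite lerBlDr -lerBlDl -IB//;apply: le_trans h0;apply: le_I => //;[exact: iB|exact: iabs (iB _ ig0I ir0I)|].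
 by move=> y _;rewrite -normrN opprB ler_norm.
pose chi (y : R) := (if `|y| <= R0 + 1 then 1 else 0) - (if `|y| <= R0 then 1 else 0) : R.
have ic : itg setT chi by exact: iB (i_box _ _) (i_box _ _).
have chi0 y : `|y| <= R0 -> chi y = 0.
 by move=> yK;rewrite /chi yK (le_trans yK) ?lerDl// subrr.
have chi_ge y : 0 <= chi y.
 rewrite /chi;case: ifP => h1;case: ifP => h2;rewrite ?subrr ?subr0 ?ler01//.
 by move: h1;rewrite (le_trans h2) ?lerDl.
have C0 : 0 <= \int[mu]_y chi y by apply: I_ge0.
have C1 : 0 < \int[mu]_y chi y + 1 by rewrite ltr_wpDl.
pose al := q / (\int[mu]_y chi y + 1).
have al0 : 0 < al by rewrite divr_gt0.
have alC : al * \int[mu]_y chi y <= q.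
 by rewrite /al mulrAC ler_pdivrMr// ler_pM2l// lerDl.
pose f y := g0 y + (- al) * chi y.
have fi : itg setT f by apply: iD => //;exact: iZ.
have sf : sign_change f R0.
 split=> //.
 - by move=> y;rewrite /f g0N /chi normrN.
 - by move=> y yR;rewrite /f chi0// mulr0 addr0.
 - by move=> y yR;rewrite /f /g0 [`|y| <= R0]leNgt yR add0r mulNr oppr_le0 mulr_ge0// ltW.
 - exists (R0 + 1 / 2), (R0 + 1), al;split=> //.
 + by rewrite ltrDl divr_gt0.
 + by rewrite ltrD2l ltr_pdivrMr// mul1r ltr1n.
 move=> y /andP[y1 y2];have y0 : 0 < y by apply: lt_le_trans y1;rewrite addr_gt0.
 have yK : R0 < y by apply: lt_le_trans y1;rewrite ltrDl divr_gt0.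
 by rewrite /f /g0 /chi (gtr0_norm y0) y2 [y <= R0]leNgt yK/= add0r subr0 mulr1.
have If : 0 < \int[mu]_y f y.
 rewrite /f ID//;last exact: iZ.
 rewrite IZ//;move: G0 alC qm q0;move: (\int[mu]_y g0 y) (\int[mu]_y chi y) => u u';lra.
have q20 : 0 < q / 2 by rewrite divr_gt0.
have [||||dd dd0 Hdd] := (@dct_eps R setT (fun s => 0 < s) (fun s y => Num.max (g0 y - heat g0 s y) 0) (fun=> 0) g0 0 measurableT _ _ _ ig0 _ _ q20).
- by move=> s s0;exact: i_meas (i_pos (iB measurableT ig0 (heat_i s0 ig0))).
- exact: measurable_cst.
- have ne z : {ae mu, forall y : R, y != z}.
 exists [set z];split;[exact: measurable_set1|exact: lebesgue_measure_set1|].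
 by move=> y /= /negP;rewrite negbK => /eqP.
 apply: aeS (ae_and (ne R0) (ne (- R0))) => y [y1 y2] _.
 have cy e' : 0 < e' -> exists2 d : R, 0 < d & forall z, `|z - y| < d -> `|g0 z - g0 y| < e'.
 have nz z : `|z| <= `|y| + `|z - y| by have := ler_normD y (z - y);rewrite addrC subrK.
 have nz' z : `|y| - `|z - y| <= `|z|.
 by rewrite lerBlDr;have := ler_normD z (y - z);rewrite addrC subrK distrC.
 move=> e'0;have [yR|yR] := ltP `|y| R0.
 have [d d0 Hd] := cG y e' e'0;exists (Num.min d (R0 - `|y|)) => [|z];first by rewrite lt_min d0 subr_gt0.
 rewrite lt_min => /andP[z1 z2];rewrite /g0 (ltW yR) ifT;first exact: Hd.
 by apply: le_trans (nz z) _;rewrite addrC -lerBrDr ltW.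
 have yR' : R0 < `|y|.
 rewrite lt_neqAle yR andbT;apply/negP => /eqP E;move: y1 y2;rewrite E.
 by case: (ger0P y) => _;rewrite ?opprK eqxx.
 exists (`|y| - R0) => [|z zy];first by rewrite subr_gt0.
 rewrite /g0 !leNgt yR' ifF ?subrr ?normr0//;apply/negbTE;rewrite negbK.
 by apply: lt_le_trans (nz' z);rewrite ltrBrDr addrC -ltrBrDr.
 move=> e' e'0;have [d d0 Hd] := heat_cont0 ig0 g0b cy e'0;exists d => // s s0 sd.
 rewrite subr0 ger0_norm ?le_max ?lexx ?orbT// gt_max e'0 andbT.
 rewrite subr0 ger0_norm ?ltW// in sd.
 have := Hd s y sd;rewrite subrr normr0 => /(_ d0);rewrite ltr_norml => /andP[h _];move: h.
 by move: (heat g0 s y) (g0 y) => *;lra.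
- move=> s y s0 _;rewrite ger0_norm ?le_max ?lexx ?orbT// ge_max g0p andbT lerBlDr lerDl.
 exact: heat_ge0.
pose dl := Num.min (dd / 2) (q / (4 * j)).
have j4 : 0 < 4 * j by rewrite mulr_gt0.
have dl0 : 0 < dl by rewrite lt_min;apply/andP;split;exact: divr_gt0.
have dld : dl < dd by apply: le_lt_trans (_ : dd / 2 < _);[rewrite ge_min lexx|rewrite ltr_pdivrMr// mulr_natr mulr2n ltrDl].
have dlq : 4 * j * dl <= q by rewrite mulrC -ler_pdivlMr// ge_min lexx orbT.
have hI : \int[mu]_y `|heat g0 dl y - g0 y| <= q.
 have hi := heat_i dl0 ig0;have ip := i_pos (iB measurableT ig0 hi).
 (* Scheffe's argument: the heat flow preserves the integral, so the L^1 distance is twice the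
    integral of the positive part of [g0 - heat g0], which is dominated by [g0]. *)
 rewrite (@eq_I _ _ _ (fun y => (heat g0 dl y - g0 y) + 2 * Num.max (g0 y - heat g0 dl y) 0));last first.
 move=> y _;move: (heat g0 dl y) (g0 y) => u v;rewrite max0E distrC.
 by rewrite mulrA divff// mul1r addrA addrC;ring.
 rewrite ID//;[|exact: iB|exact: iZ].
 rewrite IB// heat_I// subrr add0r IZ//.
 have /(_ dl0) h := Hdd dl;rewrite subr0 (gtr0_norm dl0) in h;have {}h := h dld.
 rewrite -ler_pdivlMl// mulrC;apply: le_trans h;rewrite le_eqVlt;apply/orP;left;apply/eqP.
 by apply: eq_I => y _;rewrite subr0 ger0_norm// le_max lexx orbT.
pose p y := Num.max (heat f dl y + SS j dl y) 0.
have ihf := heat_i dl0 fi;have iS := SS_i j0 dl0;have ihc := heat_i dl0 ic.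
have ip : itg setT p by apply: i_pos;exact: iD.
have pI : \int[mu]_y `|p y - g0 y| <= q + q + q.
 have i1 := iabs measurableT (iB measurableT (heat_i dl0 ig0) ig0).
 have i2 := iZ al measurableT ihc.
 apply: (@le_trans _ _ (\int[mu]_y (`|heat g0 dl y - g0 y| + al * heat chi dl y + SS j dl y))).
 apply: le_I => //;[exact: iabs (iB _ ip ig0)|exact: iD (iD _ i1 i2) iS|move=> y _].
 rewrite /p -{1}(max_l (g0p y));apply: le_trans (max0_lip _ _) _.
 have hl := @heat_lin R g0 chi dl y (- al) dl0 ig0 ic;rewrite -/f in hl;rewrite hl mulNr.
 rewrite (_ : _ - _ = (heat g0 dl y - g0 y) - al * heat chi dl y + SS j dl y);last by ring.
 apply: le_trans (ler_normD _ _) _;apply: lerD;last by rewrite ger0_norm// SS_ge0.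
 apply: le_trans (ler_normB _ _) _;rewrite lerD2l ger0_norm// mulr_ge0 ?heat_ge0// ltW//.
 rewrite ID//;last exact: iD.
 rewrite ID// IZ// heat_I//;apply: lerD;first by apply: lerD.
 exact: le_trans (SS_I j0 dl0) dlq.
pose w t x := UU f 0 0 t x + 1 * sS j t x.
pose w1 t x := - UU f 1 1 t x + 1 * S1 j t x.
pose w2 t x := UU f 2 2 t x - UU f 0 1 t x + 1 * (4 * j * hk t x).
have rw : rep j w w1 w2 0 f.
 move=> t x t0;split;first by rewrite subr0 /w /heat t0 mul1r.
 exact: (cal_lin 1 (cal_UU fi (or_introl t0)) (cal_S j x t0)).
have WE y : w dl y - 2 * j * `|y| = heat f dl y + SS j dl y.
 by have [-> _] := rw dl y dl0;rewrite subr0 /SS addrA.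
exists w, w1, w2, dl, f, R0;split=> //.
 apply: (@lt_le_trans _ _ (\int[mu]_y p y));last first.
 by rewrite le_eqVlt;apply/orP;left;apply/eqP;apply: eq_I => y _;rewrite WE.
 apply: (@lt_le_trans _ _ (\int[mu]_y (heat f dl y + SS j dl y))).
 by rewrite ID// heat_I//;apply: ltr_wpDr => //;apply: I_ge0 => y _;exact: SS_ge0.
 by apply: le_I => //;[exact: iD|move=> y _;rewrite le_max lexx].
have mP : measurable (@Rplus R) by exact: measurable_itv.
have ipP := iSub mP ip.
have igP := iSub mP ig0.
have irP := iSub mP ir0.
pose L r := `|Num.max (w dl r - 2 * j * r) 0 - rho0 r|.
have LE r : 0 <= r -> L r = `|p r - rho0 r|.
 by move=> r0';rewrite /L /p -WE (ger0_norm r0').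
have mL : measurable_fun (@Rplus R) (EFin \o L).
 apply: (eq_measurable_fun (EFin \o (fun y => `|p y - rho0 y|))).
 by move=> y;rewrite inE /Rplus /= in_itv/= andbT => y0;rewrite LE.
 apply: measurableT_comp => //;apply: measurableT_comp => //;apply: measurable_funB => //;exact: i_meas ipP.
have mR : measurable_fun (@Rplus R) (EFin \o (fun y => `|p y - r0 y|)).
 by apply: measurableT_comp => //;exact: i_meas (iabs mP (iB mP ipP irP)).
have aeL : ae_eq mu (@Rplus R) (EFin \o L) (EFin \o (fun y => `|p y - r0 y|)).
 by apply: aeS ae0 => y h yP;rewrite /= LE ?h//;move: yP;rewrite /Rplus /= in_itv/= andbT.
rewrite (@ae_eq_integral _ _ _ mu _ _ (EFin \o L) mP mL mR aeL).
rewrite -fine_int//;last exact: iabs (iB _ ipP irP).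
rewrite lee_fin;apply: le_trans qe.
apply: (@le_trans _ _ (\int[mu]_(y in @Rplus R) (`|p y - g0 y| + `|g0 y - r0 y|))).
 apply: le_I => //;[exact: iabs (iB _ ipP irP)|exact: iD (iabs mP (iB mP ipP igP)) (iabs mP (iB mP igP irP))|].
 by move=> y _;apply: le_trans (ler_normD _ _);rewrite addrA subrK.
rewrite ID//;[|exact: iabs (iB _ ipP igP)|exact: iabs (iB _ igP irP)].
have A1 : \int[mu]_(y in @Rplus R) `|p y - g0 y| <= q + q + q.
 by apply: le_trans pI;apply: I_sub => //;exact: iabs (iB _ ip ig0).
have A2 : \int[mu]_(y in @Rplus R) `|g0 y - r0 y| <= q.
 have mc : measurable [set y : R | 0 <= y <= R0].
 have -> : [set y : R | 0 <= y <= R0] = `[0, R0]%classic by apply/seteqP;split => y /=;rewrite in_itv.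
 exact: mI.
 pose h' y := if 0 <= y <= R0 then `|g0 y - r0 y| else 0.
 have ih' : itg setT h' by apply: i_if => //;exact: iabs (iB _ ig0 ir0).
 rewrite (@eq_I _ _ _ h');last first.
 move=> y;rewrite /Rplus /= in_itv/= andbT => y0;rewrite /h' y0 /=;case: ifPn => // yR.
 by rewrite /g0 (ger0_norm y0) (negbTE yR) out ?subrr ?normr0// => /andP[_];apply/negP.
 apply: le_trans (I_sub mP ih' _) _;first by move=> y;rewrite /h';case: ifP.
 rewrite (@I_supp R `[0, R0]%classic h');last by move=> y;rewrite /= in_itv/= /h' => /negP/negbTE ->.
 apply: le_trans h0;rewrite le_eqVlt;apply/orP;left;apply/eqP.
 by apply: eq_I => y;rewrite /= in_itv/= /h' => ->.
by apply: le_trans (lerD A1 A2) _;rewrite (_ : q * 4 = q + q + q + q)//;ring.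
Qed.

Lemma exists_quasi T eps : 0 < T -> 0 < eps -> exists (X : R -> R) (u : R -> R -> R), quasi_solution j rho0 T eps X u.
Proof.
move=> T0 ep;have [w [w1 [w2 [dl [f [a [rw sf dl0 P0 ini]]]]]]] := initial_stage ep.
have gw := rep_good j0 sf rw dl0 P0;set P := PW j w dl in P0.
have j4 : 0 < 4 * j by rewrite mulr_gt0.
(* The mesh keeps the mass oscillation [4 * j * h] within the accuracy and strictly below the mass
   [P], as [iterate] asks. *)
pose h := Num.min eps (P / 2) / (4 * j).
have h0 : 0 < h by rewrite divr_gt0// lt_min ep divr_gt0.
have hE : 4 * j * h = Num.min eps (P / 2) by rewrite /h mulrC divfK// gt_eqF.
have he : 4 * j * h <= eps by rewrite hE ge_min lexx.
have hP : 4 * j * h < P.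
 by apply: (@le_lt_trans _ _ (P / 2));[rewrite hE ge_min lexx orbT|rewrite ltr_pdivrMr// mulr_natr mulr2n ltrDl].
pose n := (Num.truncn (T / h)).+1.
have nT : T < n%:R * h by rewrite -ltr_pdivrMr//;exact: truncnS_gt.
have [v [v1 [v2 [s0 [g [b [_ _ _ Hv [_ v0]]]]]]]] := iterate rw sf dl0 gw (erefl P) h0 hP n.
have ab : dl < dl + n%:R * h by rewrite ltrDl (lt_trans T0).
exists (Xq j dl (dl + n%:R * h) v v1 v2), (uq j dl v).
apply: (@quasi_of_good R j dl (dl + n%:R * h) T eps P (4 * j * h) rho0 v v1 v2 ab) => //.
- by move=> t /Hv[].
- by rewrite ltrD2l.
- by move=> t /Hv[].
- by under eq_integral do rewrite v0.
Qed.
End Exist.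

(** * Weak convergence and uniqueness *)

Section Weak.
Context {R : realType}.
Notation mu := (@lebesgue_measure R).
Implicit Types (x y a b d e m r C : R) (f g phi : R -> R).

Lemma mRplus : measurable (@Rplus R).
Proof. exact: measurable_itv. Qed.

Lemma RplusE y : (@Rplus R) y <-> 0 <= y.
Proof. by rewrite /Rplus /= in_itv/= andbT. Qed.

Lemma i_ext (D : set R) f : measurable D -> itg D f ->
 itg setT (f \_ D).
Proof.
move=> mD fi;apply: (@i_supp _ D) => //.
 by move=> y nD;rewrite patchE memNset.
apply: (@eq_integrable _ _ _ mu _ mD (EFin \o f)) => //.
by move=> y yD;rewrite /= patchE yD.
Qed.

Lemma I_ext (D : set R) f : \int[mu]_y (f \_ D) y = \int[mu]_(y in D) f y.
Proof.
rewrite (@I_supp R D);last by move=> y nD;rewrite patchE memNset.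
by apply: eq_I => y yD;rewrite patchE mem_set.
Qed.

Lemma I_splitP f m : 0 <= m -> itg (@Rplus R) f ->
 \int[mu]_(y in @Rplus R) f y = \int[mu]_(y in `[0, m]) f y + \int[mu]_(y in `[m, +oo[) f y.
Proof.
move=> m0 fi;pose F := f \_ (@Rplus R).
have iF : itg setT F by exact: i_ext mRplus fi.
have FE y : 0 <= y -> F y = f y by move=> y0;rewrite /F patchE mem_set//;exact/RplusE.
have F0 y : y < 0 -> F y = 0.
 by move=> y0;rewrite /F patchE memNset// => /RplusE;rewrite leNgt y0.
have m1 : measurable (`[0, m]%classic : set R) by exact: measurable_itv.
have m2 : measurable (`[m, +oo[%classic : set R) by exact: measurable_itv.
have m3 : measurable (`[m, m]%classic : set R) by exact: measurable_itv.
have s1 D : measurable D -> itg setT (F \_ D).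
 by move=> mD;apply: i_ext => //;exact: integrableS iF.
rewrite -(I_ext (@Rplus R) f) -/F.
have -> : \int[mu]_(y in `[0, m]) f y = \int[mu]_y (F \_ `[0, m]) y.
 by rewrite I_ext;apply: eq_I => y /=;rewrite in_itv/= => /andP[y0 _];rewrite FE.
have -> : \int[mu]_(y in `[m, +oo[) f y = \int[mu]_y (F \_ `[m, +oo[) y.
 by rewrite I_ext;apply: eq_I => y /=;rewrite in_itv/= andbT => y0;rewrite FE// (le_trans m0).
have Z : \int[mu]_y (F \_ `[m, m]) y = 0 by rewrite I_ext I_set1.
rewrite -[LHS]addr0 -{1}Z -!ID//;try exact: s1.
apply: eq_I => y _;rewrite !patchE !mem_setE !in_itv/= andbT.
have [y0|y0] := ltP y 0;first by rewrite F0// !if_same !addr0.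
have pE : (point : R) = 0 by [].
by rewrite /=;case: (ltgtP y m) => // h;rewrite ?pE ?addr0 ?add0r.
Qed.

Lemma cell1 phi f a b d : itg `[a, b] f ->
 itg `[a, b] (fun y => phi y * f y) -> (forall y, 0 <= f y) ->
 (forall y, a <= y <= b -> `|phi y - phi a| <= d) ->
 `|\int[mu]_(y in `[a, b]) (phi y * f y) - phi a * \int[mu]_(y in `[a, b]) f y| <= d * \int[mu]_(y in `[a, b]) f y.
Proof.
move=> fi pf f0 H;have mD : measurable (`[a, b]%classic : set R) by exact: measurable_itv.
have ik := iZ (phi a) mD fi.
rewrite -IZ// -IB//;apply: le_trans (I_norm mD (iB mD pf ik)) _.
rewrite -IZ//;apply: le_I => //;[exact: iabs (iB _ pf ik)|exact: iZ|move=> y].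
rewrite /= in_itv/= => /H h;rewrite -mulrBl normrM (ger0_norm (f0 y)).
exact: ler_wpM2r.
Qed.

(** Riemann sums. On each of the [k] cells [phi] is replaced by its value at the left end, at a cost
    [d] times the mass of the cell; the masses of a cell under [f] and [g] differ by at most
    [2 * eta], being increments of the primitives. *)
Lemma cells phi f g C d eta (h : R) (k : nat) : 0 <= h ->
 (forall m, 0 <= m -> itg `[0, m] f /\ itg `[0, m] g) ->
 (forall m, 0 <= m -> itg `[0, m] (fun y => phi y * f y) /\
 itg `[0, m] (fun y => phi y * g y)) ->
 (forall y, 0 <= f y /\ 0 <= g y) -> (forall y, 0 <= y -> `|phi y| <= C) ->
 (forall r, 0 <= r -> `|\int[mu]_(y in `[0, r]) f y - \int[mu]_(y in `[0, r]) g y| <= eta) ->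
 (forall x y, 0 <= x <= k%:R * h -> x <= y <= x + h -> `|phi y - phi x| <= d) ->
 `|\int[mu]_(y in `[0, k%:R * h]) (phi y * f y) - \int[mu]_(y in `[0, k%:R * h]) (phi y * g y)| <=
 k%:R * (C * (2 * eta)) + d * (\int[mu]_(y in `[0, k%:R * h]) f y + \int[mu]_(y in `[0, k%:R * h]) g y).
Proof.
move=> h0 ifg ipfg fg0 HC Heta;elim: k => [|k IH] Hd;first by rewrite !mul0r !I_set1 subrr normr0 add0r addr0 mulr0.
have kE : k.+1%:R * h = k%:R * h + h by rewrite -addn1 natrD mulrDl mul1r.
have a0 : 0 <= k%:R * h by rewrite mulr_ge0 ?ler0n.
have ab : k%:R * h <= k%:R * h + h by rewrite lerDl.
have b0 := le_trans a0 ab.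
have {}IH : `|\int[mu]_(y in `[0, k%:R * h]) (phi y * f y) - \int[mu]_(y in `[0, k%:R * h]) (phi y * g y)| <=
 k%:R * (C * (2 * eta)) + d * (\int[mu]_(y in `[0, k%:R * h]) f y + \int[mu]_(y in `[0, k%:R * h]) g y).
 by apply: IH => x y /andP[x0 hx];apply: Hd;rewrite x0 kE (le_trans hx).
rewrite kE in Hd *;move: (k%:R * h) a0 ab b0 IH Hd => a a0 ab b0 IH Hd.
have [[f1 g1] [pf1 pg1]] := (ifg (a + h) b0, ipfg (a + h) b0).
rewrite !(I_split a0 ab)//.
have S1 := Heta a a0;have S2 := Heta (a + h) b0;rewrite !(I_split a0 ab)// in S2.
have sub F : itg `[0, a + h] F -> itg `[a, a + h] F by apply: iS.
have osc y : a <= y <= a + h -> `|phi y - phi a| <= d by move=> hy;apply: Hd => //;rewrite a0 lerDl.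
have c1 := @cell1 phi f a (a + h) d (sub _ f1) (sub _ pf1) (fun y => (fg0 y).1) osc.
have c2 := @cell1 phi g a (a + h) d (sub _ g1) (sub _ pg1) (fun y => (fg0 y).2) osc.
move: IH S1 S2 c1 c2 (HC a a0);move: (phi a) => pa.
move: (\int[mu]_(y in `[0, a]) (phi y * f y)) (\int[mu]_(y in `[0, a]) (phi y * g y)) => A1 A2.
move: (\int[mu]_(y in `[a, a + h]) (phi y * f y)) (\int[mu]_(y in `[a, a + h]) (phi y * g y)) => B1 B2.
move: (\int[mu]_(y in `[0, a]) f y) (\int[mu]_(y in `[0, a]) g y) => F1 G1.
move: (\int[mu]_(y in `[a, a + h]) f y) (\int[mu]_(y in `[a, a + h]) g y) => F2 G2.
move=> IH S1 S2 c1 c2 pC.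
have S3 : `|F2 - G2| <= 2 * eta.
 rewrite (_ : F2 - G2 = (F1 + F2 - (G1 + G2)) - (F1 - G1));last by ring.
 by apply: le_trans (ler_normB _ _) _;rewrite (mulrDl 1 1 eta) mul1r;apply: lerD.
have S4 : `|pa * (F2 - G2)| <= C * (2 * eta) by rewrite normrM;apply: ler_pM.
rewrite (_ : A1 + B1 - (A2 + B2) = (A1 - A2) + ((B1 - pa * F2) - (B2 - pa * G2) + pa * (F2 - G2)));last by ring.
apply: le_trans (ler_normD _ _) _.
have := ler_normD (B1 - pa * F2 - (B2 - pa * G2)) (pa * (F2 - G2)).
have := ler_normB (B1 - pa * F2) (B2 - pa * G2).
move: (`|_ + pa * (F2 - G2)|) => n1;move: (`|pa * (F2 - G2)|) S4 => n2 S4.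
move: (`|B1 - pa * F2 - (B2 - pa * G2)|) => n3;move: (`|B1 - pa * F2|) (`|B2 - pa * G2|) c1 c2 => n4 n5 c1 c2.
move: (`|A1 - A2|) IH => n6;move: (C * (2 * eta)) S4 => A S4.
rewrite -[k.+1%:R]natr1 mulrDl mul1r !mulrDr.
by move: (k%:R * A) (d * F1) (d * F2) (d * G1) (d * G2) c1 c2 => *;lra.
Qed.

Lemma phi_bounded phi : [bounded phi r | r in @Rplus R] -> exists2 C : R, 0 < C & forall y, 0 <= y -> `|phi y| <= C.
Proof.
move=> [M [_ HM]];exists (`|M| + 1);first by rewrite ltr_wpDl.
move=> y y0;apply: (HM (`|M| + 1));last exact/RplusE.
by apply: le_lt_trans (ler_norm M) _;rewrite ltrDl.
Qed.

Lemma phi_meas phi : {within @Rplus R, continuous phi} -> measurable_fun (@Rplus R) phi.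
Proof. by move=> h;apply: subspace_continuous_measurable_fun => //;exact: mRplus. Qed.

Lemma phi_eps phi : {within @Rplus R, continuous phi} -> forall x e, 0 <= x -> 0 < e ->
 exists2 d : R, 0 < d & forall y, 0 <= y -> `|y - x| < d -> `|phi y - phi x| < e.
Proof.
move=> h x e x0 e0;have xP : (@Rplus R) x by apply/RplusE.
have H : within (@Rplus R) (nbhs x) [set y | `|phi x - phi y| < e].
 rewrite nbhs_subspace_in//;have /cvgrPdist_lt/(_ e e0) := h x;exact.
move: H => [d /= d0 Hd];exists d => // y y0 yx;rewrite distrC;apply: Hd;last exact/RplusE.
by rewrite /= distrC.
Qed.

Lemma i_phi phi f C (D : set R) : measurable D -> D `<=` @Rplus R -> {within @Rplus R, continuous phi} ->
 (forall y, 0 <= y -> `|phi y| <= C) -> itg D f ->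
 itg D (fun y => phi y * f y).
Proof.
move=> mD DP hc HC fi;apply: (@i_le _ _ _ (fun y => C * `|f y|)) => //;last by apply: iZ => //;exact: iabs.
 apply: measurable_funM;last exact: i_meas fi.
 exact: measurable_funS mRplus DP (phi_meas hc).
move=> y /DP/RplusE y0;rewrite normrM;apply: ler_wpM2r => //;exact: HC.
Qed.

(** Closeness of the primitives controls the mass of every cell, and convergence of the total masses
    to [M0], with tightness of [F], controls the tails, where the test function is only bounded. *)
Lemma weak_lim (v : nat -> R -> R) (rho : R -> R) (F : R -> R) (M0 : R) :
 (forall n, itg (@Rplus R) (v n) /\ forall y, 0 <= v n y) -> (forall y, 0 <= rho y) ->
 (forall m, 0 <= m -> itg `[0, m] rho) ->
 (forall r, 0 <= r -> F r = \int[mu]_(y in `[0, r]) rho y) -> (forall r, 0 <= r -> F r <= M0) ->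
 (forall e, 0 < e -> exists2 m : R, 0 <= m & M0 - F m <= e) ->
 (forall e, 0 < e -> exists N : nat, forall n, (N <= n)%N ->
 (forall r, 0 <= r -> `|\int[mu]_(y in `[0, r]) v n y - F r| <= e) /\ `|\int[mu]_(y in @Rplus R) v n y - M0| <= e) ->
 weak_cvg v rho.
Proof.
move=> Hv rho_p irho FE FM tight conv.
have subI (m : R) : `[0, m]%classic `<=` @Rplus R.
 by move=> y /=;rewrite in_itv/= => /andP[y0 _];exact/RplusE.
have subT (m : R) : 0 <= m -> `[m, +oo[%classic `<=` @Rplus R.
 by move=> m0 y /=;rewrite in_itv/= andbT => ym;apply/RplusE;exact: le_trans ym.
have mI (m : R) : measurable (`[0, m]%classic : set R) by exact: measurable_itv.
have mT (m : R) : measurable (`[m, +oo[%classic : set R) by exact: measurable_itv.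
have UE : \bigcup_(n : nat) (`[0, n%:R]%classic : set R) = @Rplus R.
 apply/seteqP;split => y;first by move=> [n _ h];exact: subI h.
 move=> /RplusE y0;exists (Num.truncn y).+1 => //=;rewrite in_itv/= y0 ltW//;exact: truncnS_gt.
have mrho : measurable_fun (@Rplus R) rho.
 rewrite -UE;apply/measurable_fun_bigcup => n;first exact: mI.
 exact: i_meas (irho n%:R (ler0n R n)).
have cv : (\int[mu]_(y in `[0%R, n%:R]) (rho y)%:E)%E @[n --> \oo] --> (\int[mu]_(y in @Rplus R) (rho y)%:E)%E.
 rewrite -UE;apply: ge0_nondecreasing_set_cvg_integral.
 - by move=> a b ab;apply/subsetPset => y /=;rewrite !in_itv/= => /andP[-> /le_trans];apply;rewrite ler_nat.
 - by move=> n;exact: mI.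
 - by move=> n;apply: measurableT_comp => //;exact: i_meas (irho n%:R (ler0n R n)).
 - by move=> n y _;rewrite lee_fin.
have FnE n : (\int[mu]_(y in `[0%R, n%:R]) (rho y)%:E)%E = (F n%:R)%:E.
 by rewrite FE ?ler0n// fine_int//;exact: irho (ler0n R n).
have IE : (\int[mu]_(y in @Rplus R) (rho y)%:E <= M0%:E)%E.
 rewrite -(cvg_lim (@ereal_hausdorff R) cv);apply: lime_le;first exact: cvgP cv.
 by apply: nearW => n;rewrite FnE lee_fin FM ?ler0n.
have irP : itg (@Rplus R) rho.
 apply/integrableP;split;first exact: measurableT_comp.
 rewrite (_ : (\int[mu]_(x in _) _)%E = (\int[mu]_(y in @Rplus R) (rho y)%:E)%E).
 by apply: le_lt_trans IE _;rewrite ltry.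
 by apply: eq_integral => y _;rewrite /= ger0_norm.
have IrP : \int[mu]_(y in @Rplus R) rho y <= M0 by rewrite -lee_fin fine_int//;exact: mRplus.
split=> // phi hc hb;have [C C0 HC] := phi_bounded hb.
have ip D f : measurable D -> D `<=` @Rplus R -> itg D f ->
 itg D (fun y => phi y * f y) by move=> mD DP;exact: i_phi hc HC.
have M00 : 0 <= M0 by apply: le_trans (FM 0 (lexx 0));rewrite FE// I_ge0.
apply/cvgrPdist_le => e e0.
have e80 : 0 < e / 8 / C by rewrite !divr_gt0.
have [m m0 Hm] := tight _ e80.
have d0 : 0 < e / 8 / (M0 + M0 + 1) by rewrite !divr_gt0// ltr_wpDl// addr_ge0.
set d := e / 8 / (M0 + M0 + 1) in d0.
have [|h h0 Hh] := @compact_unif R (fun x h => forall y, 0 <= y -> `|y - x| < h -> `|phi y - phi x| <= d) 0 (m + 1).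
 move=> x /andP[x0 _];have [k k0 Hk] := phi_eps hc x0 (divr_gt0 d0 (ltr0n R 2)).
 exists (k / 2) => [|y h /andP[y0 _] yx /andP[_ hh] z z0 zy];first by rewrite divr_gt0.
 have kk : k / 2 < k by lra.
 rewrite (_ : phi z - phi y = (phi z - phi x) - (phi y - phi x));last by ring.
 apply: le_trans (ler_normB _ _) _;rewrite (splitr d);apply: lerD;apply: ltW;apply: Hk => //.
 rewrite (_ : z - x = (z - y) + (y - x));last by ring.
 by apply: le_lt_trans (ler_normD _ _) _;rewrite (splitr k);apply: ltrD => //;exact: lt_trans hh.
 exact: lt_trans kk.
pose k := (Num.truncn (2 * (m + 1) / h)).+1.
have k0 : 0 < k%:R :> R by rewrite ltr0n.
pose s := m / k%:R.
have s0 : 0 <= s by rewrite divr_ge0// ltW.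
have ks : k%:R * s = m by rewrite /s mulrC divfK// gt_eqF.
have sh : s < h.
 rewrite /s ltr_pdivrMr// mulrC -ltr_pdivrMr//;apply: le_lt_trans (truncnS_gt _).
 by rewrite ler_pM2r ?invr_gt0//;lra.
have kC : 0 < k%:R * (C * 2) * 8 + C * 2 * 8 + d * 8 + 8.
 have a2 : 0 < C * 2 by rewrite mulr_gt0.
 have a1 := mulr_gt0 k0 a2;move: a1 a2 d0;move: (k%:R * (C * 2)) (C * 2) => u1 u2;lra.
(* Each error term carrying [eta] becomes at most [e / 8]. *)
pose eta := Num.min 1 (e / (k%:R * (C * 2) * 8 + C * 2 * 8 + d * 8 + 8)).
have eta0 : 0 < eta by rewrite lt_min ltr01 divr_gt0.
have etaE : k%:R * (C * 2) * 8 * eta + C * 2 * 8 * eta + d * 8 * eta + 8 * eta <= e.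
 rewrite (_ : k%:R * (C * 2) * 8 * eta + C * 2 * 8 * eta + d * 8 * eta + 8 * eta = eta * (k%:R * (C * 2) * 8 + C * 2 * 8 + d * 8 + 8));last by ring.
 by rewrite -ler_pdivlMr// /eta ge_min lexx orbT.
have [N HN] := conv _ eta0;exists N => // n /= Nn;have [B1 B2] := HN n Nn.
have [iv v0] := Hv n.
have ivI x : 0 <= x -> itg `[0, x] (v n).
 by move=> _;exact: iSubE mRplus (mI x) (subI x) iv.
have osc x y : 0 <= x <= k%:R * s -> x <= y <= x + s -> `|phi y - phi x| <= d.
 rewrite ks => /andP[x0 xm] /andP[xy ys];apply: (Hh x (s + (h - s) / 2)).
 - by rewrite x0 (le_trans xm)// lerDl.
 - have hs : 0 < (h - s) / 2 by rewrite divr_gt0// subr_gt0.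
 have hs2 : (h - s) / 2 < h - s by rewrite ltr_pdivrMr// mulr_natr mulr2n ltrDl subr_gt0.
 by rewrite ltr_wpDl//= addrC -ltrBrDr.
 - exact: le_trans xy.
 - rewrite ger0_norm ?subr_ge0// ltrBlDl addrA;apply: le_lt_trans ys _.
 by rewrite ltrDl divr_gt0// subr_gt0.
have heta r : 0 <= r -> `|\int[mu]_(y in `[0, r]) v n y - \int[mu]_(y in `[0, r]) rho y| <= eta.
 by move=> r0;rewrite -FE//;exact: B1.
have H1 x : 0 <= x -> itg `[0, x] (v n) /\ itg `[0, x] rho.
 by move=> x0;split;[exact: ivI|exact: irho].
have H2 x : 0 <= x -> itg `[0, x] (fun y => phi y * v n y) /\
 itg `[0, x] (fun y => phi y * rho y).
 by move=> x0;have [a1 a2] := H1 x x0;split;exact: ip (mI x) (subI x) _.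
have H3 y : 0 <= v n y /\ 0 <= rho y by [].
have := cells s0 H1 H2 H3 HC heta osc.
rewrite ks => Hc.
rewrite distrC (I_splitP m0 (ip _ _ mRplus (@subset_refl _ _) iv)) (I_splitP m0 (ip _ _ mRplus (@subset_refl _ _) irP)).
have tail f : (forall y, 0 <= f y) -> itg (@Rplus R) f ->
 `|\int[mu]_(y in `[m, +oo[) (phi y * f y)| <= C * (\int[mu]_(y in @Rplus R) f y - \int[mu]_(y in `[0, m]) f y).
 move=> f0 fi;have fT := iSubE mRplus (mT m) (subT m m0) fi.
 rewrite (I_splitP m0 fi) addrAC subrr add0r -IZ//.
 apply: le_trans (I_norm (mT m) (ip _ _ (mT m) (subT m m0) fT)) _.
 apply: le_I => //;[exact: iabs (ip _ _ (mT m) (subT m m0) fT)|exact: iZ|move=> y /(subT m m0)/RplusE y0].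
 by rewrite normrM (ger0_norm (f0 y));apply: ler_wpM2r => //;exact: HC.
have t1 := tail _ v0 iv;have t2 := tail _ rho_p irP.
move: Hc t1 t2 (B1 m m0) B2 Hm IrP (FM m m0);rewrite -FE//.
move: (\int[mu]_(y in `[m, +oo[) (phi y * v n y)) (\int[mu]_(y in `[m, +oo[) (phi y * rho y)) => T1 T2.
move: (\int[mu]_(y in `[0, m]) (phi y * v n y)) (\int[mu]_(y in `[0, m]) (phi y * rho y)) => S1 S2.
move: (\int[mu]_(y in @Rplus R) v n y) (\int[mu]_(y in @Rplus R) rho y) (\int[mu]_(y in `[0, m]) v n y) (F m) => Iv Ir Fv Fm.
move=> Hc t1 t2;rewrite !ler_norml => /andP[b1 b2] /andP[b3 b4] Hm Ir1 Fm1.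
have x1 : `|T1| <= C * (e / 8 / C + 2 * eta) by apply: le_trans t1 _;rewrite ler_pM2l//;clear -b1 b4 Hm;lra.
have x2 : `|T2| <= C * (e / 8 / C) by apply: le_trans t2 _;rewrite ler_pM2l//;clear -Ir1 Hm;lra.
have cE : C * (e / 8 / C) = e / 8 by rewrite mulrC divfK// gt_eqF.
have x3 : d * (Fv + Fm) <= d * (M0 + M0 + 1) + d * eta.
 by rewrite -mulrDr;apply: ler_wpM2l;[exact: ltW|clear -b2 Fm1;lra].
have dE : d * (M0 + M0 + 1) = e / 8 by rewrite /d divfK// gt_eqF// ltr_wpDl// addr_ge0.
rewrite mulrDr cE in x1;rewrite cE in x2;rewrite dE in x3.
have tr : `|S1 + T1 - (S2 + T2)| <= `|S1 - S2| + (`|T1| + `|T2|).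
 rewrite (_ : _ - _ = (S1 - S2) + (T1 - T2));last by ring.
 by apply: le_trans (ler_normD _ _) _;rewrite lerD2l ler_normB.
have eta1 := eta0.
rewrite -ler_norml;apply: le_trans tr _;move: Hc x1 x2 x3 etaE e0 eta0.
rewrite (_ : k%:R * (C * (2 * eta)) = k%:R * (C * 2) * 8 * eta / 8);last by field.
rewrite (_ : C * (2 * eta) = C * 2 * 8 * eta / 8);last by field.
rewrite (_ : d * eta = d * 8 * eta / 8);last by field.
have two : (0 : R) < 2 by [].
have eight : (0 : R) < 8 by [].
have q1 : 0 <= k%:R * (C * 2) * 8 * eta := ltW (mulr_gt0 (mulr_gt0 (mulr_gt0 k0 (mulr_gt0 C0 two)) eight) eta1).
have q2 : 0 <= C * 2 * 8 * eta := ltW (mulr_gt0 (mulr_gt0 (mulr_gt0 C0 two) eight) eta1).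
have q3 : 0 <= d * 8 * eta := ltW (mulr_gt0 (mulr_gt0 d0 eight) eta1).
move: (`|S1 - S2|) (`|T1|) (`|T2|) (d * (Fv + Fm)) q1 q2 q3.
move: (k%:R * (C * 2) * 8 * eta) (C * 2 * 8 * eta) (d * 8 * eta).
move=> u1 u2 u3 n1 n2 n3 n4 q1 q2 q3;clear;lra.
Qed.

(** The continuous cut-offs [phi x n] decrease to the indicator of []-oo, x]], so every primitive of
    the difference vanishes; Lebesgue's differentiation theorem concludes. *)
Lemma weak_uniq (u rho : R -> R) : itg (@Rplus R) u -> itg (@Rplus R) rho ->
 (forall phi, {within @Rplus R, continuous phi} -> [bounded phi r | r in @Rplus R] ->
 \int[mu]_(y in @Rplus R) (phi y * u y) = \int[mu]_(y in @Rplus R) (phi y * rho y)) ->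
 ae_eq mu (@Rplus R) u rho.
Proof.
move=> iu ir H;pose D := (fun y => u y - rho y) \_ (@Rplus R).
have id := iB mRplus iu ir.
have iD' : itg setT D by exact: i_ext mRplus id.
have DE y : 0 <= y -> D y = u y - rho y by move=> y0;rewrite /D patchE mem_set//;exact/RplusE.
have D0 y : y < 0 -> D y = 0 by move=> y0;rewrite /D patchE memNset// => /RplusE;rewrite leNgt y0.
pose phi x (n : nat) (y : R) := Num.max (1 - n%:R * Num.max (y - x) 0) 0.
have phi01 x n y : 0 <= phi x n y <= 1.
 rewrite /phi le_max lexx orbT ge_max ler01 andbT gerBl mulr_ge0 ?ler0n// le_max lexx orbT.
 by [].
have phic x n : continuous (phi x n).
 move=> y;apply/cont_epsP => e e0;have n10 : 0 < n%:R + 1 :> R by rewrite ltr_wpDl ?ler0n.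
 exists (e / (n%:R + 1)) => [|z];first by rewrite divr_gt0.
 rewrite ltr_pdivlMr// => zy;apply: le_lt_trans (max0_lip _ _) _.
 rewrite (_ : _ - _ = - (n%:R * (Num.max (z - x) 0 - Num.max (y - x) 0)));last by ring.
 rewrite normrN normrM ger0_norm ?ler0n//;apply: le_lt_trans zy;rewrite mulrC.
 apply: ler_pM;rewrite ?ler0n//;last by rewrite lerDl.
 by apply: le_trans (max0_lip _ _) _;rewrite opprB addrA subrK.
have Z x : \int[mu]_(y in `]-oo, x]) D y = 0.
 have mx : measurable (`]-oo, x]%classic : set R) by exact: measurable_itv.
 have zero n : \int[mu]_y (phi x n y * D y) = 0.
 have hc : {within @Rplus R, continuous (phi x n)} by apply: continuous_subspaceT.
 have hb' y : `|phi x n y| <= 1 by have /andP[p0 p1] := phi01 x n y;rewrite ger0_norm.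
 have hb : [bounded phi x n r | r in @Rplus R].
 exists 1;split;first exact: num_real.
 by move=> M M1 y _;exact: le_trans (hb' y) (ltW M1).
 rewrite (@I_supp R (@Rplus R));last by move=> y ny;rewrite D0 ?mulr0// ltNge;apply/negP => /RplusE.
 rewrite (@eq_I _ _ _ (fun y => phi x n y * u y - phi x n y * rho y));last first.
 by move=> y /RplusE y0;rewrite DE// mulrBr.
 have ipu := @i_phi (phi x n) u 1 _ mRplus (@subset_refl _ _) hc (fun y _ => hb' y) iu.
 have ipr := @i_phi (phi x n) rho 1 _ mRplus (@subset_refl _ _) hc (fun y _ => hb' y) ir.
 by rewrite (IB mRplus ipu ipr) H// subrr.
 have mphi n : measurable_fun setT (phi x n) by apply: continuous_measurable_fun;exact: phic.
 have [|||||_ Hd] := (@dct_seq R setT (fun n y => phi x n y * D y) (D \_ `]-oo, x]%classic) (fun y => `|D y|) measurableT).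
 - by move=> n;apply: measurable_funM => //;exact: i_meas iD'.
 - by apply: (i_meas (i_ext mx _));exact: integrableS iD'.
 - apply: aeW => y _;rewrite patchE mem_setE in_itv/=;case: ifPn => yx.
 apply: cvg_near_cst;apply: nearW => n;rewrite /phi (max_r (_ : y - x <= 0)) ?subr_le0//.
 by rewrite mulr0 subr0 max_l// mul1r.
 rewrite -ltNge in yx;have d0 : 0 < y - x by rewrite subr_gt0.
 apply: cvg_near_cst;exists (Num.truncn (1 / (y - x))).+1 => // n /= Nn.
 rewrite /phi (max_l (ltW d0)) max_r ?mul0r// subr_le0 -ler_pdivrMr//.
 by apply: ltW;apply: lt_le_trans (_ : (Num.truncn (1 / (y - x))).+1%:R <= _);[exact: truncnS_gt|rewrite ler_nat].
 - exact: iabs.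
 - move=> n y _;rewrite normrM;have /andP[p0 p1] := phi01 x n y.
 by rewrite (ger0_norm p0) ler_piMl.
 rewrite -I_ext;apply/eqP;rewrite -normr_eq0 eq_le normr_ge0 andbT.
 apply/ler_addgt0Pr => e e0;rewrite add0r;have [N /(_ N (leqnn _)) h] := Hd e e0.
 have iN : itg setT (fun y => phi x N y * D y).
 apply: (i_le measurableT) (iabs measurableT iD');first by apply: measurable_funM => //;exact: i_meas iD'.
 move=> y _;rewrite normrM;have /andP[p0 p1] := phi01 x N y;by rewrite (ger0_norm p0) ler_piMl.
 have iX : mu.-integrable setT (EFin \o (D \_ `]-oo, x]%classic)) by apply: i_ext => //;exact: integrableS iD'.
 apply: le_trans h;rewrite -[leLHS]normrN -[X in `|X|]add0r -(zero N) -IB//.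
 by apply: I_norm => //;exact: iB.
have LI : locally_integrable setT D := integrable_locally mRplus id.
have F1 := @FTC1 R D -oo%O (fun y => iSub (measurable_itv _) iD') LI.
apply: aeS F1 => y /= Hy /RplusE y0;have [_ E] := Hy (ltNyr y).
apply/eqP;rewrite -subr_eq0 -DE// -E.
have -> : (fun x => \int[mu]_(t in `]-oo, x]) D t) = (fun=> 0) by apply/funext => x;exact: Z.
by rewrite (der1 (derC 0 y)).
Qed.
End Weak.

(** * The limit and its independence of the sequence *)

Section Final.
Context {R : realType}.
Notation mu := (@lebesgue_measure R).
Implicit Types (x y a b d e m r t s : R) (X : R -> R) (u : R -> R -> R).
Variables (j : R) (rho0 r0 : R -> R) (R0 B : R).
Hypotheses (j0 : 0 < j) (R00 : 0 < R0) (B0 : 0 <= B) (Hr0 : forall y, 0 <= r0 y <= B).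
Hypotheses (out : forall y, ~ (0 <= y <= R0) -> r0 y = 0) (ir0 : itg setT r0).
Hypotheses (ae0 : {ae mu, forall y, Rplus y -> rho0 y = r0 y}) (mrho : measurable_fun (@Rplus R) rho0).
Hypothesis HQ : forall T eps : R, 0 < T -> 0 < eps -> exists (X : R -> R) (u : R -> R -> R), quasi_solution j rho0 T eps X u.

Let M0 : R := \int[mu]_(y in `[0, R0]) r0 y.
Let V0 r : R := \int[mu]_(y in `[0, r]) r0 y.

Lemma V0_M r : R0 <= r -> V0 r = M0.
Proof.
move=> Rr;have E r' : R0 <= r' -> \int[mu]_(y in `[0, r']) r0 y = \int[mu]_y r0 y.
 move=> Rr';rewrite (@I_supp R `[0, r']%classic)// => y h;apply: out => /andP[y0 yR].
 by apply: h;rewrite /= in_itv/= y0 (le_trans yR).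
by rewrite /V0 /M0 !E.
Qed.

Lemma V0_lip r (r' : R) : 0 <= r -> r <= r' -> V0 r' - V0 r <= B * (r' - r).
Proof.
move=> rp rr;have mI a b : measurable (`[a, b]%classic : set R) by exact: measurable_itv.
rewrite /V0 (I_split rp rr (iSub (mI _ _) ir0)) addrAC subrr add0r.
by apply: I_diff_le => //;[exact: iSub (mI _ _) ir0|move=> y _;exact: (andP (Hr0 y)).2].
Qed.

Lemma zero_extE T X u t y : 0 <= t < T -> 0 <= y -> zero_ext X u t y = ubar T X u t y.
Proof.
move=> ht y0;rewrite /zero_ext patchE mem_setE in_itv/= y0 /=.
by case: (leP y (X t)) => h;[rewrite ubarE|rewrite ubar0// ger0_norm].
Qed.

Lemma zero_ext0 X u t y : y < 0 -> zero_ext X u t y = 0.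
Proof. by move=> y0;rewrite /zero_ext patchE mem_setE in_itv/= [0 <= y]leNgt y0. Qed.

Lemma I_leP f r : 0 <= r -> itg (@Rplus R) f -> (forall y, 0 <= f y) ->
 \int[mu]_(y in `[0, r]) f y <= \int[mu]_(y in @Rplus R) f y.
Proof. by move=> rp fi f0;rewrite (I_splitP rp fi) lerDl;apply: I_ge0. Qed.

Lemma init_close T eps X u r : quasi_solution j rho0 T eps X u -> 0 < T -> 0 <= r ->
 `|VV (ubar T X u) 0 r - V0 r| <= eps.
Proof.
move=> Q T0 rp;have h0 : 0 <= (0 : R) < T by rewrite lexx.
have iu := ubar_meas Q h0;have mI : measurable (`[0, r]%classic : set R) by exact: measurable_itv.
have id := iB measurableT iu ir0;have ia := iabs measurableT id.
rewrite /VV /V0 -IB//;[|exact: iSub|exact: iSub].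
apply: le_trans (I_norm mI (iSub mI id)) _.
apply: le_trans (I_leP rp (iSub mRplus ia) (fun y => normr_ge0 _)) _.
rewrite -lee_fin (fine_int (iSub mRplus ia) mRplus).
apply: le_trans (qs_initial Q);rewrite le_eqVlt;apply/orP;left;apply/eqP.
have m1 : measurable_fun (@Rplus R) (EFin \o (fun y => `|ubar T X u 0 y - r0 y|)).
 by apply: measurableT_comp => //;exact: i_meas (iSub mRplus ia).
have m2 : measurable_fun (@Rplus R) (EFin \o (fun y => `|zero_ext X u 0 y - rho0 y|)).
 apply: (eq_measurable_fun (EFin \o (fun y => `|ubar T X u 0 y - rho0 y|))).
 by move=> y;rewrite inE => /RplusE y0;rewrite /= (zero_extE X u h0 y0).
 apply: measurableT_comp => //;apply: measurableT_comp => //;apply: measurable_funB => //.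
 exact: i_meas (iSub mRplus iu).
apply: (@ae_eq_integral _ _ _ mu _ _ _ mRplus m1 m2).
by apply: aeS ae0 => y h yP;rewrite /= h// (zero_extE X u h0)//;exact/RplusE.
Qed.

Lemma mass_VV T eps X u t : quasi_solution j rho0 T eps X u -> 0 <= t < T -> VV (ubar T X u) t (X t) = mass X u t.
Proof. by move=> Q ht;exact: (ubar_I0 Q ht (lexx _)). Qed.

Lemma mass_close T eps X u t : quasi_solution j rho0 T eps X u -> 0 < T -> 0 <= t < T ->
 `|VV (ubar T X u) t (X t) - M0| <= 2 * eps.
Proof.
move=> Q T0 ht;rewrite (mass_VV Q ht);have h0 : 0 <= (0 : R) < T by rewrite lexx.
have A := mass_eps Q ht;pose m := Num.max (X 0) R0.
have Xm : X 0 <= m by rewrite le_max lexx.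
have Rm : R0 <= m by rewrite le_max lexx orbT.
have mp : 0 <= m by apply: le_trans Rm;exact: ltW.
have := init_close Q T0 mp;rewrite V0_M// /VV (ubar_I0 Q h0 Xm) => C.
rewrite (_ : _ - M0 = (mass X u t - mass X u 0) + (mass X u 0 - M0));last by ring.
by apply: le_trans (ler_normD _ _) _;rewrite mulrDl mul1r;apply: lerD.
Qed.

(** The lifetimes may differ, so that sequences on [[0, T[] can be compared with a reference family
    living longer. The factor 2 comes from the masses: each is within its accuracy of the initial
    mass, itself within the accuracy of [M0]. *)
Lemma pair_close T T1 T2 eps1 eps2 X1 X2 u1 u2 t r : quasi_solution j rho0 T1 eps1 X1 u1 ->
 quasi_solution j rho0 T2 eps2 X2 u2 -> 0 < T1 -> 0 < T2 -> T <= T1 -> T <= T2 -> 0 <= t < T -> 0 <= r ->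
 VV (ubar T1 X1 u1) t r - VV (ubar T2 X2 u2) t r <= 2 * (eps1 + eps2).
Proof.
move=> Q1 Q2 T10 T20 TT1 TT2 ht rp.
have e10 := qs_eps_gt0 Q1;have e20 := qs_eps_gt0 Q2.
have F1 := flow_restrict TT1 (quasi_flow Q1 T10);have F2 := flow_restrict TT2 (quasi_flow Q2 T20).
apply: le_trans (@flow_le R j j T X1 X2 _ _ (2 * (eps1 + eps2)) F1 F2 _ _ _ t r ht rp) _;last first.
- by rewrite subrr normr0 mul0r addr0.
- move=> s /andP[s0 sT];have s1 : 0 <= s < T1 by rewrite s0 (lt_le_trans sT).
 have s2 : 0 <= s < T2 by rewrite s0 (lt_le_trans sT).
 have A := mass_close Q1 T10 s1;have C := mass_close Q2 T20 s2.
 move: A C;rewrite !ler_norml => /andP[_ A] /andP[C _];move: A C.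
 by move: (VV _ _ _) (VV _ _ _) M0 => *;lra.
- move=> r1 r1p;have A := init_close Q1 T10 r1p;have C := init_close Q2 T20 r1p.
 move: A C;rewrite !ler_norml => /andP[_ A] /andP[C _];move: A C e10 e20.
 by move: (VV _ _ _) (VV _ _ _) (V0 _) => *;lra.
by rewrite mulr_ge0// addr_ge0// ltW.
Qed.

Section Limit.
Variable T : R.
Hypothesis T0 : 0 < T.

(** [V] is the supremum of the lower estimates [W n t r - 2 * q n]. By [pair_close] every primitive
    of accuracy [eps] lies within [2 * eps] of it, so one function serves all optimal sequences and
    no Cauchy argument is made. *)
Lemma reference : exists V : R -> R -> R,
 [/\ forall T' eps X u t r, T' <= T -> 0 < T' -> quasi_solution j rho0 T' eps X u -> 0 <= t < T' -> 0 <= r ->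
 `|VV (ubar T' X u) t r - V t r| <= 2 * eps,
 forall r, 0 <= r -> V 0 r = V0 r &
 exists (X : nat -> R -> R) (u : nat -> R -> R -> R), forall n, quasi_solution j rho0 T (n.+1%:R^-1) (X n) (u n)].
Proof.
have /choice[XU HXU] : forall n : nat, exists p : (R -> R) * (R -> R -> R), quasi_solution j rho0 T (n.+1%:R^-1) p.1 p.2.
 move=> n;have n0 : 0 < (n.+1%:R^-1 : R) by rewrite invr_gt0 ltr0n.
 by have [X [u Q]] := HQ T0 n0;exists (X, u).
pose W n t r := VV (ubar T (XU n).1 (XU n).2) t r.
pose q n : R := n.+1%:R^-1.
pose A t r := [set W n t r - 2 * q n | n in @setT nat].
pose V t r := sup (A t r).
have key T' eps X u t r : T' <= T -> 0 < T' -> quasi_solution j rho0 T' eps X u -> 0 <= t < T' -> 0 <= r ->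
 forall n, VV (ubar T' X u) t r - W n t r <= 2 * (eps + q n) /\ W n t r - VV (ubar T' X u) t r <= 2 * (q n + eps).
 move=> TT T'0 Q ht rp n;split.
 exact: (pair_close Q (HXU n) T'0 T0 (lexx _) TT ht rp).
 exact: (pair_close (HXU n) Q T0 T'0 TT (lexx _) ht rp).
have qs e : 0 < e -> exists n, q n <= e.
 move=> e0;have [N _ HN] := near_infty_natSinv_lt (PosNum e0).
 by exists N;apply: ltW;exact: (HN N (leqnn _)).
have P1 T' eps X u t r : T' <= T -> 0 < T' -> quasi_solution j rho0 T' eps X u -> 0 <= t < T' -> 0 <= r ->
 `|VV (ubar T' X u) t r - V t r| <= 2 * eps.
 move=> TT T'0 Q ht rp;have k := key _ _ _ _ _ _ TT T'0 Q ht rp.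
 have ub : ubound (A t r) (VV (ubar T' X u) t r + 2 * eps).
 move=> _ [n _ <-];have [_] := k n;move: (W n t r) (VV _ t r) (q n) => *;lra.
 have ne : A t r !=set0 by exists (W 0%N t r - 2 * q 0%N);exists 0%N.
 have hs : has_sup (A t r) by split=> //;exists (VV (ubar T' X u) t r + 2 * eps).
 rewrite ler_norml;apply/andP;split.
 have h : V t r <= VV (ubar T' X u) t r + 2 * eps := sup_le_ub ne ub.
 by move: h;move: (VV _ t r) (V t r) => *;lra.
 apply/ler_addgt0Pr => e e0;have e40 : 0 < e / 4 by rewrite divr_gt0.
 have [n hn] := qs _ e40;have [h _] := k n.
 have /(ub_le_sup hs.2) : A t r (W n t r - 2 * q n) by exists n.
 rewrite -/(V t r);move: h hn;move: (W n t r) (VV _ t r) (q n) (V t r) => *;lra.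
exists V;split=> //.
 move=> r rp;apply/eqP;rewrite -subr_eq0 -normr_eq0 eq_le normr_ge0 andbT.
 apply/ler_addgt0Pr => e e0;rewrite add0r;have e30 : 0 < e / 3 by rewrite divr_gt0.
 have [n hn] := qs _ e30;have h0 : 0 <= (0 : R) < T by rewrite lexx.
 have A1 := P1 _ _ _ _ _ _ (lexx T) T0 (HXU n) h0 rp;have A2 := init_close (HXU n) T0 rp.
 rewrite (_ : V 0 r - V0 r = (W n 0 r - V0 r) - (W n 0 r - V 0 r));last by ring.
 apply: le_trans (ler_normB _ _) _;move: A1 A2 hn;rewrite -/(W n 0 r) -/(q n).
 by move: (`|W n 0 r - V 0 r|) (`|W n 0 r - V0 r|) (q n) => *;lra.
by exists (fun n => (XU n).1), (fun n => (XU n).2).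
Qed.

Lemma limit_exists : exists rr : R -> R -> R,
 (forall T' (X : nat -> R -> R) (u : nat -> R -> R -> R) (eps : nat -> R), T' <= T -> 0 < T' -> optimal_sequence j rho0 T' X u eps -> forall t, 0 <= t < T' ->
 weak_cvg (fun n => zero_ext (X n) (u n) t) (rr t)) /\
 (forall t r e, 0 < t < T -> 0 < e -> exists2 d : R, 0 < d & forall s (r' : R), 0 < s < T ->
 `|s - t| < d -> `|r' - r| < d -> `|rr s r' - rr t r| < e).
Proof.
have [V [P1 PV0 [X [u HXU]]]] := reference.
pose W n := VV (ubar T (X n) (u n));pose q n : R := n.+1%:R^-1.
have qs e : 0 < e -> exists N, forall n, (N <= n)%N -> q n <= e.
 move=> e0;have [N _ HN] := near_infty_natSinv_lt (PosNum e0).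
 by exists N => n Nn;apply: ltW;exact: (HN n Nn).
have HF n : flow j T (X n) (W n) := quasi_flow (HXU n) T0.
have HV0 n t r : 0 <= t < T -> 0 <= r -> `|W n t r - V t r| <= 2 * q n.
 by move=> ht rp;exact: P1 (lexx T) T0 (HXU n) ht rp.
have qs2 e : 0 < e -> exists N, forall n, (N <= n)%N -> 2 * q n <= e.
 move=> e0;have e20 : 0 < e / 2 by rewrite divr_gt0.
 by have [N HN] := qs _ e20;exists N => n /HN;rewrite ler_pdivlMr// mulrC.
have HV e : 0 < e -> exists N : nat, forall n t r, (N <= n)%N -> 0 <= t < T -> 0 <= r -> `|W n t r - V t r| <= e.
 by move=> /qs2[N HN];exists N => n t r Nn ht rp;apply: le_trans (HV0 n t r ht rp) (HN n Nn).
have HM e : 0 < e -> exists N : nat, forall n t, (N <= n)%N -> 0 <= t < T -> `|W n t (X n t) - M0| <= e.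
 by move=> /qs2[N HN];exists N => n t Nn ht;apply: le_trans (mass_close (HXU n) T0 ht) (HN n Nn).
have VL r (r' : R) : 0 <= r -> r <= r' -> V 0 r' - V 0 r <= B * (r' - r).
 by move=> rp rr;rewrite !PV0 ?(le_trans rp)//;exact: V0_lip.
have VM r : R0 <= r -> V 0 r = M0 by move=> Rr;rewrite PV0 ?V0_M// (le_trans (ltW R00)).
have HC (tau Rm : R) (tau0 : 0 < tau) (Rm0 : 0 <= Rm) := C11 j0 B0 (ltW R00) T0 HF HV HM VL VM tau0 Rm0.
have approx e : 0 < e -> exists n, forall t r, 0 <= t < T -> 0 <= r -> `|W n t r - V t r| <= e.
 by move=> /HV[N HN];exists N => t r;exact: HN.
have tri (a b c d e : R) : `|a - c| <= e -> `|a - b| <= e -> `|b - d| <= e -> `|c - d| <= e + e + e.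
 move=> h1 h2 h3;rewrite (_ : c - d = - (a - c) + (a - b) + (b - d));last by ring.
 apply: le_trans (ler_normD _ _) _;apply: lerD => //.
 by apply: le_trans (ler_normD _ _) _;apply: lerD;rewrite ?normrN.
have three e : e / 3 + e / 3 + e / 3 = e by field.
have Vt t : 0 <= t < T -> forall e, 0 < e -> exists2 d : R, 0 < d & forall s r, 0 <= s < T -> `|s - t| < d -> 0 <= r ->
 `|V s r - V t r| <= e.
 move=> ht e e0;have e30 : 0 < e / 3 by rewrite divr_gt0.
 have [n Hn] := approx _ e30;have [d d0 Hd] := fl_cont (HF n) ht e30;exists d => // s r hs st rp.
 rewrite -(three e);apply: (tri (W n s r) (W n t r));[exact: Hn|exact: Hd|exact: Hn].
have Vr t r : 0 <= t < T -> 0 <= r -> forall e, 0 < e -> exists2 d : R, 0 < d & forall r' : R, 0 <= r' -> `|r' - r| < d ->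
 `|V t r' - V t r| <= e.
 move=> ht rp e e0;have e30 : 0 < e / 3 by rewrite divr_gt0.
 have [n Hn] := approx _ e30;have [L L0 HL] := fl_lip (HF n) ht.
 have L1 : 0 < L + 1 by rewrite ltr_wpDl.
 exists (e / 3 / (L + 1)) => [|r' r'p rr];first by rewrite divr_gt0.
 rewrite -(three e);apply: (tri (W n t r') (W n t r));[exact: Hn| |exact: Hn].
 apply: le_trans (HL _ _ r'p rp) _;move: rr;rewrite ltr_pdivlMr// mulrC => /ltW;apply: le_trans.
 by rewrite ler_wpM2r// lerDl.
have Vm t r (r' : R) (ht : 0 <= t < T) := V_mono HF HV HM ht.
have {}Vm t r (r' : R) : 0 <= t < T -> 0 <= r -> r <= r' -> V t r <= V t r' by move=> ht;exact: Vm.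
have V00 t : 0 <= t < T -> V t 0 = 0 by exact: V_at0 HF HV HM t.
have VleM t r : 0 <= t < T -> 0 <= r -> V t r <= M0 by exact: V_leM HF HV HM t r.
(* The gradient is controlled at positive times only, so at [t = 0] the datum itself is used; the
   maximum with [0] extends the gradient continuously to negative [r]. *)
pose rr t r := if t <= 0 then r0 r else GG V t (Num.max r 0).
have max_p y : 0 <= Num.max y 0 by rewrite le_max lexx orbT.
exists rr;split;last first.
 move=> t r e ht e0;have [d d0 Hd] := GG_cont HC Vt Vr ht (max_p r) e0;exists d => // s r' hs st rd.
 have [/andP[t0 _] /andP[s0 _]] := (ht, hs).
 rewrite /rr !leNgt t0 s0 /=;apply: Hd => //;exact: le_lt_trans (max0_lip _ _) rd.
move=> T' Y v eps TT T'0 [Q ceps] t ht.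
have htT : 0 <= t < T by case/andP: ht => -> h;rewrite (lt_le_trans h).
have ipos : 0 < t \/ t = 0.
 by case/andP: htT;rewrite le_eqVlt => /orP[/eqP <-|];[right|left].
have Z n y : 0 <= zero_ext (Y n) (v n) t y.
 rewrite /zero_ext patchE;case: ifPn => //;rewrite inE /= in_itv/= => hy.
 exact: (qs_u_ge0 (Q n) ht hy).
have iZn n : itg (@Rplus R) (zero_ext (Y n) (v n) t).
 apply: (@eq_integrable _ _ _ mu _ mRplus (EFin \o ubar T' (Y n) (v n) t));last exact: iSub mRplus (ubar_meas (Q n) ht).
 by move=> y;rewrite inE => /RplusE y0;rewrite /= (zero_extE (Y n) (v n) ht y0).
have VVE n r : \int[mu]_(y in `[0, r]) zero_ext (Y n) (v n) t y = VV (ubar T' (Y n) (v n)) t r.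
 by apply: eq_I => y /=;rewrite in_itv/= => /andP[y0 _];rewrite (zero_extE (Y n) (v n) ht y0).
apply: (@weak_lim R _ _ (V t) M0).
- by move=> n;split;[exact: iZn|exact: Z].
- move=> y;rewrite /rr;case: ifPn;first by move=> _;exact: (andP (Hr0 y)).1.
 rewrite -ltNge => t0;apply: (GG_ge0 HC Vm) => //;by rewrite t0 (andP htT).2.
- move=> m m0;have mI : measurable (`[0, m]%classic : set R) by exact: measurable_itv.
 rewrite /rr;case: ipos => [t0|->];last by rewrite lexx;exact: iSub mI ir0.
 by rewrite leNgt t0 /=;apply: (GG_i HC Vt Vr);rewrite t0 (andP htT).2.
- move=> r rp;rewrite /rr;case: ipos => [t0|->];last by rewrite lexx PV0.
 by rewrite leNgt t0 /=;apply: (V_int HC Vt Vr V00) => //;rewrite t0 (andP htT).2.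
- by move=> r rp;exact: VleM.
- move=> e e0;have e20 : 0 < e / 2 by rewrite divr_gt0.
 have [N1 H1] := HV _ e20;have [N2 H2] := HM _ e20;pose n := maxn N1 N2.
 have Xp : 0 <= X n t by apply: ltW;exact: (qs_X_gt0 (HXU n) htT).
 exists (X n t) => //;have := H1 n t (X n t) (leq_maxl _ _) htT Xp;have := H2 n t (leq_maxr _ _) htT.
 rewrite !ler_norml => /andP[a1 _] /andP[_ a2];move: a1 a2;move: (W n t _) (V t _) M0 => *;lra.
move=> e e0;have e20 : 0 < e / 2 by rewrite divr_gt0.
have /cvgrPdist_le/(_ _ e20)[N _ HN] := ceps;exists N => n Nn.
have en : 2 * eps n <= e.
 have := HN n Nn;rewrite /= sub0r normrN => h;rewrite mulrC -ler_pdivlMr//;exact: le_trans (ler_norm _) h.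
split.
 move=> r rp;rewrite VVE;apply: le_trans en;exact: P1 TT T'0 (Q n) ht rp.
rewrite -(@I_supp R (@Rplus R));last first.
 by move=> y ny;apply: zero_ext0;rewrite ltNge;apply/negP => /RplusE.
rewrite (@I_supp R `[0, Y n t]%classic);last by move=> y ny;rewrite /zero_ext patchE memNset.
by rewrite VVE;apply: le_trans en;exact: mass_close (Q n) T'0 ht.
Qed.
End Limit.
End Final.

Theorem theorem1p2 (R : realType) (j : R) (rho0 : R -> R) (T : R)
    (j_gt0 : 0 < j) (rho0_L : Linfty_L1_nonneg rho0)
    (edge_gt0 : (0 < right_edge rho0)%E) (edge_fin : (right_edge rho0 < +oo)%E)
    (T_gt0 : 0 < T) :
  [/\ (exists (X : nat -> R -> R) (u : nat -> R -> R -> R) (eps : nat -> R),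
        optimal_sequence j rho0 T X u eps),
      (forall (X : nat -> R -> R) (u : nat -> R -> R -> R) (eps : nat -> R),
        optimal_sequence j rho0 T X u eps ->
        exists rho : R -> R -> R,
          (forall t : R, 0 <= t < T ->
            weak_cvg (fun n => zero_ext (X n) (u n) t) (rho ^~ t)) /\
          generalized_solution j rho0 T rho) &
      (exists rhobar : R -> R -> R,
        {within [set z : R * R | 0 <= z.1 /\ 0 < z.2],
          continuous (fun z : R * R => rhobar z.1 z.2)} /\
        forall u : R -> R -> R, generalized_solution j rho0 T u ->
          forall t : R, 0 <= t < T ->
            ae_eq (@lebesgue_measure R) (@Rplus R) (u ^~ t) (rhobar ^~ t))].
Proof.
have [r0 [R0 [B [[R00 [B0 Hr0] out ir0 I0] [ae0 mrho]]]]] := rho_facts rho0_L edge_gt0 edge_fin.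
have HQ T' eps : 0 < T' -> 0 < eps -> exists (X : R -> R) (u : R -> R -> R), quasi_solution j rho0 T' eps X u.
  exact: exists_quasi.
(* On the horizon [2 * T] the limit density is continuous at [T] and slightly beyond, so that
   freezing the time at [T] gives a function continuous for all positive times. *)
have T20 : 0 < 2 * T by rewrite mulr_gt0.
have TT : T <= 2 * T by rewrite mulrDl mul1r lerDl ltW.
have TT' : T < 2 * T by rewrite mulrDl mul1r ltrDl.
have [rr [Hw Hc]] := limit_exists j_gt0 R00 B0 Hr0 out ir0 ae0 mrho HQ T20.
split.
- have [_ [_ _ [X [u H]]]] := reference R00 out ir0 ae0 mrho HQ T_gt0.
  exists X, u, (fun n => n.+1%:R^-1); split=> //.
  apply/cvgrPdist_lt => e e0; have := near_infty_natSinv_lt (PosNum e0).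
  by apply: filterS => n /= h; rewrite sub0r normrN ger0_norm// invr_ge0 ler0n.
- move=> X u eps O; exists (fun r t => rr t r); have W := Hw T X u eps TT T_gt0 O.
  by split=> //; exists X, u, eps.
exists (fun r t => rr (Num.min t T) r); split.
  apply: continuous_in_subspaceT => z; rewrite inE /= => -[z1 z2].
  have mT t : 0 < t -> 0 < Num.min t T < 2 * T.
    by move=> t0; rewrite lt_min t0 T_gt0/= gt_min TT' orbT.
  apply/cvgrPdist_lt => e e0; have [d d0 Hd] := Hc (Num.min z.2 T) z.1 e (mT _ z2) e0.
  have d20 : 0 < Num.min d z.2 by rewrite lt_min d0.
  exists (ball z.1 (Num.min d z.2), ball z.2 (Num.min d z.2)) => /=.
    by split; exact: nbhsx_ballx.
  move=> y [/= y1 y2]; rewrite distrC.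
  have {}y1 : `|z.1 - y.1| < Num.min d z.2 := y1; have {}y2 : `|z.2 - y.2| < Num.min d z.2 := y2.
  move: y1 y2; rewrite !lt_min => /andP[y1 _] /andP[y2 y3].
  have yp : 0 < y.2 by move: y3; rewrite ltr_norml => /andP[_]; rewrite ltrBlDl -ltrBlDr subrr.
  apply: Hd; [exact: mT| |by rewrite distrC].
  rewrite distrC; apply: le_lt_trans y2; move: (z.2) (y.2) => a b.
  rewrite /Num.min; case: (ltP a T) => aT; case: (ltP b T) => bT //; rewrite ?subrr ?normr0//.
    rewrite distrC (ger0_norm (_ : 0 <= T - a)) ?subr_ge0; last exact: ltW.
    by rewrite distrC; apply: le_trans (ler_norm _); rewrite lerD2r.
  rewrite (ger0_norm (_ : 0 <= T - b)) ?subr_ge0; last exact: ltW.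
  by apply: le_trans (ler_norm _); rewrite lerD2r.
move=> u [X [v [eps [OS Wu]]]] t ht.
have tT : Num.min t T = t by rewrite min_l// ltW// (andP ht).2.
have [iu cu] := Wu t ht; have [ir cr] := Hw T X v eps TT T_gt0 OS t ht; rewrite tT.
apply: weak_uniq => // phi hc hb.
exact: (cvg_unique (@norm_hausdorff _ _) (cu phi hc hb) (cr phi hc hb)).
Qed.
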